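(* Let $n\ge2$, $m\in\mathbb N$. There is a nonzero polynomial $\mathcal R$ with integer coefficients in the $nm$ coordinates of $(v_1,\dots,v_m)$ such that for every $S=\{v_1,\dots,v_m\}\subset\mathbb Z^n$ with $\mathcal R(v_1,\dots,v_m)\ne0$ the following holds (notation as in the context, $\xi$ ranging over $A_\alpha$ with $r$ small). Consider the Melnikov resonances, for $\nu\in\mathbb Z^m$, $\sigma\in\{+1,-1\}$ and $h,k\in S^c$: (M1) $(\omega(\xi),\nu)=0$, with $\nu\ne0$; (M2) $(\omega(\xi),\nu)+\tilde\Omega_k(\xi)=0$; (M3) $(\omega(\xi),\nu)+\tilde\Omega_k(\xi)+\sigma\tilde\Omega_h(\xi)=0$, with $(\sigma,\nu,h,k)\ne(-,0,h,h)$; where only choices of $(\sigma,\nu,h,k)$ compatible with momentum conservation (and parity) are considered. 1. The set of $\xi$ for which some resonance (M1) or (M2) occurs has measure zero. 2. If $n=2$ or $n=3$, the set of $\xi$ for which some resonance (M1), (M2) or (M3) occurs has measure zero, and for each single condition the resonance set (for fixed $\nu$, $\sigma$ and fixed components of $\Gamma_S$ to which $k$ and $h$ belong) is algebraic.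
   Context: $S^c=\mathbb Z^n\setminus S$; $(\cdot,\cdot)$ is the standard scalar product, $|k|^2=(k,k)$; $e_1,\dots,e_m$ is the standard basis of $\mathbb Z^m$ and $\pi:\mathbb Z^m\to\mathbb Z^n$, $\pi(\nu)=\sum_i\nu_iv_i$. $A_\alpha=\{\xi\in\mathbb R^m:\frac12r^\alpha\le\xi_i\le r^\alpha\}$, $0<\alpha<2$. $\omega_i(\xi)=|v_i|^2-2\xi_i+4\sum_j\xi_j$. The graph $\Gamma_S$ on $S^c$: for $i\ne j$, $k$ and $h$ are joined by a black edge oriented from $k$ to $h$ and marked $(i,j)$ if $h-k=v_j-v_i$ and $|h|^2-|k|^2=|v_j|^2-|v_i|^2$; by a (non-oriented) red edge marked $(i,j)$ if $h+k=v_i+v_j$ and $|h|^2+|k|^2=|v_i|^2+|v_j|^2$. For generic $S$ all connected components $A$ are finite and the following is well defined. Fix a root $x(A)\in A$; to each vertex $a\in A$ attach $\sigma(a)=\pm1$ and $L(a)\in\mathbb Z^m$ by: $\sigma=1$, $L=0$ at the root; along a black edge from $a$ to $b$ marked $(i,j)$, $\sigma(b)=\sigma(a)$, $L(b)=L(a)+e_j-e_i$; along a red edge marked $(i,j)$, $\sigma(b)=-\sigma(a)$, $L(b)=e_i+e_j-L(a)$. The matrix $C_A$, indexed by the vertices of $A$, has entries $C_A(a,a)=\sigma(a)(\xi,L(a))$; $C_A(a,b)=2\sigma(b)\sqrt{\xi_i\xi_j}$ if $a\neq b$ are joined by an edge marked $(i,j)$; $C_A(a,b)=0$ if $a\ne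 b$ are not joined. Put $$M'_A=\Bigl(|x(A)|^2+4\sum_j\xi_j\Bigr)I+2C_A,$$ and let $\tilde\Omega_k(\xi)$, $k\in A$, be the (possibly complex) eigenvalues of $M'_A$, listed with multiplicity and labelled by the vertices of $A$. For $k\in A$ write $x(k)=x(A)$. Compatibility with momentum conservation and parity: in (M1), $\pi(\nu)=0$ and $\sum_i\nu_i$ even; in (M2), $\pi(\nu)+x(k)=0$ and $\sum_i\nu_i$ odd; in (M3), $\pi(\nu)+x(k)+\sigma x(h)=0$ and $\sum_i\nu_i$ even. *)

(* Defs.v *)
From HB Require Import structures.
From mathcomp Require Import all_boot all_order all_algebra.
From mathcomp Require Import complex.
From mathcomp Require Import all_classical all_reals exp.
From mathcomp Require mpoly.
(* The notations of mpoly clash with those of mathcomp-analysis. *)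
Import -(notations) mpoly.

Set Implicit Arguments.
Unset Strict Implicit.
Unset Printing Implicit Defensive.

Import Order.TTheory GRing.Theory Num.Theory.
Local Open Scope ring_scope.

Definition dot (K : pzRingType) (p : nat) (x y : 'rV[K]_p) : K :=
  \sum_i x 0 i * y 0 i.

Definition sqn (p : nat) (k : 'rV[int]_p) : int := dot k k.

Section Graph.
Variables (n m : nat) (v : 'M[int]_(m, n)).
(* The sites v_1, ..., v_m are the rows of v. *)

Definition insites (k : 'rV[int]_n) : bool := [exists i, k == row i v].

(* black i j k h: black edge oriented from k to h and marked (i, j).  The same
   edge read from h to k is the black edge marked (j, i). *)
Definition black (i j : 'I_m) (k h : 'rV[int]_n) : bool :=
  [&& i != j, h - k == row j v - row i v
    & sqn h - sqn k == sqn (row j v) - sqn (row i v)].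

Definition red (i j : 'I_m) (k h : 'rV[int]_n) : bool :=
  [&& i != j, h + k == row i v + row j v
    & sqn h + sqn k == sqn (row i v) + sqn (row j v)].

Definition marked (i j : 'I_m) (k h : 'rV[int]_n) : bool :=
  black i j k h || red i j k h.

(* Adjacency in Gamma_S, whose vertex set is the complement of S. *)
Definition adj (k h : 'rV[int]_n) : bool :=
  [&& ~~ insites k, ~~ insites h & [exists i, exists j, marked i j k h]].

Definition same_comp (k h : 'rV[int]_n) : Prop :=
  exists2 p, path adj k p & last k p = h.

(* s lists, without repetition, the connected component of the vertex k. *)
Definition comp_enum (k : 'rV[int]_n) (s : seq 'rV[int]_n) : Prop :=
  uniq s /\ forall h, h \in s <-> same_comp k h.

(* x k is the root of the component of k. *)
Definition root_choice (x : 'rV[int]_n -> 'rV[int]_n) : Prop :=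
  forall k, ~~ insites k ->
    same_comp k (x k) /\ forall h, same_comp k h -> x h = x k.

Definition labels (x : 'rV[int]_n -> 'rV[int]_n)
    (sg : 'rV[int]_n -> int) (L : 'rV[int]_n -> 'rV[int]_m) : Prop :=
  [/\ forall k, ~~ insites k -> sg (x k) = 1 /\ L (x k) = 0,
      forall i j a b, ~~ insites a -> ~~ insites b -> black i j a b ->
        sg b = sg a /\ L b = L a + delta_mx 0 j - delta_mx 0 i
    & forall i j a b, ~~ insites a -> ~~ insites b -> red i j a b ->
        sg b = - sg a /\ L b = delta_mx 0 i + delta_mx 0 j - L a].

(* The genericity facts without which the matrices C_A are not defined: the
   components are finite, an edge determines the unordered pair {i, j} of its
   mark, and the rules propagating sigma and L from the roots are consistent
   (uniqueness of sigma and L on the vertices is then automatic). *)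
Definition well_posed : Prop :=
  [/\ forall k, ~~ insites k -> exists s, comp_enum k s,
      forall i j i' j' a b, ~~ insites a -> ~~ insites b ->
        marked i j a b -> marked i' j' a b ->
        [set i; j]%SET = [set i'; j']%SET
    & forall x, root_choice x -> exists sg L, labels x sg L].

Variable R : realType.

Definition omega (xi : 'rV[R]_m) : 'rV[R]_m :=
  \row_i ((sqn (row i v))%:~R - 2 * xi 0 i + 4 * \sum_j xi 0 j).

Definition toreal (p : nat) (nu : 'rV[int]_p) : 'rV[R]_p :=
  map_mx (fun z : int => z%:~R) nu.

Section Normal_form.
Variables (x : 'rV[int]_n -> 'rV[int]_n)
  (sg : 'rV[int]_n -> int) (L : 'rV[int]_n -> 'rV[int]_m) (xi : 'rV[R]_m).

Definition Centry (a b : 'rV[int]_n) : R :=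
  if a == b then (sg a)%:~R * dot xi (toreal (L a))
  else if [pick ij : 'I_m * 'I_m | marked ij.1 ij.2 a b] is Some ij
       then 2 * (sg b)%:~R * Num.sqrt (xi 0 ij.1 * xi 0 ij.2)
       else 0.

Definition Cmx (s : seq 'rV[int]_n) : 'M[R]_(size s) :=
  \matrix_(p, q) Centry (nth 0 s p) (nth 0 s q).

(* k is any vertex of the component listed by s. *)
Definition Mmx (k : 'rV[int]_n) (s : seq 'rV[int]_n) : 'M[R]_(size s) :=
  ((sqn (x k))%:~R + 4 * \sum_j xi 0 j)%:M + 2 *: Cmx s.

(* Om lists, component by component, the complex eigenvalues of M'_A with
   multiplicity, labelled by the vertices of A in an arbitrary way. *)
Definition eigen_labelling (Om : 'rV[int]_n -> R[i]) : Prop :=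
  forall k s, ~~ insites k -> comp_enum k s ->
    char_poly (map_mx (real_complex R) (Mmx k s))
      = \prod_(h <- s) ('X - (Om h)%:P).

End Normal_form.

Definition mass (nu : 'rV[int]_m) : int := \sum_i nu 0 i.

(* The momentum pi(nu) is nu *m v. *)
Definition resM1 (nu : 'rV[int]_m) (xi : 'rV[R]_m) : Prop :=
  [/\ nu != 0, nu *m v = 0, (2 %| mass nu)%Z
    & dot (omega xi) (toreal nu) = 0].

Definition resM2 (x : 'rV[int]_n -> 'rV[int]_n)
    (Om : 'rV[R]_m -> 'rV[int]_n -> R[i])
    (nu : 'rV[int]_m) (k : 'rV[int]_n) (xi : 'rV[R]_m) : Prop :=
  [/\ ~~ insites k, nu *m v + x k = 0, ~~ (2 %| mass nu)%Z
    & real_complex R (dot (omega xi) (toreal nu)) + Om xi k = 0].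

Definition resM3 (x : 'rV[int]_n -> 'rV[int]_n)
    (Om : 'rV[R]_m -> 'rV[int]_n -> R[i])
    (sigma : int) (nu : 'rV[int]_m) (h k : 'rV[int]_n) (xi : 'rV[R]_m) : Prop :=
  [/\ ~~ insites h /\ ~~ insites k,
      sigma = 1 \/ sigma = -1,
      ~ [/\ sigma = -1, nu = 0 & h = k],
      nu *m v + x k + sigma *: x h = 0 /\ (2 %| mass nu)%Z
    & real_complex R (dot (omega xi) (toreal nu)) + Om xi k
        + sigma%:~R * Om xi h = 0].

End Graph.

Section Sets.
Variables (R : realType) (m : nat).
Local Open Scope classical_set_scope.

Definition Abox (alpha r : R) : set 'rV[R]_m :=
  [set xi | forall i, r `^ alpha / 2 <= xi 0 i <= r `^ alpha].

(* Lebesgue-null subsets of R^m for 0 < m: sets that can be covered by countably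
   many closed boxes of arbitrarily small total volume. *)
Definition null_set (E : set 'rV[R]_m) : Prop :=
  forall eps : R, 0 < eps -> exists a b : nat -> 'rV[R]_m,
    [/\ forall l i, a l 0 i <= b l 0 i,
        E `<=` \bigcup_l [set xi | forall i, a l 0 i <= xi 0 i <= b l 0 i]
      & forall N : nat, \sum_(l < N) \prod_i (b l 0 i - a l 0 i) <= eps].

(* E is the trace on D of the common zero set of finitely many polynomials. *)
Definition algebraic_in (D E : set 'rV[R]_m) : Prop :=
  exists s : seq (mpoly m R),
    E = D `&` [set xi : 'rV[R]_m | forall P, P \in s -> meval (xi 0) P = 0].

End Sets.

(* Main.v *)
(* A statement about v holds generically when it follows from P(v) <> 0 for some
   nonzero integer polynomial P; a polynomial identity forced by a bounded label
   is excluded generically by exhibiting one v at which it fails.  A vertex of a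
   component is y = s x + pi(L) with |y|^2 = s |x|^2 + sum_i L_i |v_i|^2; n + 1
   such equations in x with s = 1 are overdetermined, so generically the simple
   paths are short, the components are finite and the labels are unique.

   C_A is conjugate to a matrix which is polynomial in xi, so each resonance is
   the zero set of a resultant, and it suffices that this polynomial is nonzero,
   zero sets of nonzero polynomials being null.  Modulo 2 the matrices become
   diagonal with entries (xi, L_a).  A resultant that vanishes identically thus
   yields two vertices with labels congruent modulo 2, which for n = 2, 3 is
   generically impossible among n + 2 points joined by edges.  The remaining
   pairs of components have at most four vertices in all, and are excluded by
   evaluation at points xi supported on the mark of an edge, chosen such that the
   eigenvalues of its 2 x 2 block are not real. *)
Require Import Defs.
From mathcomp Require Import all_boot all_order all_algebra.
From mathcomp Require Import complex.
From mathcomp Require Import all_classical all_reals exp.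
From mathcomp Require mpoly.
Import -(notations) mpoly.
From mathcomp Require Import fingroup perm.
From mathcomp Require Import zify ring lra.
Import Order.TTheory GRing.Theory Num.Theory.
Local Open Scope ring_scope.
Local Open Scope classical_set_scope.
Set Implicit Arguments.
Unset Strict Implicit.
Unset Printing Implicit Defensive.

(** One polynomial in the sites has to serve all [nu] at once, although genericity only controls
    labels below a fixed bound. The two are reconciled because a resonance polynomial that vanishes
    identically already confines [nu]: its value at xi = 0 makes the constant term vanish, and its
    values on the coordinate axes put every entry of [nu] within a fixed distance of 2 [eta], which
    bounds [nu] itself. The vanishing constant term together with momentum conservation says
    moreover that [- nu] is an exact label from one root to the other, so that two components can be
    treated as one configuration of points with a common origin. No resultant is ever expanded. The
    forms are defined over an arbitrary commutative ring and commute with morphisms; polynomial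
    identities, reduction modulo 2 and evaluation are all instances of this. The test points leave
    the positive cone, hence the complex square roots. For sigma = -1 and nu = 0 on a single
    component the resultant vanishes identically and a discriminant takes its place. *)

Section NullSets.
Variables (R : realType) (m : nat).
Hypothesis m_gt0 : (0 < m)%N.
Implicit Types (E F : set 'rV[R]_m) (a b xi : 'rV[R]_m).

Definition box a b : set 'rV[R]_m := [set xi | forall i, a 0 i <= xi 0 i <= b 0 i].
Definition vol a b : R := \prod_i (b 0 i - a 0 i).

Lemma vol_ge0 a b : (forall i, a 0 i <= b 0 i) -> 0 <= vol a b.
Proof. by move=> ab; apply: prodr_ge0 => i _; rewrite subr_ge0. Qed.

Lemma vol_point a : vol a a = 0.
Proof. by rewrite /vol (bigD1 (Ordinal m_gt0)) //= subrr mul0r. Qed.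

Lemma null_set_sub E F : E `<=` F -> null_set F -> null_set E.
Proof.
move=> EF nF eps eps0; have [a [b [ab FU le]]] := nF eps eps0.
by exists a, b; split=> //; apply: subset_trans FU.
Qed.

Lemma ler_sum_subseq (T : eqType) (f : T -> R) (s t : seq T) :
  (forall x, 0 <= f x) -> uniq s -> {subset s <= t} ->
  \sum_(x <- s) f x <= \sum_(x <- t) f x.
Proof.
move=> f0; elim: s t => [|x s IH] t /=; first by rewrite big_nil sumr_ge0.
move=> /andP[xs us] st; have xt : x \in t by apply: st; rewrite inE eqxx.
rewrite big_cons (big_rem x xt) /= lerD2l; apply: IH => // y ys.
have : y \in t by apply: st; rewrite inE ys orbT.
rewrite (perm_mem (perm_to_rem xt)) inE => /orP[/eqP yx|//].
by rewrite yx (negbTE xs) in ys.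
Qed.

Lemma sum_geom_half (eps : R) K : 0 < eps ->
  \sum_(k <- iota 0 K) eps / 2 ^+ k.+1 <= eps.
Proof.
move=> eps0; have -> : \sum_(k <- iota 0 K) eps / 2 ^+ k.+1 = eps - eps / 2 ^+ K.
  elim: K => [|K IH]; first by rewrite big_nil expr0 divr1 subrr.
  rewrite -addn1 iotaD big_cat IH /= big_cons big_nil addr0 add0n addn1 exprS.
  have : (2 : R) ^+ K != 0 by rewrite expf_neq0 ?pnatr_eq0.
  by move=> h; field; rewrite h.
by rewrite gerBl divr_ge0 ?exprn_ge0 // ltW.
Qed.

Lemma null_set_bigcup (E : nat -> set 'rV[R]_m) :
  (forall k, null_set (E k)) -> null_set (\bigcup_k E k).
Proof.
move=> nE eps eps0.
have ex k : exists ab : (nat -> 'rV[R]_m) * (nat -> 'rV[R]_m),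
    [/\ forall l i, ab.1 l 0 i <= ab.2 l 0 i,
        E k `<=` \bigcup_l box (ab.1 l) (ab.2 l)
      & forall N : nat, \sum_(l < N) vol (ab.1 l) (ab.2 l) <= eps / 2 ^+ k.+1].
  have [|a [b H]] := nE k (eps / 2 ^+ k.+1); first by rewrite divr_gt0 ?exprn_gt0.
  by exists (a, b).
have [ab abP] := choice ex.
(* The boxes are enumerated by the codes of pairs; a number that codes no pair receives the
   degenerate box at 0, of volume zero since [0 < m]. *)
pose dec := @pickle_inv (nat * nat)%type.
pose A (p : nat * nat) := (ab p.1).1 p.2; pose B (p : nat * nat) := (ab p.1).2 p.2.
pose V (p : nat * nat) := vol (A p) (B p).
have AB p i : A p 0 i <= B p 0 i by have [h _ _] := abP p.1; apply: h.
have V0 p : 0 <= V p by apply: vol_ge0 => i; apply: AB.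
exists (fun l => oapp A 0 (dec l)), (fun l => oapp B 0 (dec l)); split.
- by move=> l i; case: (dec l) => [p|] /=; rewrite ?lexx ?AB.
- move=> xi [k _ Ek]; have [_ h _] := abP k; have [j _ hj] := h _ Ek.
  by exists (pickle (k, j)) => //; rewrite /dec pickleK_inv.
move=> N.
have -> : \sum_(l < N) vol (oapp A 0 (dec l)) (oapp B 0 (dec l))
   = \sum_(p <- pmap dec (iota 0 N)) V p.
  rewrite -(big_mkord xpredT (fun l => vol (oapp A 0 (dec l)) (oapp B 0 (dec l)))).
  rewrite /index_iota subn0; elim: (iota 0 N) => [|l s IH]; rewrite ?big_nil // big_cons IH /=.
  by case: (dec l) => [p|] /=; rewrite ?big_cons // vol_point add0r.
set s := pmap _ _.
have us : uniq s.
  by apply: (pmap_uniq (g := pickle)); [exact: pickle_invK|exact: iota_uniq].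
(* The finitely many pairs in use lie in a square of side [K], over which the volumes are summed row
   by row against a geometric series. *)
pose K := (\max_(p <- s) (maxn p.1 p.2).+1)%N.
have sK p : p \in s -> (p.1 < K)%N /\ (p.2 < K)%N.
  move=> ps; have : ((maxn p.1 p.2).+1 <= K)%N.
    by rewrite /K (big_rem p ps) /= leq_maxl.
  by rewrite gtn_max => /andP[].
apply: (@le_trans _ _ (\sum_(p <- [seq (k, j) | k <- iota 0 K, j <- iota 0 K]) V p)).
  apply: ler_sum_subseq => // -[k j] /sK[/= kK jK].
  by apply/allpairsP; exists (k, j); rewrite !mem_iota.
rewrite big_allpairs_dep /=; apply: le_trans (sum_geom_half K eps0).
apply: ler_sum => k _; have [_ _ h] := abP k.
by have := h K; rewrite -(big_mkord xpredT (fun l => vol ((ab k).1 l) ((ab k).2 l))) /index_iota subn0.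
Qed.

Lemma null_set_bigcup_count (T : countType) (E : T -> set 'rV[R]_m) :
  (forall t, null_set (E t)) -> null_set (\bigcup_t E t).
Proof.
move=> nE; pose F k := if unpickle k is Some t then E t else set0.
apply: (@null_set_sub _ (\bigcup_k F k)).
  by move=> xi [t _ h]; exists (pickle t) => //; rewrite /F pickleK.
apply: null_set_bigcup => k; rewrite /F; case: unpickle => [t|] // eps eps0.
exists (fun=> 0), (fun=> 0); split=> // N.
by rewrite big1 ?ltW // => l _; apply: vol_point.
Qed.

Lemma null_set_finite E :
  (forall eps : R, 0 < eps -> exists s : seq ('rV[R]_m * 'rV[R]_m),
    [/\ forall p i, p \in s -> p.1 0 i <= p.2 0 i,
        forall xi, E xi -> exists2 p, p \in s & box p.1 p.2 xi
      & \sum_(p <- s) vol p.1 p.2 <= eps]) -> null_set E.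
Proof.
move=> h eps eps0; have [s [ab EU le]] := h eps eps0.
(* Default value of [nth]: the finite list is continued by degenerate boxes. *)
pose d : 'rV[R]_m * 'rV[R]_m := (0, 0).
have abn l i : (nth d s l).1 0 i <= (nth d s l).2 0 i.
  have [ls|sl] := ltnP l (size s); first by apply: ab; rewrite mem_nth.
  by rewrite nth_default.
exists (fun l => (nth d s l).1), (fun l => (nth d s l).2); split => //.
- move=> xi /EU[p ps hp]; exists (index p s) => //; by rewrite nth_index.
move=> N; apply: le_trans le.
have -> : \sum_(p <- s) vol p.1 p.2 = \sum_(l < size s) vol (nth d s l).1 (nth d s l).2.
  by rewrite (big_nth d) big_mkord.
rewrite -!(big_mkord xpredT (fun l => vol (nth d s l).1 (nth d s l).2)).
have [Ns|sN] := leqP N (size s).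
  rewrite (big_cat_nat _ Ns) //= lerDl sumr_ge0 // => l _.
  by apply: vol_ge0 => i.
rewrite (big_cat_nat _ (ltnW sN)) //= [X in _ + X]big_nat_cond.
rewrite [X in _ + X]big1 ?addr0 // => l /andP[/andP[sl _] _].
by rewrite nth_default ?vol_point.
Qed.

End NullSets.

(** * Zero sets of nonzero polynomials are null *)

Section PolyZeros.
Variables (R : realType) (m : nat).
Hypothesis m_gt0 : (0 < m)%N.
Implicit Types (p q c : 'rV[R]_m) (f : mpoly m R).

Definition nearby (eta : R) c p := forall i, `|p 0 i - c 0 i| <= eta.

(** Continuity at diagonal points only, for the sup norm: a Hadamard quotient depends on two points,
    both close to c, and is compared with the partial derivative at c. *)
Definition cont_diag (g : 'rV[R]_m -> 'rV[R]_m -> R) :=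
  forall c (eps : R), 0 < eps -> exists2 eta : R, 0 < eta &
    forall p q, nearby eta c p -> nearby eta c q -> `|g p q - g c c| < eps.

Lemma nearby_min eta eta' c p :
  nearby (Num.min eta eta') c p -> nearby eta c p /\ nearby eta' c p.
Proof. by move=> h; split=> i; have := h i; rewrite le_min => /andP[]. Qed.

Lemma cont_diagD g1 g2 : cont_diag g1 -> cont_diag g2 ->
  cont_diag (fun p q => g1 p q + g2 p q).
Proof.
move=> h1 h2 c eps eps0; have e2 : 0 < eps / 2 by rewrite divr_gt0.
have [e1 e10 H1] := h1 c _ e2; have [e3 e30 H2] := h2 c _ e2.
exists (Num.min e1 e3); first by rewrite lt_min e10 e30.
move=> p q /nearby_min[p1 p2] /nearby_min[q1 q2].
have a1 := H1 _ _ p1 q1; have a2 := H2 _ _ p2 q2.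
rewrite (_ : _ - _ = (g1 p q - g1 c c) + (g2 p q - g2 c c)); last by ring.
by apply: le_lt_trans (ler_normD _ _) _; lra.
Qed.

Lemma cont_diagM g1 g2 : cont_diag g1 -> cont_diag g2 ->
  cont_diag (fun p q => g1 p q * g2 p q).
Proof.
move=> h1 h2 c eps eps0; set a := g1 c c; set b := g2 c c.
have A0 : 0 < `|a| + 1 by rewrite ltr_wpDl.
have B0 : 0 < `|b| + 1 by rewrite ltr_wpDl.
have e1 : 0 < eps / 2 / (`|b| + 1) by rewrite !divr_gt0.
have e2 : 0 < Num.min 1 (eps / 2 / (`|a| + 1)) by rewrite lt_min ltr01 !divr_gt0.
have [r1 r10 H1] := h1 c _ e1; have [r2 r20 H2] := h2 c _ e2.
exists (Num.min r1 r2); first by rewrite lt_min r10 r20.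
move=> p q /nearby_min[p1 p2] /nearby_min[q1 q2].
have a1 := H1 _ _ p1 q1; have := H2 _ _ p2 q2.
rewrite lt_min -/a -/b in a1 * => /andP[a2 a3].
rewrite (_ : _ - _ = (g1 p q - a) * g2 p q + a * (g2 p q - b)); last by ring.
apply: le_lt_trans (ler_normD _ _) _; rewrite !normrM.
have gb : `|g2 p q| <= `|b| + 1.
  by rewrite -[g2 p q](subrK b) addrC; apply: le_trans (ler_normD _ _) _; lra.
have t1 : `|g1 p q - a| * `|g2 p q| < eps / 2.
  apply: le_lt_trans (ler_wpM2l (normr_ge0 _) gb) _.
  by rewrite -ltr_pdivlMr.
have t2 : `|a| * `|g2 p q - b| <= eps / 2.
  apply: le_trans (ler_wpM2r (normr_ge0 _) (_ : `|a| <= `|a| + 1)) _; first lra.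
  by rewrite mulrC -ler_pdivlMr // ltW.
lra.
Qed.

Lemma cont_diag_cst (a : R) : cont_diag (fun _ _ => a).
Proof. by move=> c eps eps0; exists 1 => // p q _ _; rewrite subrr normr0. Qed.

(* Hadamard's factorization; on the diagonal the quotients are the partial derivatives. *)
Definition hadamard f := exists h : 'I_m -> 'rV[R]_m -> 'rV[R]_m -> R,
  [/\ forall p q, meval (p 0) f - meval (q 0) f
        = \sum_j h j p q * (p 0 j - q 0 j),
      forall j, cont_diag (h j)
    & forall j c, h j c c = meval (c 0) (mderiv j f)].

Lemma cont_diag_bound (I : finType) (h : I -> 'rV[R]_m -> 'rV[R]_m -> R) c :
  (forall j, cont_diag (h j)) -> exists eta H : R, [/\ 0 < eta, 0 < H &
    forall j p q, nearby eta c p -> nearby eta c q -> `|h j p q| <= H].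
Proof.
move=> ch.
have /choice [eta etaP] j : exists eta : R, 0 < eta /\
    forall p q, nearby eta c p -> nearby eta c q -> `|h j p q - h j c c| < 1.
  by have [e e0 H] := ch j c 1 ltr01; exists e.
(* A sum replaces the maximum of finitely many bounds; the leading 1 keeps it positive even if [I]
   is empty. *)
exists (\big[Num.min/1]_j eta j), (1 + \sum_j (`|h j c c| + 1)); split.
- by elim/big_ind: _ => // [x y x0 y0|j _]; [rewrite lt_min x0|have [] := etaP j].
- by rewrite ltr_pwDl // sumr_ge0 // => j _; rewrite addr_ge0.
move=> j p q np nq; have [_ H] := etaP j.
have le : \big[Num.min/1]_j eta j <= eta j by apply: bigmin_le_cond.
have := H p q (fun i => le_trans (np i) le) (fun i => le_trans (nq i) le).
have -> : 1 + \sum_j (`|h j c c| + 1) =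
   `|h j c c| + 1 + (1 + \sum_(i | i != j) (`|h i c c| + 1)).
  by rewrite (bigD1 j) //=; ring.
have : 0 <= \sum_(i | i != j) (`|h i c c| + 1).
  by apply: sumr_ge0 => i _; rewrite addr_ge0.
rewrite -[X in `|X| <= _](subrK (h j c c)).
by have := ler_normD (h j p q - h j c c) (h j c c); lra.
Qed.

Lemma hadamard_cont f : hadamard f -> cont_diag (fun p _ => meval (p 0) f).
Proof.
move=> [h [hE ch _]] c eps eps0; have [eta [H [eta0 H0 hH]]] := cont_diag_bound c ch.
have M0 : 0 < H * m%:R + 1 by rewrite ltr_wpDl // mulr_ge0 // ltW.
exists (Num.min eta (eps / (H * m%:R + 1) / 2)).
  by rewrite lt_min eta0 !divr_gt0.
move=> p _ /nearby_min[p1 p2] _; rewrite hE.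
apply: le_lt_trans (ler_norm_sum _ _ _) _.
apply: (@le_lt_trans _ _ (\sum_(j < m) H * (eps / (H * m%:R + 1) / 2))).
  apply: ler_sum => j _; rewrite normrM; apply: ler_pM => //.
  by apply: hH => // i; rewrite subrr normr0 ltW.
rewrite sumr_const card_ord -[_ *+ m]mulr_natl.
rewrite (_ : m%:R * _ = eps * (H * m%:R) / (H * m%:R + 1) / 2); last first.
  by field; rewrite gt_eqF.
rewrite ltr_pdivrMr // ltr_pdivrMr //.
have : 0 <= H * m%:R by rewrite mulr_ge0 // ltW.
nra.
Qed.

Lemma hadamardC (a : R) : hadamard (mpolyC m a).
Proof.
exists (fun _ _ _ => 0); split.
- by move=> p q; rewrite !mevalC subrr big1 // => j _; rewrite mul0r.
- by move=> j; apply: cont_diag_cst.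
- by move=> j c; rewrite mderivC meval0.
Qed.

Lemma hadamardU i : hadamard (mpolyX R (mnm1 i)).
Proof.
exists (fun j _ _ => (j == i)%:R); split.
- move=> p q; rewrite !mevalXU (bigD1 i) //= eqxx mul1r big1 ?addr0 // => j /negbTE->.
  by rewrite mul0r.
- by move=> j; apply: cont_diag_cst.
- move=> j c; rewrite mderivX mevalZ mevalX mnm1E eq_sym.
  have [->|_] := eqVneq j i; last by rewrite mul0r.
  by rewrite mul1r big1 // => k _; rewrite mnmBE subnn expr0.
Qed.

Lemma hadamardD f (g : mpoly m R) : hadamard f -> hadamard g -> hadamard (f + g).
Proof.
move=> [h [h1 h2 h3]] [k [k1 k2 k3]].
exists (fun j p q => h j p q + k j p q); split.
- move=> p q; rewrite !mevalD (_ : _ - _ = (meval (p 0) f - meval (q 0) f)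
    + (meval (p 0) g - meval (q 0) g)); last by ring.
  by rewrite h1 k1 -big_split; apply: eq_bigr => j _; rewrite mulrDl.
- by move=> j; apply: cont_diagD.
- by move=> j c; rewrite mderivD mevalD h3 k3.
Qed.

Lemma hadamardM f (g : mpoly m R) : hadamard f -> hadamard g -> hadamard (f * g).
Proof.
move=> hf hg; have cf := hadamard_cont hf; have cg := hadamard_cont hg.
move: hf hg => [h [h1 h2 h3]] [k [k1 k2 k3]].
exists (fun j p q => h j p q * meval (p 0) g + meval (q 0) f * k j p q); split.
- move=> p q; rewrite !mevalM (_ : _ - _ = (meval (p 0) f - meval (q 0) f) * meval (p 0) g
    + meval (q 0) f * (meval (p 0) g - meval (q 0) g)); last by ring.
  rewrite h1 k1 mulr_suml mulr_sumr -big_split; apply: eq_bigr => j _ /=.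
  by ring.
- move=> j; apply: cont_diagD; apply: cont_diagM => //.
  move=> c eps eps0; have [eta e0 H] := cf c eps eps0.
  by exists eta => // p q np nq; apply: (H q q).
- by move=> j c; rewrite mderivM mevalD !mevalM h3 k3.
Qed.

(** The property passes to sums and products, so it is enough to have it for constants and variables
    and the quotients are never written down. *)
Lemma hadamard_all f : hadamard f.
Proof.
elim/mpolyind: f => [|a u f _ _ hf]; first by rewrite -mpolyC0; apply: hadamardC.
apply: hadamardD => //; rewrite -mul_mpolyC; apply: hadamardM; first exact: hadamardC.
rewrite mpolyXE_id; elim/big_ind: _ => [||i _]; first by rewrite -mpolyC1; apply: hadamardC.
- exact: hadamardM.
elim: (u i) => [|k IH]; first by rewrite expr0 -mpolyC1; apply: hadamardC.
by rewrite exprS; apply: hadamardM => //; apply: hadamardU.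
Qed.

Lemma grid_cell n (s t : R) : 0 <= t -> t <= n.+1%:R * s ->
  exists k : 'I_n.+1, k%:R * s <= t <= (k%:R + 1) * s.
Proof.
move=> t0; elim: n => [|n IH] tn.
  by exists ord0; rewrite mul0r t0 add0r.
have [/IH[k hk]|tk] := leP t (n.+1%:R * s).
  by exists (widen_ord (leqnSn _) k).
exists ord_max; rewrite /= (ltW tk) /=; by rewrite -(natrD _ n.+1 1) addn1.
Qed.

(** A Lipschitz form of the implicit function theorem: for two zeros near c the factorization reads
    0 = sum of quotients times differences, and the quotient of index [i] stays away from 0, so the
    i-th coordinates differ by at most a constant times the other differences. A grid with N cells
    in each of the other m - 1 directions then yields N^(m - 1) boxes of volume of order N^(-m). *)
Lemma null_zeros_near f c i : meval (c 0) (mderiv i f) != 0 ->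
  exists2 eta : R, 0 < eta & null_set [set p : 'rV[R]_m | meval (p 0) f = 0 /\ nearby eta c p].
Proof.
move=> d0; have [h [hE ch hd]] := hadamard_all f; set d := meval _ _ in d0.
have d20 : 0 < `|d| / 2 by rewrite divr_gt0 ?normr_gt0.
have [e1 e10 H1] := ch i c _ d20.
have [e2 [H [e20 H0 H2]]] := cont_diag_bound c ch.
pose eta := Num.min e1 e2; have eta0 : 0 < eta by rewrite lt_min e10 e20.
exists eta => //.
have lip p q : meval (p 0) f = 0 -> meval (q 0) f = 0 -> nearby eta c p -> nearby eta c q ->
    `|p 0 i - q 0 i| <= H / (`|d| / 2) * \sum_(j | j != i) `|p 0 j - q 0 j|.
  move=> fp fq /nearby_min[p1 p2] /nearby_min[q1 q2].
  have := hE p q; rewrite fp fq subrr (bigD1 i) //= => /esym/eqP.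
  rewrite addr_eq0 => /eqP E.
  have dh : `|d| / 2 <= `|h i p q|.
    have := H1 p q p1 q1; rewrite hd -/d => hlt.
    have : `|d| <= `|h i p q| + `|h i p q - d|.
      rewrite -[X in `|X| <= _](subKr (h i p q)); exact: ler_normB.
    lra.
  rewrite mulrAC ler_pdivlMr //.
  apply: (@le_trans _ _ `|h i p q * (p 0 i - q 0 i)|).
    by rewrite normrM mulrC ler_wpM2r.
  rewrite E normrN mulr_sumr; apply: le_trans (ler_norm_sum _ _ _) _.
  by apply: ler_sum => j _; rewrite normrM ler_wpM2r // H2.
apply: null_set_finite => // eps eps0.
have eq_le (a b : R) : a = b -> a <= b by move->.
(* [C / n.+1] bounds the variation of the i-th coordinate over the zeros in one cell, and [W / n.+1]
   is the total volume of all boxes. *)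
pose C := H / (`|d| / 2) * m%:R * (2 * eta).
have C0 : 0 <= C.
  apply: mulr_ge0; last by rewrite mulr_ge0 // ltW.
  by apply: mulr_ge0 => //; apply: divr_ge0; apply: ltW.
pose W := (2 * C) * \prod_(j < m | j != i) (2 * eta).
have W0 : 0 <= W.
  apply: mulr_ge0; first exact: mulr_ge0.
  by apply: prodr_ge0 => j _; rewrite mulr_ge0 // ltW.
pose n := Num.truncn (W / eps).
have nW : W / n.+1%:R <= eps.
  rewrite ler_pdivrMr // mulrC -ler_pdivrMr //; apply: ltW.
  by rewrite truncnS_gt.
pose s := 2 * eta / n.+1%:R; have s0 : 0 < s by rewrite divr_gt0 // mulr_gt0.
pose delta := C / n.+1%:R; have delta0 : 0 <= delta by rewrite divr_ge0.
pose lo (k : {ffun 'I_m -> 'I_n.+1}) j := c 0 j - eta + (k j)%:R * s.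
pose good k q := [/\ meval (q 0) f = 0, nearby eta c q &
   forall j, j != i -> lo k j <= q 0 j <= lo k j + s].
(* One zero is selected in each cell that contains any; in direction [i] the box of the cell is
   centred at it. *)
have /choice[Q QP] (k : {ffun 'I_m -> 'I_n.+1}) : exists q, (exists q, good k q) -> good k q.
  have [[q gq]|ng] := pselect (exists q, good k q); first by exists q.
  by exists 0 => e; case: ng.
(* Cells are indexed by functions on all coordinates, which lets the total volume factor; an index
   with [k i] nonzero gets a degenerate box. *)
pose A (k : {ffun 'I_m -> 'I_n.+1}) : 'rV[R]_m := if (k i == ord0) then \row_j (if j == i then Q k 0 i - delta else lo k j) else 0.
pose B (k : {ffun 'I_m -> 'I_n.+1}) : 'rV[R]_m := if (k i == ord0) then \row_j (if j == i then Q k 0 i + delta else lo k j + s) else 0.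
exists [seq (A k, B k) | k : {ffun 'I_m -> 'I_n.+1}]; split.
- move=> _ j /mapP[k _ ->] /=; rewrite /A /B; case: ifP => // _; rewrite !mxE.
  by case: ifP => _; [rewrite lerD2l; lra|rewrite lerDl ltW].
- move=> p [fp np].
  have /choice[k kP] j : exists k : 'I_n.+1,
      c 0 j - eta + k%:R * s <= p 0 j <= c 0 j - eta + k%:R * s + s.
    have := np j; rewrite ler_norml => /andP[l1 l2].
    have [||k /andP[k1 k2]] := @grid_cell n s (p 0 j - c 0 j + eta); first by lra.
      rewrite /s [_ * (_ / _)]mulrC divfK ?pnatr_eq0 //; lra.
    by exists k; apply/andP; split; lra.
  pose kf := [ffun j => if j == i then ord0 else k j].
  have gp : good kf p.
    split=> // j ji; rewrite /lo ffunE (negbTE ji); exact: kP.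
  have [fq nq gq] := QP kf (ex_intro _ p gp); set q := Q kf in fq nq gq.
  exists (A kf, B kf); first by apply: map_f; rewrite mem_enum.
  move=> j; rewrite /A /B /= ffunE eqxx eqxx !mxE; case: ifP => [/eqP->|/negbT ji].
    suff : `|p 0 i - q 0 i| <= delta by rewrite ler_norml => /andP[]; rewrite -/q; lra.
    apply: le_trans (lip p q fp fq np nq) _.
    rewrite /delta /C -!mulrA; apply: ler_wpM2l; first exact: ltW.
    rewrite ler_wpM2l ?invr_ge0 ?(ltW d20) // (_ : 2 * _ = s); last by rewrite /s mulrA.
    apply: (@le_trans _ _ (\sum_(j < m | j != i) s)).
      apply: ler_sum => l li; have [_ _ gp3] := gp.
      have /andP[a1 a2] := gp3 l li; have /andP[b1 b2] := gq l li.
      by rewrite ler_norml; apply/andP; split; lra.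
    rewrite big_mkcond /= mulr_natl -[X in _ <= _ *+ X]card_ord -sumr_const.
    by apply: ler_sum => l _; case: ifP => // _; exact: ltW.
  by have [_ _ gp3] := gp; apply: gp3.
rewrite big_map big_enum /=.
pose G (j : 'I_m) (t : 'I_n.+1) := if j == i then (if t == ord0 then 2 * delta else 0) else s.
apply: (@le_trans _ _ (\sum_(k : {ffun 'I_m -> 'I_n.+1}) \prod_j G j (k j))).
  apply: ler_sum => k _; rewrite /vol /A /B; case: (k i =P ord0) => ki.
    apply: eq_le; apply: eq_bigr => j _; rewrite !mxE /G.
    by case: (j =P i) => [->|_]; [rewrite ki eqxx; ring|ring].
  rewrite (bigD1 i) //= subrr mul0r prodr_ge0 // => j _; rewrite /G.
  by case: ifP => _; [case: ifP => // _; rewrite mulr_ge0|apply: ltW].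
rewrite -bigA_distr_bigA (bigD1 i) //= {1}/G eqxx (bigD1 ord0) //= big1 => [|t /negbTE->//].
rewrite addr0 (eq_bigr (fun=> 2 * eta)) => [|j /negbTE ji]; last first.
  rewrite /G ji sumr_const card_ord -[_ *+ _]mulr_natl /s.
  by rewrite [_ * (_ / _)]mulrC divfK ?pnatr_eq0.
by apply: le_trans nW; rewrite /W /delta; apply: eq_le; ring.
Qed.

(** Induction on the size: the zeros of a partial derivative that is not the zero polynomial are
    null, and the zeros of [f] off this set have null neighbourhoods, among which countably many
    boxes with rational corners suffice. *)
Lemma null_zeros f : f != 0 -> null_set [set p : 'rV[R]_m | meval (p 0) f = 0].
Proof.
have [k] := ubnP (msize f); elim: k f => // k IH f /ltnSE fk f0.
have [/eqP f1|f1] := boolP (msize f == 1%N).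
  have [/msize_poly1P[a a0 fE]] := introT eqP f1.
  rewrite fE; apply: (@null_set_sub _ _ _ set0) => [p /=|]; first by rewrite mevalC => a00; rewrite a00 eqxx in a0.
  move=> eps eps0; exists (fun=> 0), (fun=> 0); split=> // N.
  by rewrite big1 ?ltW // => l _; apply: vol_point.
have [i di] : exists i, mderiv i f != 0.
  apply: contrapT => h; have {}h i : mderiv i f = 0.
    by apply: contrapT => /eqP hi; apply: h; exists i.
  (* In characteristic zero a polynomial whose derivatives all vanish is constant. *)
  have fz u : u != mnm0 -> mcoeff u f = 0.
    move=> u0; have [i ui] : exists i, u i != 0%N.
      apply: contrapT => hu; case/eqP: u0; apply/mnmP => i; rewrite mnm0E.
      by apply: contrapT => /eqP ui; apply: hu; exists i.
    have := mcoeff_deriv i (mnm_sub u (mnm1 i)) f; rewrite h mcoeff0.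
    rewrite submK; last by apply/mnm_lepP => j; rewrite mnm1E; case: eqP => [<-|//]; rewrite lt0n.
    by move/esym/eqP; rewrite mulrn_eq0 /= => /eqP.
  case/eqP: f1; apply/eqP/msize_poly1P; exists (mcoeff mnm0 f).
    apply: contra f0 => /eqP f00; apply/eqP/mpolyP => u; rewrite mcoeff0.
    by have [->//|/fz] := eqVneq u mnm0.
  apply/mpolyP => u; rewrite mcoeffC; have [->|u0] := eqVneq u mnm0.
    by rewrite mulr1.
  by rewrite fz // mulr0.
pose Z := [set p : 'rV[R]_m | meval (p 0) f = 0].
pose bx (t : 'rV[rat]_m * 'rV[rat]_m) : set 'rV[R]_m :=
  [set p | forall j, ratr (t.1 0 j) <= p 0 j <= ratr (t.2 0 j)].
(* [None] stands for the zeros of the derivative. A rational box counts only if it meets the zeros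
   of [f] in a null set, so that each member of the family is null by construction. *)
pose E (o : option ('rV[rat]_m * 'rV[rat]_m)) : set 'rV[R]_m :=
  if o is Some t then (if `[< null_set (Z `&` bx t) >] then Z `&` bx t else set0)
  else [set p | meval (p 0) (mderiv i f) = 0].
apply: (@null_set_sub _ _ _ (\bigcup_o E o)); last first.
  apply: null_set_bigcup_count => // -[t|] /=; last first.
    apply: IH => //; apply: leq_trans fk.
    have fp : (0 < msize f)%N by rewrite lt0n msize_poly_eq0.
    rewrite -(prednK fp) ltnS; rewrite [msize (mderiv i f)]msizeE; apply/bigmax_leqP_seq => u us _.
    move: us; rewrite mcoeff_msupp mcoeff_deriv => us.
    have : (mnm_add u (mnm1 i)) \in msupp f.
      by rewrite mcoeff_msupp; apply: contraNneq us => ->; rewrite mul0rn.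
    by move/msize_mdeg_lt; rewrite mdegD mdeg1 addn1; case: (msize f) fp.
  case: ifP => [/asboolP//|_] eps eps0; exists (fun=> 0), (fun=> 0); split=> // N.
  by rewrite big1 ?ltW // => l _; apply: vol_point.
move=> c fc; have [dc|dc] := eqVneq (meval (c 0) (mderiv i f)) 0; first by exists None.
have [eta eta0 nn] := null_zeros_near dc.
have /choice[a aP] j : exists q : rat, c 0 j - eta < ratr q < c 0 j.
  have [|q] := @rat_in_itvoo R (c 0 j - eta) (c 0 j); first by rewrite ltrBlDr ltrDl.
  by rewrite in_itv; exists q.
have /choice[b bP] j : exists q : rat, c 0 j < ratr q < c 0 j + eta.
  have [|q] := @rat_in_itvoo R (c 0 j) (c 0 j + eta); first by rewrite ltrDl.
  by rewrite in_itv; exists q.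
pose t := (\row_j a j, \row_j b j).
exists (Some t) => //=; rewrite asboolT; last first.
  apply: null_set_sub nn => p [fp pt]; split=> // j; have := pt j; rewrite !mxE.
  have := aP j; have := bP j; move=> /andP[b1 b2] /andP[a1 a2] /andP[c1 c2].
  by rewrite ler_norml; apply/andP; split; lra.
split=> // j; rewrite !mxE; have /andP[_ a2] := aP j; have /andP[b1 _] := bP j.
by rewrite !ltW.
Qed.

End PolyZeros.

(** * Generic conditions on the sites *)

Section Generic.
Variables (m n : nat).
Implicit Types (v w : 'M[int]_(m, n)) (f g : 'M[int]_(m, n) -> int).

Definition polyfun f :=
  exists P : mpoly (m * n) int, forall v, f v = meval (mxvec v 0) P.

Definition generic (G : 'M[int]_(m, n) -> Prop) :=
  exists2 P : mpoly (m * n) int, P != 0 &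
    forall v, meval (mxvec v 0) P != 0 -> G v.

Lemma polyfun_ext f g : f =1 g -> polyfun f -> polyfun g.
Proof. by move=> fg [P hP]; exists P => v; rewrite -fg. Qed.

Lemma polyfun_cst a : polyfun (fun=> a).
Proof. by exists (mpolyC _ a) => v; rewrite mevalC. Qed.

Lemma polyfun_entry i j : polyfun (fun v => v i j).
Proof.
by exists (mpolyX _ (mnm1 (mxvec_index i j))) => v; rewrite mevalXU mxvecE.
Qed.

Lemma polyfunD f g : polyfun f -> polyfun g -> polyfun (fun v => f v + g v).
Proof. by move=> [P hP] [Q hQ]; exists (P + Q) => v; rewrite mevalD hP hQ. Qed.

Lemma polyfunN f : polyfun f -> polyfun (fun v => - f v).
Proof. by move=> [P hP]; exists (- P) => v; rewrite mevalN hP. Qed.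

Lemma polyfunB f g : polyfun f -> polyfun g -> polyfun (fun v => f v - g v).
Proof. by move=> hf hg; apply: polyfunD => //; apply: polyfunN. Qed.

Lemma polyfunM f g : polyfun f -> polyfun g -> polyfun (fun v => f v * g v).
Proof. by move=> [P hP] [Q hQ]; exists (P * Q) => v; rewrite mevalM hP hQ. Qed.

Lemma polyfun_sum (I : Type) (r : seq I) (Q : pred I) (F : I -> 'M[int]_(m, n) -> int) :
  (forall i, polyfun (F i)) -> polyfun (fun v => \sum_(i <- r | Q i) F i v).
Proof.
move=> hF; elim: r => [|i r IH].
  by apply: polyfun_ext (polyfun_cst 0) => v; rewrite big_nil.
have [qi|/negbTE qi] := boolP (Q i).
  by apply: polyfun_ext (polyfunD (hF i) IH) => v; rewrite big_cons qi.
by apply: polyfun_ext IH => v; rewrite big_cons qi.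
Qed.

Lemma polyfun_prod (I : Type) (r : seq I) (F : I -> 'M[int]_(m, n) -> int) :
  (forall i, polyfun (F i)) -> polyfun (fun v => \prod_(i <- r) F i v).
Proof.
move=> hF; elim: r => [|i r IH].
  by apply: polyfun_ext (polyfun_cst 1) => v; rewrite big_nil.
by apply: polyfun_ext (polyfunM (hF i) IH) => v; rewrite big_cons.
Qed.

Lemma polyfun_det k (M : 'M[int]_(m, n) -> 'M[int]_k) :
  (forall i j, polyfun (fun v => M v i j)) -> polyfun (fun v => \det (M v)).
Proof.
move=> hM; apply: polyfun_sum => s; apply: polyfunM; first exact: polyfun_cst.
exact: polyfun_prod.
Qed.

Lemma polyfun_mulmx k p (M : 'M[int]_(m, n) -> 'M[int]_(k, p)) l
    (N : 'M[int]_(m, n) -> 'M[int]_(p, l)) i j :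
  (forall i j, polyfun (fun v => M v i j)) -> (forall i j, polyfun (fun v => N v i j)) ->
  polyfun (fun v => (M v *m N v) i j).
Proof.
move=> hM hN; apply: polyfun_ext (_ : polyfun (fun v => \sum_k M v i k * N v k j)) => [v|].
  by rewrite mxE.
by apply: polyfun_sum => t; apply: polyfunM.
Qed.

Lemma polyfun_adj k (M : 'M[int]_(m, n) -> 'M[int]_k) i j :
  (forall i j, polyfun (fun v => M v i j)) -> polyfun (fun v => (\adj (M v)) i j).
Proof.
move=> hM; apply: polyfun_ext (_ : polyfun (fun v => cofactor (M v) j i)) => [v|].
  by rewrite mxE.
apply: polyfunM; first exact: polyfun_cst.
apply: polyfun_det => a b; apply: polyfun_ext (hM (lift j a) (lift i b)) => v.
by rewrite !mxE.
Qed.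

Lemma generic_true (G : 'M[int]_(m, n) -> Prop) : (forall v, G v) -> generic G.
Proof. by move=> h; exists 1; rewrite ?oner_eq0. Qed.

Lemma generic_imp (G G' : 'M[int]_(m, n) -> Prop) :
  (forall v, G v -> G' v) -> generic G -> generic G'.
Proof. by move=> h [P P0 hP]; exists P => // v /hP /h. Qed.

Lemma generic_and (G G' : 'M[int]_(m, n) -> Prop) :
  generic G -> generic G' -> generic (fun v => G v /\ G' v).
Proof.
move=> [P P0 hP] [Q Q0 hQ]; exists (P * Q); first by rewrite mulf_neq0.
by move=> v; rewrite mevalM mulf_eq0 negb_or => /andP[/hP ? /hQ].
Qed.

Lemma generic_forall (T : finType) (G : T -> 'M[int]_(m, n) -> Prop) :
  (forall t, generic (G t)) -> generic (fun v => forall t, G t v).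
Proof.
move=> hG; suff H (s : seq T) : generic (fun v => forall t, t \in s -> G t v).
  by apply: generic_imp (H (enum T)) => v h t; apply: h; rewrite mem_enum.
elim: s => [|t s IH]; first exact: generic_true.
apply: generic_imp (generic_and (hG t) IH) => v [h1 h2] u.
by rewrite inE => /orP[/eqP->//|/h2].
Qed.

Lemma generic_neq0 f w : polyfun f -> f w != 0 -> generic (fun v => f v != 0).
Proof.
move=> [P hP] fw; exists P; last by move=> v; rewrite hP.
by apply: contraNneq fw => P0; rewrite hP P0 meval0.
Qed.

(* Either the polynomial condition is a nontrivial one, and then it fails for
   generic sites, or it holds for all sites. *)
Lemma generic_vanish f (C : Prop) : polyfun f -> ((forall w, f w = 0) -> C) ->
  generic (fun v => f v = 0 -> C).
Proof.
move=> pf fC; have [h|] := pselect (forall w, f w = 0).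
  by apply: generic_true => v _; apply: fC.
move/existsNP => [w /eqP fw]; apply: generic_imp (generic_neq0 pf fw) => v.
by move=> fv fv0; rewrite fv0 eqxx in fv.
Qed.

Definition bounded N k l (A : 'M[int]_(k, l)) := forall i j, `|A i j| <= N%:Z.

(** Bounded integer matrices are finitely many, so their conditions can be multiplied into a single
    polynomial. *)
Lemma generic_bounded N k l (G : 'M[int]_(k, l) -> 'M[int]_(m, n) -> Prop) :
  (forall A, generic (G A)) -> generic (fun v => forall A, bounded N A -> G A v).
Proof.
move=> hG; pose dec (t : 'M['I_(N.*2.+1)]_(k, l)) : 'M[int]_(k, l) :=
  map_mx (fun a : 'I_(N.*2.+1) => (a : nat)%:Z - N%:Z) t.
apply: generic_imp (generic_forall (fun t => hG (dec t))) => v h A bA.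
suff -> : A = dec (map_mx (fun a : int => inord (absz (a + N%:Z)%R)) A) by [].
apply/matrixP => i j; rewrite !mxE; have := bA i j => hb.
by rewrite inordK; lia.
Qed.

End Generic.

(** * Integral linear algebra, energy of labels, collinear sites *)

Lemma common_denominator k l (D : 'M[rat]_(k, l)) :
  exists2 d : int, d != 0 & exists Z : 'M[int]_(k, l),
    d%:~R *: D = map_mx intr Z.
Proof.
pose d := \prod_(p : 'I_k * 'I_l) denq (D p.1 p.2).
exists d; first by apply/prodf_neq0 => p _; rewrite denq_neq0.
exists (\matrix_(i, j) (numq (D i j) * \prod_(p | p != (i, j)) denq (D p.1 p.2))).
apply/matrixP => i j; rewrite !mxE /d (bigD1 (i, j)) //= !intrM.
by rewrite mulrAC [_ * D i j]mulrC -numqE.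
Qed.

Definition ratmx k l (A : 'M[int]_(k, l)) : 'M[rat]_(k, l) := map_mx intr A.

Lemma ratmx_inj k l : injective (@ratmx k l).
Proof.
by move=> A B /matrixP h; apply/matrixP => i j; have := h i j; rewrite !mxE => /intr_inj.
Qed.

Lemma ratmxM k l p (A : 'M[int]_(k, l)) (B : 'M[int]_(l, p)) :
  ratmx (A *m B) = ratmx A *m ratmx B.
Proof. exact: map_mxM. Qed.

(** Over the integers a right inverse exists up to a factor. The columns of [Y] are [c] times a dual
    basis of the rows of [A]; used as sites, they give the forms of these rows prescribed values. *)
Lemma int_right_inverse k l (A : 'M[int]_(k, l)) : row_free (ratmx A) ->
  exists2 c : int, c != 0 & exists Y : 'M[int]_(l, k), A *m Y = c%:M.
Proof.
move=> /row_freeP[B AB]; have [c c0 [Y hY]] := common_denominator B.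
exists c => //; exists Y; apply: ratmx_inj.
rewrite ratmxM [ratmx Y](_ : _ = c%:~R *: B) // -scalemxAr AB scalemx1.
by rewrite /ratmx map_scalar_mx.
Qed.

Lemma int_combination k l (A : 'M[int]_(k, l)) (L : 'rV[int]_l) :
  (ratmx L <= ratmx A)%MS ->
  exists2 d : int, d != 0 & exists e : 'rV[int]_k, d *: L = e *m A.
Proof.
move=> /submxP[D LD]; have [d d0 [e he]] := common_denominator D.
exists d => //; exists e; apply: ratmx_inj.
rewrite ratmxM [ratmx e](_ : _ = d%:~R *: D) // -scalemxAl -LD.
by apply/matrixP => i j; rewrite !mxE intrM.
Qed.

Lemma row_free_cons k l (L : 'rV[int]_l) (A : 'M[int]_(k, l)) :
  row_free (ratmx A) -> ~~ (ratmx L <= ratmx A)%MS -> row_free (ratmx (col_mx L A)).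
Proof.
move=> fA nL; rewrite /row_free /ratmx map_col_mx.
rewrite eqn_leq rank_leq_row /=.
have lt : (ratmx A < ratmx L + ratmx A)%MS.
  by rewrite ltmxE addsmxSr; apply: contra nL => h; apply: submx_trans h; apply: addsmxSl.
have := ltmxErank (ratmx A) (ratmx L + ratmx A)%MS; rewrite lt => /esym/andP[_].
by rewrite addsmxE (eqP fA).
Qed.

Section Dot.
Variable p : nat.
Implicit Types x y z : 'rV[int]_p.

Lemma dotC x y : dot x y = dot y x.
Proof. by apply: eq_bigr => i _; rewrite mulrC. Qed.

Lemma dotDr x y z : dot x (y + z) = dot x y + dot x z.
Proof. by rewrite /dot -big_split; apply: eq_bigr => i _; rewrite mxE mulrDr. Qed.

Lemma dotZr a x y : dot x (a *: y) = a * dot x y.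
Proof. by rewrite /dot mulr_sumr; apply: eq_bigr => i _; rewrite mxE mulrCA. Qed.

Lemma dotNr x y : dot x (- y) = - dot x y.
Proof. by rewrite -scaleN1r dotZr mulN1r. Qed.

Lemma dotDl x y z : dot (y + z) x = dot y x + dot z x.
Proof. by rewrite dotC dotDr !(dotC x). Qed.

Lemma dotZl a x y : dot (a *: y) x = a * dot y x.
Proof. by rewrite dotC dotZr dotC. Qed.

Lemma dotNl x y : dot (- y) x = - dot y x.
Proof. by rewrite dotC dotNr dotC. Qed.

Lemma dot0r x : dot x 0 = 0.
Proof. by rewrite /dot big1 // => i _; rewrite mxE mulr0. Qed.

Lemma dot_suml k (e : 'rV[int]_k) (A : 'M[int]_(k, p)) x :
  dot x (e *m A) = \sum_i e 0 i * dot x (row i A).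
Proof.
rewrite mulmx_sum_row; elim/big_ind2: _ => [|a b c d <- <-|i _]; first exact: dot0r.
  by rewrite dotDr.
by rewrite dotZr.
Qed.

End Dot.

Lemma sqn_ge0 p (x : 'rV[int]_p) : 0 <= sqn x.
Proof. by apply: sumr_ge0 => i _; rewrite -expr2 sqr_ge0. Qed.

Lemma sqn_eq0 p (x : 'rV[int]_p) : (sqn x == 0) = (x == 0).
Proof.
apply/idP/eqP => [|->]; last by rewrite /sqn dot0r.
rewrite psumr_eq0 => [/allP h|i _]; last by rewrite -expr2 sqr_ge0.
apply/rowP => i; rewrite mxE; apply/eqP; have := h i (mem_index_enum _).
by rewrite /= mulf_eq0 orbb.
Qed.

Lemma sqnD p (x y : 'rV[int]_p) : sqn (x + y) = sqn x + 2 * dot x y + sqn y.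
Proof. by rewrite /sqn !(dotDl, dotDr) (dotC y x); ring. Qed.

Lemma sqnZ p (a : int) (x : 'rV[int]_p) : sqn (a *: x) = a ^+ 2 * sqn x.
Proof. by rewrite /sqn dotZl dotZr mulrA. Qed.

Lemma sqnN p (x : 'rV[int]_p) : sqn (- x) = sqn x.
Proof. by rewrite /sqn dotNl dotNr opprK. Qed.

Section Energy.
Variables (m n : nat).
Implicit Types (v w : 'M[int]_(m, n)) (L : 'rV[int]_m) (x y : 'rV[int]_n).

(* L encodes the formal vertex s x + pi(L); en v L is its energy excess. *)
Definition en v L : int := \sum_i L 0 i * sqn (row i v).
Definition qf v L : int := en v L - sqn (L *m v).
Definition rf v L : int := 2 * en v L - sqn (L *m v).

(** Energy conservation for the vertex x + pi(L): the squares of x cancel, and a hyperplane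
    remains. *)
Definition eqp v x L := 2 * dot x (L *m v) = qf v L.
(** Energy conservation for the vertex - x + pi(L): completing the square gives a sphere about half
    of pi(L). *)
Definition eqm v x L := sqn (2 *: x - L *m v) = rf v L.

Lemma enD v L1 L2 : en v (L1 + L2) = en v L1 + en v L2.
Proof. by rewrite /en -big_split; apply: eq_bigr => i _; rewrite mxE mulrDl. Qed.

Lemma enZ v a L : en v (a *: L) = a * en v L.
Proof. by rewrite /en mulr_sumr; apply: eq_bigr => i _; rewrite mxE mulrA. Qed.

Lemma enN v L : en v (- L) = - en v L.
Proof. by rewrite -scaleN1r enZ mulN1r. Qed.

Lemma polyfun_sqn (g : 'M[int]_(m, n) -> 'rV[int]_n) :
  (forall j, polyfun (fun v => g v 0 j)) -> polyfun (fun v => sqn (g v)).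
Proof. by move=> h; apply: polyfun_sum => i; apply: polyfunM. Qed.

Lemma polyfun_mom L j : polyfun (fun v => (L *m v) 0 j).
Proof.
apply: polyfun_mulmx => i k; first exact: polyfun_cst.
exact: polyfun_entry.
Qed.

Lemma polyfun_en L : polyfun (fun v => en v L).
Proof.
apply: polyfun_sum => i; apply: polyfunM; first exact: polyfun_cst.
by apply: polyfun_sqn => j; apply: polyfun_ext (polyfun_entry i j) => v; rewrite mxE.
Qed.

Lemma polyfun_qf L : polyfun (fun v => qf v L).
Proof. by apply: polyfunB; [exact: polyfun_en|apply: polyfun_sqn => j; exact: polyfun_mom]. Qed.

Lemma polyfun_rf L : polyfun (fun v => rf v L).
Proof.
apply: polyfunB; last by apply: polyfun_sqn => j; exact: polyfun_mom.
by apply: polyfunM; [exact: polyfun_cst|exact: polyfun_en].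
Qed.

End Energy.
Arguments polyfun_en {m n} L.
Arguments polyfun_qf {m n} L.
Arguments polyfun_rf {m n} L.

Section Line.
Variables (m p : nat).
Implicit Types (y z : 'I_m -> int) (L : 'rV[int]_m).

Definition lin L y : int := \sum_i L 0 i * y i.
Definition qua L y : int := \sum_i L 0 i * y i ^+ 2.
(** All sites on the first axis: momentum and energy become the linear form [lin] and the diagonal
    quadratic form [qua], and an identity in the sites becomes one between polynomials in [y]. *)
Definition vline y : 'M[int]_(m, p.+1) := \matrix_(i, j) (if j == ord0 then y i else 0).

Lemma mom_vline L y : L *m vline y = lin L y *: delta_mx 0 ord0.
Proof.
apply/rowP => j; rewrite !mxE eqxx /=; case: (eqVneq j ord0) => [->|/negbTE jn] /=.
  by rewrite mulr1; apply: eq_bigr => i _; rewrite mxE eqxx.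
by rewrite mulr0 big1 // => i _; rewrite mxE jn mulr0.
Qed.

Lemma sqn_delta (a : int) : sqn (a *: delta_mx 0 ord0 : 'rV[int]_p.+1) = a ^+ 2.
Proof.
rewrite /sqn /dot (bigD1 ord0) //= big1 => [|i /negbTE i0]; rewrite !mxE /=.
  by rewrite mulr1 addr0.
by rewrite i0 /= mulr0 mul0r.
Qed.

Lemma sqn_vline L y : sqn (L *m vline y) = lin L y ^+ 2.
Proof. by rewrite mom_vline sqn_delta. Qed.

Lemma en_vline L y : en (vline y) L = qua L y.
Proof.
apply: eq_bigr => i _; congr (_ * _); rewrite -(sqn_delta (y i)); congr sqn.
by apply/rowP => j; rewrite !mxE /=; case: (j == ord0); rewrite ?mulr1 ?mulr0.
Qed.

Lemma qf_vline L y : qf (vline y) L = qua L y - lin L y ^+ 2.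
Proof. by rewrite /qf en_vline sqn_vline. Qed.

Lemma rf_vline L y : rf (vline y) L = 2 * qua L y - lin L y ^+ 2.
Proof. by rewrite /rf en_vline sqn_vline. Qed.

Lemma linD L y z : lin L (fun i => y i + z i) = lin L y + lin L z.
Proof. by rewrite /lin -big_split; apply: eq_bigr => i _; rewrite mulrDr. Qed.

Lemma lin_comb k (e : 'rV[int]_k) (A : 'M[int]_(k, m)) y :
  lin (e *m A) y = \sum_s e 0 s * lin (row s A) y.
Proof.
rewrite /lin (eq_bigr (fun i => \sum_s e 0 s * (A s i * y i))); last first.
  by move=> i _; rewrite mxE mulr_suml; apply: eq_bigr => s _; rewrite mulrA.
rewrite exchange_big; apply: eq_bigr => s _; rewrite mulr_sumr.
by apply: eq_bigr => i _; rewrite mxE.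
Qed.

Lemma qua_comb k (e : 'rV[int]_k) (A : 'M[int]_(k, m)) y :
  qua (e *m A) y = \sum_s e 0 s * qua (row s A) y.
Proof. exact: (lin_comb e A (fun i => y i ^+ 2)). Qed.

Lemma linZ a L y : lin (a *: L) y = a * lin L y.
Proof. by rewrite /lin mulr_sumr; apply: eq_bigr => i _; rewrite mxE mulrA. Qed.

Lemma quaZ a L y : qua (a *: L) y = a * qua L y.
Proof. exact: linZ. Qed.

Lemma lin_addl L L' y : lin (L + L') y = lin L y + lin L' y.
Proof. by rewrite /lin -big_split; apply: eq_bigr => i _; rewrite mxE mulrDl. Qed.

Lemma qua_addl L L' y : qua (L + L') y = qua L y + qua L' y.
Proof. exact: lin_addl. Qed.

Lemma lin_opp L y : lin (- L) y = - lin L y.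
Proof. by rewrite -scaleN1r linZ mulN1r. Qed.

Lemma qua_opp L y : qua (- L) y = - qua L y.
Proof. exact: lin_opp. Qed.

(** Points with one, two or three nonzero coordinates, at which the coefficients of such identities
    are read off. *)
Definition pt1 i (a : int) : 'I_m -> int := fun k => if k == i then a else 0.

Lemma lin_pt1 L i a : lin L (pt1 i a) = L 0 i * a.
Proof.
rewrite /lin (bigD1 i) //= /pt1 eqxx big1 ?addr0 // => k /negbTE->.
by rewrite mulr0.
Qed.

Lemma qua_pt1 L i a : qua L (pt1 i a) = L 0 i * a ^+ 2.
Proof.
rewrite /qua (bigD1 i) //= /pt1 eqxx big1 ?addr0 // => k /negbTE->.
by rewrite expr0n mulr0.
Qed.

Definition pt2 i j (a b : int) : 'I_m -> int := fun k => pt1 i a k + pt1 j b k.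

Lemma lin_pt2 L i j a b : lin L (pt2 i j a b) = L 0 i * a + L 0 j * b.
Proof. by rewrite linD !lin_pt1. Qed.

Lemma quaD_disj L y z : (forall k, y k * z k = 0) ->
  qua L (fun k => y k + z k) = qua L y + qua L z.
Proof.
move=> yz; rewrite /qua -big_split; apply: eq_bigr => k _ /=.
have -> : (y k + z k) ^+ 2 = y k ^+ 2 + z k ^+ 2 + 2 * (y k * z k) by ring.
by rewrite yz; ring.
Qed.

Lemma pt1_disj i j a b k : i != j -> pt1 i a k * pt1 j b k = 0.
Proof.
move=> ij; rewrite /pt1; case: eqP => [->|_]; last by rewrite mul0r.
by rewrite (negbTE ij) mulr0.
Qed.

Lemma qua_pt2 L i j a b : i != j -> qua L (pt2 i j a b) = L 0 i * a ^+ 2 + L 0 j * b ^+ 2.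
Proof. by move=> ij; rewrite quaD_disj ?qua_pt1 // => k; apply: pt1_disj. Qed.

Definition pt3 i j l (a b c : int) : 'I_m -> int := fun k => pt2 i j a b k + pt1 l c k.

Lemma lin_pt3 L i j l a b c :
  lin L (pt3 i j l a b c) = L 0 i * a + L 0 j * b + L 0 l * c.
Proof. by rewrite linD lin_pt2 lin_pt1. Qed.

Lemma qua_pt3 L i j l a b c : i != j -> i != l -> j != l ->
  qua L (pt3 i j l a b c) = L 0 i * a ^+ 2 + L 0 j * b ^+ 2 + L 0 l * c ^+ 2.
Proof.
move=> ij il jl; rewrite quaD_disj ?qua_pt2 ?qua_pt1 // => k.
by rewrite /pt2 mulrDl !pt1_disj.
Qed.

End Line.

(** * Overdetermined systems for vertices of equal sign *)

Section PlusLabels.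
Variables (m p : nat).
Local Notation n := p.+1.
Implicit Types (v : 'M[int]_(m, n)) (L : 'rV[int]_m) (x : 'rV[int]_n).

(* If L is a combination of the free labels A, the energy equations force the
   squares of the linear forms to be in the same relation, which on the dual
   basis of A leaves only idempotent coefficients. *)
Lemma generic_dependent_plus k (A : 'M[int]_(k, m)) L :
  row_free (ratmx A) -> (ratmx L <= ratmx A)%MS -> L != 0 ->
  (forall s, L != row s A) ->
  generic (fun v => forall x, (forall s, eqp v x (row s A)) -> eqp v x L -> False).
Proof.
move=> fA LA L0 LnA; have [d d0 [e dL]] := int_combination LA.
pose f v := d * qf v L - \sum_s e 0 s * qf v (row s A).
have pf : polyfun f.
  apply: polyfunB; first by apply: polyfunM; [exact: polyfun_cst|exact: polyfun_qf].
  by apply: polyfun_sum => s; apply: polyfunM; [exact: polyfun_cst|exact: polyfun_qf].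
suff fF : (forall v, f v = 0) -> False.
  apply: generic_imp (generic_vanish pf fF) => v h x hA hL; apply: h; rewrite /f -hL.
  have -> : \sum_s e 0 s * qf v (row s A) = 2 * dot x (e *m A *m v).
    rewrite -mulmxA dot_suml mulr_sumr; apply: eq_bigr => s _.
    by rewrite -hA row_mul; ring.
  by rewrite -dL -scalemxAl dotZr; ring.
(* Evaluation at the columns of [Y], dual to the rows of [A] up to [c], isolates single coefficients
   of the identity [id1]. *)
move=> f0; have [c c0 [Y AY]] := int_right_inverse fA.
have id1 y : d * lin L y ^+ 2 = \sum_s e 0 s * lin (row s A) y ^+ 2.
  have E : \sum_s e 0 s * qf (vline p y) (row s A) =
      qua (e *m A) y - \sum_s e 0 s * lin (row s A) y ^+ 2.
    by rewrite qua_comb -sumrB; apply: eq_bigr => s _; rewrite qf_vline mulrBr.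
  have := f0 (vline p y); rewrite /f qf_vline mulrBr -quaZ dL E.
  by move/eqP; rewrite subr_eq0 (inj_eq (addrI _)) eqr_opp => /eqP.
have linY s t : lin (row s A) (fun i => Y i t) = c *+ (s == t).
  have := congr1 (fun M : 'M_k => M s t) AY; rewrite !mxE => <-.
  by apply: eq_bigr => i _; rewrite mxE.
pose u s := lin L (fun i => Y i s).
have eu s : d * u s = e 0 s * c.
  rewrite /u -linZ dL lin_comb (bigD1 s) //= linY eqxx mulr1n big1 ?addr0 // => t ts.
  by rewrite linY (negbTE ts) mulr0.
(* At a dual vector [id1] reads d u_s^2 = e_s c^2; with [eu] this makes u_s / c idempotent. *)
have uu s : u s = 0 \/ u s = c.
  have := id1 (fun i => Y i s); rewrite -/(u s) (bigD1 s) //= linY eqxx mulr1n big1.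
    rewrite addr0 expr2 mulrA (eu s) => h.
    have : (d * c) * (u s * (u s - c)) = 0.
      have -> : d * c * (u s * (u s - c)) = c * (d * u s * u s) - d * u s * c * c by ring.
      by rewrite (eu s) h; ring.
    move/eqP; rewrite !mulf_eq0 (negbTE d0) (negbTE c0) /= subr_eq0.
    by case/orP => /eqP; [left|right].
  by move=> t ts; rewrite linY (negbTE ts) mulr0n expr0n mulr0.
(* At the sum of two dual vectors, two coefficients equal to one would give 4 = 2. *)
have uniq_c s t : s != t -> u s = c -> u t = c -> False.
  move=> st us ut; have := id1 (fun i => Y i s + Y i t).
  rewrite linD -/(u s) -/(u t) us ut (bigD1 s) //= (bigD1 t) 1?eq_sym //= big1.
    rewrite !linD !linY !eqxx (negbTE st) eq_sym (negbTE st) !mulr1n !mulr0n addr0 add0r.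
    have := eu s; have := eu t; rewrite us ut => /(mulIf c0) <- /(mulIf c0) <- => h.
    have : 2 * (d * (c * c)) = 0.
      by rewrite -(subrr (d * (c + c) ^+ 2)) {2}h; ring.
    by move/eqP; rewrite !mulf_eq0 (negbTE d0) (negbTE c0).
  move=> r /andP[rs rt]; rewrite linD !linY (negbTE rs) (negbTE rt).
  by rewrite !mulr0n addr0 expr0n mulr0.
have [[s us]|none] := pselect (exists s, u s = c).
  have /negP := LnA s; apply; rewrite -(inj_eq (scalemx_inj d0)) dL.
    rewrite mulmx_sum_row (bigD1 s) //= big1 ?addr0 => [|t ts].
      by have := eu s; rewrite us => /(mulIf c0) <-.
    have : u t = 0 by case: (uu t) => // ut; case: (uniq_c s t); rewrite // eq_sym.
    move=> ut; have := eu t; rewrite ut mulr0 => /esym/eqP.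
    by rewrite mulf_eq0 (negbTE c0) orbF => /eqP ->; rewrite scale0r.
case/negP: L0; have : d *: L = 0.
  rewrite dL (_ : e = 0) ?mul0mx //; apply/rowP => s; rewrite mxE.
  have us : u s = 0 by case: (uu s) => // us; case: none; exists s.
  have := eu s; rewrite us mulr0 => /esym/eqP.
  by rewrite mulf_eq0 (negbTE c0) orbF => /eqP.
by move/eqP; rewrite scalemx_eq0 (negbTE d0).
Qed.

(** Induction on the number of rows leads to a first row that depends on free remaining rows. *)
Lemma generic_plus_free k (A : 'M[int]_(k, m)) :
  (forall s, row s A != 0) -> (forall s t, s != t -> row s A != row t A) ->
  ~~ row_free (ratmx A) ->
  generic (fun v => forall x, (forall s, eqp v x (row s A)) -> False).
Proof.
elim: k A => [|k IH] A A0 Ai nf.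
  by case/negP: nf; rewrite /row_free eqn_leq rank_leq_row.
have AE : A = col_mx (usubmx (A : 'M_(1 + k, m))) (dsubmx (A : 'M_(1 + k, m))).
  by rewrite vsubmxK.
set L := usubmx _ in AE; set A' := dsubmx _ in AE.
have LE : L = row ord0 A.
  by apply/rowP => j; rewrite !mxE; congr (A _ _); apply/val_inj.
have A'E s : row s A' = row (lift ord0 s) A.
  by apply/rowP => j; rewrite !mxE; congr (A _ _); apply/val_inj.
have [fA'|nf'] := boolP (row_free (ratmx A')); last first.
  apply: generic_imp (IH A' _ _ nf') => [v h x hx|s|s t st]; last 2 first.
  - by rewrite A'E.
  - by rewrite !A'E Ai // (inj_eq lift_inj).
  by apply: (h x) => s; rewrite A'E.
have [LA'|nLA'] := boolP (ratmx L <= ratmx A')%MS; last first.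
  by have := row_free_cons fA' nLA'; rewrite -AE (negbTE nf).
apply: generic_imp (generic_dependent_plus fA' LA' _ _) => [v h x hx||s].
- by apply: (h x); rewrite ?LE // => s; rewrite A'E.
- by rewrite LE.
- by rewrite A'E LE Ai.
Qed.

End PlusLabels.

Section Overdetermined.
Variables (m p : nat).
Local Notation n := p.+1.
Implicit Types (v : 'M[int]_(m, n)) (L : 'rV[int]_m) (x : 'rV[int]_n).

(** This is [qf] for collinear sites. *)
Definition gq L (y : 'I_m -> int) := qua L y - lin L y ^+ 2.

Lemma sqn_row_mx k l (a : 'rV[int]_k) (b : 'rV[int]_l) :
  sqn (row_mx a b) = sqn a + sqn b.
Proof.
rewrite /sqn /dot big_split_ord; congr (_ + _); apply: eq_bigr => i _.
  by rewrite row_mxEl.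
by rewrite row_mxEr.
Qed.

Lemma kernel_vector_det k (M : 'M[int]_k) (u : 'cV[int]_k) i :
  M *m u = 0 -> u i 0 != 0 -> \det M = 0.
Proof.
move=> Mu ui; have := congr1 (fun w => (\adj M *m w) i 0) Mu.
rewrite mulmxA mul_adj_mx mul_scalar_mx mulmx0 !mxE => /eqP.
by rewrite mulf_eq0 (negbTE ui) orbF => /eqP.
Qed.

(* n + 1 linear equations for x in Z^n. When their determinant vanishes
   identically in v, sites with first coordinates t y and the other coordinates
   killing all labels but the first two show that already the one dimensional
   equations of these two labels are compatible. *)
Lemma generic_two_rows (A : 'M[int]_(p.+2, m)) (s0 := ord0) (s1 := lift ord0 ord0) :
  row_free (ratmx A) ->
  generic (fun v => forall x, (forall s, eqp v x (row s A)) ->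
    forall y, gq (row s0 A) y * lin (row s1 A) y = gq (row s1 A) y * lin (row s0 A) y).
Proof.
move=> fA; pose Q v : 'cV[int]_(p.+2) := \col_s qf v (row s A).
(* The equations say that the vector (1, - 2 x) lies in the kernel of this augmented square
   matrix. *)
pose M v : 'M[int]_(p.+2) := row_mx (Q v) (A *m v : 'M_(p.+2, p.+1)).
have pf : polyfun (fun v => \det (M v)).
  apply: polyfun_det => i j; rewrite /M.
  case: (split_ordP (j : 'I_(1 + p.+1))) => k ->.
    apply: polyfun_ext (polyfun_qf (row i A)) => v.
    by rewrite [RHS](row_mxEl (Q v) (A *m v) i k) mxE.
  apply: polyfun_ext (polyfun_mom (row i A) k) => v.
  by rewrite [RHS](row_mxEr (Q v) (A *m v) i k) -row_mul mxE.
suff H : (forall v, \det (M v) = 0) ->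
    forall y, gq (row s0 A) y * lin (row s1 A) y = gq (row s1 A) y * lin (row s0 A) y.
  apply: generic_imp (generic_vanish pf H) => v h x hx; apply: h.
  apply: (@kernel_vector_det _ _ (col_mx (1%:M : 'M_1) (- (2 *: x)^T)) ord0); last first.
    have -> : (ord0 : 'I_(1 + p.+1)) = lshift p.+1 ord0 by apply/val_inj.
    by rewrite col_mxEu mxE eqxx.
  rewrite mul_row_col mulmx1; apply/matrixP => i j; rewrite ord1 !mxE.
  rewrite -hx /dot mulr_sumr -big_split big1 // => k _.
  by rewrite -row_mul !mxE /=; ring.
move=> M0 y; have [c c0 [Y AY]] := int_right_inverse fA.
(* [A *m Z] vanishes on the first two rows and is [c] times the identity on the other p. *)
pose Z : 'M[int]_(m, p) := Y *m col_mx (0 : 'M_(2, p)) 1%:M.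
have AZ : A *m Z = c *: col_mx (0 : 'M_(2, p)) 1%:M.
  by rewrite /Z mulmxA AY mul_scalar_mx.
set D := col_mx _ _ in AZ.
have DU i j : D (lshift p i) j = 0 by rewrite col_mxEu mxE.
have DD i j : D (rshift 2 i) j = (i == j)%:R by rewrite col_mxEd mxE.
pose vt t : 'M[int]_(m, 1 + p) := row_mx (\col_i (t * y i)) Z.
pose E s := \sum_i A s i * sqn (row i Z).
have AZ0 (s : 'I_p.+2) : (s < 2)%N -> row s (A *m Z) = 0.
  move=> s2; rewrite AZ; apply/rowP => j; rewrite mxE mxE [RHS]mxE.
  have -> : (s : 'I_(2 + p)) = lshift p (Ordinal s2) by apply/val_inj.
  by rewrite [X in c * X]DU mulr0.
have qt t (s : 'I_p.+2) : (s < 2)%N -> qf (vt t) (row s A) = t ^+ 2 * gq (row s A) y + E s.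
  move=> s2; have -> : qf (vt t) (row s A) = en (vt t) (row s A) - t ^+ 2 * lin (row s A) y ^+ 2.
    rewrite /qf /vt mul_mx_row sqn_row_mx -[row s A *m Z]row_mul AZ0 // [sqn 0]dot0r addr0.
    congr (_ - _); rewrite /sqn /dot big_ord1 mxE -exprMn -expr2; congr (_ ^+ 2).
    by rewrite /lin mulr_sumr; apply: eq_bigr => i _; rewrite !mxE; ring.
  have -> : en (vt t) (row s A) = t ^+ 2 * qua (row s A) y + E s.
    rewrite /en /qua /E mulr_sumr -big_split; apply: eq_bigr => i _ /=.
    rewrite row_row_mx sqn_row_mx mulrDr !mxE; congr (_ + _).
    by rewrite /sqn /dot big_ord1 !mxE; ring.
  by rewrite /gq; ring.
(* A row vector annihilating the matrix vanishes on the last p rows, because of the block coming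
   from [Z]; it is therefore a relation between the first two rows alone. *)
have rel t : qf (vt t) (row s0 A) * (t * lin (row s1 A) y) =
    qf (vt t) (row s1 A) * (t * lin (row s0 A) y).
  have : \det (ratmx (M (vt t))) == 0 by rewrite det_map_mx M0.
  case/det0P => e e0 eM.
  have : row_mx (e *m ratmx (Q (vt t))) (e *m ratmx (A *m vt t)) = 0.
    rewrite -mul_mx_row -[RHS]eM; congr (_ *m _).
    by rewrite /ratmx -map_row_mx.
  move/eqP; rewrite row_mx_eq0 => /andP[/eqP eQ]; rewrite /vt mul_mx_row /ratmx map_row_mx.
  rewrite mul_mx_row row_mx_eq0 => /andP[/eqP ew]; rewrite AZ => /eqP eZ.
  have ek (k : 'I_p) : e 0 (rshift 2 k) = 0.
    have := congr1 (fun w : 'M[rat]_(1, p) => w 0 k) eZ; rewrite mxE [RHS]mxE.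
    rewrite (@big_split_ord _ _ _ 2 p) /= big1 ?add0r => [|l _].
      rewrite (bigD1 k) //= big1 => [|l lk]; rewrite mxE mxE -/D DD ?eqxx.
        by rewrite mulr1 addr0 => /eqP; rewrite mulf_eq0 intr_eq0 (negbTE c0) orbF => /eqP.
      by rewrite (negbTE lk) mulr0 mulr0.
    by rewrite mxE mxE -/D DU mulr0 mulr0.
  have e2 (F : 'cV[rat]_(p.+2)) : e *m F = 0 -> e 0 s0 * F s0 0 + e 0 s1 * F s1 0 = 0.
    move=> eF; have := congr1 (fun w : 'M_(1, 1) => w 0 0) eF.
    rewrite !mxE (@big_split_ord _ _ _ 2 p) /= [X in _ + X]big1 => [|k _].
      rewrite addr0 big_ord_recl big_ord1 => <-; congr (e _ _ * F _ _ + e _ _ * F _ _);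
      exact/val_inj.
    by rewrite ek mul0r.
  have := e2 _ eQ; have := e2 _ ew.
  have lE s : map_mx intr (A *m \col_i (t * y i)) s 0 = (t * lin (row s A) y)%:~R :> rat.
    by rewrite !mxE mulr_sumr; congr _%:~R; apply: eq_bigr => j _; rewrite !mxE; ring.
  have qE s : ratmx (Q (vt t)) s 0 = (qf (vt t) (row s A))%:~R by rewrite !mxE.
  rewrite !lE !qE => h1 h2; apply: (@intr_inj rat); rewrite !intrM.
  set a := (qf _ _)%:~R in h2 *; set b := (qf _ _)%:~R in h2 *.
  rewrite !intrM in h1; set w0 := t%:~R * _ in h1 *; set w1 := t%:~R * _ in h1 *.
  have [e00|e01] := eqVneq (e 0 s0) 0; last first.
    apply: (mulfI e01); have -> : e 0 s0 * (a * w1) =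
      (e 0 s0 * a + e 0 s1 * b) * w1 - b * (e 0 s0 * w0 + e 0 s1 * w1) + e 0 s0 * (b * w0) by ring.
    by rewrite h1 h2; ring.
  have e1 : e 0 s1 != 0.
    apply: contraNneq e0 => e10; apply/eqP/rowP => k; rewrite mxE.
    case: (split_ordP (k : 'I_(2 + p))) => j -> //; case: j => [[|[|//]] jl].
      by rewrite -[RHS]e00; congr (e _ _); apply/val_inj.
    by rewrite -[RHS]e10; congr (e _ _); apply/val_inj.
  apply: (mulfI e1); have -> : e 0 s1 * (a * w1) =
    a * (e 0 s0 * w0 + e 0 s1 * w1) - w0 * (e 0 s0 * a + e 0 s1 * b) + e 0 s1 * (b * w0) by ring.
  by rewrite h1 h2; ring.
(* The energies [E] of the auxiliary coordinates come with t and the wanted terms with t^3, so the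
   values 1 and 2 of t eliminate [E]. *)
have r1 := rel 1; have r2 := rel 2; rewrite !qt // in r1 r2.
lia.
Qed.

Lemma row_free_row_perm k (A : 'M[int]_(k, m)) (s : 'S_k) :
  row_free (ratmx A) -> row_free (ratmx (row_perm s A)).
Proof.
move=> fA; rewrite /row_free /ratmx map_row_perm row_permE.
by rewrite (eqmxMfull (ratmx A)) // row_full_unit unitmx_perm.
Qed.

Lemma generic_row_pair (A : 'M[int]_(p.+2, m)) i j : i != j ->
  row_free (ratmx A) ->
  generic (fun v => forall x, (forall s, eqp v x (row s A)) ->
    forall y, gq (row i A) y * lin (row j A) y = gq (row j A) y * lin (row i A) y).
Proof.
move=> ij fA; pose s1 : 'I_p.+2 := lift ord0 ord0.
pose s := (tperm s1 (tperm ord0 i j) * tperm ord0 i)%g.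
have si : s ord0 = i.
  rewrite /s permM [tperm s1 _ ord0]tpermD ?tpermL //.
  rewrite (can2_eq (tpermK _ _) (tpermK _ _)) tpermL //; by rewrite eq_sym.
have sj : s s1 = j by rewrite /s permM tpermL tpermK.
have rE k : row k (row_perm s A) = row (s k) A by apply/rowP => l; rewrite !mxE.
apply: generic_imp (generic_two_rows (row_free_row_perm s fA)) => v h x hx y.
by have := h x _ y; rewrite !rE si sj; apply => k; rewrite rE.
Qed.

End Overdetermined.

(* The coefficients of y_i^3 and y_i^2 y_j. *)
Lemma pair_entries m (a b : 'rV[int]_m) : a != 0 -> b != 0 -> a != b ->
  (forall y, gq a y * lin b y = gq b y * lin a y) ->
  forall i, a 0 i != 0 -> (a 0 i = 1 /\ b 0 i = 0) \/ (a 0 i = -1 /\ b 0 i = -1).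
Proof.
move=> a0 b0 ab I i ai.
have I1 k : a 0 k * b 0 k * (b 0 k - a 0 k) = 0.
  by have := I (pt1 k 1); rewrite /gq !lin_pt1 !qua_pt1; lia.
have I2 j : i != j -> a 0 i * b 0 j - a 0 j * b 0 i - a 0 i ^+ 2 * b 0 j
    + b 0 i ^+ 2 * a 0 j + 2 * (a 0 i * b 0 i * (b 0 j - a 0 j)) = 0.
  move=> ij; have := I (pt2 i j 1 1); have := I (pt2 i j 1 (-1)); have := I1 j.
  by rewrite /gq !lin_pt2 !qua_pt2 //; lia.
have [bi|bi] := eqVneq (b 0 i) 0.
  left; split=> //; have [j bj] : exists j, b 0 j != 0.
    apply: contrapT => h; case/eqP: b0; apply/rowP => j; rewrite mxE.
    by apply: contrapT => /eqP bj; apply: h; exists j.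
  have ij : i != j by apply: contraNneq bj => <-; rewrite bi.
  have := I2 j ij; rewrite bi => h.
  have : a 0 i * b 0 j * (1 - a 0 i) = 0 by lia.
  by move/eqP; rewrite !mulf_eq0 (negbTE ai) (negbTE bj) /= subr_eq0 => /eqP.
right; have := I1 i => /eqP; rewrite !mulf_eq0 (negbTE ai) (negbTE bi) /= subr_eq0 => /eqP ba.
have [j bj] : exists j, b 0 j != a 0 j.
  apply: contrapT => h; case/eqP: ab; apply/rowP => j.
  by apply: contrapT => /eqP bj; apply: h; exists j; rewrite eq_sym.
have ij : i != j by apply: contraNneq bj => <-; rewrite ba.
have := I2 j ij; rewrite ba => h.
have : a 0 i * (b 0 j - a 0 j) * (1 + a 0 i) = 0 by lia.
move/eqP; rewrite !mulf_eq0 (negbTE ai) subr_eq0 (negbTE bj) /= => /eqP.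
by rewrite -ba; lia.
Qed.

Lemma eq_of_subr (V : zmodType) (a b c d : V) : a = b -> c - d = a - b -> c = d.
Proof. by move=> ->; rewrite subrr => /eqP; rewrite subr_eq0 => /eqP. Qed.

Lemma entries_unit_vector m (L : 'rV[int]_m) i : \sum_k L 0 k = 0 -> L 0 i = -1 ->
  (forall k, k != i -> L 0 k = 0 \/ L 0 k = 1) ->
  exists2 j, j != i & L = delta_mx 0 j - delta_mx 0 i.
Proof.
move=> S Li h; move: S; rewrite (bigD1 i) //= Li => S.
have [j ji Lj] : exists2 j, j != i & L 0 j = 1.
  apply: contrapT => no; move: S; rewrite big1 ?addr0 // => k ki.
  by case: (h k ki) => // Lk; case: no; exists k.
exists j => //; move: S; rewrite (bigD1 j) //= Lj addrA add0r => /eqP.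
rewrite psumr_eq0 => [/allP z|k /andP[ki _]]; last by case: (h k ki) => ->.
apply/rowP => k; rewrite !mxE /=.
have [->|kj] := eqVneq k j; first by rewrite (negbTE ji) Lj.
have [->|ki] := eqVneq k i; first by rewrite Li.
by have := z k (mem_index_enum _); rewrite ki kj /= => /eqP.
Qed.

(** By [pair_entries] both vectors have entries in {-1, 0, 1} and share their entries -1. Evaluation
    at three coordinates forbids a second common -1, and mass zero then leaves exactly one entry 1
    in each. *)
Lemma pair_star m (a b : 'rV[int]_m) : a != 0 -> b != 0 -> a != b ->
  \sum_i a 0 i = 0 -> \sum_i b 0 i = 0 ->
  (forall y, gq a y * lin b y = gq b y * lin a y) ->
  forall i, a 0 i = -1 ->
  (exists2 j, j != i & a = delta_mx 0 j - delta_mx 0 i) /\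
  (exists2 j, j != i & b = delta_mx 0 j - delta_mx 0 i).
Proof.
move=> a0 b0 ab Sa Sb I i ai.
have Ib y : gq b y * lin a y = gq a y * lin b y by rewrite I.
have ea := pair_entries a0 b0 ab I.
have ba : b != a by rewrite eq_sym.
have eb := pair_entries b0 a0 ba Ib.
have bi : b 0 i = -1 by case: (ea i) => [|[]|[]]; rewrite ai.
have no j : j != i -> a 0 j = -1 -> b 0 j = -1 -> False.
  move=> ji aj bj; have [k kab] : exists k, a 0 k != b 0 k.
    apply: contrapT => h; case/eqP: ab; apply/rowP => k.
    by apply: contrapT => /eqP abk; apply: h; exists k.
  have ki : k != i by apply: contraNneq kab => ->; rewrite ai bi.
  have kj : k != j by apply: contraNneq kab => ->; rewrite aj bj.
  have [ij ik jk] : [/\ i != j, i != k & j != k] by split; rewrite eq_sym.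
  have := I (pt3 i j k 1 1 1); rewrite /gq !lin_pt3 !qua_pt3 // ai aj bi bj.
  have [ak|ak] := eqVneq (a 0 k) 0.
    have bk : b 0 k != 0 by move: kab; rewrite ak eq_sym.
    by case: (eb k bk) => -[h1 h2]; lia.
  by case: (ea k ak) => -[h1 h2]; lia.
split; apply: entries_unit_vector => // k ki.
  have [->|ak] := eqVneq (a 0 k) 0; first by left.
  by case: (ea k ak) => -[h1 h2]; [right|case: (no k ki)].
have [->|bk] := eqVneq (b 0 k) 0; first by left.
by case: (eb k bk) => -[h1 h2]; [right|case: (no k ki)].
Qed.

Lemma row_deltaM m n (v : 'M[int]_(m, n)) i : delta_mx 0 i *m v = row i v.
Proof. by rewrite rowE. Qed.

Lemma en_delta m n (v : 'M[int]_(m, n)) i : en v (delta_mx 0 i) = sqn (row i v).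
Proof.
rewrite /en (bigD1 i) //= mxE !eqxx mul1r big1 ?addr0 // => k /negbTE ki.
by rewrite mxE ki mul0r.
Qed.

Section PlusBound.
Variables (m p : nat).
Local Notation n := p.+1.
Implicit Types (v : 'M[int]_(m, n)) (L : 'rV[int]_m) (x : 'rV[int]_n).

(** If the labels are free, any two of them fall under [pair_star], so all are e_j - e_i with a
    common i. The equations then make x - v_i orthogonal to the momenta of the labels, n of which
    are generically independent, whence x = v_i. *)
Lemma generic_overdetermined_plus (A : 'M[int]_(p.+2, m)) :
  (forall s, row s A != 0) -> (forall s t, s != t -> row s A != row t A) ->
  (forall s, \sum_i row s A 0 i = 0) ->
  generic (fun v => forall x, (forall s, eqp v x (row s A)) -> insites v x).
Proof.
move=> A0 Ai Am; have [fA|nf] := boolP (row_free (ratmx A)); last first.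
  by apply: generic_imp (generic_plus_free p A0 Ai nf) => v h x /h.
have [c c0 [Y AY]] := int_right_inverse fA.
pose A' : 'M[int]_(n, m) := dsubmx (A : 'M_(1 + n, m)).
have pf : polyfun (fun v : 'M[int]_(m, n) => \det (A' *m v)).
  apply: polyfun_det => i j; apply: polyfun_mulmx => k l; first exact: polyfun_cst.
  exact: polyfun_entry.
(* Sites at which the determinant of n of the momenta is a power of [c], so that it is not the zero
   polynomial. *)
pose w : 'M[int]_(m, n) := Y *m (col_mx (0 : 'M_(1, n)) 1%:M : 'M_(p.+2, n)).
have A'w : A' *m w = c%:M.
  have -> : A' *m w = dsubmx ((A *m w) : 'M_(1 + n, n)) by rewrite mul_dsub_mx.
  rewrite /w mulmxA AY mul_scalar_mx (_ : c *: _ = col_mx (c *: (0 : 'M_(1, n))) (c *: 1%:M)).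
    by rewrite col_mxKd scalemx1.
  exact: scale_col_mx.
have g1 := generic_neq0 (w := w) pf.
have {}g1 := g1 (_ : \det (A' *m w) != 0).
have {}g1 : generic (fun v => \det (A' *m v) != 0).
  by apply: g1; rewrite A'w det_scalar expf_neq0.
have g2 : generic (fun v => forall ij : 'I_p.+2 * 'I_p.+2, ij.1 != ij.2 ->
    forall x, (forall s, eqp v x (row s A)) -> forall y,
    gq (row ij.1 A) y * lin (row ij.2 A) y = gq (row ij.2 A) y * lin (row ij.1 A) y).
  apply: generic_forall => -[i j] /=.
  have [->|ij] := eqVneq i j; first exact: generic_true.
  by apply: generic_imp (generic_row_pair ij fA) => v h _.
apply: generic_imp (generic_and g1 g2) => v [dv hv] x hx.
pose s0 : 'I_p.+2 := ord0; pose s1 : 'I_p.+2 := lift ord0 ord0.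
have pair s t : s != t -> forall y, gq (row s A) y * lin (row t A) y = gq (row t A) y * lin (row s A) y.
  by move=> st; apply: (hv (s, t)).
(* Otherwise the entries of the first row are nonnegative with sum zero. *)
have [i ai] : exists i, row s0 A 0 i = -1.
  apply: contrapT => no; case/negP: (A0 s0); apply/eqP/rowP => k; rewrite [RHS]mxE.
  have e := pair_entries (A0 s0) (A0 s1) (Ai s0 s1 isT) (pair s0 s1 isT).
  have ge i : 0 <= row s0 A 0 i.
    have [->//|h] := eqVneq (row s0 A 0 i) 0.
    by case: (e i h) => -[h1 h2]; [rewrite h1|case: no; exists i].
  have := Am s0 => /eqP; rewrite psumr_eq0 // => /allP/(_ k (mem_index_enum _)).
  by move/eqP.
have star s : exists2 j, j != i & row s A = delta_mx 0 j - delta_mx 0 i.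
  have [->|s0s] := eqVneq s s0.
    by have [] := pair_star (A0 s0) (A0 s1) (Ai s0 s1 isT) (Am s0) (Am s1) (pair s0 s1 isT) ai.
  rewrite eq_sym in s0s.
  by have [] := pair_star (A0 s0) (A0 s) (Ai s0 s s0s) (Am s0) (Am s) (pair s0 s s0s) ai.
have orth s : dot (x - row i v) (row s A *m v) = 0.
  have [j ji sE] := star s; have := hx s; rewrite /eqp /qf sE enD enN !en_delta.
  rewrite mulmxBl !row_deltaM; set vi := row i v; set vj := row j v.
  rewrite !(dotDl, dotDr, dotNl, dotNr) sqnD sqnN dotNr (dotC vj vi) /sqn; lia.
apply/existsP; exists i; rewrite -subr_eq0; have [//|xi] := eqVneq (x - row i v) 0.
exfalso; case/negP: dv.
have [k xk] : exists k, (x - row i v) 0 k != 0.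
  apply: contrapT => h; case/eqP: xi; apply/rowP => k; rewrite [RHS]mxE.
  by apply: contrapT => /eqP hk; apply: h; exists k.
apply/eqP; apply: (@kernel_vector_det _ _ (x - row i v)^T k); last by rewrite mxE.
apply/matrixP => s l; rewrite ord1 [RHS]mxE -(orth (rshift 1 s)) mxE /dot.
apply: eq_bigr => t _; rewrite [(_ - _)^T _ _]mxE mulrC; congr (_ * _).
have -> : (A' *m v) s t = row s (A' *m v) 0 t by rewrite [RHS]mxE.
by rewrite row_mul; congr ((_ *m v) _ _); apply/rowP => l'; rewrite !mxE.
Qed.

Lemma generic_mom_neq0 L : L != 0 -> generic (fun v => L *m v != 0).
Proof.
move=> L0; have pf : polyfun (fun v : 'M[int]_(m, n) => sqn (L *m v)).
  by apply: polyfun_sqn => j; apply: polyfun_mom.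
(* With the entries of L as sites on a line, the momentum is |L|^2. *)
apply: generic_imp (generic_neq0 (w := vline p (fun i => L 0 i)) pf _) => [v|].
  by apply: contraNneq => ->; rewrite /sqn dot0r.
by rewrite sqn_vline expf_neq0 // -/(sqn L) sqn_eq0.
Qed.

(** Radius zero means 2 x = pi(L), which is what two labels of opposite signs for one vertex lead
    to. The identity at one coordinate leaves entries 0 and 2, and at two coordinates at most one 2:
    the labels of x = 0 and of x = v_i. *)
Lemma generic_rf_eq0 L :
  generic (fun v => rf v L = 0 -> L = 0 \/ exists i, L = 2 *: delta_mx 0 i).
Proof.
apply: generic_vanish; first exact: polyfun_rf.
move=> h; have L2 i : L 0 i = 0 \/ L 0 i = 2.
  have := h (vline p (pt1 i 1)); rewrite rf_vline lin_pt1 qua_pt1 => e.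
  have : L 0 i * (2 - L 0 i) = 0 by lia.
  by move/eqP; rewrite mulf_eq0 subr_eq0 => /orP[/eqP|/eqP]; [left|right].
have [->|L0] := eqVneq L 0; [by left|right].
have [i Li] : exists i, L 0 i = 2.
  apply: contrapT => no; case/eqP: L0; apply/rowP => i; rewrite mxE.
  by case: (L2 i) => // Li; case: no; exists i.
exists i; apply/rowP => k; rewrite !mxE /=.
have [->|ki] := eqVneq k i; first by rewrite Li.
have := h (vline p (pt2 k i 1 1)); rewrite rf_vline lin_pt2 qua_pt2 // Li.
by case: (L2 k) => ->; lia.
Qed.

(** The squared radius [rf] is nonnegative on every line of sites; in this form the reality of a
    configuration constrains its labels. *)
Definition psd (b : 'rV[int]_m) := forall y, 0 <= 2 * qua b y - lin b y ^+ 2.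

Lemma psd_entries b : psd b -> forall i, [/\ 0 <= b 0 i, b 0 i <= 2 &
  b 0 i = 2 -> b = 2 *: delta_mx 0 i].
Proof.
move=> hb; have h1 k : 0 <= b 0 k <= 2.
  by have := hb (pt1 k 1); rewrite lin_pt1 qua_pt1; nia.
move=> i; have /andP[-> ->] := h1 i; split=> // bi; apply/rowP => k; rewrite !mxE /=.
have [->|ki] := eqVneq k i; first by rewrite bi.
have := hb (pt2 k i 1 1); rewrite lin_pt2 qua_pt2 // bi.
by have := h1 k; nia.
Qed.

Lemma poly_large_nonroot (P : {poly int}) (T : int) : P != 0 ->
  exists2 t : int, T <= t & P.[t] != 0.
Proof.
move=> P0; apply: contrapT => no.
pose rs := [seq T + (i%:Z) | i <- iota 0 (size P)].
have : (size rs < size P)%N.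
  apply: max_poly_roots => //.
    apply/allP => _ /mapP[i _ ->]; apply: contrapT => nr; apply: no.
    by exists (T + i%:Z); [rewrite lerDl|rewrite -/(root P _); apply/negP].
  by rewrite map_inj_uniq ?iota_uniq // => i j /addrI [].
by rewrite size_map size_iota ltnn.
Qed.

(** Since [rf] is quadratic in the sites, for large [t] it has the sign of a nonzero [rf v b] even
    if [w] is in general position. *)
Lemma rf_pencil (b : 'rV[int]_m) v w : exists e : int, forall t : int,
  rf (t *: v + w) b = t ^+ 2 * rf v b + t * e + rf w b.
Proof.
pose e1 := \sum_i b 0 i * dot (row i v) (row i w).
exists (4 * e1 - 2 * dot (b *m v) (b *m w)) => t.
have -> : rf (t *: v + w) b = 2 * (t ^+ 2 * en v b + 2 * t * e1 + en w b)
    - (t ^+ 2 * sqn (b *m v) + 2 * t * dot (b *m v) (b *m w) + sqn (b *m w)).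
  rewrite /rf mulmxDr -scalemxAr sqnD sqnZ dotZl; congr (2 * _ - _); last by ring.
  rewrite /en /e1 !mulr_sumr -!big_split; apply: eq_bigr => i _ /=.
  have -> : row i (t *: v + w) = t *: row i v + row i w by apply/rowP => k; rewrite !mxE.
  by rewrite sqnD sqnZ dotZl; ring.
by rewrite /rf; ring.
Qed.

(* x is the solution of n independent linear equations, so that D |2x - bv| is a
   polynomial in v, where D is their determinant. If its square is D^2 rf v b
   identically, then rf v b >= 0 wherever D <> 0. *)
Lemma generic_psd (U : 'M[int]_(n, m)) (rho : 'I_n -> 'M[int]_(m, n) -> int) b :
  row_free (ratmx U) -> (forall s, polyfun (rho s)) ->
  generic (fun v => forall x, (forall s, 2 * dot x (row s U *m v) = rho s v) ->
    eqm v x b -> psd b).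
Proof.
move=> fU prho; pose D v := \det (U *m v).
pose X v : 'rV[int]_n := (\adj (U *m v) *m \col_s rho s v)^T.
pose F v := sqn (X v - D v *: (b *m v)) - D v ^+ 2 * rf v b.
have pUv i j : polyfun (fun v : 'M[int]_(m, n) => (U *m v) i j).
  by apply: polyfun_mulmx => k l; [exact: polyfun_cst|exact: polyfun_entry].
have pD : polyfun D by apply: polyfun_det.
have pF : polyfun F.
  apply: polyfunB; last first.
    by apply: polyfunM; [apply: polyfunM|exact: polyfun_rf].
  apply: polyfun_sqn => j; have pX : polyfun (fun v => X v 0 j).
    apply: polyfun_ext (_ : polyfun (fun v => (\adj (U *m v) *m \col_s rho s v) j 0)) => [v|].
      by rewrite [RHS]mxE.
    apply: polyfun_mulmx => k l; first exact: polyfun_adj.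
    by apply: polyfun_ext (prho k) => v; rewrite mxE.
  apply: polyfun_ext (polyfunB pX (polyfunM pD (polyfun_mom b j))) => v.
  by rewrite !mxE.
suff FP : (forall v, F v = 0) -> psd b.
  apply: generic_imp (generic_vanish pF FP) => v h x hx hb; apply: h.
  (* Cramer's rule without division. *)
  have XE : X v = (2 * D v) *: x.
    rewrite /X; have -> : \col_s rho s v = (U *m v) *m (2 *: x)^T.
      apply/colP => s; rewrite !mxE -hx /dot mulr_sumr -row_mul.
      by apply: eq_bigr => k _; rewrite !mxE; ring.
    by rewrite mulmxA mul_adj_mx mul_scalar_mx -linearZ /= trmxK scalerA mulrC.
  rewrite /F XE mulrC -scalerA -scalerBr sqnZ hb; ring.
move=> F0 y; rewrite leNgt; apply/negP => neg.
have [c c0 [w Uw]] := int_right_inverse fU.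
have [e rE] := rf_pencil b (vline p y) w.
pose P : {poly int} := \det ('X *: map_mx polyC (U *m vline p y) + map_mx polyC (U *m w)).
have PE t : P.[t] = D (t *: vline p y + w).
  rewrite /P -horner_evalE -det_map_mx /D; congr (\det _).
  rewrite map_mxD map_mxZ -!map_mx_comp mulmxDr -scalemxAr.
  by apply/matrixP => i j; rewrite !mxE /= !horner_evalE !hornerE.
have P0 : P != 0.
  apply: contra_neq (_ : P.[0] != 0) => [->|]; first by rewrite horner0.
  by rewrite PE scale0r add0r /D Uw det_scalar expf_neq0.
(* Beyond this threshold the quadratic polynomial of [rf_pencil] is negative, its leading
   coefficient being an integer at most -1; the determinant does not vanish identically in t because
   it is nonzero at t = 0. *)
have [t tT Pt] := poly_large_nonroot (`|e| + `|rf w b| + 1) P0.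
have := F0 (t *: vline p y + w); rewrite /F => /eqP; rewrite subr_eq0 => /eqP h.
have : 0 <= D (t *: vline p y + w) ^+ 2 * rf (t *: vline p y + w) b by rewrite -h sqn_ge0.
rewrite pmulr_rge0; last by rewrite exprn_even_gt0 //= -PE.
rewrite rE rf_vline; move: neg tT; set r := 2 * _ - _; set g := rf w b.
by clear; nia.
Qed.

(* Four vertices of two colours whose labels are dependent span a line of sites,
   on which both red labels have to be e_i + e_j. *)
Lemma generic_circuit22 L u w (e0 e1 : int) : e0 != 0 -> e1 != 0 ->
  e0 *: L = e1 *: (u - w) -> u != w ->
  generic (fun v => forall x, eqp v x L -> eqm v x u -> eqm v x w ->
    0 < rf v u -> 0 < rf v w -> False).
Proof.
(* This combination of energies is free of x: the squares of x cancel between [u] and [w], and the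
   linear terms by the dependence of the labels. *)
move=> e00 e10 eL uw; pose f v := e0 * qf v L + e1 * (qf v u - qf v w).
have pf : polyfun f.
  apply: polyfunD; apply: polyfunM; try exact: polyfun_cst; first exact: polyfun_qf.
  by apply: polyfunB; exact: polyfun_qf.
have sup v : f v = 0 -> forall x, eqp v x L -> True by [].
have real v x : eqp v x L -> eqm v x u -> eqm v x w -> f v = 0.
  rewrite /eqp /eqm /f => hL hu hw; rewrite -hL.
  have q (b : 'rV[int]_m) : sqn (2 *: x - b *m v) = rf v b -> qf v b = 2 * sqn x - 2 * dot x (b *m v).
    by rewrite sqnD sqnN sqnZ dotZl dotNr /rf /qf; lia.
  rewrite (q u hu) (q w hw).
  have : e0 * dot x (L *m v) = e1 * dot x ((u - w) *m v).
    by rewrite -!dotZr !scalemxAl eL.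
  rewrite mulmxBl dotDr dotNr => /eqP; rewrite -subr_eq0 => /eqP h.
  by rewrite -[RHS](mulr0 2) -h; ring.
apply: generic_imp (_ : generic (fun v => f v = 0 -> 0 < rf v u -> 0 < rf v w -> False)).
  by move=> v h x hL hu hw; apply: h; apply: (real v x).
have [f0|/existsNP[v0 /eqP fv0]] := pselect (forall v, f v = 0); last first.
  apply: generic_imp (generic_neq0 pf fv0) => v fv fv0'; by rewrite fv0' eqxx in fv.
apply: generic_true => v _ ru rw.
pose t i := u 0 i - w 0 i.
have tE i : e0 * L 0 i = e1 * t i.
  by have := congr1 (fun M : 'rV_m => M 0 i) eL; rewrite !mxE.
have I y : 2 * e0 * qua (u - w) y =
    e1 * lin (u - w) y ^+ 2 + e0 * (lin u y ^+ 2 - lin w y ^+ 2).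
  have := f0 (vline p y); rewrite /f !qf_vline => h.
  have h1 : e0 * qua L y = e1 * qua (u - w) y by rewrite -!quaZ eL.
  have h2 : e0 * lin L y = e1 * lin (u - w) y by rewrite -!linZ eL.
  have h3 : qua (u - w) y = qua u y - qua w y by rewrite qua_addl qua_opp.
  apply: (mulfI e10).
  have : e0 * (e0 * (qua L y - lin L y ^+ 2) + e1 * (qua u y - lin u y ^+ 2 - (qua w y - lin w y ^+ 2))) = 0.
    by rewrite h mulr0.
  have -> : e0 * (e0 * (qua L y - lin L y ^+ 2) + e1 * (qua u y - lin u y ^+ 2 - (qua w y - lin w y ^+ 2)))
    = e0 * (e0 * qua L y) - (e0 * lin L y) ^+ 2 + e0 * e1 * ((qua u y - qua w y) - (lin u y ^+ 2 - lin w y ^+ 2)) by ring.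
  rewrite h1 h2 -h3 => h'; apply/eqP; rewrite -subr_eq0 -h'; apply/eqP; ring.
have lt y : lin (u - w) y = lin u y - lin w y by rewrite lin_addl lin_opp.
have I1 i : t i != 0 -> e0 * (u 0 i + w 0 i) = 2 * e0 - e1 * t i.
  move=> ti; apply: (mulfI ti); have := I (pt1 i 1).
  rewrite qua_pt1 !lin_pt1 !mxE /t => h; apply: (eq_of_subr (esym h)); ring.
have I2 i j : i != j -> e1 * t i * t j + e0 * (u 0 i * u 0 j - w 0 i * w 0 j) = 0.
  move=> ij; have := I (pt2 i j 1 (-1)); have := I (pt2 i j 1 1).
  rewrite !qua_pt2 // !lin_pt2 !mxE /t => h1 h2; apply: (mulfI (_ : 4 != 0 :> int)) => //.
  by apply: (eq_of_subr (congr2 (fun a b => b - a) h1 h2)); ring.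
have [i ti] : exists i, t i != 0.
  apply: contrapT => no; case/eqP: uw; apply/rowP => i; apply/eqP; rewrite -subr_eq0.
  by apply: contrapT => ti; apply: no; exists i; apply/negP.
have zero j : t j = 0 -> u 0 j = 0 /\ w 0 j = 0.
  move=> tj; have ij : i != j by apply: contraNneq ti => ->; rewrite tj.
  have := I2 i j ij; rewrite tj mulr0 add0r.
  have wj : w 0 j = u 0 j by move: tj; rewrite /t; lia.
  rewrite wj -mulrBl => /eqP; rewrite !mulf_eq0 (negbTE e00) (negbTE ti) /= => /eqP ->.
  by [].
(* Any two nonzero entries of u - w are opposite, so there are at most two of them. *)
have opp j k : j != k -> t j != 0 -> t k != 0 -> t j + t k = 0.
  move=> jk tj tk; have := I2 j k jk; have := I1 j tj; have := I1 k tk => h1 h2 h3.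
  have : e0 * (t j + t k) = 0; last by move/eqP; rewrite mulf_eq0 (negbTE e00) => /eqP.
  have : 2 * (e1 * t j * t k + e0 * (u 0 j * u 0 k - w 0 j * w 0 k)) =
    2 * e1 * t j * t k + t j * (e0 * (u 0 k + w 0 k)) + t k * (e0 * (u 0 j + w 0 j)).
    by rewrite /t; ring.
  rewrite h1 h2 h3 => h; apply: (mulfI (_ : 2 != 0 :> int)) => //.
  by apply: (eq_of_subr (esym h)); ring.
have rf_support (b : 'rV[int]_m) j : (forall k, k != i -> k != j -> b 0 k = 0) ->
    i != j -> b 0 i + b 0 j = 2 -> rf v b = b 0 i * b 0 j * sqn (row i v - row j v).
  move=> bz ij bs.
  have -> : b = b 0 i *: delta_mx 0 i + b 0 j *: delta_mx 0 j.
    apply/rowP => k; rewrite !mxE /=.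
    have [->|ki] := eqVneq k i; first by rewrite (negbTE ij) mulr1 mulr0 addr0.
    have [->|kj] := eqVneq k j; first by rewrite mulr0 mulr1 add0r.
    by rewrite bz // !mulr0.
  rewrite /rf enD !enZ !en_delta mulmxDl -!scalemxAl !row_deltaM !sqnD !sqnZ sqnN !dotZr !dotZl !dotNr.
  rewrite !mxE !eqxx /= (negbTE ij) eq_sym (negbTE ij) !mulr1 !mulr0 addr0 add0r.
  have -> : b 0 j = 2 - b 0 i by lia.
  by ring.
have [[j /andP[ij tj]]|no] := pselect (exists j, (i != j) && (t j != 0)).
  have z k : k != i -> k != j -> t k = 0.
    move=> ki kj; apply: contrapT => /eqP tk.
    have := opp i j ij ti tj; have := opp i k _ ti tk; have := opp j k _ tj tk.
    rewrite eq_sym kj eq_sym ki => /(_ isT) a /(_ isT) b c.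
    by case/eqP: ti; lia.
  have h1 := I1 i ti; have h2 := I1 j tj; have h3 := opp i j ij ti tj.
  have us : u 0 i + u 0 j = 2 /\ w 0 i + w 0 j = 2.
    have : e0 * (u 0 i + u 0 j + w 0 i + w 0 j - 4) = e1 * - (t i + t j) by lia.
    rewrite h3 oppr0 mulr0 => /eqP; rewrite mulf_eq0 (negbTE e00) /= => /eqP.
    by move: h3; rewrite /t; move: (u 0 i) (u 0 j) (w 0 i) (w 0 j); clear; lia.
  move: ru rw; rewrite !(rf_support _ j) ?us.1 ?us.2 //.
  - have := sqn_ge0 (row i v - row j v); set d := sqn _ => d0 r1 r2.
    (* The squared radius is a (2 - a) |v_i - v_j|^2, which for an integer a is positive only if a =
       1. *)
    have pos (a b : int) : a + b = 2 -> 0 < a * b * d -> a = 1.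
      by move=> ab; rewrite (_ : b = 2 - a); [nia|lia].
    have a1 := pos _ _ us.1 r1; have a2 := pos _ _ us.2 r2.
    by case/eqP: ti; rewrite /t a1 a2.
  - by move=> k ki kj; have [] := zero k (z k ki kj).
  - by move=> k ki kj; have [] := zero k (z k ki kj).
have z k : k != i -> u 0 k = 0 /\ w 0 k = 0.
  move=> ki; apply: zero; apply: contrapT => /eqP tk; apply: no; exists k.
  by rewrite eq_sym ki tk.
have single (b : 'rV[int]_m) : (forall k, k != i -> b 0 k = 0) -> 0 < rf v b -> b 0 i = 1.
  move=> bz; have -> : rf v b = b 0 i * (2 - b 0 i) * sqn (row i v).
    have {1}-> : b = b 0 i *: delta_mx 0 i.
      apply/rowP => k; rewrite !mxE /=; have [->|ki] := eqVneq k i; first by rewrite mulr1.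
      by rewrite bz // mulr0.
    by rewrite /rf enZ en_delta -scalemxAl row_deltaM sqnZ; ring.
  by have := sqn_ge0 (row i v); nia.
case/eqP: ti; rewrite /t (single u) ?(single w) // => k /z[].
  by [].
by [].
Qed.

End PlusBound.

(** * Dependent configurations of three and two points *)

Section Circuit23Arith.
Variables u w z L : 'I_3 -> int.

Definition distinct3 (i j k : 'I_3) := [/\ i != j, i != k & j != k].
Definition mass3 (f : 'I_3 -> int) (a : int) := forall i j k, distinct3 i j k -> f i + f j + f k = a.
(* sum_i f_i g_i / L_i = -2, with denominators cleared *)
Definition duality (f g : 'I_3 -> int) := forall i j k, distinct3 i j k ->
  f i * g i * L j * L k + f j * g j * L i * L k + f k * g k * L i * L j = - 2 * L i * L j * L k.
(** The shape which a red label takes on three columns, with mass 2. Likewise [black3] is the shape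
    of the difference of two labels across a black edge, and [notdouble] excludes the labels of
    radius zero. *)
Definition red3 (f : 'I_3 -> int) := exists2 p, f p = 0 & forall r, r != p -> f r = 1.
Definition black3 (f g : 'I_3 -> int) := exists p q, [/\ p != q, f p = g p + 1, f q = g q - 1
  & forall r, r != p -> r != q -> f r = g r].
Definition notdouble (f : 'I_3 -> int) := forall p, f p = 2 -> (forall r, r != p -> f r = 0) -> False.

Lemma third3 (p q : 'I_3) : p != q -> exists r, distinct3 p q r /\
  forall x, [\/ x = p, x = q | x = r].
Proof.
case: p q => [[|[|[|//]]] hp] [[|[|[|//]]] hq] // _;
by [exists (@Ordinal 3 0 isT); split=> // -[[|[|[|//]]] hx]; (constructor 1; exact/val_inj) || (constructor 2; exact/val_inj) || (constructor 3; exact/val_inj)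
  | exists (@Ordinal 3 1 isT); split=> // -[[|[|[|//]]] hx]; (constructor 1; exact/val_inj) || (constructor 2; exact/val_inj) || (constructor 3; exact/val_inj)
  | exists (@Ordinal 3 2 isT); split=> // -[[|[|[|//]]] hx]; (constructor 1; exact/val_inj) || (constructor 2; exact/val_inj) || (constructor 3; exact/val_inj)].
Qed.

End Circuit23Arith.

Lemma distinct3_perm (i j k : 'I_3) : distinct3 i j k ->
  [/\ distinct3 i k j, distinct3 j i k, distinct3 j k i, distinct3 k i j & distinct3 k j i].
Proof. by move=> [a b c]; split; split; rewrite // eq_sym. Qed.

Lemma red3_cases (f : 'I_3 -> int) i j k : distinct3 i j k -> red3 f ->
  [\/ [/\ f i = 0, f j = 1 & f k = 1], [/\ f i = 1, f j = 0 & f k = 1]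
    | [/\ f i = 1, f j = 1 & f k = 0]].
Proof.
move=> [ij ik jk] [p fp h]; have [r [d cov]] := third3 ij.
have kr : k = r.
  by case: (cov k) => // e; [rewrite e eqxx in ik|rewrite e eqxx in jk].
case: (cov p) => pe; rewrite pe in fp h.
- by constructor 1; split=> //; apply: h; rewrite eq_sym.
- by constructor 2; split=> //; apply: h; rewrite // eq_sym.
- by constructor 3; rewrite kr; split=> //; apply: h; rewrite -kr.
Qed.

Section Circuit23Claims.
Variables u w z L : 'I_3 -> int.
Hypothesis L0 : forall i, L i != 0.
Hypothesis Lm : mass3 L 0.

(** With zeros at different places p and q, the duality relation reduces to L_p L_q (1 + 2 L_r) = 0,
    impossible for integers. *)
Lemma two_reds_false (f g : 'I_3 -> int) : duality L f g -> red3 f -> red3 g ->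
  (exists r, f r != g r) -> False.
Proof.
move=> E [p fp hf] [q gq' hg] [r0 fg].
have [pq|pq] := eqVneq p q.
  have [r0p|r0p] := eqVneq r0 p.
    by rewrite r0p fp pq gq' eqxx in fg.
  by rewrite hf // hg ?eqxx // -?pq in fg.
have [r [d _]] := third3 pq; have [_ pr qr] := d.
have := E p q r d; rewrite fp gq' (hf r) 1?eq_sym // (hg r) 1?eq_sym //.
have := L0 p; have := L0 q; move: (L p) (L q) (L r) => a b c b0 a0.
rewrite mul0r mulr0 !mul0r !add0r mulr1 mul1r => h.
have : (a * b) * (1 + 2 * c) = 0 by lia.
by move/eqP; rewrite !mulf_eq0 (negbTE a0) (negbTE b0) /=; lia.
Qed.

(** The relations of f and g with a common h differ only in the terms p and q. *)
Lemma black3_cross (f g h : 'I_3 -> int) p q r : distinct3 p q r ->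
  duality L f h -> duality L g h ->
  f p = g p + 1 -> f q = g q - 1 -> f r = g r -> h p * L q = h q * L p.
Proof.
move=> d E1 E2 fp fq fr; have := E1 _ _ _ d; have := E2 _ _ _ d; rewrite fp fq fr.
move=> e2 e1; apply: (mulfI (L0 r)).
by apply: (eq_of_subr (congr2 (fun a b => a - b) e1 e2)); ring.
Qed.

End Circuit23Claims.

(** [red3] and [notdouble] on explicit triples, which turns the case analyses below into integer
    arithmetic. *)
Definition r3 (a b c : int) :=
  [\/ [/\ a = 0, b = 1 & c = 1], [/\ a = 1, b = 0 & c = 1] | [/\ a = 1, b = 1 & c = 0]].
Definition nd3 (a b c : int) :=
  [/\ ~ [/\ a = 2, b = 0 & c = 0], ~ [/\ a = 0, b = 2 & c = 0] & ~ [/\ a = 0, b = 0 & c = 2]].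

(** For each shape of a red triple the cross relation makes some [l] vanish or gives l1 = l2; in the
    latter case the duality relation contradicts the shape of the other triple. *)
Lemma black_two_reds_int (f1 f2 f3 h1 h2 h3 l1 l2 l3 : int) :
  l1 != 0 -> l2 != 0 -> l3 != 0 -> l1 + l2 + l3 = 0 ->
  f1 + f2 + f3 = 2 -> h1 + h2 + h3 = 2 -> h1 * l2 = h2 * l1 ->
  f1 * h1 * l2 * l3 + f2 * h2 * l1 * l3 + f3 * h3 * l1 * l2 = - 2 * l1 * l2 * l3 ->
  (r3 h1 h2 h3 -> r3 (f1 + l1) (f2 + l2) (f3 + l3) -> False) /\
  (r3 f1 f2 f3 -> r3 (h1 + l1) (h2 + l2) (h3 + l3) -> False).
Proof.
move=> n1 n2 n3 sl sf sh X E; split=> rh rf.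
  case: rh => -[e1 e2 e3]; rewrite e1 e2 e3 ?mul0r ?mul1r in X E.
  - by rewrite -X eqxx in n1.
  - by rewrite X eqxx in n2.
  rewrite -X in sl E rf n1; have : l2 * l3 * (f1 + f2 + 2 * l2) = 0.
    by apply: (eq_of_subr E); ring.
  by move/eqP; rewrite !mulf_eq0 (negbTE n2) (negbTE n3) /= => /eqP; case: rf => -[]; lia.
have X' : (h1 + l1) * l2 = (h2 + l2) * l1 by apply: (eq_of_subr X); ring.
case: rf => -[e1 e2 e3]; rewrite e1 e2 ?mul0r ?mul1r in X'.
- by rewrite -X' eqxx in n1.
- by rewrite X' eqxx in n2.
have h1E : h1 = 1 - l2 by lia.
have h2E : h2 = 1 - l2 by lia.
have h3E : h3 = 2 * l2 by lia.
have l3E : l3 = - 2 * l2 by lia.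
have f3E : f3 = 2 - f1 - f2 by lia.
have : l2 * l2 * (2 * (f1 + f2)) = 0.
  by move: E; rewrite -X' h1E h2E h3E l3E f3E => E'; apply: (eq_of_subr (esym E')); ring.
by move/eqP; rewrite !mulf_eq0 (negbTE n2) /= => /eqP; case: rh => -[]; lia.
Qed.

(** Adding the two cross relations and inserting the masses gives l2 (2 - s) = 0. *)
Lemma black_path_same_int (s w1 w2 w3 l1 l2 l3 : int) :
  s = 1 \/ s = -1 -> l2 != 0 -> l1 + l2 + l3 = 0 -> w1 + w2 + w3 = 2 ->
  w1 * l2 = (w2 - s) * l1 -> w3 * l2 = (w2 - s) * l3 -> False.
Proof.
move=> hs n2 sl sw X1 X3.
have l3E : l3 = - l1 - l2 by lia.
have w3E : w3 = 2 - w1 - w2 by lia.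
have : l2 * (2 - s) = 0.
  by apply: (eq_of_subr (congr2 (fun a b => a + b) X1 X3)); rewrite w3E l3E; ring.
by move/eqP; rewrite mulf_eq0 (negbTE n2) /=; lia.
Qed.

(** Everything is determined by w1: l = l1 (1, 2, -3), w = (w1, 2 w1 - 1, 3 - 3 w1) and l1 = 1 - 2
    w1. A red triple among the three would fix w1, and each possible value is contradictory or makes
    an outer triple twice a unit vector. *)
Lemma black_path_int (w1 w2 w3 l1 l2 l3 : int) :
  l1 != 0 -> l1 + l2 + l3 = 0 -> w1 + w2 + w3 = 2 ->
  w1 * l2 = (w2 + 1) * l1 -> w3 * l2 = (w2 - 1) * l3 ->
  (w1 + 1) * w1 * l2 * l3 + (w2 - 1) * w2 * l1 * l3 + w3 * w3 * l1 * l2 = - 2 * l1 * l2 * l3 ->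
  nd3 (w1 + 1) (w2 - 1) w3 -> nd3 w1 (w2 + 1) (w3 - 1) ->
  r3 w1 w2 w3 \/ r3 (w1 + 1) (w2 - 1) w3 \/ r3 w1 (w2 + 1) (w3 - 1) -> False.
Proof.
move=> n1 sl sw X1 X3 E ndu ndz hr.
have l3E : l3 = - l1 - l2 by lia.
have w3E : w3 = 2 - w1 - w2 by lia.
have l2E : l2 = 2 * l1.
  by apply: (eq_of_subr (congr2 (fun a b => a + b) X1 X3)); rewrite w3E l3E; ring.
have l3E' : l3 = - 3 * l1 by lia.
have w1E : w2 = 2 * w1 - 1.
  by apply: (mulIf n1); apply: (eq_of_subr (esym X1)); rewrite l2E; ring.
have w3E' : w3 = 3 - 3 * w1 by lia.
have w2E : l1 = 1 - 2 * w1.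
  have : l1 * l1 * (l1 - 1 + 2 * w1) * 12 = 0.
    by apply: (eq_of_subr (esym E)); rewrite l3E' l2E w3E' w1E; ring.
  by move/eqP; rewrite !mulf_eq0 (negbTE n1) /= orbF; lia.
case: ndu ndz => [d1 d2 d3] [d4 d5 d6].
case: hr => [|[]] [[a b c]|[a b c]|[a b c]]; first [lia | (apply: d1; split; lia) |
  (apply: d2; split; lia) | (apply: d3; split; lia) | (apply: d4; split; lia) |
  (apply: d5; split; lia) | (apply: d6; split; lia)].
Qed.

Section Circuit23.
Variable L : 'I_3 -> int.
Hypothesis L0 : forall i, L i != 0.
Hypothesis Lm : mass3 L 0.

Lemma red3_r3 f p q r : distinct3 p q r -> red3 f -> r3 (f p) (f q) (f r).
Proof. exact: red3_cases. Qed.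

Lemma notdouble_nd3 f p q r : distinct3 p q r -> notdouble f -> nd3 (f p) (f q) (f r).
Proof.
move=> d nf; have [pq pr qr] := d; have [r' [d' cov]] := third3 pq.
have rr : r = r' by case: (cov r) => // e; [rewrite e eqxx in pr|rewrite e eqxx in qr].
rewrite -rr in cov; split=> -[a b c]; [apply: (nf p)|apply: (nf q)|apply: (nf r)] => // s;
by case: (cov s) => ->; rewrite ?eqxx.
Qed.

Lemma black_two_reds_false f g h e e' :
  mass3 f 2 -> mass3 g 2 -> mass3 h 2 ->
  duality L f g -> duality L f h -> duality L g h ->
  notdouble f -> notdouble g ->
  notdouble (fun i => f i + L i) -> notdouble (fun i => g i + L i) ->
  black3 f g ->
  [\/ e = f, e = g | e = h] -> [\/ e' = f, e' = g | e' = h] ->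
  red3 e -> red3 (fun i => e' i + L i) -> False.
Proof.
move=> mf mg mh Efg Efh Egh nf ng nfL ngL [p [q [pq fp fq hr]]] he he' re re'.
have [r [d _]] := third3 pq; have [_ pr qr] := d.
have fr : f r = g r by apply: hr; rewrite eq_sym.
have X := black3_cross L0 d Efh Egh fp fq fr.
have [F1 F2] := black_two_reds_int (L0 p) (L0 q) (L0 r) (Lm d) (mf _ _ _ d) (mh _ _ _ d) X
  (Efh _ _ _ d).
have [G1 G2] := black_two_reds_int (L0 p) (L0 q) (L0 r) (Lm d) (mg _ _ _ d) (mh _ _ _ d) X
  (Egh _ _ _ d).
have := red3_r3 d re; have := red3_r3 d re'.
have := notdouble_nd3 d nf; have := notdouble_nd3 d ng.
have := notdouble_nd3 d nfL; have := notdouble_nd3 d ngL.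
have := L0 p; have := L0 q; have := L0 r.
case: he => ->; case: he' => -> /=; try by [move=> *; exact: F1|move=> *; exact: F2|move=> *; exact: G1|move=> *; exact: G2];
move: fp fq fr;
move: (f p) (f q) (f r) (g p) (g q) (g r) (h p) (h q) (h r) (L p) (L q) (L r);
clear; rewrite /nd3 /r3 => f1 f2 f3 g1 g2 g3 h1 h2 h3 l1 l2 l3 e1 e2 e3 n3 n2 n1
  [a1 a2 a3] [b1 b2 b3] [c1 c2 c3] [d1 d2 d3] [] [x1 x2 x3] [] [y1 y2 y3];
first [lia | (apply: a1; split; lia) | (apply: a2; split; lia) | (apply: b1; split; lia)
  | (apply: b2; split; lia) | (apply: c1; split; lia) | (apply: c2; split; lia)
  | (apply: d1; split; lia) | (apply: d2; split; lia)].
Qed.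

(** Two black edges at w that lead to different ends meet in one of three ways: one coordinate
    changes equally along both ([same]), the second change is opposite to the first ([back]), or the
    two changes follow each other ([core]). *)
Lemma black_path_false u w z e : u <> z ->
  mass3 u 2 -> mass3 w 2 -> mass3 z 2 ->
  duality L u w -> duality L z w -> duality L u z ->
  notdouble u -> notdouble w -> notdouble z ->
  black3 u w -> black3 z w ->
  [\/ e = u, e = w | e = z] -> red3 e -> False.
Proof.
have sym f g : duality L f g -> duality L g f.
  by move=> E i j k d; have := E i j k d; lia.
move=> uz mu mw mz Euw Ezw Euz nu nw nz.
have core u' z' a b c : distinct3 a b c -> duality L u' w -> duality L u' z' -> duality L z' w ->
    u' a = w a + 1 -> u' b = w b - 1 -> u' c = w c ->
    z' a = w a -> z' b = w b + 1 -> z' c = w c - 1 ->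
    notdouble u' -> notdouble z' ->
    red3 w \/ red3 u' \/ red3 z' -> False.
  move=> d E1 E2 E3 ua ub uc za zb zc n1 n2 re.
  have [d1 d2 d3 d4 d5] := distinct3_perm d.
  have X1 := black3_cross L0 d E2 (sym _ _ E3) ua ub uc.
  have X3 := black3_cross L0 d3 (sym _ _ E2) (sym _ _ E1) zb zc za.
  rewrite za zb ub uc in X1 X3.
  have nd1 := notdouble_nd3 d n1; have nd2 := notdouble_nd3 d n2.
  have E := E1 _ _ _ d.
  rewrite ua ub uc in nd1 E; rewrite za zb zc in nd2.
  apply: (black_path_int (L0 a) (Lm d) (mw _ _ _ d) X1 (esym X3) E nd1 nd2).
  by case: re => [/(red3_r3 d)|[/(red3_r3 d)|/(red3_r3 d)]]; rewrite ?ua ?ub ?uc ?za ?zb ?zc; auto.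
have same s a b c : distinct3 a b c -> s = 1 \/ s = -1 ->
    u a = w a + s -> u b = w b - s -> u c = w c ->
    z a = w a -> z b = w b - s -> z c = w c + s -> False.
  move=> d hs ua ub uc za zb zc; have [d1 d2 d3 d4 d5] := distinct3_perm d.
  have X1 : z a * L b = z b * L a.
    case: hs => hs; rewrite hs in ua ub.
      exact: (black3_cross L0 d Euz (sym _ _ Ezw) ua ub uc).
    by apply/esym; apply: (black3_cross L0 d2 Euz (sym _ _ Ezw) _ _ uc); rewrite ?ub ?ua; lia.
  have X3 : u c * L b = u b * L c.
    case: hs => hs; rewrite hs in zb zc.
      exact: (black3_cross L0 d5 (sym _ _ Euz) (sym _ _ Euw) zc zb za).
    by apply/esym; apply: (black3_cross L0 d3 (sym _ _ Euz) (sym _ _ Euw) _ _ za); rewrite ?zb ?zc; lia.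
  rewrite za zb uc ub in X1 X3.
  exact: (black_path_same_int hs (L0 b) (Lm d) (mw _ _ _ d) X1 X3).
have back a b c : distinct3 a b c ->
    u a - w a = w a - z a -> u b - w b = w b - z b -> u c = w c -> z c = w c ->
    u a - w a = 1 \/ u a - w a = -1 -> u b - w b = - (u a - w a) -> False.
  move=> d ha hb uc zc hs hab; have e1 := Euw _ _ _ d; have e2 := Ezw _ _ _ d; have e3 := Euz _ _ _ d.
  have lc := L0 c; have lm := Lm d.
  have ua : u a = w a + (u a - w a) by lia.
  have ub : u b = w b - (u a - w a) by lia.
  have za : z a = w a - (u a - w a) by lia.
  have zb : z b = w b + (u a - w a) by lia.
  set s := u a - w a in hs ua ub za zb; rewrite ua ub uc za zb zc in e1 e2 e3.
  have : s ^+ 2 * L c * (L a + L b) = 0.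
    have -> : s ^+ 2 * L c * (L a + L b) =
     ((w a + s) * w a * L b * L c + (w b - s) * w b * L a * L c + w c * w c * L a * L b) +
     ((w a - s) * w a * L b * L c + (w b + s) * w b * L a * L c + w c * w c * L a * L b) - 
     ((w a + s) * (w a - s) * L b * L c + (w b - s) * (w b + s) * L a * L c + w c * w c * L a * L b)
     - (w a * w a * L b * L c + w b * w b * L a * L c + w c * w c * L a * L b) by ring.
    have {}e3 : (w a + s) * w a * L b * L c + (w b - s) * w b * L a * L c + w c * w c * L a * L b +
     ((w a - s) * w a * L b * L c + (w b + s) * w b * L a * L c + w c * w c * L a * L b)
     = 2 * (w a * w a * L b * L c + w b * w b * L a * L c + w c * w c * L a * L b) by ring.
    rewrite e1 e2 in e3 *. have {}e3 : w a * w a * L b * L c + w b * w b * L a * L c + w c * w c * L a * L b = -2 * L a * L b * L c by lia.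
    rewrite e3; have := Euz _ _ _ d; rewrite ua ub uc za zb zc => ->; ring.
  have -> : L a + L b = - L c by lia.
  case: hs => ->; rewrite ?expr1n ?sqrrN ?expr1n mul1r mulrN => /eqP;
  by rewrite oppr_eq0 mulf_eq0 (negbTE lc).
move=> [p [q [pq up uq ur]]] [p' [q' [pq' zp zq zr]]] he re.
have [r [d cov]] := third3 pq; have [_ pr qr] := d.
have [d1 d2 d3 d4 d5] := distinct3_perm d.
have ur' : u r = w r by apply: ur; rewrite eq_sym.
have re' : red3 w \/ red3 u \/ red3 z by case: he re => ->; auto.
have re'' : red3 w \/ red3 z \/ red3 u by case: he re => ->; auto.
case: (cov p') => pe; case: (cov q') => qe; rewrite pe qe ?eqxx // in pq' zp zq zr.
- case: uz; apply/funext => x; case: (cov x) => ->; rewrite ?up ?uq ?zp ?zq //.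
  by rewrite ur' zr // eq_sym.
- have zq' : z q = w q by apply: zr; rewrite // eq_sym.
  by apply: (same (-1) q p r); rewrite ?up ?uq ?zp ?zq ?zq'; auto; lia.
- have zr' : z r = w r by apply: zr; rewrite eq_sym.
  by apply: (back p q r) => //; lia.
- have zp' : z p = w p by apply: zr; rewrite // eq_sym.
  apply: (core u z p q r) => //.
- have zq' : z q = w q by apply: zr; rewrite // eq_sym.
  apply: (core z u r p q) => //; exact: sym.
- have zp' : z p = w p by apply: zr; rewrite // eq_sym.
  by apply: (same 1 p q r); rewrite ?up ?uq ?zp ?zq ?zq'; auto; lia.
Qed.

End Circuit23.

Lemma sum3 (V : zmodType) (F : 'I_3 -> V) i j k : distinct3 i j k -> \sum_t F t = F i + F j + F k.
Proof.
move=> [ij ik jk]; rewrite (bigD1 i) //= (bigD1 j) 1?eq_sym //= (bigD1 k) /=; last first.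
  by rewrite !(eq_sym k) ik jk.
rewrite big1 ?addr0 ?addrA // => t /andP[/andP[ti tj] tk].
have [r [_ cov]] := third3 ij.
have kr : k = r by case: (cov k) => // e; [rewrite e eqxx in ik|rewrite e eqxx in jk].
by case: (cov t) => e; [rewrite e eqxx in ti|rewrite e eqxx in tj|rewrite e kr eqxx in tk].
Qed.

(* The columns of B are pairwise orthogonal for the nondegenerate form
   K = diag c + c^T c, so exactly three of them do not vanish; dualizing
   B^T K B = 2 diag (c B) gives the relations between the rows. *)
Lemma orthogonal_columns l (B : 'M[rat]_(3, l)) (c : 'rV[rat]_3) (X := c *m B) :
  row_free B -> (forall k, c 0 k != 0) -> \sum_k c 0 k = 0 -> (forall k, \sum_j B k j = 2) ->
  (forall i j, X 0 i * X 0 j + \sum_k c 0 k * B k i * B k j = 2 * X 0 i *+ (i == j)) ->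
  exists f : 'I_3 -> 'I_l, [/\ injective f, forall t, X 0 (f t) != 0,
    forall j, (forall t, j != f t) -> forall k, B k j = 0
    & forall a b, a != b -> \sum_t B a (f t) * B b (f t) / X 0 (f t) = -2].
Proof.
move=> fB c0 sc mB ortho.
have fullB : row_full B^T by rewrite /row_full mxrank_tr.
pose f := fullrankfun fullB; pose N : 'M[rat]_3 := rowsub f B^T.
have fi : injective f by exact: fullrankfun_inj.
have uN : N \in unitmx by exact: fullrowsub_unit.
have NE t k : N t k = B k (f t) by rewrite !mxE.
pose K : 'M[rat]_3 := \matrix_(a, b) (c 0 a *+ (a == b) + c 0 a * c 0 b).
have XE j : X 0 j = \sum_k c 0 k * B k j by rewrite mxE.
have KB a j : \sum_b K a b * B b j = c 0 a * (B a j + X 0 j).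
  rewrite mulrDr XE mulr_sumr (eq_bigr (fun b => c 0 a *+ (a == b) * B b j + c 0 a * (c 0 b * B b j))).
    rewrite big_split /= (bigD1 a) //= eqxx mulr1n big1 ?addr0 // => b ba.
    by rewrite eq_sym (negbTE ba) mul0r.
  by move=> b _; rewrite mxE mulrDl mulrA.
have NKB s j : \sum_a N s a * (\sum_b K a b * B b j) = 2 * X 0 (f s) *+ (f s == j).
  rewrite -ortho addrC [X 0 (f s)]XE mulr_suml -big_split; apply: eq_bigr => a _ /=.
  by rewrite KB NE; ring.
(* A kernel vector of [K] has all entries equal because no entry of c vanishes, and the common value
   is zero because c has sum zero. *)
have uK : K \in unitmx.
  rewrite -row_free_unit -kermx_eq0; apply/eqP/row_matrixP => i; rewrite row0.
  set e := row i _; have eK : e *m K = 0 by rewrite /e -row_mul mulmx_ker row0.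
  have ec a : c 0 a * (e 0 a + \sum_b e 0 b * c 0 b) = 0.
    transitivity ((e *m K) 0 a); last by rewrite eK mxE.
    rewrite [RHS]mxE.
    rewrite [RHS](eq_bigr (fun b => e 0 b * c 0 b *+ (b == a) + c 0 a * (e 0 b * c 0 b))).
      rewrite big_split /= [X in _ = X + _](bigD1 a) //= eqxx mulr1n [X in _ = _ + X + _]big1 ?addr0.
        by rewrite -mulr_sumr mulrDr [e 0 a * _]mulrC.
      by move=> b /negbTE->.
    move=> b _; rewrite [K b a]mxE mulrDr mulrnAr; congr (_ + _); ring.
  have ea a : e 0 a = - \sum_b e 0 b * c 0 b.
    by have /eqP := ec a; rewrite mulf_eq0 (negbTE (c0 a)) addr_eq0 => /eqP.
  have z : \sum_b e 0 b * c 0 b = 0.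
    by under eq_bigr do rewrite ea; rewrite -mulr_sumr sc mulr0.
  by apply/rowP => a; rewrite ea z oppr0 mxE.
have NKN s t : (N *m K *m N^T) s t = 2 * X 0 (f s) *+ (s == t).
  rewrite -mulmxA mxE -(inj_eq fi) -NKB; apply: eq_bigr => a _; congr (_ * _).
  by rewrite mxE; apply: eq_bigr => b _; rewrite [N^T _ _]mxE NE.
(* The matrix [N *m K *m N^T] is invertible and diagonal, with entries 2 X. *)
have X0 t : X 0 (f t) != 0.
  apply/eqP => Xt; have u3 : N *m K *m N^T \in unitmx by rewrite !unitmx_mul uN uK unitmx_tr.
  have := @row_free_inj _ 1 _ _ (N *m K *m N^T); rewrite row_free_unit u3 => /(_ isT).
  move/(_ (delta_mx 0 t) 0); rewrite mul0mx -rowE => H.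
  have /matrixP/(_ 0 t)/eqP : delta_mx 0 t = 0 :> 'rV[rat]_3.
    by apply: H; apply/rowP => s; rewrite mxE NKN Xt mulr0 mul0rn mxE.
  by rewrite !mxE !eqxx oner_eq0.
exists f; split=> // [j nj k|a b ab].
  (* Any further column is orthogonal to three independent ones. *)
  have uNK : N *m K \in unitmx by rewrite unitmx_mul uN uK.
  have h : (N *m K) *m col j B = 0.
    apply/matrixP => s i; rewrite ord1 [RHS]mxE -mulmxA mxE.
    rewrite -[RHS](_ : 2 * X 0 (f s) *+ (f s == j) = 0); last first.
      by rewrite eq_sym (negbTE (nj s)) mulr0n.
    rewrite -NKB; apply: eq_bigr => a _; congr (_ * _).
    by rewrite mxE; apply: eq_bigr => b _; rewrite [col _ _ _ _]mxE.
  have := congr1 (mulmx (invmx (N *m K))) h; rewrite mulKmx // mulmx0 => /matrixP/(_ k 0).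
  by rewrite !mxE.
(* [G] turns out to be twice the inverse of [K]. Since c has sum zero, the product of [G] with c is
   the constant 2, and this gives the off-diagonal entries -2. *)
pose Li : 'M[rat]_3 := diag_mx (\row_t (X 0 (f t))^-1).
pose G := N^T *m Li *m N.
have GE a' b' : G a' b' = \sum_t B a' (f t) * B b' (f t) / X 0 (f t).
  rewrite mxE; apply: eq_bigr => t _.
  by rewrite mul_mx_diag mxE [N^T _ _]mxE [(\row__ _) _ _]mxE !NE; ring.
have inv : (2^-1 *: (N *m K)) *m (N^T *m Li) = 1%:M.
  rewrite -scalemxAl mulmxA; apply/matrixP => s t; rewrite mul_mx_diag mxE mxE NKN [(\row__ _) _ _]mxE [RHS]mxE.
  have [->|_] := eqVneq s t; last by rewrite mulr0n mul0r mulr0.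
  by rewrite mulr1n -mulrA mulKf // mulfV.
have GK : G *m K = 2%:M.
  have := mulmx1C inv; rewrite -scalemxAr mulmxA => /(congr1 (fun A => 2 *: A)).
  by rewrite scalerA mulfV // scale1r /G -mulmxA => ->; rewrite scalemx1.
have GKE a' b' : G a' b' * c 0 b' + (\sum_e G a' e * c 0 e) * c 0 b' = 2 *+ (a' == b').
  transitivity ((G *m K) a' b'); last by rewrite GK mxE.
  rewrite [RHS]mxE.
  rewrite [RHS](eq_bigr (fun e => G a' e * c 0 e *+ (e == b') + G a' e * c 0 e * c 0 b')).
    rewrite big_split /= [X in _ = X + _](bigD1 b') //= eqxx mulr1n [X in _ = _ + X + _]big1 ?addr0.
      by rewrite mulr_suml.
    by move=> e /negbTE->.
  by move=> e _; rewrite [K e b']mxE mulrDr mulrnAr mulrA; have [->|] := eqVneq e b'.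
have Gc a' : \sum_e G a' e * c 0 e = 2.
  have : \sum_b' (G a' b' * c 0 b' + (\sum_e G a' e * c 0 e) * c 0 b') = \sum_b' 2 *+ (a' == b').
    by apply: eq_bigr => b' _; rewrite GKE.
  rewrite big_split /= -mulr_sumr sc mulr0 addr0 => ->.
  by rewrite (bigD1 a') //= eqxx big1 ?addr0 // => e; rewrite eq_sym => /negbTE->.
have := GKE a b; rewrite Gc (negbTE ab) mulr0n -mulrDl -GE => /eqP.
by rewrite mulf_eq0 (negbTE (c0 b)) orbF addr_eq0 => /eqP.
Qed.

Definition isred m (b : 'rV[int]_m) :=
  exists i j, i != j /\ b = delta_mx 0 i + delta_mx 0 j.
Definition isblack m (b : 'rV[int]_m) :=
  exists i j, i != j /\ b = delta_mx 0 j - delta_mx 0 i.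

Lemma ordinals3 : exists i j k : 'I_3, distinct3 i j k.
Proof. by exists (@Ordinal 3 0 isT), (@Ordinal 3 1 isT), (@Ordinal 3 2 isT). Qed.

Lemma red3_of01 (g : 'I_3 -> int) : (forall t, g t = 0 \/ g t = 1) -> mass3 g 2 -> red3 g.
Proof.
move=> g01 mg; have [i [j [k d]]] := ordinals3; have [ij ik jk] := d.
have [r [_ cov]] := third3 ij.
have kr : k = r by case: (cov k) => // e; [rewrite e eqxx in ik|rewrite e eqxx in jk].
rewrite -kr in cov; have := mg _ _ _ d.
have one s : s != i -> s != j -> s = k by case: (cov s) => -> //; rewrite eqxx.
case: (g01 i) => gi; case: (g01 j) => gj; case: (g01 k) => gk; rewrite gi gj gk //.
- by exists i => // s si; case: (cov s) => e; rewrite e // in si *; rewrite eqxx in si.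
- by exists j => // s si; case: (cov s) => e; rewrite e // in si *; rewrite eqxx in si.
- by exists k => // s si; case: (cov s) => e; rewrite e // in si *; rewrite eqxx in si.
Qed.

Lemma black3_of01 (f g : 'I_3 -> int) : mass3 f 2 -> mass3 g 2 ->
  (forall t, [\/ f t = g t, f t = g t + 1 | f t = g t - 1]) -> (exists t, f t != g t) ->
  black3 f g.
Proof.
move=> mf mg h [t ft].
have [j tj] : exists j : 'I_3, t != j.
  have [i [j [_ [ij _ _]]]] := ordinals3.
  by have [e|ti] := eqVneq t i; [exists j; rewrite e|exists i].
have [k [d cov]] := third3 tj; have [_ tk jk] := d.
have e1 := mf _ _ _ d; have e2 := mg _ _ _ d.
have rest x y : x != y -> t = x \/ t = y -> j = y \/ k = y \/ j = x \/ k = x ->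
   (forall s, s = t \/ s = j \/ s = k).
  by move=> _ _ _ s; case: (cov s); auto.
case: (h t) => ht; [by rewrite ht eqxx in ft| |]; case: (h j) => hj; case: (h k) => hk;
  try by (exfalso; move: e1; rewrite ht hj hk; move: e2; move: (g t) (g j) (g k); clear; lia).
- exists t, k; split=> // s st sk.
  by case: (cov s) => e; rewrite e ?eqxx // in st sk *.
- exists t, j; split=> // s st sk.
  by case: (cov s) => e; rewrite e ?eqxx // in st sk *.
- exists k, t; split; rewrite // 1?eq_sym // => s st sk.
  by case: (cov s) => e; rewrite e ?eqxx // in st sk *.
- exists j, t; split; rewrite // 1?eq_sym // => s st sk.
  by case: (cov s) => e; rewrite e ?eqxx // in st sk *.
Qed.

Section Extension.
Variable m : nat.
Implicit Types b L : 'rV[int]_m.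

(* The extra site v_0 = 0 absorbs the defect of mass of a label. *)
Definition ext (s : int) b : 'rV[int]_(1 + m) := row_mx (s - \sum_i b 0 i)%:M b.

Lemma ext0 s b : ext s b 0 (lshift m ord0) = s - \sum_i b 0 i.
Proof. by rewrite /ext row_mxEl mxE eqxx. Qed.

Lemma extS s b i : ext s b 0 (rshift 1 i) = b 0 i.
Proof. by rewrite /ext row_mxEr. Qed.

Lemma ext_sum s b : \sum_j ext s b 0 j = s.
Proof.
rewrite (@big_split_ord _ _ _ 1 m) /= big_ord1 ext0 (eq_bigr (fun i => b 0 i)) ?subrK //.
by move=> i _; rewrite extS.
Qed.

Lemma extD s b b' j : ext s (b + b') 0 j = ext s b 0 j + ext 0 b' 0 j.
Proof.
case: (split_ordP (j : 'I_(1 + m))) => i ->; last by rewrite !extS mxE.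
rewrite ord1 !ext0 (eq_bigr (fun i => b 0 i + b' 0 i)); last by move=> k _; rewrite mxE.
by rewrite big_split /=; ring.
Qed.

Lemma extP s b b' : (forall j, ext s b 0 j = ext s b' 0 j) -> b = b'.
Proof. by move=> h; apply/rowP => i; rewrite -(extS s b) h extS. Qed.

Lemma sum_entries_delta i : \sum_k (delta_mx 0 i : 'rV[int]_m) 0 k = 1.
Proof.
by rewrite (bigD1 i) //= mxE !eqxx big1 ?addr0 // => k /negbTE ki; rewrite mxE ki.
Qed.

Lemma sum_entriesD b b' : \sum_k (b + b') 0 k = \sum_k b 0 k + \sum_k b' 0 k.
Proof. by rewrite -big_split; apply: eq_bigr => k _; rewrite mxE. Qed.

Lemma sum_entriesN b : \sum_k (- b) 0 k = - \sum_k b 0 k.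
Proof. by rewrite -sumrN; apply: eq_bigr => k _; rewrite mxE. Qed.

Lemma isred_ext b j : isred b -> ext 2 b 0 j = 0 \/ ext 2 b 0 j = 1.
Proof.
move=> [i [k [ik ->]]]; case: (split_ordP (j : 'I_(1 + m))) => l ->.
  by left; rewrite ord1 ext0 sum_entriesD !sum_entries_delta.
rewrite extS !mxE /=; have [->|li] := eqVneq l i; last by case: eqP; auto.
by rewrite (negbTE ik); right.
Qed.

Lemma isblack_ext b b' j : isblack (b - b') ->
  [\/ ext 2 b 0 j = ext 2 b' 0 j, ext 2 b 0 j = ext 2 b' 0 j + 1 | ext 2 b 0 j = ext 2 b' 0 j - 1].
Proof.
move=> [i [k [ik bb]]]; have -> : b = b' + (b - b') by rewrite addrC subrK.
rewrite extD bb.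
suff : [\/ ext 0 (delta_mx 0 k - delta_mx 0 i) 0 j = 0, ext 0 (delta_mx 0 k - delta_mx 0 i) 0 j = 1
    | ext 0 (delta_mx 0 k - delta_mx 0 i) 0 j = -1].
  by case=> ->; [constructor 1|constructor 2|constructor 3]; rewrite ?addr0.
case: (split_ordP (j : 'I_(1 + m))) => l ->.
  by constructor 1; rewrite ord1 ext0 sum_entriesD sum_entriesN !sum_entries_delta.
rewrite extS !mxE /=; have [->|li] := eqVneq l k.
  by rewrite eq_sym (negbTE ik); constructor 2.
by case: eqP => _; [constructor 3|constructor 1].
Qed.

Lemma ext_double b j : ext 2 b 0 j = 2 -> (forall k, k != j -> ext 2 b 0 k = 0) ->
  b = 0 \/ exists i, b = 2 *: delta_mx 0 i.
Proof.
case: (split_ordP (j : 'I_(1 + m))) => l -> bj hk.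
  left; apply/rowP => i; rewrite mxE -(extS 2 b); apply: hk.
  by apply/eqP => /(congr1 val) /=; rewrite ord1.
right; exists l; apply/rowP => i; rewrite !mxE /=; have [->|il] := eqVneq i l.
  by rewrite mulr1 -bj extS.
rewrite mulr0 -(extS 2 b); apply: hk; apply: contra il => /eqP /(congr1 val) /=.
by move/addnI/val_inj => ->.
Qed.

End Extension.

Lemma clear_denominators (K : fieldType) (x y z a b c : K) : a != 0 -> b != 0 -> c != 0 ->
  x / a + y / b + z / c = -2 -> x * b * c + y * a * c + z * a * b = - 2 * a * b * c.
Proof.
move=> a0 b0 c0 E; transitivity ((x / a + y / b + z / c) * (a * b * c)).
  by field; rewrite a0 b0 c0.
by rewrite E; ring.
Qed.

Section Claims.
Variables (m : nat) (b : 'I_3 -> 'rV[int]_m) (L : 'rV[int]_m).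

(** Constraints on the edges among three points of one colour and two of the other: [b k] and
    [b k + L] are the labels joining the k-th of the three to the one and to the other of the two,
    and differences of the [b k] are labels between the three. *)
Definition circuit_claims :=
  [/\ forall k l, k != l -> (isred (b k) -> isred (b l) -> False) /\
                            (isred (b k + L) -> isred (b l + L) -> False),
      forall j k l, distinct3 j k l -> isblack (b j - b k) -> isblack (b l - b k) ->
        forall t, (isred (b t) -> False) /\ (isred (b t + L) -> False),
      forall j k, j != k -> isblack (b j - b k) ->
        forall s t, isred (b s) -> isred (b t + L) -> False
    & ~ isblack L].

Variables (d : int) (C : 'I_3 -> int).
Hypothesis d0 : d != 0.
Hypothesis C0 : forall k, C k != 0.
Hypothesis sC : \sum_k C k = 0.
Hypothesis dL : d *: L = \sum_k C k *: b k.
Hypothesis b_free : forall e : 'I_3 -> rat, \sum_k e k = 0 ->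
  (forall i, \sum_k e k * (b k 0 i)%:~R = 0) -> forall k, e k = 0.
Hypothesis I2 : forall i j, d * L 0 i * L 0 j + \sum_k C k * b k 0 i * b k 0 j =
  2 * d * L 0 i *+ (i == j).
Hypothesis bn0 : forall k, b k <> 0 /\ forall i, b k <> 2 *: delta_mx 0 i.
Hypothesis bLn0 : forall k, b k + L <> 0 /\ forall i, b k + L <> 2 *: delta_mx 0 i.

(** On extended labels the identity [I2] becomes orthogonality of columns, so that only three
    columns survive and the rows satisfy [duality]. The labels [b k + L] satisfy it with - L in
    place of L, hence the arithmetic lemmas apply to them as well. *)
Lemma circuit_claims_hold : circuit_claims.
Proof.
pose B : 'M[rat]_(3, 1 + m) := \matrix_(k, j) (ext 2 (b k) 0 j)%:~R.
pose c : 'rV[rat]_3 := \row_k ((C k)%:~R / d%:~R).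
have dq : d%:~R != 0 :> rat by rewrite intr_eq0.
have BE k j : B k j = (ext 2 (b k) 0 j)%:~R by rewrite mxE.
have cE k : c 0 k = (C k)%:~R / d%:~R by rewrite mxE.
have c0 k : c 0 k != 0 by rewrite cE mulf_neq0 ?invr_eq0 ?intr_eq0.
have sc : \sum_k c 0 k = 0.
  under eq_bigr do rewrite cE; by rewrite -mulr_suml -rmorph_sum sC mul0r.
have mB k : \sum_j B k j = 2.
  under eq_bigr do rewrite BE; by rewrite -rmorph_sum ext_sum.
have Li i : (d * L 0 i)%:~R = \sum_k (C k * b k 0 i)%:~R :> rat.
  rewrite -rmorph_sum; congr _%:~R; have := congr1 (fun w : 'rV_m => w 0 i) dL.
  by rewrite mxE summxE => ->; apply: eq_bigr => k _; rewrite mxE.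
have XS i : (c *m B) 0 (rshift 1 i) = (L 0 i)%:~R.
  rewrite mxE; apply: (mulfI dq); rewrite -intrM Li mulr_sumr; apply: eq_bigr => k _.
  by rewrite BE extS cE intrM; field.
have sX : \sum_j (c *m B) 0 j = 0.
  under eq_bigr do rewrite mxE; rewrite exchange_big /=.
  by under eq_bigr do rewrite -mulr_sumr mB; rewrite -mulr_suml sc mul0r.
have X0 : (c *m B) 0 (lshift m ord0) = - \sum_i (L 0 i)%:~R.
  move: sX; rewrite (@big_split_ord _ _ _ 1 m) /= big_ord1; under [X in _ + X]eq_bigr do rewrite XS.
  by move/eqP; rewrite addr_eq0 => /eqP.
have XE j : (c *m B) 0 j = (ext 0 L 0 j)%:~R.
  case: (split_ordP (j : 'I_(1 + m))) => i ->; last by rewrite XS extS.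
  by rewrite ord1 X0 ext0 sub0r rmorphN rmorph_sum.
pose H i j : rat := (c *m B) 0 i * (c *m B) 0 j + \sum_k c 0 k * B k i * B k j.
have Hsym i j : H i j = H j i.
  by rewrite /H mulrC; congr (_ + _); apply: eq_bigr => k _; rewrite -!mulrA [B k i * _]mulrC.
have HSS i j : H (rshift 1 i) (rshift 1 j) = 2 * (L 0 i)%:~R *+ (i == j).
  rewrite /H !XS; under eq_bigr do rewrite !BE !extS cE.
  apply: (mulfI dq); rewrite mulrDr mulr_sumr.
  have := congr1 (fun z : int => z%:~R : rat) (I2 i j).
  rewrite rmorphD rmorph_sum /= !intrM rmorphMn ?intrM /= => h.
  rewrite mulrnAr (_ : d%:~R * (2 * (L 0 i)%:~R) = (2 * d * L 0 i)%:~R); last by rewrite !intrM; ring.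
  rewrite -h mulrA; congr (_ + _); apply: eq_bigr => k _; rewrite !intrM; by field.
(* Since all rows have sum 2, orthogonality carries over to the column added by [ext]. *)
have Hsum i : \sum_j H i j = 2 * (c *m B) 0 i.
  rewrite big_split /= -mulr_sumr sX mulr0 add0r exchange_big /=.
  under eq_bigr do rewrite -mulr_sumr mB.
  by rewrite -mulr_suml mulrC mxE.
have H0S j : H (lshift m ord0) (rshift 1 j) = 0.
  rewrite Hsym; have := Hsum (rshift 1 j); rewrite (@big_split_ord _ _ _ 1 m) /= big_ord1.
  under [X in _ + X]eq_bigr do rewrite HSS.
  rewrite (bigD1 j) //= eqxx mulr1n big1 ?addr0 => [|i].
    by rewrite XS => /eqP; rewrite -subr_eq0 addrK => /eqP.
  by rewrite eq_sym => /negbTE ->.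
have H00 : H (lshift m ord0) (lshift m ord0) = 2 * (c *m B) 0 (lshift m ord0).
  by rewrite -Hsum (@big_split_ord _ _ _ 1 m) /= big_ord1 big1 ?addr0 // => i _.
have ortho i j : (c *m B) 0 i * (c *m B) 0 j + \sum_k c 0 k * B k i * B k j
    = 2 * (c *m B) 0 i *+ (i == j).
  rewrite -/(H i j); case: (split_ordP (i : 'I_(1 + m))) => i' ->;
  case: (split_ordP (j : 'I_(1 + m))) => j' ->; rewrite ?(ord1 i') ?(ord1 j').
  - by rewrite H00 eqxx.
  - by rewrite H0S eqE /= mulr0n.
  - by rewrite Hsym H0S eqE /= mulr0n.
  - by rewrite HSS XS (inj_eq (@rshift_inj _ _)).
have fB : row_free B.
  rewrite -kermx_eq0; apply/eqP/row_matrixP => r; rewrite row0.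
  set e := row r _; have eB : e *m B = 0 by rewrite /e -row_mul mulmx_ker row0.
  have eBj j : \sum_k e 0 k * B k j = 0.
    by transitivity ((e *m B) 0 j); [rewrite [RHS]mxE|rewrite eB mxE].
  have se : \sum_k e 0 k = 0.
    have : \sum_j \sum_k e 0 k * B k j = 0 by rewrite big1 // => j _; exact: eBj.
    rewrite exchange_big /=; under eq_bigr do rewrite -mulr_sumr mB.
    by rewrite -mulr_suml => /eqP; rewrite mulf_eq0 orbF => /eqP.
  apply/rowP => k; rewrite [RHS]mxE; apply: (b_free (e := fun k => e 0 k)) => // i.
  by have := eBj (rshift 1 i); under eq_bigr do rewrite BE extS.
have [f [fi Xf0 zout dual]] := orthogonal_columns fB c0 sc mB ortho.
pose F k t := ext 2 (b k) 0 (f t); pose FL t := ext 0 L 0 (f t).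
have bout k j : (forall t, j != f t) -> ext 2 (b k) 0 j = 0.
  by move=> /zout/(_ k); rewrite BE => /eqP; rewrite intr_eq0 => /eqP.
have Lout j : (forall t, j != f t) -> ext 0 L 0 j = 0.
  move=> hj; apply/eqP; rewrite -(intr_eq0 rat) -XE mxE big1 // => k _.
  by rewrite zout ?mulr0.
have bLout k j : (forall t, j != f t) -> ext 2 (b k + L) 0 j = 0.
  by move=> hj; rewrite extD bout // Lout.
have sumf (g : 'I_(1 + m) -> int) : (forall j, (forall t, j != f t) -> g j = 0) ->
    \sum_j g j = \sum_t g (f t).
  move=> gz; rewrite (bigID (mem (f @: [set: 'I_3])%SET)) /= [X in _ + X]big1 ?addr0 => [|j].
    rewrite big_imset /=; last by move=> x y _ _ /fi.
    by apply: eq_bigl => t; rewrite inE.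
  move=> nj; apply: gz => t; apply: contra nj => /eqP ->; by rewrite imset_f ?inE.
have massf s (g : 'rV[int]_m) : (forall j, (forall t, j != f t) -> ext s g 0 j = 0) ->
    mass3 (fun t => ext s g 0 (f t)) s.
  by move=> gz i j k dd; rewrite -(sum3 (fun t => ext s g 0 (f t)) dd) -sumf // ext_sum.
have FL0 t : FL t != 0 by rewrite -(intr_eq0 rat) -XE.
have FLm : mass3 FL 0 by apply: massf.
have Fm k : mass3 (F k) 2 by apply: massf; apply: bout.
have FLE k t : ext 2 (b k + L) 0 (f t) = F k t + FL t.
  by rewrite extD.
have FD k l : k != l -> duality FL (F k) (F l).
  move=> kl i j h dd; have := dual k l kl; rewrite (sum3 _ dd) !BE !XE -!/(F _ _) -!/(FL _).
  have q t : (FL t)%:~R != 0 :> rat by rewrite intr_eq0 FL0.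
  move=> /(clear_denominators (q i) (q j) (q h)) E.
  by apply: (@intr_inj rat); rewrite !(rmorphD, rmorphM, rmorphN).
have redF k : isred (b k) -> red3 (F k).
  by move=> hr; apply: red3_of01 (Fm k) => t; apply: isred_ext.
have redFL k : isred (b k + L) -> red3 (fun t => F k t + FL t).
  move=> hr; apply: red3_of01 => [t|]; first by rewrite -FLE; apply: isred_ext.
  by move=> i j h dd; rewrite -!FLE; apply: (massf 2 (b k + L)) => //; apply: bLout.
have blackF k l : isblack (b k - b l) -> black3 (F k) (F l).
  move=> hb; apply: black3_of01 => // [t|]; first exact: isblack_ext.
  apply: contrapT => no; have [i [j [ij bb]]] := hb.
  have bkl : b k = b l.
    apply: (@extP _ 2) => x; have [[t ->]|nx] := pselect (exists t, x = f t).
      by apply: contrapT => /eqP h; apply: no; exists t.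
    by rewrite !bout // => t; apply/eqP => xt; apply: nx; exists t.
  have := congr1 (fun w : 'rV_m => w 0 i) bb; rewrite bkl subrr !mxE eqxx (negbTE ij) /=.
  by rewrite eqxx.
have ndF (g : 'rV[int]_m) : (forall j, (forall t, j != f t) -> ext 2 g 0 j = 0) ->
    g <> 0 -> (forall i, g <> 2 *: delta_mx 0 i) -> notdouble (fun t => ext 2 g 0 (f t)).
  move=> gz g0 g2 t gt gs; case: (@ext_double _ g (f t) gt) => [x xt|//|[i gi]]; last exact: (g2 i).
  have [[s xs]|nx] := pselect (exists s, x = f s).
    by rewrite xs gs //; apply: contra xt => /eqP <-; rewrite xs.
  by apply: gz => s; apply/eqP => xs; apply: nx; exists s.
have nd k : notdouble (F k) by have [h1 h2] := bn0 k; apply: ndF => //; apply: bout.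
have ndL k : notdouble (fun t => F k t + FL t).
  have [h1 h2] := bLn0 k; have := ndF _ (bLout k) h1 h2.
  by move=> h t; rewrite -FLE => gt gs; apply: (h t) => // s st; rewrite FLE gs.
have FLneq k l : k != l -> exists t, F k t != F l t.
  move=> kl; apply: contrapT => no.
  have bkl : b k = b l.
    apply: (@extP _ 2) => x; have [[t ->]|nx] := pselect (exists t, x = f t).
      by apply: contrapT => /eqP h; apply: no; exists t.
    by rewrite !bout // => t; apply/eqP => xt; apply: nx; exists t.
  have sel (g : 'I_3 -> rat) : \sum_t ((t == k)%:R - (t == l)%:R) * g t = g k - g l.
    under eq_bigr do rewrite mulrBl.
    rewrite sumrB (bigD1 k) //= eqxx mul1r big1 ?addr0 => [|t /negbTE->]; last by rewrite mul0r.
    congr (_ - _); rewrite (bigD1 l) //= eqxx mul1r big1 ?addr0 // => t /negbTE->.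
    by rewrite mul0r.
  have e1 : \sum_t ((t == k)%:R - (t == l)%:R) = 0 :> rat.
    rewrite -[RHS](subrr 1) -(sel (fun=> 1)); apply: eq_bigr => t _; by rewrite mulr1.
  have e2 i : \sum_t ((t == k)%:R - (t == l)%:R) * (b t 0 i)%:~R = 0 :> rat.
    by rewrite (sel (fun t => (b t 0 i)%:~R)) bkl subrr.
  by have := b_free e1 e2 k; rewrite eqxx (negbTE kl) subr0 => /eqP; rewrite oner_eq0.
have FLm' : mass3 (fun t => - FL t) 0 by move=> i j k dd; rewrite -!opprD FLm ?oppr0.
have FL0' t : - FL t != 0 by rewrite oppr_eq0.
pose F' k t := F k t + FL t.
have F'm k : mass3 (F' k) 2.
  by move=> i j h dd; have := Fm k _ _ _ dd; have := FLm _ _ _ dd; rewrite /F'; lia.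
(* Exchanging the two points of the second colour replaces F by F + FL and FL by - FL; duality is
   preserved because the masses are 2, 2 and 0. *)
have F'D k l : k != l -> duality (fun t => - FL t) (F' k) (F' l).
  move=> kl i j h dd; have E := FD k l kl _ _ _ dd.
  have e1 := Fm k _ _ _ dd; have e2 := Fm l _ _ _ dd; have e3 := FLm _ _ _ dd.
  rewrite /F'; move: e1 e2 e3 E; move: (F k i) (F k j) (F k h) (F l i) (F l j) (F l h) (FL i) (FL j) (FL h).
  clear => f1 f2 f3 g1 g2 g3 l1 l2 l3 e1 e2 e3 E.
  have -> : (f1 + l1) * (g1 + l1) * - l2 * - l3 + (f2 + l2) * (g2 + l2) * - l1 * - l3
      + (f3 + l3) * (g3 + l3) * - l1 * - l2
    = (f1 * g1 * l2 * l3 + f2 * g2 * l1 * l3 + f3 * g3 * l1 * l2)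
      + l1 * l2 * l3 * ((f1 + f2 + f3) + (g1 + g2 + g3) + (l1 + l2 + l3)) by ring.
  by rewrite E e1 e2 e3; ring.
have F'neq k l : k != l -> exists t, F' k t != F' l t.
  by move=> /FLneq[t ft]; exists t; rewrite /F' (inj_eq (addIr _)).
have black' k l : black3 (F k) (F l) -> black3 (F' k) (F' l).
  move=> [p [q [pq fp fq fr]]]; exists p, q; split=> //; rewrite /F'; try lia.
  by move=> r rp rq; rewrite fr.
split.
- move=> k l kl; split.
    move=> /redF r1 /redF r2; exact: (two_reds_false FL0 (FD k l kl) r1 r2 (FLneq k l kl)).
  move=> /redFL r1 /redFL r2; exact: (two_reds_false FL0' (F'D k l kl) r1 r2 (F'neq k l kl)).
- move=> j k l dd b1 b2 t; have [jk jl kl] := dd.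
  have [r [dr cov]] := third3 jk.
  have lr : l = r by case: (cov l) => // e; [rewrite e eqxx in jl|rewrite e eqxx in kl].
  rewrite -lr in cov.
  have covt (G : 'I_3 -> 'I_3 -> int) : [\/ G t = G j, G t = G k | G t = G l].
    by case: (cov t) => ->; [constructor 1|constructor 2|constructor 3].
  have lk : l != k by rewrite eq_sym.
  have neq (G : 'I_3 -> 'I_3 -> int) : (exists s, G j s != G l s) -> G j <> G l.
    by move=> [s gs] e; rewrite e eqxx in gs.
  split=> [/redF|/redFL].
    apply: (black_path_false FL0 FLm (neq F (FLneq j l jl)) (Fm j) (Fm k) (Fm l)
      (FD _ _ jk) (FD _ _ lk) (FD _ _ jl) (nd j) (nd k) (nd l) (blackF _ _ b1) (blackF _ _ b2) (covt F)).
  apply: (black_path_false FL0' FLm' (neq F' (F'neq j l jl)) (F'm j) (F'm k) (F'm l)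
      (F'D _ _ jk) (F'D _ _ lk) (F'D _ _ jl) (ndL j) (ndL k) (ndL l)
      (black' _ _ (blackF _ _ b1)) (black' _ _ (blackF _ _ b2)) (covt F')).
- move=> j k jk bb s t /redF r1 /redFL r2.
  have [l [dd cov]] := third3 jk; have [_ jl kl] := dd.
  have covt x : [\/ F x = F j, F x = F k | F x = F l].
    by case: (cov x) => ->; [constructor 1|constructor 2|constructor 3].
  exact: (black_two_reds_false FL0 FLm (Fm j) (Fm k) (Fm l) (FD _ _ jk) (FD _ _ jl) (FD _ _ kl)
    (nd j) (nd k) (ndL j) (ndL k) (blackF _ _ bb) (covt s) (covt t) r1 r2).
(* A black L would have three entries 1 or -1 with sum zero. *)
- move=> bL; have h t : FL t = 1 \/ FL t = -1.
    have : isblack (L - 0) by rewrite subr0.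
    move/(isblack_ext (f t)); have e0 : ext 2 L 0 (f t) = ext 2 0 0 (f t) + FL t.
      by rewrite -[in LHS](add0r L) extD.
    by rewrite e0; move: (FL0 t) => /eqP; move: (FL t) (ext _ _ _ _) => a z a0; case; lia.
  have [i [j [k dd]]] := ordinals3; have := FLm _ _ _ dd.
  by case: (h i) => ->; case: (h j) => ->; case: (h k) => ->.
Qed.

End Claims.

Section Circuit23Generic.
Variables (m p : nat).
Local Notation n := p.+1.
Implicit Types (v : 'M[int]_(m, n)) (L : 'rV[int]_m) (x : 'rV[int]_n).

Let o0 : 'I_3 := @Ordinal 3 0 isT.
Let o1 : 'I_3 := @Ordinal 3 1 isT.
Let o2 : 'I_3 := @Ordinal 3 2 isT.

Lemma sum_ord3 (V : nmodType) (F : 'I_3 -> V) : \sum_k F k = F o0 + F o1 + F o2.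
Proof.
rewrite !big_ord_recl big_ord0 addr0 addrA.
by congr (F _ + F _ + F _); apply/val_inj.
Qed.

Lemma eqm_qf v x b : eqm v x b -> qf v b = 2 * sqn x - 2 * dot x (b *m v).
Proof. by rewrite /eqm sqnD sqnN sqnZ dotZl dotNr /rf /qf; lia. Qed.

Lemma rf_double v i : rf v (2 *: delta_mx 0 i) = 0.
Proof. by rewrite /rf enZ en_delta -scalemxAl row_deltaM sqnZ; ring. Qed.

Lemma rf_0 v : rf v 0 = 0.
Proof.
rewrite /rf /en big1 ?mul0mx ?mulr0 ?/sqn ?dot0r //.
by move=> i _; rewrite mxE mul0r.
Qed.

(** L is a combination of the three [b k] with coefficients of sum zero. If one coefficient
    vanishes, only two of the [b k] are involved and [generic_circuit22] applies; otherwise x is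
    eliminated from the four energy relations, and the identity that is left feeds
    [circuit_claims_hold]. *)
Lemma generic_circuit23 (b : 'I_3 -> 'rV[int]_m) L : L != 0 ->
  row_free (ratmx (col_mx (b o0 - b o2) (b o1 - b o2))) ->
  (ratmx L <= ratmx (col_mx (b o0 - b o2) (b o1 - b o2)))%MS ->
  generic (fun v => forall x, eqp v x L -> (forall k, eqm v x (b k)) ->
    (forall k, 0 < rf v (b k)) -> (forall k, 0 < rf v (b k + L)) -> circuit_claims b L).
Proof.
move=> L0 fA LA; have [d d0 [e dLe]] := int_combination LA.
pose e0 := lsubmx e 0 0; pose e1 := rsubmx e 0 0.
have dL : d *: L = e0 *: (b o0 - b o2) + e1 *: (b o1 - b o2).
  rewrite dLe -[e]hsubmxK mul_row_col.
  by rewrite [lsubmx e]mx11_scalar [rsubmx e]mx11_scalar !mul_scalar_mx.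
have dL0 : d *: L != 0 by rewrite scalemx_eq0 negb_or d0.
have pair c u w : d *: L = c *: (b u - b w) ->
    generic (fun v => forall x, eqp v x L -> (forall k, eqm v x (b k)) ->
      (forall k, 0 < rf v (b k)) -> (forall k, 0 < rf v (b k + L)) -> circuit_claims b L).
  move=> E; have c0 : c != 0 by apply: contraNneq dL0 => c0; rewrite E c0 scale0r.
  have uw : b u != b w by apply: contraNneq dL0 => uw; rewrite E uw subrr scaler0.
  apply: generic_imp (generic_circuit22 p d0 c0 E uw) => v h x hL hb rb _.
  by case: (h x hL (hb u) (hb w) (rb u) (rb w)).
have [e00|e00] := eqVneq e0 0; first by apply: (pair e1 o1 o2); rewrite dL e00 scale0r add0r.
have [e10|e10] := eqVneq e1 0; first by apply: (pair e0 o0 o2); rewrite dL e10 scale0r addr0.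
have [e01|e01] := eqVneq (e0 + e1) 0.
  apply: (pair e0 o0 o1); rewrite dL; have -> : e1 = - e0 by apply: (eq_of_subr e01); ring.
  by rewrite scaleNr -scalerBr opprB addrA subrK.
pose C (k : 'I_3) : int := if k == o0 then e0 else if k == o1 then e1 else - (e0 + e1).
have C0 k : C k != 0 by rewrite /C; case: ifP => // _; case: ifP => // _; rewrite oppr_eq0.
have sC : \sum_k C k = 0 by rewrite sum_ord3 /C /= subrr.
have dLC : d *: L = \sum_k C k *: b k.
  by rewrite dL sum_ord3 /C /= !scalerBr scaleNr scalerDl opprD addrACA.
(* The coefficients have sum zero, which cancels the squares of x, and combine the [b k] to
   [d *: L], which cancels the linear terms. *)
pose f v := d * qf v L + \sum_k C k * qf v (b k).
have pf : polyfun f.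
  apply: polyfunD; first by apply: polyfunM; [exact: polyfun_cst|exact: polyfun_qf].
  by apply: polyfun_sum => k; apply: polyfunM; [exact: polyfun_cst|exact: polyfun_qf].
have real v x : eqp v x L -> (forall k, eqm v x (b k)) -> f v = 0.
  move=> hL hb; rewrite /f -hL.
  rewrite (eq_bigr (fun k => C k * (2 * sqn x) - 2 * (C k * dot x (b k *m v)))); last first.
    by move=> k _; rewrite (eqm_qf (hb k)); ring.
  rewrite sumrB -mulr_suml sC mul0r sub0r -mulr_sumr.
  have -> : \sum_k C k * dot x (b k *m v) = d * dot x (L *m v).
    rewrite -dotZr scalemxAl dLC mulmx_suml; elim/big_rec2: _ => [|k y z _ ->].
      by rewrite dot0r.
    by rewrite dotDr -scalemxAl dotZr.
  ring.
have [f0|/existsNP[v0 /eqP fv0]] := pselect (forall v, f v = 0); last first.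
  apply: generic_imp (generic_neq0 pf fv0) => v fv x hL hb.
  by rewrite (real v x) ?eqxx in fv.
apply: generic_true => v x hL hb rb rbL.
have dLi i : d * L 0 i = \sum_k C k * b k 0 i.
  have := congr1 (fun w : 'rV_m => w 0 i) dLC.
  by rewrite mxE summxE => ->; apply: eq_bigr => k _; rewrite mxE.
have I y : 2 * (d * qua L y) = d * lin L y ^+ 2 + \sum_k C k * lin (b k) y ^+ 2.
  have h : d * qua L y = \sum_k C k * qua (b k) y.
    rewrite /qua mulr_sumr (eq_bigr (fun i => \sum_k C k * b k 0 i * y i ^+ 2)); last first.
      by move=> i _; rewrite mulrA dLi mulr_suml.
    rewrite exchange_big; apply: eq_bigr => k _; rewrite mulr_sumr.
    by apply: eq_bigr => i _; rewrite mulrA.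
  have := f0 (vline p y); rewrite /f qf_vline.
  rewrite (eq_bigr (fun k => C k * qua (b k) y - C k * lin (b k) y ^+ 2)); last first.
    by move=> k _; rewrite qf_vline mulrBr.
  rewrite sumrB -h => E; apply: (eq_of_subr E); ring.
apply: (circuit_claims_hold d0 C0 sC dLC) => [q sq hq|i j|k|k].
- have q01 : row_mx (q o0)%:M (q o1)%:M = 0 :> 'rV[rat]_(1 + 1).
    apply: (row_free_inj fA); rewrite mul0mx /ratmx map_col_mx mul_row_col !mul_scalar_mx.
    apply/rowP => i; rewrite !mxE !rmorphD !rmorphN /=.
    have := hq i; have := sq; rewrite !sum_ord3 => s h.
    have q2 : q o2 = - q o0 - q o1 by apply: (eq_of_subr s); ring.
    by rewrite -[RHS]h q2; ring.
  have z0 : q o0 = 0.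
    by have := congr1 (fun w : 'rV_(1 + 1) => w 0 (lshift 1 ord0)) q01; rewrite row_mxEl !mxE eqxx.
  have z1 : q o1 = 0.
    by have := congr1 (fun w : 'rV_(1 + 1) => w 0 (rshift 1 ord0)) q01; rewrite row_mxEr !mxE eqxx.
  have z2 : q o2 = 0 by move: sq; rewrite sum_ord3 z0 z1 !add0r.
  move=> [[|[|[|//]]] hk].
  - by rewrite -[RHS]z0; congr q; apply/val_inj.
  - by rewrite -[RHS]z1; congr q; apply/val_inj.
  - by rewrite -[RHS]z2; congr q; apply/val_inj.
- have h1 l : 2 * (d * L 0 l) = d * L 0 l ^+ 2 + \sum_k C k * b k 0 l ^+ 2.
    have := I (pt1 l 1); rewrite qua_pt1 lin_pt1 expr1n !mulr1 => ->; congr (_ + _).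
    by apply: eq_bigr => k _; rewrite lin_pt1 mulr1.
  have [->|ij] := eqVneq i j.
    rewrite mulr1n -[RHS]mulrA h1; congr (_ + _); first by ring.
    by apply: eq_bigr => k _; ring.
  have := I (pt2 i j 1 1); rewrite qua_pt2 // lin_pt2 !expr1n !mulr1.
  rewrite (eq_bigr (fun k => C k * b k 0 i ^+ 2 + C k * b k 0 j ^+ 2 + 2 * (C k * b k 0 i * b k 0 j))).
    rewrite !big_split /= -mulr_sumr => E; apply: (mulfI (_ : 2 != 0 :> int)) => //; rewrite mulr0.
    apply: (eq_of_subr (congr2 (fun a b => a - b) (esym E) (congr2 +%R (esym (h1 i)) (esym (h1 j))))).
    by ring.
  by move=> k _; rewrite lin_pt2 !mulr1; ring.
- have r := rb k; split=> [bk|i bk]; rewrite bk in r.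
    by rewrite rf_0 ltxx in r.
  by rewrite rf_double ltxx in r.
- have r := rbL k; split=> [bk|i bk]; rewrite bk in r.
    by rewrite rf_0 ltxx in r.
  by rewrite rf_double ltxx in r.
Qed.

End Circuit23Generic.

(** * Configurations of points containing an even pair *)

Definition even_vec m (L : 'rV[int]_m) := forall l, (2 %| (L 0%R l))%Z.

Section Configurations.
Variables (m p : nat).
Local Notation n := p.+1.
Implicit Types (v : 'M[int]_(m, n)).

(* k distinct points; the colour c i tells whether pt i = o + pi(M i) or
   pt i = - o + pi(M i) for a common origin o. *)
Definition realized k (c : 'I_k -> bool) (M : 'I_k -> 'rV[int]_m) v (pt : 'I_k -> 'rV[int]_n) :=
  [/\ injective pt,
      forall i j, c i = c j -> eqp v (pt i) (M j - M i) /\ pt j = pt i + (M j - M i) *m v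
    & forall i j, c i != c j -> eqm v (pt i) (M i + M j) /\ pt j = - pt i + (M i + M j) *m v].

Definition even_pair k (c : 'I_k -> bool) (M : 'I_k -> 'rV[int]_m) i j :=
  even_vec (if c i == c j then M j - M i else M i + M j).
(** What the presence of an edge imposes on the labels alone. *)
Definition real_edge k (c : 'I_k -> bool) (M : 'I_k -> 'rV[int]_m) i j :=
  if c i == c j then isblack (M j - M i) else isred (M i + M j).

Lemma realized_sub k l (g : 'I_l -> 'I_k) c M v pt : injective g ->
  realized c M v pt -> realized (c \o g) (M \o g) v (pt \o g).
Proof.
move=> gi [h1 h2 h3]; split; first exact: inj_comp.
  by move=> i j cc; apply: h2.
by move=> i j cc; apply: h3.
Qed.

Lemma realized_flip k c M v (pt : 'I_k -> 'rV[int]_n) :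
  realized c M v pt -> realized (fun i => ~~ c i) M v pt.
Proof.
move=> [h1 h2 h3]; split=> // i j cc; first by apply: h2; exact: negb_inj.
by apply: h3; apply: contra cc => /eqP ->.
Qed.

(** The squared radius is the squared distance of two distinct points. *)
Lemma realized_rf k c M v (pt : 'I_k -> 'rV[int]_n) i j : realized c M v pt ->
  c i != c j -> 0 < rf v (M i + M j).
Proof.
move=> [h1 h2 h3] cc; have [e E] := h3 i j cc; rewrite -e.
have -> : 2 *: pt i - (M i + M j) *m v = pt i - pt j.
  by rewrite E scaler_nat mulr2n opprD opprK addrA.
rewrite lt_neqAle sqn_ge0 andbT eq_sym sqn_eq0 subr_eq0; apply: contra cc => /eqP /h1 ->.
by [].
Qed.

Lemma realized_neq k c M v (pt : 'I_k -> 'rV[int]_n) i j : realized c M v pt ->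
  c i = c j -> i != j -> M i != M j.
Proof.
move=> [h1 h2 _] cc; apply: contra => /eqP Mij; have [_] := h2 i j cc.
by rewrite Mij subrr mul0mx addr0 => /h1 ->.
Qed.

(** Positivity confines the labels between opposite colours to entries 0 and 1, a 2 being possible
    only in a label of radius zero. Labels within one colour are differences of these, so an even
    label vanishes, which distinct points forbid. *)
Lemma psd_even_false k (c : 'I_k -> bool) M v pt i j a b : realized c M v pt ->
  (forall s t, c s -> ~~ c t -> psd (M s + M t)) ->
  c a -> ~~ c b -> i != j -> even_pair c M i j -> False.
Proof.
move=> R hp ca cb ij; rewrite /even_pair.
have hp' s t : c s != c t -> psd (M s + M t).
  case cs: (c s); case ct: (c t) => // _; first by apply: hp; rewrite ?ct.
  by rewrite addrC; apply: hp; rewrite ?cs.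
have nd s t l : c s != c t -> M s + M t <> 2 *: delta_mx 0 l.
  by move=> cst E; have := realized_rf R cst; rewrite E rf_double ltxx.
have ent s t l : c s != c t -> 0 <= (M s + M t) 0 l <= 1.
  move=> cst; have [h1 h2 h3] := psd_entries (hp' s t cst) l.
  have : (M s + M t) 0 l <> 2 by move/h3; apply: nd.
  by move: h1 h2; move: ((M s + M t) 0 l) => z; lia.
have [cij|cij] := eqVneq (c i) (c j) => ev; last first.
  have z : M i + M j = 0.
    apply/rowP => l; rewrite [RHS]mxE; have := ent i j l cij; have := ev l.
    by move: ((M i + M j) 0 l) => z; lia.
  by have := realized_rf R cij; rewrite z rf_0 ltxx.
have [t ct] : exists t, c i != c t.
  by case ci: (c i); [exists b|exists a]; [rewrite (negbTE cb)|rewrite ca].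
have z : M j - M i = 0.
  apply/rowP => l; rewrite [RHS]mxE; have := ent i t l ct; have ctj : c j != c t by rewrite -cij.
  have := ent j t l ctj; have := ev l; rewrite !mxE.
  by move: (M i 0 l) (M j 0 l) (M t 0 l) => x y z; lia.
by have := realized_neq R cij ij; rewrite eq_sym -subr_eq0 z eqxx.
Qed.

(** The n differences within the two colour classes give n linear equations for each point of the
    colour of [a], so that [generic_psd] applies to every pair of points of opposite colours. *)
Lemma generic_config_free k (c : 'I_k -> bool) M (e : 'I_n -> 'I_k) i0 j0 a b :
  c a -> ~~ c b ->
  let U : 'M[int]_(n, m) := \matrix_s (M (e s) - M (if c (e s) then a else b)) in
  row_free (ratmx U) -> i0 != j0 -> even_pair c M i0 j0 ->
  generic (fun v => forall pt, realized c M v pt -> False).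
Proof.
move=> ca cb U fU ij ev.
(* The equations at the base points [a] and [b], transported to the point st.1; from [b], of the
   other colour, they arrive with the sign changed. *)
pose rho (st : 'I_k * 'I_k) (s : 'I_n) v : int :=
  if c (e s) then qf v (row s U) + 2 * dot ((M st.1 - M a) *m v) (row s U *m v)
  else - qf v (row s U) + 2 * dot ((M st.1 + M b) *m v) (row s U *m v).
have pdot (L L' : 'rV[int]_m) : polyfun (fun v : 'M[int]_(m, n) => dot (L *m v) (L' *m v)).
  by apply: polyfun_sum => i; apply: polyfunM; apply: polyfun_mom.
have prho st s : polyfun (rho st s).
  rewrite /rho; case: (c (e s)).
    apply: polyfunD; first exact: polyfun_qf.
    by apply: polyfunM; [exact: polyfun_cst|exact: pdot].
  apply: polyfunD; first by apply: polyfunN; exact: polyfun_qf.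
  by apply: polyfunM; [exact: polyfun_cst|exact: pdot].
have G := generic_forall (fun st : 'I_k * 'I_k => generic_psd (M st.1 + M st.2) fU (prho st)).
apply: generic_imp G => v h pt R; apply: (psd_even_false R _ ca cb ij ev) => s t cs ct.
have [_ h2 h3] := R.
have cst : c s != c t by rewrite cs (negbTE ct).
apply: (h (s, t) (pt s)); last by have [] := h3 s t cst.
move=> r; rewrite /rho /=; have rU : row r U = M (e r) - M (if c (e r) then a else b).
  by apply/rowP => l; rewrite !mxE.
case ce: (c (e r)) in rU *.
  have [E _] := h2 a (e r) (etrans ca (esym ce)); rewrite -rU /eqp in E; rewrite -E.
  have [_ ->] := h2 a s (etrans ca (esym cs)).
  by rewrite dotDl mulrDr.
have [E _] := h2 b (e r) (etrans (negbTE cb) (esym ce)); rewrite -rU /eqp in E; rewrite -E.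
have cbs : c b != c s by rewrite cs (negbTE cb).
have [_ ->] := h3 b s cbs; rewrite dotDl dotNl [M b + M s]addrC; ring.
Qed.

(** Dependent differences are excluded by [generic_plus_free]; free ones have entries in {-1, 0, 1}
    by [pair_entries], and a nonzero vector of this kind is not even. *)
Lemma generic_config_same (c : 'I_p.+3 -> bool) M i0 j0 :
  (forall i j, c i = c j) -> i0 != j0 -> even_pair c M i0 j0 ->
  generic (fun v => forall pt, realized c M v pt -> False).
Proof.
move=> cc ij; rewrite /even_pair (cc i0 j0) eqxx => ev.
have [Mi|nMi] := pselect (forall i j, i != j -> M i != M j); last first.
  apply: generic_true => v pt R; apply: nMi => i j ne.
  exact: (realized_neq R (cc i j) ne).
pose A : 'M[int]_(p.+2, m) := \matrix_s (M (lift i0 s) - M i0).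
have rA s : row s A = M (lift i0 s) - M i0 by apply/rowP => l; rewrite !mxE.
have A0 s : row s A != 0 by rewrite rA subr_eq0 Mi // eq_sym neq_lift.
have Ai s t : s != t -> row s A != row t A.
  by move=> st; rewrite !rA (inj_eq (addIr _)) Mi // (inj_eq lift_inj).
have eqA v pt : realized c M v pt -> forall s, eqp v (pt i0) (row s A).
  by move=> [_ h2 _] s; rewrite rA; have [] := h2 i0 (lift i0 s) (cc _ _).
have [fA|nf] := boolP (row_free (ratmx A)); last first.
  by apply: generic_imp (generic_plus_free p A0 Ai nf) => v h pt R; apply: (h (pt i0)); apply: eqA.
have [s1 s1E _] := unlift_some ij.
have [s2 s12] : exists s2, s1 != s2.
  pose u : 'I_p.+2 := ord0; pose w : 'I_p.+2 := lift ord0 ord0.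
  by have [e|ne] := eqVneq s1 u; [exists w; rewrite e|exists u].
have G := generic_row_pair s12 fA; apply: generic_imp G => v h pt R.
have id := h (pt i0) (eqA v pt R).
have ent := pair_entries (A0 s1) (A0 s2) (Ai _ _ s12) id.
case/negP: (A0 s1); apply/eqP/rowP => l; rewrite [RHS]mxE; apply: contrapT => /eqP nl.
have := ev l; rewrite s1E -rA; have := ent l nl.
by move: (row s1 A 0 l) (row s2 A 0 l) => x y; lia.
Qed.

Lemma generic_dependent_class k (c : 'I_k -> bool) M q (e : 'I_q -> 'I_k) a
    (A : 'M[int]_(q, m) := \matrix_s (M (e s) - M a)) :
  injective e -> (forall s, e s != a) -> (forall s, c (e s) = c a) ->
  ~~ row_free (ratmx A) ->
  generic (fun v : 'M[int]_(m, n) => forall pt, realized c M v pt -> False).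
Proof.
move=> ei ea ca nf.
have rA s : row s A = M (e s) - M a by apply/rowP => l; rewrite !mxE.
have [A0|nA0] := pselect (forall s, row s A != 0); last first.
  apply: generic_true => v pt R; apply: nA0 => s; rewrite rA subr_eq0.
  exact: (realized_neq R (ca s) (ea s)).
have [Ai|nAi] := pselect (forall s t, s != t -> row s A != row t A); last first.
  apply: generic_true => v pt R; apply: nAi => s t st; rewrite !rA (inj_eq (addIr _)).
  by apply: (realized_neq R); rewrite ?ca // (inj_eq ei).
apply: generic_imp (generic_plus_free p A0 Ai nf) => v h pt [_ h2 _].
by apply: (h (pt a)) => s; rewrite rA; have [] := h2 a (e s) (esym (ca s)).
Qed.

(** The large colour class alone supplies the n differences required by [generic_config_free]. *)
Lemma generic_config_single (c : 'I_p.+3 -> bool) M i0 j0 :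
  (forall i, c i = (i < p.+2)%N) -> i0 != j0 -> even_pair c M i0 j0 ->
  generic (fun v => forall pt, realized c M v pt -> False).
Proof.
move=> cE ij ev; pose e (s : 'I_n) : 'I_p.+3 := lift ord0 (widen_ord (leqnSn p.+1) s).
have ce s : c (e s) by rewrite cE /= /bump /= add1n ltnS ltn_ord.
have c0 : c ord0 by rewrite cE.
have cm : ~~ c ord_max by rewrite cE /= ltnn.
have eI : injective e by move=> s t /lift_inj /(congr1 val) /= /val_inj.
have e0 s : e s != ord0 by rewrite eq_sym neq_lift.
have UE : (\matrix_s (M (e s) - M (if c (e s) then ord0 else ord_max)) : 'M[int]_(n, m))
    = \matrix_s (M (e s) - M ord0).
  by apply/matrixP => s l; rewrite !mxE ce.
have [fU|nf] := boolP (row_free (ratmx (\matrix_s (M (e s) - M ord0) : 'M[int]_(n, m)))).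
  by apply: (@generic_config_free _ c M e i0 j0 ord0 ord_max) => //; rewrite UE.
by apply: (generic_dependent_class (c := c) eI e0) => // s; rewrite ce c0.
Qed.

Lemma sort_colours k (c : 'I_k -> bool) : exists t (g : 'I_k -> 'I_k),
  [/\ injective g, t = count c (enum 'I_k) & forall i, c (g i) = (i < t)%N].
Proof.
pose s1 := [seq i <- enum 'I_k | c i]; pose s2 := [seq i <- enum 'I_k | ~~ c i].
have sz : size (s1 ++ s2) = k.
  by rewrite size_cat !size_filter count_predC size_enum_ord.
have us : uniq (s1 ++ s2).
  rewrite cat_uniq; apply/and3P; split; try exact: (filter_uniq _ (enum_uniq _)).
  apply/hasPn => i.
  by rewrite !mem_filter => /andP[/negbTE ->].
exists (size s1), (fun i => nth i (s1 ++ s2) i); split.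
- move=> i j; rewrite (set_nth_default i) ?sz // => /eqP.
  by rewrite nth_uniq ?sz // => /eqP/val_inj.
- by rewrite size_filter.
move=> i; rewrite nth_cat; case: ltnP => h.
  by have := mem_nth i h; rewrite mem_filter => /andP[].
have : nth i s2 (i - size s1) \in s2.
  by apply: mem_nth; rewrite ltn_subLR // -size_cat sz.
by rewrite mem_filter => /andP[/negbTE].
Qed.

End Configurations.

Lemma circuit22_config m p k (c : 'I_k -> bool) (M : 'I_k -> 'rV[int]_m) a a' b b' (e0 e1 : int) :
  c a = c a' -> c b = c b' -> c a != c b -> b != b' -> e0 != 0 -> e1 != 0 ->
  e0 *: (M a' - M a) = e1 *: (M b' - M b) ->
  generic (fun v : 'M[int]_(m, p.+1) => forall pt, realized c M v pt -> False).
Proof.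
move=> ca cb cab bb e00 e10 E.
have [bbM|bbM] := eqVneq (M b') (M b).
  apply: generic_true => v pt R; have := realized_neq R cb bb.
  by rewrite bbM eqxx.
have uw : M a + M b' != M a + M b by rewrite (inj_eq (addrI _)).
have E' : e0 *: (M a' - M a) = e1 *: ((M a + M b') - (M a + M b)).
  by rewrite E opprD addrACA subrr add0r.
apply: generic_imp (generic_circuit22 p e00 e10 E' uw) => v h pt R.
have cab' : c a != c b' by rewrite -cb.
have [_ h2 h3] := R; apply: (h (pt a)).
- by have [] := h2 a a' ca.
- by have [] := h3 a b' cab'.
- by have [] := h3 a b cab.
- exact: (realized_rf R cab').
- exact: (realized_rf R cab).
Qed.

(* Exhaustive search over the graphs on {0, 1, 2} + {3, 4}; the edge {i, j}
   with i < j is the bit j (j - 1) / 2 + i. *)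
Definition edge_bit (b : seq bool) i j :=
  nth false b ((maxn i j * (maxn i j).-1)./2 + minn i j).

(** Combinatorial form of [circuit_claims], with 3 and 4 as the two points of the second colour. *)
Definition edge_rules (b : seq bool) :=
  let E := edge_bit b in let I := iota 0 3 in
  [&& ~~ E 3%N 4%N,
      all (fun k => all (fun l => (k != l) ==> ~~ (E 3%N k && E 3%N l) && ~~ (E 4%N k && E 4%N l)) I) I,
      all (fun j => all (fun k => all (fun l => [&& j != k, j != l, k != l, E j k & E l k]
        ==> all (fun t => ~~ E 3%N t && ~~ E 4%N t) I) I) I) I
    & all (fun j => all (fun k => (j != k) && E j k ==>
        all (fun s => all (fun t => ~~ (E 3%N s && E 4%N t)) I) I) I) I].

Definition grows (E : nat -> nat -> bool) i0 j0 k1 k2 k3 :=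
  [&& E k1 i0 || E k1 j0, [|| E k2 i0, E k2 j0 | E k2 k1]
    & [|| E k3 i0, E k3 j0, E k3 k1 | E k3 k2]].

Fixpoint all_bits n : seq (seq bool) :=
  if n is n'.+1 then [seq true :: b | b <- all_bits n'] ++ [seq false :: b | b <- all_bits n']
  else [:: [::]].

Lemma mem_all_bits b : b \in all_bits (size b).
Proof.
elim: b => [|x b IH] //=; rewrite mem_cat; apply/orP.
by case: x; [left|right]; apply/mapP; exists b.
Qed.

(** The count behind the search: growth uses three edges without a cycle. At most two of them join
    0, 1, 2. If two do, there is no red edge; if one does, only one of 3 and 4 has a red edge, and
    only one such edge; if none does, 3 and 4 have at most one each. *)
Lemma edge_rules_no_growth :
  all (fun b => if edge_rules b then let I := iota 0 5 in
    all (fun i0 => all (fun j0 => if i0 != j0 then all (fun k1 => if k1 \notin [:: i0; j0] then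
    all (fun k2 => if k2 \notin [:: i0; j0; k1] then all (fun k3 => if k3 \notin [:: i0; j0; k1; k2]
      then ~~ grows (edge_bit b) i0 j0 k1 k2 k3 else true) I else true) I else true) I else true) I) I
    else true) (all_bits 10).
Proof. by vm_compute. Qed.

Lemma no_growth b i0 j0 k1 k2 k3 : size b = 10%N -> edge_rules b ->
  all (gtn 5) [:: i0; j0; k1; k2; k3] -> uniq [:: i0; j0; k1; k2; k3] ->
  ~~ grows (edge_bit b) i0 j0 k1 k2 k3.
Proof.
move=> sb rules /and5P[h1 h2 h3 h4 /andP[h5 _]] /= /and5P[].
rewrite !inE !negb_or => /and4P[n1 n2 n3 n4] /and3P[n5 n6 n7] /andP[n8 n9] n10 _.
have io x : (x < 5)%N -> x \in iota 0 5 by rewrite mem_iota.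
have := allP edge_rules_no_growth b; rewrite -{1}sb => /(_ (mem_all_bits b)); rewrite rules.
move=> /allP/(_ _ (io _ h1))/allP/(_ _ (io _ h2)); rewrite n1 => /allP/(_ _ (io _ h3)).
rewrite !inE !negb_or !(eq_sym k1) n2 n5 => /allP/(_ _ (io _ h4)).
rewrite !inE !negb_or !(eq_sym k2) n3 n6 n8 => /allP/(_ _ (io _ h5)).
by rewrite !inE !negb_or !(eq_sym k3) n4 n7 n9 n10.
Qed.

Section SmallDimension.
Variable m : nat.

Lemma row_free_rV (L : 'rV[int]_m) : L != 0 -> row_free (ratmx L).
Proof.
move=> L0; rewrite /row_free rank_rV; have -> // : ratmx L != 0.
by apply: contra L0 => /eqP h; apply/eqP/(@ratmx_inj 1 m); rewrite h /ratmx map_mx0.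
Qed.

(** Splittings 4 + 0, 3 + 1 and 2 + 2. In the last one the two differences are free, or proportional
    and then subject to [generic_circuit22]. *)
Lemma generic_sorted2 (c : 'I_4 -> bool) (M : 'I_4 -> 'rV[int]_m) t i0 j0 :
  (forall i, c i = (i < t)%N) -> (2 <= t)%N -> i0 != j0 -> even_pair c M i0 j0 ->
  generic (fun v : 'M[int]_(m, 2) => forall pt, realized c M v pt -> False).
Proof.
move=> ct t2 ij ev.
have [t4|t4] := leqP 4 t.
  apply: (generic_config_same (p := 1) _ ij ev) => i j.
  by rewrite !ct !(leq_trans (ltn_ord _) t4).
have [t3|t3] := eqVneq t 3.
  by apply: (generic_config_single (p := 1) _ ij ev) => i; rewrite ct t3.
have {}t2 : t = 2 by lia.
pose a0 : 'I_4 := @Ordinal 4 0 isT; pose a1 : 'I_4 := @Ordinal 4 1 isT.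
pose a2 : 'I_4 := @Ordinal 4 2 isT; pose a3 : 'I_4 := @Ordinal 4 3 isT.
have [c0 c1 c2 c3] : [/\ c a0, c a1, ~~ c a2 & ~~ c a3] by rewrite !ct t2.
have [r0|r0] := eqVneq (M a1 - M a0) 0.
  apply: generic_true => v pt R; have := realized_neq R (etrans c1 (esym c0)) isT.
  by rewrite -subr_eq0 r0 eqxx.
have [r1|r1] := eqVneq (M a3 - M a2) 0.
  apply: generic_true => v pt R; have := realized_neq R (etrans (negbTE c3) (esym (negbTE c2))) isT.
  by rewrite -subr_eq0 r1 eqxx.
have f1 := row_free_rV r1.
pose e (s : 'I_2) := if s == ord0 then a1 else a3.
have [le|nle] := boolP (ratmx (M a1 - M a0) <= ratmx (M a3 - M a2))%MS.
  have [d d0 [z dz]] := int_combination le.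
  have dz' : d *: (M a1 - M a0) = z 0 0 *: (M a3 - M a2).
    by rewrite dz [z]mx11_scalar mul_scalar_mx mxE eqxx.
  have z0 : z 0 0 != 0.
    apply: contraNneq r0 => z0; move/eqP: dz'; rewrite z0 scale0r scalemx_eq0.
    by rewrite (negbTE d0).
  apply: (circuit22_config 1 (c := c) _ _ _ _ d0 z0 dz') => //.
  - by rewrite c0 c1.
  - by rewrite (negbTE c2) (negbTE c3).
  - by rewrite c0 (negbTE c2).
have := row_free_cons f1 nle; set A := col_mx _ _ => fA.
apply: (@generic_config_free m 1 4 c M e i0 j0 a0 a2) => //.
rewrite (_ : \matrix_s _ = A) //; apply/row_matrixP => s.
have -> : row s (\matrix_s0 (M (e s0) - M (if c (e s0) then a0 else a2)) : 'M[int]_(2, m)) =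
    M (e s) - M (if c (e s) then a0 else a2) by apply/rowP => l; rewrite !mxE.
case: (split_ordP (s : 'I_(1 + 1))) => k ->; rewrite ord1.
  by rewrite [RHS]rowKu row_id /e /= c1.
by rewrite [RHS]rowKd row_id /e /= (negbTE c3).
Qed.

(** Splittings 5 + 0, 4 + 1 and 3 + 2. For 3 + 2 with dependent differences the contradiction comes
    from the edges instead of the even pair, through [circuit_claims] and [no_growth]. *)
Lemma generic_sorted3 (c : 'I_5 -> bool) (M : 'I_5 -> 'rV[int]_m) t i0 j0 k1 k2 k3 :
  (forall i, c i = (i < t)%N) -> (3 <= t)%N -> i0 != j0 -> even_pair c M i0 j0 ->
  k1 \notin [:: i0; j0] -> k2 \notin [:: i0; j0; k1] -> k3 \notin [:: i0; j0; k1; k2] ->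
  (real_edge c M k1 i0 \/ real_edge c M k1 j0) ->
  [\/ real_edge c M k2 i0, real_edge c M k2 j0 | real_edge c M k2 k1] ->
  [\/ real_edge c M k3 i0, real_edge c M k3 j0, real_edge c M k3 k1 | real_edge c M k3 k2] ->
  generic (fun v : 'M[int]_(m, 3) => forall pt, realized c M v pt -> False).
Proof.
move=> ct t2 ij ev n1 n2 n3 g1 g2 g3.
have [t5|t5] := leqP 5 t.
  apply: (generic_config_same (p := 2) _ ij ev) => i j.
  by rewrite !ct !(leq_trans (ltn_ord _) t5).
have [t4|t4] := eqVneq t 4.
  by apply: (generic_config_single (p := 2) _ ij ev) => i; rewrite ct t4.
have {}t2 : t = 3 by lia.
pose a (k : nat) : 'I_5 := inord k.
have ca k : (k < 5)%N -> c (a k) = (k < 3)%N by move=> h; rewrite ct inordK // t2.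
have ai k l : (k < 5)%N -> (l < 5)%N -> (a k == a l) = (k == l).
  by move=> h h'; rewrite -val_eqE /= !inordK.
pose e2 (s : 'I_2) := a s.
pose A := \matrix_s (M (e2 s) - M (a 2)) : 'M[int]_(2, m).
have [fA|nfA] := boolP (row_free (ratmx A)); last first.
  apply: (generic_dependent_class 2 (c := c) _ _ _ nfA) => [s s' /eqP|s|s].
  - by rewrite ai ?(ltn_trans (ltn_ord _)) // => /eqP/val_inj.
  - by rewrite ai ?(ltn_trans (ltn_ord _)) // neq_ltn ltn_ord.
  - by rewrite !ca ?(ltn_trans (ltn_ord _)).
pose L := M (a 4) - M (a 3).
have [L0|L0] := eqVneq L 0.
  apply: generic_true => v pt R; have := realized_neq (i := a 4) (j := a 3) R.
  by rewrite !ca // ai // => /(_ erefl isT); rewrite -subr_eq0 -/L L0 eqxx.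
pose b (k : 'I_3) := M (a k) + M (a 3).
have AE : A = col_mx (b (@Ordinal 3 0 isT) - b (@Ordinal 3 2 isT)) (b (@Ordinal 3 1 isT) - b (@Ordinal 3 2 isT)).
  apply/row_matrixP => s; have -> : row s A = M (e2 s) - M (a 2) by apply/rowP => l; rewrite !mxE.
  have bb (k l : 'I_3) : b k - b l = M (a k) - M (a l) by rewrite /b opprD addrACA subrr addr0.
  case: (split_ordP (s : 'I_(1 + 1))) => k ->; rewrite ord1.
    by rewrite [RHS]rowKu row_id bb.
  by rewrite [RHS]rowKd row_id bb.
have [le|nle] := boolP (ratmx L <= ratmx A)%MS; last first.
  have := row_free_cons fA nle; set U := col_mx _ _ => fU.
  pose e (s : 'I_3) := if s == ord0 then a 4 else a s.-1.
  apply: (@generic_config_free m 2 5 c M e i0 j0 (a 2) (a 3)) => //; rewrite ?ca //.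
  rewrite (_ : \matrix_s _ = U) //; apply/row_matrixP => s.
  have -> : row s (\matrix_s0 (M (e s0) - M (if c (e s0) then a 2 else a 3)) : 'M[int]_(3, m)) =
    M (e s) - M (if c (e s) then a 2 else a 3) by apply/rowP => l; rewrite !mxE.
  case: (split_ordP (s : 'I_(1 + 2))) => k ->.
    by rewrite ord1 [RHS]rowKu row_id /e /= ca.
  rewrite [RHS]rowKd /e /= ca ?(leq_trans (ltn_ord k)) //.
  by apply/rowP => l; rewrite !mxE.
rewrite AE in fA le; apply: generic_imp (generic_circuit23 2 L0 fA le) => v h pt R.
have [_ R2 R3] := R.
have c3k (k : 'I_3) : c (a 3) != c (a k) by rewrite !ca ?ltn_ord // (ltn_trans (ltn_ord k)).
have c4k (k : 'I_3) : c (a 4) != c (a k) by rewrite !ca ?ltn_ord // (ltn_trans (ltn_ord k)).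
have bL k : b k + L = M (a 4) + M (a k) by rewrite /b /L [M (a 4) - _]addrC addrA addrK addrC.
have bE k : b k = M (a 3) + M (a k) by rewrite /b addrC.
have [|k|k|k|C1 C2 C3 C4] := h (pt (a 3)).
- by have [] := R2 (a 3) (a 4) (_ : c (a 3) = c (a 4)); rewrite ?ca.
- by rewrite bE; have [] := R3 (a 3) (a k) (c3k k).
- by rewrite bE; apply: (realized_rf R (c3k k)).
- by rewrite bL; apply: (realized_rf R (c4k k)).
pose E i j := `[< real_edge c M (a i) (a j) >].
have symE (x y : 'I_5) : real_edge c M x y -> real_edge c M y x.
  rewrite /real_edge [c y == _]eq_sym; case: ifP => _; last by rewrite addrC.
  move=> [i [j [ne xy]]]; exists j, i; split; first by rewrite eq_sym.
  by rewrite -opprB xy opprB.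
have EC i j : E i j = E j i by apply/asboolP/asboolP; apply: symE.
pose bits := [:: E 0 1; E 0 2; E 1 2; E 0 3; E 1 3; E 2 3; E 0 4; E 1 4; E 2 4; E 3 4].
have bitE (x y : 'I_5) : x != y -> real_edge c M x y -> edge_bit bits x y.
  move=> xy /asboolP; rewrite -[x]inord_val -[y]inord_val -/(E x y).
  rewrite /bits; case: x xy => [[|[|[|[|[|//]]]]] hx]; case: y => [[|[|[|[|[|//]]]]] hy] //= _;
  by rewrite /edge_bit /= ?inordK //= EC.
have bitP i j : (i < j)%N -> (j < 5)%N -> edge_bit bits i j = E i j.
  by case: i => [|[|[|[|//]]]]; case: j => [|[|[|[|[|//]]]]].
have bit3 j k : (j < 3)%N -> (k < 3)%N -> j != k -> edge_bit bits j k = E j k.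
  move=> j3 k3' jk; have [lt|lt|e] := ltngtP j k; last by rewrite e eqxx in jk.
    exact: bitP (ltn_trans k3' _).
  by rewrite EC -bitP ?(ltn_trans j3) // /edge_bit maxnC minnC.
have bit4 l k : (3 <= l)%N -> (l < 5)%N -> (k < 3)%N -> edge_bit bits l k = E l k.
  move=> l3 l5 k3'; rewrite EC -bitP ?(leq_trans k3' l3) //.
  by rewrite /edge_bit maxnC minnC.
have redE l (k : 'I_3) : (l == 3) || (l == 4) -> E l k -> isred (M (a l) + M (a k)).
  move=> hl /asboolP; rewrite /real_edge; case/orP: hl => /eqP ->.
    by rewrite (negbTE (c3k k)).
  by rewrite (negbTE (c4k k)).
have blackE (j k : 'I_3) : E j k -> isblack (b j - b k).
  rewrite EC => /asboolP; rewrite /real_edge !ca ?ltn_ord ?(ltn_trans (ltn_ord _)) //= => h'.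
  by rewrite /b opprD addrACA subrr addr0.
have E34 : ~ E 3%N 4%N.
  move=> /asboolP; rewrite /real_edge (ca 3%N) // (ca 4%N) //=; exact: C4.
have rules : edge_rules bits.
  apply/and4P; split.
  - by rewrite bitP //; apply/negP.
  - apply/allP => k; rewrite mem_iota => /andP[_ k3']; apply/allP => l; rewrite mem_iota => /andP[_ l3'].
    apply/implyP => kl; have [H1 H2] := C1 (Ordinal k3') (Ordinal l3') kl.
    rewrite !bit4 //.
    apply/andP; split; apply/andP => -[x y].
      by apply: H1; rewrite bE; [apply: (redE 3 (Ordinal k3'))|apply: (redE 3 (Ordinal l3'))].
    by apply: H2; rewrite bL; [apply: (redE 4 (Ordinal k3'))|apply: (redE 4 (Ordinal l3'))].
  - apply/allP => j; rewrite mem_iota => /andP[_ j3]; apply/allP => k; rewrite mem_iota => /andP[_ k3'].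
    apply/allP => l; rewrite mem_iota => /andP[_ l3']; apply/implyP => /and5P[jk jl kl].
    rewrite !bit3 // 1?eq_sym //.
    move=> e1 e3; apply/allP => s; rewrite mem_iota => /andP[_ s3].
    have [H1 H2] := C2 (Ordinal j3) (Ordinal k3') (Ordinal l3') (And3 jk jl kl)
      (blackE (Ordinal j3) (Ordinal k3') e1) (blackE (Ordinal l3') (Ordinal k3') e3) (Ordinal s3).
    rewrite !bit4 //.
    apply/andP; split; apply/negP => x.
      by apply: H1; rewrite bE; apply: (redE 3 (Ordinal s3)).
    by apply: H2; rewrite bL; apply: (redE 4 (Ordinal s3)).
  - apply/allP => j; rewrite mem_iota => /andP[_ j3]; apply/allP => k; rewrite mem_iota => /andP[_ k3'].
    apply/implyP => /andP[jk]; rewrite bit3 //.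
    move=> e1; apply/allP => s; rewrite mem_iota => /andP[_ s3].
    apply/allP => r; rewrite mem_iota => /andP[_ r3]; rewrite !bit4 //.
    apply/andP => -[x y].
    apply: (C3 (Ordinal j3) (Ordinal k3') jk (blackE (Ordinal j3) (Ordinal k3') e1) (Ordinal s3) (Ordinal r3)).
      by rewrite bE; apply: (redE 3 (Ordinal s3)).
    by rewrite bL; apply: (redE 4 (Ordinal r3)).
apply: (negP (@no_growth bits i0 j0 k1 k2 k3 erefl rules _ _)).
- by rewrite /= !ltn_ord.
- rewrite -[X in uniq X]/(map val [:: i0; j0; k1; k2; k3]) (map_inj_uniq val_inj) /=.
  move: ij n1 n2 n3; rewrite !inE !negb_or ![_ == i0]eq_sym ![_ == j0]eq_sym ![_ == k1]eq_sym ![_ == k2]eq_sym.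
  by move=> -> /andP[-> ->] /and3P[-> -> ->] /and4P[-> -> -> ->].
have {n1 n2 n3} [n1 n2 n3] : [/\ (k1 != i0) && (k1 != j0), [&& k2 != i0, k2 != j0 & k2 != k1]
   & [&& k3 != i0, k3 != j0, k3 != k1 & k3 != k2]].
  by move: n1 n2 n3; rewrite !inE !negb_or.
move: n1 n2 n3 => /andP[n10 n11] /and3P[n20 n21 n22] /and4P[n30 n31 n32 n33].
apply/and3P; split.
- by case: g1 => /bitE -> //; rewrite orbT.
- by case: g2 => /bitE -> //; rewrite ?orbT.
- by case: g3 => /bitE -> //; rewrite ?orbT.
Qed.

(** Sorting the points, after an exchange of the colours if necessary, puts a class with at least
    half of the points first. *)
Lemma generic_config2 (c : 'I_4 -> bool) (M : 'I_4 -> 'rV[int]_m) i0 j0 :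
  i0 != j0 -> even_pair c M i0 j0 ->
  generic (fun v : 'M[int]_(m, 2) => forall pt, realized c M v pt -> False).
Proof.
move=> ij ev; pose goal := generic (fun v : 'M[int]_(m, 2) => forall pt, realized c M v pt -> False).
have sorted c' t (g : 'I_4 -> 'I_4) : injective g -> (forall i, c' (g i) = (i < t)%N) -> (2 <= t)%N ->
    even_pair c' M i0 j0 -> (forall (v : 'M[int]_(m, 2)) pt, realized c M v pt -> realized c' M v pt) -> goal.
  move=> gi ct t2 ev' cc'; have gK := f_invF gi.
  have := @generic_sorted2 (c' \o g) (M \o g) t (invF gi i0) (invF gi j0) ct t2.
  rewrite /even_pair /= !gK (inj_eq (can_inj gK)) => /(_ ij ev') G.
  apply: generic_imp G => v h pt R; apply: (h (pt \o g)); apply: (realized_sub gi).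
  exact: cc'.
have [t [g [gi tE ct]]] := sort_colours c.
have [t' [g' [gi' tE' ct']]] := sort_colours (fun i => ~~ c i).
have tt : (t + t' = 4)%N by rewrite tE tE' count_predC size_enum_ord.
have [t2|t2] := leqP 2 t; first exact: (sorted c t g).
apply: (sorted (fun i => ~~ c i) t' g') => //; first by lia.
  by rewrite /even_pair (inj_eq negb_inj).
by move=> v pt; apply: realized_flip.
Qed.

Lemma generic_config3 (c : 'I_5 -> bool) (M : 'I_5 -> 'rV[int]_m) i0 j0 k1 k2 k3 :
  i0 != j0 -> even_pair c M i0 j0 ->
  k1 \notin [:: i0; j0] -> k2 \notin [:: i0; j0; k1] -> k3 \notin [:: i0; j0; k1; k2] ->
  (real_edge c M k1 i0 \/ real_edge c M k1 j0) ->
  [\/ real_edge c M k2 i0, real_edge c M k2 j0 | real_edge c M k2 k1] ->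
  [\/ real_edge c M k3 i0, real_edge c M k3 j0, real_edge c M k3 k1 | real_edge c M k3 k2] ->
  generic (fun v : 'M[int]_(m, 3) => forall pt, realized c M v pt -> False).
Proof.
move=> ij ev n1 n2 n3 g1 g2 g3.
pose goal := generic (fun v : 'M[int]_(m, 3) => forall pt, realized c M v pt -> False).
have sorted c' t (g : 'I_5 -> 'I_5) : injective g -> (forall i, c' (g i) = (i < t)%N) -> (3 <= t)%N ->
    (forall i j, (c' i == c' j) = (c i == c j)) ->
    (forall (v : 'M[int]_(m, 3)) pt, realized c M v pt -> realized c' M v pt) -> goal.
  move=> gi ct t2 e' cc'; have gK := f_invF gi; have Ki := can_inj gK.
  have nin x s : x \notin s -> invF gi x \notin map (invF gi) s by rewrite mem_map.
  have eE x y : real_edge (c' \o g) (M \o g) (invF gi x) (invF gi y) = real_edge c M x y.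
    by rewrite /real_edge /= !gK e'.
  have := @generic_sorted3 (c' \o g) (M \o g) t (invF gi i0) (invF gi j0) (invF gi k1) (invF gi k2) (invF gi k3) ct t2.
  rewrite /even_pair /= !gK (inj_eq Ki) e' !eE => /(_ ij ev (nin _ _ n1) (nin _ _ n2) (nin _ _ n3) g1 g2 g3) G.
  apply: generic_imp G => v h pt R; apply: (h (pt \o g)); apply: (realized_sub gi).
  exact: cc'.
have [t [g [gi tE ct]]] := sort_colours c.
have [t' [g' [gi' tE' ct']]] := sort_colours (fun i => ~~ c i).
have tt : (t + t' = 5)%N by rewrite tE tE' count_predC size_enum_ord.
have [t2|t2] := leqP 3 t; first exact: (sorted c t g).
apply: (sorted (fun i => ~~ c i) t' g') => //; first by lia.
  by move=> i j; rewrite (inj_eq negb_inj).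
by move=> v pt; apply: realized_flip.
Qed.

End SmallDimension.

(** * Labels along paths and well-posedness *)

Section Labels.
Variables (m n : nat) (v : 'M[int]_(m, n)).
Implicit Types (x y z : 'rV[int]_n) (L : 'rV[int]_m) (s : int).

Definition lab x s L y := y = s *: x + L *m v /\ sqn y = s * sqn x + en v L.

Definition is_sign s := s = 1 \/ s = -1.

Lemma is_signM s t : is_sign s -> is_sign t -> is_sign (s * t).
Proof. by case=> -> [] ->; [left|right|right|left]. Qed.

Lemma signK s : is_sign s -> s * s = 1.
Proof. by case=> ->. Qed.

(* Bounded labels whose mass is the one propagated by the edges of the graph. *)
Definition plab N x s L y :=
  [/\ is_sign s, mass L = 1 - s, bounded N L & lab x s L y].

Lemma massD (L1 L2 : 'rV[int]_m) : mass (L1 + L2) = mass L1 + mass L2.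
Proof. by rewrite /mass -big_split; apply: eq_bigr => i _; rewrite mxE. Qed.

Lemma massZ a (L : 'rV[int]_m) : mass (a *: L) = a * mass L.
Proof. by rewrite /mass mulr_sumr; apply: eq_bigr => i _; rewrite mxE. Qed.

Lemma massN (L : 'rV[int]_m) : mass (- L) = - mass L.
Proof. by rewrite -scaleN1r massZ mulN1r. Qed.

Lemma mass0 : mass (0 : 'rV[int]_m) = 0.
Proof. by rewrite /mass big1 // => i _; rewrite mxE. Qed.

Lemma mass_delta i : mass (delta_mx 0 i : 'rV[int]_m) = 1.
Proof.
rewrite /mass (bigD1 i) //= mxE !eqxx big1 ?addr0 // => j ji.
by rewrite mxE (negbTE ji) andbF.
Qed.

Lemma lab_refl x : lab x 1 0 x.
Proof. by rewrite /lab scale1r mul0mx addr0 mul1r /en big1 ?addr0 // => i _; rewrite mxE mul0r. Qed.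

Lemma lab_comp x s L y t L' z : lab x s L y -> lab y t L' z -> lab x (t * s) (t *: L + L') z.
Proof.
move=> [e1 e2] [e3 e4]; split.
  by rewrite e3 e1 scalerDr scalerA mulmxDl -scalemxAl addrA.
by rewrite e4 e2 enD enZ mulrDr mulrA addrA.
Qed.

Lemma lab_inv x s L y : is_sign s -> lab x s L y -> lab y s (- s *: L) x.
Proof.
move=> /signK ss [e1 e2]; split.
  by rewrite e1 scalerDr scalerA ss scale1r -scalemxAl scaleNr addrK.
by rewrite e2 mulrDr mulrA ss mul1r enZ mulNr addrK.
Qed.

Lemma lab_black i j x y : black v i j x y -> lab x 1 (delta_mx 0 j - delta_mx 0 i) y.
Proof.
move=> /and3P[_ /eqP h /eqP e]; split.
  by rewrite mulmxBl !row_deltaM -h scale1r addrC subrK.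
by rewrite enD enN !en_delta -e mul1r addrC subrK.
Qed.

Lemma lab_red i j x y : red v i j x y -> lab x (-1) (delta_mx 0 i + delta_mx 0 j) y.
Proof.
move=> /and3P[_ /eqP h /eqP e]; split.
  by rewrite mulmxDl !row_deltaM -h scaleN1r addrC addrK.
by rewrite enD !en_delta -e mulN1r addrC addrK.
Qed.

Lemma boundedD N N' L L' : bounded N L -> bounded N' L' -> bounded (N + N') (L + L').
Proof. by move=> h h' i j; rewrite mxE PoszD; apply: le_trans (ler_normD _ _) (lerD _ _). Qed.

Lemma boundedN N L : bounded N L -> bounded N (- L).
Proof. by move=> h i j; rewrite mxE normrN. Qed.

Lemma boundedS N s L : is_sign s -> bounded N L -> bounded N (s *: L).
Proof. by case=> ->; rewrite ?scale1r // scaleN1r; apply: boundedN. Qed.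

Lemma bounded_leq N N' L : (N <= N')%N -> bounded N L -> bounded N' L.
Proof. by move=> le h i j; apply: le_trans (h i j) _; rewrite lez_nat. Qed.

Lemma bounded_pair s i j : is_sign s -> i != j ->
  bounded 1 (delta_mx 0 j + s *: delta_mx 0 i : 'rV[int]_m).
Proof.
move=> ss ij r k; rewrite !mxE !ord1 eqxx /=; have [->|kj] := eqVneq k j.
  by rewrite eq_sym (negbTE ij) mulr0.
by rewrite add0r; case: ss => ->; case: (k == i).
Qed.

Lemma plab_refl x : plab 0 x 1 0 x.
Proof.
split; [by left|by rewrite mass0|by move=> i j; rewrite mxE|exact: lab_refl].
Qed.

Lemma plab_leq N N' x s L y : (N <= N')%N -> plab N x s L y -> plab N' x s L y.
Proof. by move=> le [h1 h2 h3 h4]; split=> //; apply: bounded_leq h3. Qed.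

Lemma plab_comp N N' x s L y t L' z : plab N x s L y -> plab N' y t L' z ->
  plab (N + N') x (t * s) (t *: L + L') z.
Proof.
move=> [h1 h2 h3 h4] [h1' h2' h3' h4']; split; first exact: is_signM.
- by rewrite massD massZ h2 h2'; ring.
- by apply: boundedD => //; apply: boundedS.
- exact: lab_comp h4 h4'.
Qed.

Lemma plab_black i j x y : black v i j x y -> plab 1 x 1 (delta_mx 0 j - delta_mx 0 i) y.
Proof.
move=> b; split; [by left| |by have /and3P[ij _ _] := b; rewrite -scaleN1r; apply: bounded_pair => //; right|exact: lab_black].
by rewrite massD massN !mass_delta.
Qed.

Lemma plab_red i j x y : red v i j x y -> plab 1 x (-1) (delta_mx 0 i + delta_mx 0 j) y.
Proof.
move=> b; split; [by right| | |exact: lab_red].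
  by rewrite massD !mass_delta.
have /and3P[ij _ _] := b; rewrite addrC -[X in _ + X]scale1r; apply: bounded_pair => //.
by left.
Qed.

Lemma plab_adj x y : adj v x y -> exists s L, plab 1 x s L y.
Proof.
move=> /and3P[_ _ /existsP[i /existsP[j /orP[/plab_black h|/plab_red h]]]].
  by exists 1, (delta_mx 0 j - delta_mx 0 i).
by exists (-1), (delta_mx 0 i + delta_mx 0 j).
Qed.

Lemma plab_path x p : path (adj v) x p -> exists s L, plab (size p) x s L (last x p).
Proof.
elim: p x => [|y p IH] x /=; first by exists 1, 0; apply: plab_refl.
move=> /andP[/plab_adj[s [L h]] /IH[t [L' h']]].
by exists (t * s), (t *: L + L'); apply: plab_comp h h'.
Qed.

Lemma black_sym i j x y : black v i j x y -> black v j i y x.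
Proof.
move=> /and3P[ij /eqP e1 /eqP e2]; apply/and3P; split; first by rewrite eq_sym.
  by rewrite -opprB e1 opprB.
by rewrite -opprB e2 opprB.
Qed.

Lemma red_sym i j x y : red v i j x y -> red v i j y x.
Proof. by rewrite /red [y + x]addrC [sqn y + _]addrC. Qed.

Lemma adj_sym x y : adj v x y = adj v y x.
Proof.
suff imp a b : adj v a b -> adj v b a by apply/idP/idP; apply: imp.
move=> /and3P[h1 h2 /existsP[i /existsP[j /orP[h|h]]]]; apply/and3P; split=> //.
  by apply/existsP; exists j; apply/existsP; exists i; rewrite /marked black_sym.
by apply/existsP; exists i; apply/existsP; exists j; rewrite /marked red_sym ?orbT.
Qed.

Lemma marked_adj i j x y : ~~ insites v x -> ~~ insites v y -> marked v i j x y -> adj v x y.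
Proof.
by move=> h1 h2 h; apply/and3P; split=> //; apply/existsP; exists i; apply/existsP; exists j.
Qed.

Lemma same_comp_refl x : same_comp v x x.
Proof. by exists [::]. Qed.

Lemma same_comp_trans x y z : same_comp v x y -> same_comp v y z -> same_comp v x z.
Proof.
move=> [p h e] [q h' e']; exists (p ++ q); first by rewrite cat_path h e.
by rewrite last_cat e.
Qed.

Lemma same_comp_adj x y : adj v x y -> same_comp v x y.
Proof. by move=> h; exists [:: y]; rewrite //= h. Qed.

Lemma same_comp_sym x y : same_comp v x y -> same_comp v y x.
Proof.
move=> [p h <-]; exists (rev (belast x p)); last by case: p {h} => //= a p; rewrite rev_cons last_rcons.
by rewrite rev_path; apply: sub_path h => a b; rewrite adj_sym.
Qed.

Lemma same_comp_insites x y : same_comp v x y -> ~~ insites v x -> ~~ insites v y.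
Proof.
move=> [p h <-] hx; elim: p x h hx => //= a p IH x /andP[/and3P[_ ha _] h] _.
exact: IH.
Qed.

Definition short_path x y N := exists p, [/\ path (adj v) x p, last x p = y & (size p <= N)%N].

Definition neighbours x : seq 'rV[int]_n :=
  [seq y <- [seq x + row ij.2 v - row ij.1 v | ij <- enum {: 'I_m * 'I_m}] ++
            [seq row ij.1 v + row ij.2 v - x | ij <- enum {: 'I_m * 'I_m}] | adj v x y].

Lemma mem_neighbours x y : (y \in neighbours x) = adj v x y.
Proof.
rewrite mem_filter andb_idr // => /and3P[_ _ /existsP[i /existsP[j /orP[|]]]] /and3P[_ /eqP e _].
  rewrite mem_cat; apply/orP; left; apply/mapP; exists (i, j); first by rewrite mem_enum.
  by rewrite /= -addrA -e addrC subrK.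
rewrite mem_cat; apply/orP; right; apply/mapP; exists (i, j); first by rewrite mem_enum.
by rewrite /= -e addrK.
Qed.

Lemma short_paths_finite x N : exists e : seq 'rV[int]_n, forall y, y \in e <-> short_path x y N.
Proof.
elim: N => [|N [s IH]].
  exists [:: x] => y; rewrite inE; split=> [/eqP ->|]; first by exists [::].
  by move=> [[|z p] [_ /= <-]].
exists (s ++ flatten [seq neighbours z | z <- s]) => y; split.
  rewrite mem_cat => /orP[/IH[p [h1 h2 h3]]|]; first by exists p; split=> //; apply: leqW.
  move=> /flatten_mapP[z /IH[p [h1 h2 h3]]]; rewrite mem_neighbours => a.
  by exists (rcons p y); rewrite rcons_path last_rcons size_rcons h1 h2.
move=> [p]; case/lastP: p => [|p z] [h1 h2 h3].
  by rewrite mem_cat; apply/orP; left; apply/IH; exists [::].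
move: h1 h2 h3; rewrite rcons_path last_rcons size_rcons ltnS => /andP[h1 a] <- h3.
rewrite mem_cat; apply/orP; right; apply/flatten_mapP; exists (last x p); last by rewrite mem_neighbours.
by apply/IH; exists p.
Qed.

Lemma comp_enum_exists N x :
  (forall p, path (adj v) x p -> uniq (x :: p) -> (size p <= N)%N) -> exists e, comp_enum v x e.
Proof.
move=> bd; have [e h] := short_paths_finite x N; exists (undup e).
split=> [|y]; first exact: undup_uniq.
rewrite mem_undup; split=> [/h[p [h1 h2 h3]]|[p]]; first by exists p.
move=> hp; case/shortenP: hp => p' h1 h2 _ <-; apply/h; exists p'; split=> //; exact: bd.
Qed.

End Labels.

Section LabelGeometry.
Variables (m n : nat) (v : 'M[int]_(m, n)).
Implicit Types (x y z : 'rV[int]_n) (L : 'rV[int]_m).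

(** Referred to [y] instead of the common origin, vertices of equal sign give hyperplanes and, in
    the next lemma, vertices of opposite signs give spheres. *)
Lemma lab_eqp x s L y L' y' : lab v x s L y -> lab v x s L' y' ->
  eqp v y (L' - L) /\ y' = y + (L' - L) *m v.
Proof.
move=> [e1 e2] [e3 e4]; have e5 : y' = y + (L' - L) *m v.
  by rewrite mulmxBl e1 e3 -addrA [_ *m v + _]addrC subrK.
split=> //; have := sqnD y ((L' - L) *m v); rewrite -e5 e4 e2.
rewrite /eqp /qf enD enN => h; apply/esym; apply: (eq_of_subr h); ring.
Qed.

Lemma lab_eqm x s L y L' y' : lab v x s L y -> lab v x (- s) L' y' ->
  eqm v y (L + L') /\ y' = - y + (L + L') *m v.
Proof.
move=> [e1 e2] [e3 e4]; have e5 : y' = - y + (L + L') *m v.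
  by rewrite mulmxDl e1 e3 opprD scaleNr addrA subrK.
split=> //; rewrite /eqm.
have -> : 2 *: y - (L + L') *m v = y - y'.
  by rewrite e5 opprD opprK addrA -mulr2n scaler_nat.
have := sqnD y y'; rewrite {1}e5 addrA subrr add0r => h.
have := sqnD y (- y'); rewrite sqnN dotNr e4 e2 => ->.
rewrite /rf enD h e4 e2; ring.
Qed.

End LabelGeometry.

Section WellPosed.
Variables (m p : nat).
Local Notation n := p.+1.

(** The three facts yield, in this order, uniqueness of the label for a given sign, uniqueness of
    the sign, and the bound on simple paths. *)
Definition good_labels N (v : 'M[int]_(m, n)) :=
  [/\ forall L : 'rV[int]_m, bounded N L -> L != 0 -> L *m v != 0,
      forall L, bounded N L -> rf v L = 0 -> L = 0 \/ exists i, L = 2 *: delta_mx 0 i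
    & forall A : 'M[int]_(n.+1, m), bounded N A ->
        (forall s, row s A != 0) -> (forall s t, s != t -> row s A != row t A) ->
        (forall s, \sum_i row s A 0 i = 0) ->
        forall x, (forall s, eqp v x (row s A)) -> insites v x].

Lemma generic_implies (C : Prop) (G : 'M[int]_(m, n) -> Prop) :
  (C -> generic G) -> generic (fun v => C -> G v).
Proof.
move=> h; have [c|nc] := pselect C; last by apply: generic_true.
by apply: generic_imp (h c) => v g _.
Qed.

Lemma generic_good_labels N : generic (good_labels N).
Proof.
have h1 : generic (fun v : 'M[int]_(m, n) =>
    forall L : 'rV_m, bounded N L -> L != 0 -> L *m v != 0).
  by apply: generic_bounded => L; apply: generic_implies; apply: generic_mom_neq0.
have h2 : generic (fun v : 'M[int]_(m, n) => forall L : 'rV_m, bounded N L ->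
    rf v L = 0 -> L = 0 \/ exists i, L = 2 *: delta_mx 0 i).
  by apply: generic_bounded => L; apply: generic_rf_eq0.
have h3 : generic (fun v : 'M[int]_(m, n) => forall A : 'M[int]_(n.+1, m), bounded N A ->
    (forall s, row s A != 0) -> (forall s t, s != t -> row s A != row t A) ->
    (forall s, \sum_i row s A 0 i = 0) ->
    forall x, (forall s, eqp v x (row s A)) -> insites v x).
  apply: generic_bounded => A; do 3!apply: generic_implies => ?.
  exact: generic_overdetermined_plus.
by apply: generic_imp (generic_and h1 (generic_and h2 h3)) => v [? [? ?]].
Qed.

Variables (N : nat) (v : 'M[int]_(m, n)).
Hypothesis good : good_labels N v.
Implicit Types (x y z : 'rV[int]_n) (L : 'rV[int]_m).

(** For equal signs the difference of the labels has zero momentum. For opposite signs it has, up to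
    sign, momentum 2 x and radius zero: it is 0, against the masses 0 and 2, or 2 e_i, which makes x
    a site. *)
Lemma plab_unique K x s L y s' L' : (K + K <= N)%N -> ~~ insites v x ->
  plab v K x s L y -> plab v K x s' L' y -> s = s' /\ L = L'.
Proof.
move=> KN xS [h1 h2 h3 h4] [h1' h2' h3' h4']; have [g1 g2 _] := good.
have bd : bounded N (L' - L).
  by apply: bounded_leq KN _; apply: boundedD => //; apply: boundedN.
have [e|ne] := eqVneq s s'.
  split=> //; apply/eqP; rewrite eq_sym -subr_eq0; apply/negPn/negP => /(g1 _ bd)/eqP; apply.
  by rewrite mulmxBl; apply/eqP; rewrite subr_eq0; apply/eqP/(addrI (s *: x)); rewrite -h4.1 {1}e -h4'.1.
have {ne h1'} e' : s' = - s by case: h1 h1' ne => -> [] ->.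
have bd' : bounded N (s *: (L' - L)) by apply: boundedS.
have ex : 2 *: x = (s *: (L' - L)) *m v.
  rewrite -scalemxAl mulmxBl.
  have -> : L' *m v = y + s *: x by rewrite h4'.1 e' scaleNr addrAC addNr add0r.
  have -> : L *m v = y - s *: x by rewrite h4.1 addrAC subrr add0r.
  by rewrite opprB [y + _]addrC addrACA subrr addr0 scalerDr scalerA (signK h1) scale1r -mulr2n scaler_nat.
have rf0 : rf v (s *: (L' - L)) = 0.
  rewrite /rf -ex sqnZ enZ enD enN.
  have -> : en v L' = sqn y + s * sqn x by rewrite h4'.2 e' mulNr addrAC addNr add0r.
  have -> : en v L = sqn y - s * sqn x by rewrite h4.2 addrAC subrr add0r.
  have ss := signK h1; transitivity (4 * (s * s) * sqn x - 4 * sqn x); first by ring.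
  by rewrite ss mulr1 subrr.
have [e0|[i e0]] := g2 _ bd' rf0.
  have := massZ s (L' - L); rewrite e0 mass0 massD massN h2 h2' e'.
  by case: h1 => ->.
case/negP: xS; apply/existsP; exists i; apply/eqP.
have e2 : 2 *: x = 2 *: row i v by rewrite ex e0 -scalemxAl row_deltaM.
by apply/rowP => l; move/rowP/(_ l): e2; rewrite !mxE; apply: mulfI.
Qed.

(** A longer path has 2 n + 3 initial vertices, of which n + 2 carry the same sign; relative to one
    of them the others give n + 1 labels. *)
Definition diameter := (2 * n + 2)%N.

(** On a simple path vertices of equal sign have distinct labels, of equal mass. Relative to one of
    n + 2 such vertices they overdetermine it, so it would be a site, whereas the vertices of a path
    starting off the sites are not sites. *)
Lemma uniq_path_size x q : (2 * diameter <= N)%N -> ~~ insites v x ->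
  path (adj v) x q -> uniq (x :: q) -> (size q <= diameter)%N.
Proof.
move=> dN xS hq uq; rewrite leqNgt; apply/negP => lt.
pose z (t : 'I_diameter.+1) := nth x (x :: q) t.
have sz (t : 'I_diameter.+1) : (t < size (x :: q))%N by apply: leq_trans (ltn_ord t) (leqW lt).
have zi : injective z.
  by move=> s t /eqP; rewrite /z nth_uniq // => /eqP/val_inj.
have [sL hsL] : exists sL : 'I_diameter.+1 -> int * 'rV[int]_m,
    forall t, plab v diameter x (sL t).1 (sL t).2 (z t).
  apply: (@fin_all_exists _ _ (fun t sL => plab v diameter x sL.1 sL.2 (z t))) => t.
  have hp : path (adj v) x (take t q) by move: hq; rewrite -{1}(cat_take_drop t q) cat_path => /andP[].
  have [s [L h]] := plab_path hp; exists (s, L).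
  have -> : z t = last x (take t q).
    rewrite /z (last_nth x) size_take; have := sz t; rewrite /= ltnS.
    rewrite leq_eqVlt => /predU1P[->|tq]; first by rewrite ltnn take_size.
    by rewrite tq; case: (nat_of_ord t) tq => //= k kq; rewrite nth_take.
  by apply: plab_leq h; rewrite size_take_min geq_min -ltnS ltn_ord.
have [C [s [cC hC]]] : exists (C : {set 'I_diameter.+1}) s, (n.+2 <= #|C|)%N /\
    forall t, t \in C -> (sL t).1 = s.
  pose T : {set 'I_diameter.+1} := [set t | (sL t).1 == 1]%SET; have [le|gt] := leqP n.+2 #|T|.
    by exists T, 1; split=> // t; rewrite inE => /eqP.
  exists (~: T)%SET, (-1); split.
    by rewrite -(leq_add2l #|T|) cardsC card_ord /diameter; move: gt; move: #|T| => *; lia.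
  by move=> t; rewrite !inE; have [[->|-> //] _ _ _] := hsL t; rewrite eqxx.
pose f (i : 'I_n.+2) := enum_val (widen_ord cC i).
have fi : injective f by move=> i j /enum_val_inj /(congr1 val) /= /val_inj.
have fC i : (sL (f i)).1 = s by apply/hC/enum_valP.
pose A := \matrix_(i < n.+1) ((sL (f (lift ord0 i))).2 - (sL (f ord0)).2).
have rA i : row i A = (sL (f (lift ord0 i))).2 - (sL (f ord0)).2.
  by apply/rowP => j; rewrite !mxE.
have hl i : lab v x s (sL (f i)).2 (z (f i)) by rewrite -(fC i); have [] := hsL (f i).
have Li : injective (fun i => (sL (f i)).2).
  by move=> i j /= e; apply/fi/zi; rewrite (hl i).1 (hl j).1 e.
have [_ _ g3] := good; have : insites v (z (f ord0)).
  apply: (g3 A) => [i j|i|i j ij|i|i].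
  - have -> : A i j = row i A 0 j by rewrite [RHS]mxE.
    rewrite rA; apply: (@bounded_leq _ (diameter + diameter)); first by rewrite addnn -mul2n.
    by apply: boundedD; first have [] := hsL (f (lift ord0 i)); last by apply: boundedN; have [] := hsL (f ord0).
  - by rewrite rA subr_eq0; apply/negP => /eqP/Li/eqP; rewrite eq_sym (negbTE (neq_lift _ _)).
  - rewrite !rA; apply: contra ij => /eqP/addIr/Li/lift_inj ->; exact: eqxx.
  - rewrite -/(mass _) rA massD massN.
    by have [_ -> _ _] := hsL (f (lift ord0 i)); have [_ -> _ _] := hsL (f ord0); rewrite !fC subrr.
  - by rewrite rA; have [] := lab_eqp (hl ord0) (hl (lift ord0 i)).
apply/negP; apply: same_comp_insites xS.
have := sz (f ord0); rewrite /z; case: (nat_of_ord _) => [_|k kq] /=; first exact: same_comp_refl.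
exists (take k.+1 q); first by move: hq; rewrite -{1}(cat_take_drop k.+1 q) cat_path => /andP[].
by rewrite (last_nth x) size_takel //= nth_take.
Qed.

(** Vertex labels have size [diameter], and consistency of the rules compares labels that are longer
    by one edge; [plab_unique] needs twice this size, whence the [+ 2]. *)
Lemma good_well_posed : (2 * diameter + 2 <= N)%N -> well_posed v.
Proof.
move=> dN; have dN' : (2 * diameter <= N)%N by apply: leq_trans dN; rewrite leq_addr.
split.
- move=> k kS; apply: (@comp_enum_exists _ _ _ diameter) => q; exact: uniq_path_size.
- move=> i j i' j' a b aS bS h h'.
  (* Both kinds of edges are written e_j - s e_i, so that one uniqueness statement determines the
     pair {i, j}. *)
  have lab1 i1 j1 : marked v i1 j1 a b -> exists s, is_sign s /\
      plab v 1 a s (delta_mx 0 j1 - s *: delta_mx 0 i1) b.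
    move=> /orP[/plab_black|/plab_red]; first by exists 1; split; [left|rewrite scale1r].
    by exists (-1); split; [right|rewrite scaleN1r opprK addrC].
  have ne i1 j1 : marked v i1 j1 a b -> i1 != j1 by case/orP => /and3P[].
  have [s [ss p1]] := lab1 _ _ h; have [s' [_ p2]] := lab1 _ _ h'.
  have [|e e'] := plab_unique _ aS p1 p2; first by apply: leq_trans dN; lia.
  move: e' (ne _ _ h) (ne _ _ h'); rewrite -{}e => e'; clear h h' p1 p2 lab1 ne.
  have E l : (l == j)%:R - s * (l == i)%:R = (l == j')%:R - s * (l == i')%:R :> int.
    by have := congr1 (fun M : 'rV[int]_m => M 0 l) e'; rewrite !mxE !eqxx.
  move=> ij ij'; have sub (i1 j1 i2 j2 : 'I_m) : i1 != j1 -> i2 != j2 ->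
      (forall l, (l == j1)%:R - s * (l == i1)%:R = (l == j2)%:R - s * (l == i2)%:R :> int) ->
      [set i1; j1]%SET \subset [set i2; j2]%SET.
    move=> n1 n2 EE; apply/fintype.subsetP => l; rewrite !inE => hl.
    move: (EE l); case: (eqVneq l i2) => //= li2; case: (eqVneq l j2) => //= lj2.
    by case/orP: hl => /eqP ->; rewrite eqxx ?(negbTE n1) ?[_ == i1]eq_sym ?(negbTE n1); case: ss => ->.
  by apply/eqP; rewrite finset.eqEsubset !sub.
- move=> x hx.
  have ex k : exists sL : int * 'rV[int]_m,
      ~~ insites v k -> plab v diameter (x k) sL.1 sL.2 k.
    have [kS|kS] := boolP (insites v k); first by exists (0, 0).
    have [c _] := hx k kS; have xS := same_comp_insites c kS.
    have [q hq lq] := same_comp_sym c; case/shortenP: hq lq => q' h1 h2 _ lq.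
    have [s [L h]] := plab_path h1; exists (s, L) => _.
    by rewrite lq in h; apply: plab_leq h; apply: uniq_path_size h1 h2.
  have [sL hsL] := choice ex.
  exists (fun k => (sL k).1), (fun k => (sL k).2).
  have xS k : ~~ insites v k -> ~~ insites v (x k).
    by move=> kS; have [c _] := hx k kS; apply: same_comp_insites c kS.
  have xadj a b : ~~ insites v a -> ~~ insites v b -> adj v a b -> x b = x a.
    by move=> aS bS ab; have [_ ->] := hx a aS => //; apply: same_comp_adj.
  split=> [k kS|i j a b aS bS h|i j a b aS bS h].
  + have [c e] := hx k kS; have xx := e _ c.
    have := hsL _ (xS k kS); rewrite xx => p1.
    by apply: (plab_unique _ (xS k kS) p1 (plab_leq _ (plab_refl v (x k)))) => //; rewrite addnn -mul2n.
  + have xba := xadj a b aS bS (marked_adj aS bS (introT orP (or_introl h))).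
    have p1 := plab_comp (hsL a aS) (plab_black h); have p2 := hsL b bS; rewrite xba in p2.
    have [|-> ->] := plab_unique _ (xS a aS) (plab_leq (leq_addr 1 _) p2) p1.
      by apply: leq_trans dN; lia.
    by rewrite mul1r scale1r addrA.
  + have xba := xadj a b aS bS (marked_adj aS bS (introT orP (or_intror h))).
    have p1 := plab_comp (hsL a aS) (plab_red h); have p2 := hsL b bS; rewrite xba in p2.
    have [|-> ->] := plab_unique _ (xS a aS) (plab_leq (leq_addr 1 _) p2) p1.
      by apply: leq_trans dN; lia.
    by rewrite mulN1r scaleN1r addrC.
Qed.

End WellPosed.

(** * Resultants, polynomial form of the matrices, reduction modulo 2 *)

Section Resultants.

(** For monic polynomials the degrees, and with them the shape of the Sylvester matrix, survive the
    morphism. *)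
Lemma rmorph_resultant (K K' : nzRingType) (f : {rmorphism K -> K'}) (p q : {poly K}) :
  p \is monic -> q \is monic ->
  f (resultant p q) = resultant (map_poly f p) (map_poly f q).
Proof.
move=> /monicP pm /monicP qm.
have sz (r : {poly K}) : lead_coef r = 1 -> size (map_poly f r) = size r.
  by move=> rm; rewrite size_map_poly_id0 // rm rmorph1 oner_neq0.
rewrite /resultant /Sylvester_mx !sz // -det_map_mx /= map_col_mx.
by congr (\det (col_mx _ _)); apply: map_lin1_mx => u;
  rewrite map_poly_rV rmorphM /= map_rVpoly.
Qed.

Lemma resultant_roots (K : idomainType) (I : Type) (r : seq I) (a : I -> K) (q : {poly K}) :
  q \is monic ->
  (resultant (\prod_(i <- r) ('X - (a i)%:P)) q == 0) = has (fun i => root q (a i)) r.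
Proof.
move=> qm; rewrite resultant_eq0; set p := \prod_(i <- r) _.
have : (size (gcdp p q) > 1)%N = ~~ coprimep p q.
  have : gcdp p q != 0 by rewrite gcdp_eq0 (negbTE (monic_neq0 qm)) andbF.
  by rewrite -size_poly_gt0 /coprimep; case: size => [|[]].
move=> ->; rewrite coprimep_sym /p; elim: r {p} => [|i r IH]; first by rewrite big_nil coprimep1.
by rewrite big_cons coprimepMr negb_and IH coprimep_XsubC negbK.
Qed.

Lemma resultant_common_root (K : closedFieldType) (p q : {poly K}) : p \is monic ->
  resultant p q = 0 -> exists2 z, root p z & root q z.
Proof.
move=> pm /eqP; rewrite resultant_eq0 => sz.
have /closed_rootP[z] : size (gcdp p q) != 1%N by rewrite neq_ltn sz orbT.
by rewrite root_gcd => /andP[]; exists z.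
Qed.

(** Diagonal conjugation stated without inverses, so that it is available over polynomial rings. *)
Lemma char_poly_conj (K : idomainType) k (d : 'rV[K]_k) (A B : 'M[K]_k) :
  (forall i, d 0 i != 0) -> (forall i j, d 0 i * A i j = B i j * d 0 j) ->
  char_poly A = char_poly B.
Proof.
move=> d0 dAB; pose D := map_mx polyC (diag_mx d).
have D0 : \det D != 0.
  rewrite det_map_mx det_diag polyC_eq0; apply/prodf_neq0 => i _; exact: d0.
apply: (mulfI D0); rewrite [RHS]mulrC -!det_mulmx; congr (\det _).
rewrite /char_poly_mx mulmxBr mulmxBl scalar_mxC; congr (_ - _).
rewrite -!map_mxM; congr (map_mx _ _); apply/matrixP => i j.
by rewrite mul_diag_mx mul_mx_diag !mxE dAB.
Qed.

Lemma char_poly_diagonal (K : comNzRingType) k (A : 'M[K]_k) :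
  (forall i j, i != j -> A i j = 0) -> char_poly A = \prod_i ('X - (A i i)%:P).
Proof.
move=> A0; rewrite char_poly_trig //; apply/is_trig_mxP => i j ij; apply: A0.
by rewrite neq_ltn ij.
Qed.

End Resultants.

Section ComponentMatrices.
Variables (m n : nat) (v : 'M[int]_(m, n)).
Variables (sg : 'rV[int]_n -> int) (L : 'rV[int]_n -> 'rV[int]_m).
Implicit Types (a b : 'rV[int]_n) (s : seq 'rV[int]_n).

Definition mark a b := [pick ij : 'I_m * 'I_m | marked v ij.1 ij.2 a b].

Definition lform (K : pzRingType) (xi : 'rV[K]_m) (M : 'rV[int]_m) : K :=
  \sum_q xi 0 q * (M 0 q)%:~R.

(** [Centry] after the substitution xi = y^2, which turns square roots into products and makes sense
    over every ring. *)
Definition sentry (K : pzRingType) (y : 'rV[K]_m) a b : K :=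
  if a == b then (sg a)%:~R * lform (map_mx (fun t => t ^+ 2) y) (L a)
  else if mark a b is Some ij then 2 * (sg b)%:~R * (y 0 ij.1 * y 0 ij.2) else 0.

(* The matrix of sentry conjugated so that its entries are polynomials in the
   squares of the entries of y. *)
Definition gentry (K : pzRingType) (xi : 'rV[K]_m) a b : K :=
  if a == b then (sg a)%:~R * lform xi (L a)
  else if mark a b is Some ij then
    2 * (sg b)%:~R *
      (if black v ij.1 ij.2 a b then xi 0 (if sg a == 1 then ij.2 else ij.1)
       else if sg a == 1 then 1 else xi 0 ij.1 * xi 0 ij.2)
  else 0.

Definition smx (K : pzRingType) (y : 'rV[K]_m) s : 'M[K]_(size s) :=
  \matrix_(p, q) sentry y (nth 0 s p) (nth 0 s q).
Definition gmx (K : pzRingType) (xi : 'rV[K]_m) s : 'M[K]_(size s) :=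
  \matrix_(p, q) gentry xi (nth 0 s p) (nth 0 s q).

Lemma map_lform (K K' : pzRingType) (f : {rmorphism K -> K'}) (xi : 'rV[K]_m) M :
  f (lform xi M) = lform (map_mx f xi) M.
Proof.
by rewrite /lform rmorph_sum; apply: eq_bigr => q _; rewrite rmorphM rmorph_int mxE.
Qed.

Lemma map_gmx (K K' : pzRingType) (f : {rmorphism K -> K'}) (xi : 'rV[K]_m) s :
  map_mx f (gmx xi s) = gmx (map_mx f xi) s.
Proof.
apply/matrixP => p q; rewrite !mxE /gentry; case: ifP => _.
  by rewrite rmorphM rmorph_int map_lform.
case: mark => [ij|]; last exact: rmorph0.
rewrite !rmorphM rmorph_int rmorph_nat /=; congr (_ * _).
by case: ifP => _; first rewrite mxE; case: ifP => _; rewrite ?rmorph1 ?rmorphM ?mxE.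
Qed.

Lemma map_smx (K K' : pzRingType) (f : {rmorphism K -> K'}) (y : 'rV[K]_m) s :
  map_mx f (smx y s) = smx (map_mx f y) s.
Proof.
apply/matrixP => p q; rewrite !mxE /sentry; case: ifP => _.
  rewrite rmorphM rmorph_int map_lform; congr (_ * lform _ _).
  by apply/rowP => l; rewrite !mxE rmorphXn.
case: mark => [ij|]; last exact: rmorph0.
by rewrite !rmorphM rmorph_int rmorph_nat !mxE.
Qed.

Lemma markP a b ij : mark a b = Some ij -> marked v ij.1 ij.2 a b.
Proof. by rewrite /mark; case: pickP => // x h [<-]. Qed.

Definition edge_labels s :=
  [/\ forall a, a \in s -> is_sign (sg a),
      forall i j a b, a \in s -> b \in s -> black v i j a b ->
        sg b = sg a /\ L b = L a + delta_mx 0 j - delta_mx 0 i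
    & forall i j a b, a \in s -> b \in s -> red v i j a b ->
        sg b = - sg a /\ L b = delta_mx 0 i + delta_mx 0 j - L a].

Definition monomial (K : comPzRingType) (y : 'rV[K]_m) (e : 'I_m -> nat) :=
  \prod_q y 0 q ^+ e q.

Lemma monomial_addD (K : comPzRingType) (y : 'rV[K]_m) e e' :
  monomial y (fun q => e q + e' q)%N = monomial y e * monomial y e'.
Proof. by rewrite /monomial -big_split; apply: eq_bigr => q _; rewrite exprD. Qed.

Lemma monomial1 (K : comPzRingType) (y : 'rV[K]_m) i :
  monomial y (fun q => (q == i : nat)) = y 0 i.
Proof.
rewrite /monomial (bigD1 i) //= eqxx expr1 big1 ?mulr1 // => q /negbTE ->; exact: expr0.
Qed.

(** The conjugating matrix is diagonal with entries y^(sg(a) L(a)); all exponents are shifted by the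
    constant [B], which makes them natural numbers and does not affect the conjugation. *)
Lemma char_gmx_neq0 (K : idomainType) (y : 'rV[K]_m) s : edge_labels s ->
  (forall q, y 0 q != 0) ->
  char_poly (gmx (map_mx (fun t => t ^+ 2) y) s) = char_poly (smx y s).
Proof.
move=> [hs hb hr] y0.
pose B := (\sum_(a <- s) \sum_q `|L a 0%R q|)%N.
have LB a q : a \in s -> `|L a 0 q| <= B%:Z.
  move=> as_; rewrite -abszE lez_nat /B (big_rem a as_) /=.
  apply: leq_trans (leq_addr _ _); rewrite (bigD1 q) //=; exact: leq_addr.
pose e a q := `|(B%:Z + sg a * L a 0 q)%R|%N.
have eE a q : a \in s -> (e a q)%:Z = B%:Z + sg a * L a 0 q.
  move=> as_; rewrite /e abszE ger0_norm //; have := LB _ q as_; rewrite ler_norml => /andP[].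
  by case: (hs _ as_) => -> l1 l2; lia.
have mon_eq e1 e2 : (forall q, (e1 q)%:Z = (e2 q)%:Z) -> monomial y e1 = monomial y e2.
  by move=> h; apply: eq_bigr => q _; have /eqP := h q; rewrite eqz_nat => /eqP ->.
have ind (i q : 'I_m) : ((q == i)%:R : int) = (q == i : nat)%:Z by case: (q == i).
apply: (@char_poly_conj _ _ (\row_p monomial y (e (nth 0 s p)))) => [p|p q].
  by rewrite mxE; apply/prodf_neq0 => q _; rewrite expf_neq0.
rewrite !mxE; have := mem_nth 0 (ltn_ord p); have := mem_nth 0 (ltn_ord q).
move: (nth 0 s p) (nth 0 s q) => a b bs as_; rewrite /gentry /sentry.
case: ifP => [/eqP ->|_]; first by rewrite mulrC.
case E : (mark a b) => [ij|]; last by rewrite mulr0 mul0r.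
set i := ij.1; set j := ij.2; rewrite mulrCA -!mulrA; congr (_ * (_ * _)); rewrite mulrA.
have := markP E; rewrite /marked -/i -/j; case: ifP => [bl _|nb /= rd].
  have [sb Lb] := hb _ _ _ _ as_ bs bl; case: (hs _ as_) => sa; rewrite sa /= mxE.
    rewrite mulrC expr2 -!mulrA [RHS]mulrCA; congr (_ * _).
    rewrite -(monomial1 y i) -(monomial1 y j) -!monomial_addD; apply: mon_eq => r.
    by rewrite !PoszD !eE // sb sa Lb !mxE /= -!ind; ring.
  rewrite mulrC expr2 -!mulrA; congr (_ * _).
  rewrite -(monomial1 y i) -(monomial1 y j) -!monomial_addD; apply: mon_eq => r.
  by rewrite !PoszD !eE // sb sa Lb !mxE /= -!ind; ring.
have [sb Lb] := hr _ _ _ _ as_ bs rd; case: (hs _ as_) => sa; rewrite sa /= ?mxE.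
  rewrite mulr1 -(monomial1 y i) -(monomial1 y j) -!monomial_addD; apply: mon_eq => r.
  by rewrite !PoszD !eE // sb sa Lb !mxE /= -!ind; ring.
rewrite -exprMn mulrC expr2 -!mulrA; congr (_ * (_ * _)).
rewrite -(monomial1 y i) -(monomial1 y j) -!monomial_addD; apply: mon_eq => r.
by rewrite !PoszD !eE // sb sa Lb !mxE /= -!ind; ring.
Qed.

(* Zero entries of y are first replaced by an indeterminate. *)
Lemma char_gmx (K : fieldType) (y : 'rV[K]_m) s : edge_labels s ->
  char_poly (gmx (map_mx (fun t => t ^+ 2) y) s) = char_poly (smx y s).
Proof.
move=> hs; pose Y : 'rV[{poly K}]_m := \row_q (if y 0 q == 0 then 'X else (y 0 q)%:P).
have Y0 q : Y 0 q != 0 by rewrite mxE; case: ifP => [_|/negbT]; rewrite ?polyX_eq0 ?polyC_eq0.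
have YE : map_mx (horner_eval 0) Y = y.
  apply/rowP => q; rewrite !mxE; case: ifP => [/eqP ->|_]; first by rewrite horner_evalE hornerX.
  by rewrite horner_evalE hornerC.
pose f : {rmorphism {poly K} -> K} := horner_eval 0.
have Eg (Z : 'rV[{poly K}]_m) : map_poly f (char_poly (gmx Z s)) = char_poly (gmx (map_mx f Z) s) :=
  etrans (map_char_poly f _) (congr1 _ (map_gmx f Z s)).
have Es (Z : 'rV[{poly K}]_m) : map_poly f (char_poly (smx Z s)) = char_poly (smx (map_mx f Z) s) :=
  etrans (map_char_poly f _) (congr1 _ (map_smx f Z s)).
have e := congr1 (map_poly f) (char_gmx_neq0 hs Y0).
have {e} := etrans (esym (Eg _)) (etrans e (Es Y)); rewrite [map_mx f Y]YE => <-.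
by congr (char_poly (gmx _ s)); apply/rowP => q; rewrite -YE !mxE rmorphXn.
Qed.

End ComponentMatrices.

Section CharPoly.

Lemma char_poly_horner (K : comNzRingType) k (A : 'M[K]_k) z :
  (char_poly A).[z] = \det (z%:M - A).
Proof.
rewrite /char_poly -horner_evalE -det_map_mx; congr (\det _); apply/matrixP => i j.
by rewrite !mxE rmorphB rmorphMn /= !horner_evalE hornerX hornerC.
Qed.

Lemma sign_neq0 (K : nzRingType) (s : int) : is_sign s -> (s%:~R : K) != 0.
Proof. by case=> ->; rewrite ?mulrNz ?oppr_eq0 oner_neq0. Qed.

Lemma root_char_affine (K : idomainType) k (A : 'M[K]_k) c (s : int) z : is_sign s ->
  root (char_poly (c%:M - s%:~R *: A)) z = root (char_poly A) (s%:~R * (c - z)).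
Proof.
move=> ss; rewrite !rootE !char_poly_horner.
have -> : z%:M - (c%:M - s%:~R *: A) = (- s%:~R) *: ((s%:~R * (c - z))%:M - A).
  rewrite scalerBr scale_scalar_mx mulrA mulNr -rmorphM /= (signK ss) mulN1r opprB.
  by rewrite scaleNr opprK opprB addrA raddfB /= addrAC.
by rewrite detZ mulf_eq0 expf_eq0 oppr_eq0 (negbTE (sign_neq0 _ ss)) andbF.
Qed.

(** Substitution of 2 X + c for X, after which a power of 2 is cancelled. *)
Lemma char_poly_shift_scale (K : fieldType) (T : Type) (s : seq T) (A : 'M[K]_(size s))
    (c : K) (o : T -> K) : (2 : K) != 0 ->
  char_poly (c%:M + 2 *: A) = \prod_(h <- s) ('X - (o h)%:P) ->
  char_poly A = \prod_(h <- s) ('X - ((o h - c) / 2)%:P).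
Proof.
move=> K2 /(congr1 (comp_poly (2 *: 'X + c%:P))) E.
have P2 : (2%:P : {poly K}) ^+ size s != 0 by rewrite expf_neq0 ?polyC_eq0.
apply: (mulfI P2); transitivity (char_poly (c%:M + 2 *: A) \Po (2 *: 'X + c%:P)).
  rewrite -detZ /char_poly -det_map_mx; congr (\det _); apply/matrixP => i j.
  rewrite !mxE /= comp_polyB comp_polyC.
  rewrite [(_ + 2 * _)%:P]polyCD polyCM polyCMn -mul_polyC.
  by case: (i == j); rewrite ?mulr1n ?mulr0n ?comp_polyX ?comp_poly0; ring.
rewrite E rmorph_prod /=.
have -> : (2%:P : {poly K}) ^+ size s = \prod_(h <- s) 2%:P by rewrite big_const_seq count_predT iter_mulr_1.
rewrite -big_split; apply: eq_bigr => h _ /=.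
rewrite comp_polyB comp_polyX comp_polyC mulrBr -polyCM mulrCA divff // mulr1 polyCB mul_polyC.
ring.
Qed.

End CharPoly.

Section ResonanceForms.
Variables (m n : nat) (v : 'M[int]_(m, n)).
Variables (sg : 'rV[int]_n -> int) (L : 'rV[int]_n -> 'rV[int]_m).
Implicit Types (a b : 'rV[int]_n) (s : seq 'rV[int]_n) (nu : 'rV[int]_m).
Local Notation gmx := (gmx v sg L).
Local Notation smx := (smx v sg L).

(** Since (omega, nu) = en(nu) - 2 (xi, nu) + 4 mass(nu) sum(xi) and M' is affine in C, solving a
    resonance for the eigenvalues of C gives this form minus a constant, with [eta] equal to
    mass(nu) + 1 for (M2) and to mass(nu) + 1 + sigma for (M3). *)
Definition tform (K : pzRingType) (xi : 'rV[K]_m) nu (eta : int) : K :=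
  lform xi nu - 2 * eta%:~R * \sum_q xi 0 q.

(* Its zeros are the resonances (M2) of the component s. *)
Definition res2 (K : comNzRingType) nu eta s (kappa : K) (xi : 'rV[K]_m) : K :=
  (char_poly (gmx xi s)).[tform xi nu eta - kappa].

(* Its zeros are the resonances (M3) of the components s and s'. *)
Definition res3 (K : comNzRingType) (sigma : int) nu eta s s' (kappa : K) (xi : 'rV[K]_m) : K :=
  resultant (char_poly (gmx xi s))
    (char_poly ((tform xi nu eta - kappa)%:M - sigma%:~R *: gmx xi s')).

(* A discriminant; unlike the derivative, the second argument is monic. *)
Definition disc (K : comNzRingType) s (xi : 'rV[K]_m) : K :=
  resultant (char_poly (gmx xi s)) (char_poly (gmx xi s) + (char_poly (gmx xi s))^`()).

Lemma monic_add_deriv (K : nzRingType) (p : {poly K}) : p \is monic -> p + p^`() \is monic.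
Proof.
by move=> pm; rewrite monicE lead_coefDl -?monicE // lt_size_deriv // monic_neq0.
Qed.

Lemma map_tform (K K' : pzRingType) (f : {rmorphism K -> K'}) (xi : 'rV[K]_m) nu eta :
  f (tform xi nu eta) = tform (map_mx f xi) nu eta.
Proof.
rewrite rmorphB map_lform !rmorphM rmorph_nat rmorph_int rmorph_sum; congr (_ - _ * _).
by apply: eq_bigr => q _; rewrite mxE.
Qed.

Lemma map_res2 (K K' : comNzRingType) (f : {rmorphism K -> K'}) nu eta s kappa (xi : 'rV[K]_m) :
  f (res2 nu eta s kappa xi) = res2 nu eta s (f kappa) (map_mx f xi).
Proof. by rewrite /res2 -horner_map /= map_char_poly map_gmx rmorphB map_tform. Qed.

Lemma map_res3 (K K' : comNzRingType) (f : {rmorphism K -> K'}) sigma nu eta s s' kappa (xi : 'rV[K]_m) :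
  f (res3 sigma nu eta s s' kappa xi) = res3 sigma nu eta s s' (f kappa) (map_mx f xi).
Proof.
rewrite /res3 rmorph_resultant ?char_poly_monic // !map_char_poly map_gmx.
congr (resultant _ (char_poly _)); rewrite map_mxB map_scalar_mx map_mxZ rmorph_int map_gmx.
by rewrite rmorphB map_tform.
Qed.

Lemma map_disc (K K' : comNzRingType) (f : {rmorphism K -> K'}) s (xi : 'rV[K]_m) :
  f (disc s xi) = disc s (map_mx f xi).
Proof.
rewrite /disc rmorph_resultant ?monic_add_deriv ?char_poly_monic //.
by rewrite rmorphD /= -deriv_map !map_char_poly map_gmx.
Qed.

Section Mod2.
Variable R : numDomainType.

(** Vanishing passes from real to integer points, then to Z[X], where a nonzero element has a
    nonzero value, and finally modulo 2. Powers of one indeterminate suffice as coordinates since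
    they are linearly independent over F_2. *)
Lemma mod2_transfer (G : forall K : comNzRingType, 'rV[K]_m -> K) :
  (forall (K K' : comNzRingType) (f : {rmorphism K -> K'}) xi, f (G K xi) = G K' (map_mx f xi)) ->
  (forall xi : 'rV[R]_m, G R xi = 0) -> G {poly 'F_2} (\row_(q < m) 'X^q) = 0.
Proof.
move=> nat G0; pose X (K : comNzRingType) : 'rV[{poly K}]_m := \row_(q < m) 'X^q.
have Gint (xi : 'rV[int]_m) : G int xi = 0.
  by apply/eqP; rewrite -(intr_eq0 R) (nat int R intr) G0.
have G1 : G {poly int} (X int) = 0.
  apply/eqP/negPn/negP => /(poly_large_nonroot 0)[t _]; rewrite -horner_evalE.
  by rewrite (nat {poly int} int (horner_eval t)) Gint eqxx.
have := congr1 (map_poly (intr : int -> 'F_2)) G1; rewrite rmorph0.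
rewrite (nat {poly int} {poly 'F_2} (map_poly intr)); congr (G _ _ = 0).
by apply/rowP => q; rewrite !mxE; apply: map_polyXn.
Qed.

Local Notation X2 := (\row_(q < m) 'X^q : 'rV[{poly 'F_2}]_m).

Lemma two_eq0 : (2 : {poly 'F_2}) = 0.
Proof. by rewrite -polyC_natr (_ : 2 = 0 :> 'F_2) //; apply/eqP. Qed.

Lemma opp_F2 (x : {poly 'F_2}) : - x = x.
Proof. by apply/eqP; rewrite eq_sym -addr_eq0 -mulr2n -mulr_natl two_eq0 mul0r. Qed.

Lemma sign_F2 (e : int) : is_sign e -> (e%:~R : {poly 'F_2}) = 1.
Proof. by case=> -> //; rewrite mulrNz opp_F2. Qed.

Lemma lformD (K : pzRingType) (xi : 'rV[K]_m) M M' : lform xi (M + M') = lform xi M + lform xi M'.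
Proof. by rewrite -big_split; apply: eq_bigr => q _; rewrite mxE rmorphD mulrDr. Qed.

Lemma lform_F2 M : lform X2 M = 0 -> even_vec M.
Proof.
move=> h l; have /(congr1 (fun p : {poly 'F_2} => p`_l)) := h.
rewrite coef_sum (bigD1 l) //= big1 => [|q ql].
  rewrite addr0 coef0 mxE -(rmorph_int (@polyC _)) coefMC coefXn eqxx mul1r => /eqP.
  by rewrite -(dvdz_pcharf (pchar_Fp (isT : prime 2))).
by rewrite mxE -(rmorph_int (@polyC _)) coefMC coefXn eq_sym val_eqE (negbTE ql) mul0r.
Qed.

Lemma lform_sign_F2 (e : int) M : is_sign e -> e%:~R * lform X2 M = lform X2 M.
Proof. by move/sign_F2 ->; rewrite mul1r. Qed.

Lemma lform_add_F2 M M' : lform X2 M = lform X2 M' -> even_vec (M + M').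
Proof. by move=> e; apply: lform_F2; rewrite lformD e -[X in _ + X]opp_F2 subrr. Qed.

Lemma gmx_F2 s (i : 'I_(size s)) : (forall a, a \in s -> is_sign (sg a)) ->
  gmx X2 s i i = lform X2 (L (nth 0 s i)).
Proof. by move=> hs; rewrite mxE /gentry eqxx lform_sign_F2 //; apply/hs/mem_nth. Qed.

Lemma gmx_diag_F2 s (i j : 'I_(size s)) : uniq s -> i != j -> gmx X2 s i j = 0.
Proof.
move=> us ij; rewrite mxE /gentry nth_uniq // val_eqE (negbTE ij).
by case: (mark _ _ _) => // ij'; rewrite two_eq0 !mul0r.
Qed.

Lemma tform_F2 nu eta : tform X2 nu eta = lform X2 nu.
Proof. by rewrite /tform two_eq0 !mul0r subr0. Qed.

Lemma char_gmx_F2 s : uniq s -> (forall a, a \in s -> is_sign (sg a)) ->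
  char_poly (gmx X2 s) = \prod_(a <- s) ('X - (lform X2 (L a))%:P).
Proof.
move=> us hs; rewrite char_poly_diagonal => [|i j]; last exact: gmx_diag_F2.
by rewrite [RHS](big_nth 0) big_mkord; apply: eq_bigr => i _; rewrite gmx_F2.
Qed.

Lemma root_prodX (K : idomainType) (T : eqType) (r : seq T) (a : T -> K) z :
  root (\prod_(i <- r) ('X - (a i)%:P)) z -> exists2 i, i \in r & z = a i.
Proof.
rewrite rootE horner_prod => h; have /hasP[i ir] : has (fun i => ('X - (a i)%:P).[z] == 0) r.
  elim: r h => [|j r IH]; first by rewrite big_nil oner_eq0.
  by rewrite big_cons mulf_eq0 /= => /orP[->//|/IH ->]; rewrite orbT.
by rewrite hornerXsubC subr_eq0 => /eqP ->; exists i.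
Qed.

Lemma res2_nonzero nu eta s : uniq s -> (forall a, a \in s -> is_sign (sg a)) ->
  (forall xi : 'rV[R]_m, res2 nu eta s 0 xi = 0) -> exists2 a, a \in s & even_vec (nu + L a).
Proof.
move=> us hs h0.
have := @mod2_transfer (fun K xi => res2 nu eta s 0 xi) _ h0; rewrite /res2 => /(_ _)/eqP.
rewrite subr0 tform_F2 char_gmx_F2 // => /(_ _)/root_prodX[].
  by move=> K K' f xi; rewrite map_res2 rmorph0.
by move=> a as_ /lform_add_F2; exists a.
Qed.

Lemma res3_nonzero sigma nu eta s s' : is_sign sigma -> uniq s -> uniq s' ->
  (forall a, a \in s -> is_sign (sg a)) -> (forall a, a \in s' -> is_sign (sg a)) ->
  (forall xi : 'rV[R]_m, res3 sigma nu eta s s' 0 xi = 0) ->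
  exists a b, [/\ a \in s, b \in s' & even_vec (nu + L a + L b)].
Proof.
move=> ss us us' hs hs' h0.
have := @mod2_transfer (fun K xi => res3 sigma nu eta s s' 0 xi) _ h0; rewrite /res3 => /(_ _)/eqP.
rewrite subr0 tform_F2 char_gmx_F2 // resultant_roots ?char_poly_monic // => /(_ _)/hasP[].
  by move=> K K' f xi; rewrite map_res3 rmorph0.
move=> a as_; rewrite root_char_affine // char_gmx_F2 // sign_F2 // mul1r => /root_prodX[b bs e].
exists a, b; split=> //; apply: lform_add_F2; rewrite lformD -e.
by rewrite -[X in _ = _ + X]opp_F2 opprK.
Qed.

(** At a root of the product only P' survives in P + P', as the product of the other factors. *)
Lemma disc_nonzero s : uniq s -> (forall a, a \in s -> is_sign (sg a)) ->
  (forall xi : 'rV[R]_m, disc s xi = 0) ->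
  exists a b, [/\ a \in s, b \in s, a != b & even_vec (L a + L b)].
Proof.
move=> us hs h0.
have := @mod2_transfer (fun K xi => disc s xi) _ h0; rewrite /disc => /(_ _)/eqP.
rewrite char_gmx_F2 // resultant_roots; last by apply/monic_add_deriv/monic_prod_XsubC.
move=> /(_ _)/hasP[]; first by move=> K K' f xi; rewrite map_disc.
move=> a as_; rewrite (big_rem a as_) /=.
rewrite rootE derivM derivXsubC mul1r !hornerD !hornerM hornerXsubC subrr !mul0r add0r addr0 => /root_prodX[b bs e].
exists a, b; split; rewrite ?(mem_rem bs) //; last exact: lform_add_F2.
by apply: contraTneq bs => ->; rewrite mem_rem_uniqF.
Qed.

End Mod2.

End ResonanceForms.

(** * Resonances as zeros of polynomials in xi *)

Section RealSpectrum.
Variables (R : realType) (m n : nat) (v : 'M[int]_(m, n)).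
Variables (x : 'rV[int]_n -> 'rV[int]_n).
Variables (sg : 'rV[int]_n -> int) (L : 'rV[int]_n -> 'rV[int]_m).
Implicit Types (xi : 'rV[R]_m) (s : seq 'rV[int]_n) (nu : 'rV[int]_m).
Local Notation gmx := (gmx v sg L).
Local Notation smx := (smx v sg L).

Local Notation "z %:C" := (real_complex R z).

Lemma dot_toreal xi nu : dot xi (toreal R nu) = lform xi nu.
Proof. by apply: eq_bigr => q _; rewrite mxE. Qed.

Lemma Cmx_smx xi s : (forall i, 0 < xi 0 i) ->
  Cmx v sg L xi s = smx (map_mx Num.sqrt xi) s.
Proof.
move=> xi0; apply/matrixP => p q; rewrite !mxE /Centry /sentry; case: ifP => _.
  rewrite dot_toreal; congr (_ * lform _ _); apply/rowP => i.
  by rewrite !mxE sqr_sqrtr // ltW.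
by rewrite -/(mark v _ _); case: mark => // ij; rewrite !mxE sqrtrM // ltW.
Qed.

Lemma char_Cmx xi s : edge_labels v sg L s -> (forall i, 0 < xi 0 i) ->
  char_poly (Cmx v sg L xi s) = char_poly (gmx xi s).
Proof.
move=> hs xi0; rewrite Cmx_smx // -char_gmx //; congr (char_poly (gmx _ s)).
by apply/rowP => i; rewrite !mxE sqr_sqrtr // ltW.
Qed.

(** The eigenvalue of C_A that corresponds to [Om h] under the affine relation between M' and C. *)
Definition evC (Om : 'rV[int]_n -> R[i]) xi h : R[i] :=
  (Om h - ((sqn (x h))%:~R + 4 * \sum_j xi 0 j)%:C) / 2.

Lemma char_gmx_evC Om xi k s : eigen_labelling v x sg L xi Om -> ~~ insites v k ->
  comp_enum v k s -> edge_labels v sg L s -> (forall i, 0 < xi 0 i) ->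
  {in s, forall h, x h = x k} ->
  map_poly (real_complex R) (char_poly (gmx xi s)) = \prod_(h <- s) ('X - (evC Om xi h)%:P).
Proof.
move=> hO kS ks hs xi0 xk; rewrite -char_Cmx // map_char_poly.
transitivity (\prod_(h <- s)
   ('X - ((Om h - ((sqn (x k))%:~R + 4 * \sum_j xi 0 j)%:C) / 2)%:P)).
  apply: char_poly_shift_scale; first by rewrite pnatr_eq0.
  rewrite -(hO _ _ kS ks) /Mmx map_mxD map_scalar_mx map_mxZ /=.
  by rewrite rmorph_nat.
by apply: eq_big_seq => h hs'; rewrite /evC xk.
Qed.

Lemma dot_omega xi nu : dot (omega v xi) (toreal R nu) =
  (en v nu)%:~R - 2 * lform xi nu + 4 * (mass nu)%:~R * \sum_q xi 0 q.
Proof.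
set S := \sum_q xi 0 q.
transitivity (\sum_q (((nu 0 q * sqn (row q v))%:~R : R) - 2 * (xi 0 q * (nu 0 q)%:~R)
    + (nu 0 q)%:~R * (4 * S))).
  by apply: eq_bigr => q _; rewrite !mxE -/S rmorphM /=; ring.
rewrite !big_split sumrN -mulr_sumr -mulr_suml -!rmorph_sum /= -/(lform xi nu) -/(mass nu) -/(en v nu).
by ring.
Qed.

Lemma resM2_evC Om xi nu k :
  (dot (omega v xi) (toreal R nu))%:C + Om k = 0 <->
  evC Om xi k = (tform xi nu (mass nu + 1) - (en v nu + sqn (x k))%:~R / 2)%:C.
Proof.
rewrite dot_omega /evC /tform; set S := \sum_q _; set l := lform _ _.
move: (en v nu) (sqn (x k)) (mass nu) (Om k) => e q mu o; split=> [h|h].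
  have -> : o = - ((e%:~R - 2 * l + 4 * mu%:~R * S)%:C) by apply/eqP; rewrite -addr_eq0 addrC h.
  rewrite !(rmorphD, rmorphB, rmorphN, rmorphM, rmorph_nat, rmorph_int, fmorphV) /=.
  by field.
have -> : o = 2 * ((o - (q%:~R + 4 * S)%:C) / 2) + (q%:~R + 4 * S)%:C by field.
rewrite h; by rewrite !(rmorphD, rmorphB, rmorphN, rmorphM, rmorph_nat, rmorph_int, fmorphV) /=; field.
Qed.

Lemma resM3_evC Om xi sigma nu h k :
  (dot (omega v xi) (toreal R nu))%:C + Om k + sigma%:~R * Om h = 0 <->
  evC Om xi k + sigma%:~R * evC Om xi h =
    (tform xi nu (mass nu + 1 + sigma) - (en v nu + sqn (x k) + sigma * sqn (x h))%:~R / 2)%:C.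
Proof.
rewrite dot_omega /evC /tform; set S := \sum_q _; set l := lform _ _.
move: (en v nu) (sqn (x k)) (sqn (x h)) (mass nu) (Om k) (Om h) => e q q' mu o o'; split=> [E|E].
  have -> : o = - ((e%:~R - 2 * l + 4 * mu%:~R * S)%:C) - sigma%:~R * o'.
    by apply/eqP; rewrite eq_sym subr_eq eq_sym -addr_eq0 addrC addrA E.
  rewrite !(rmorphD, rmorphB, rmorphN, rmorphM, rmorph_nat, rmorph_int, fmorphV) /=.
  by field.
have -> : o = 2 * ((o - (q%:~R + 4 * S)%:C) / 2 + sigma%:~R * ((o' - (q'%:~R + 4 * S)%:C) / 2))
   - sigma%:~R * (o' - (q'%:~R + 4 * S)%:C) + (q%:~R + 4 * S)%:C by field.
rewrite E; by rewrite !(rmorphD, rmorphB, rmorphN, rmorphM, rmorph_nat, rmorph_int, fmorphV) /=; field.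
Qed.

Lemma res2_zero (mu : 'rV[int]_n -> R[i]) xi nu eta (kappa : R) s :
  map_poly (real_complex R) (char_poly (gmx xi s)) = \prod_(h <- s) ('X - (mu h)%:P) ->
  (exists2 k, k \in s & mu k = (tform xi nu eta - kappa)%:C) <-> res2 v sg L nu eta s kappa xi = 0.
Proof.
move=> E; rewrite /res2; split=> [[k ks e]|].
  apply/eqP; rewrite -(fmorph_eq0 (real_complex R)) -horner_map E /= -e.
  by rewrite (big_rem k ks) /= hornerM hornerXsubC subrr mul0r.
move/eqP; rewrite -(fmorph_eq0 (real_complex R)) -horner_map E => /root_prodX[k ks e].
by exists k.
Qed.

Lemma res3_zero (mu : 'rV[int]_n -> R[i]) xi sigma nu eta (kappa : R) s s' : is_sign sigma ->
  map_poly (real_complex R) (char_poly (gmx xi s)) = \prod_(h <- s) ('X - (mu h)%:P) ->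
  map_poly (real_complex R) (char_poly (gmx xi s')) = \prod_(h <- s') ('X - (mu h)%:P) ->
  (exists h k, [/\ h \in s', k \in s & mu k + sigma%:~R * mu h = (tform xi nu eta - kappa)%:C])
  <-> res3 v sg L sigma nu eta s s' kappa xi = 0.
Proof.
move=> ss E E'; have -> : (res3 v sg L sigma nu eta s s' kappa xi = 0) = (has (fun k =>
    root (\prod_(h <- s') ('X - (mu h)%:P)) (sigma%:~R * ((tform xi nu eta - kappa)%:C - mu k))) s : Prop).
  transitivity (is_true (res3 v sg L sigma nu eta s s' kappa xi == 0)).
    by apply/propext; split=> /eqP.
  rewrite -(fmorph_eq0 (real_complex R)) /res3 rmorph_resultant ?char_poly_monic //.
  rewrite [X in resultant X _]E map_char_poly resultant_roots ?char_poly_monic //.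
  congr (is_true _); apply: eq_has => k.
  rewrite map_mxB map_scalar_mx map_mxZ rmorph_int root_char_affine //.
  by rewrite -map_char_poly E'.
split=> [[h [k [hs ks e]]]|/hasP[k ks /root_prodX[h hs e]]].
  apply/hasP; exists k => //; rewrite -e addrAC subrr add0r mulrA -rmorphM /= (signK ss) mul1r.
  by rewrite (big_rem h hs) /= rootM root_XsubC eqxx.
exists h, k; split=> //; rewrite -e mulrA -rmorphM /= (signK ss) mul1r.
by rewrite addrC subrK.
Qed.

Lemma disc_zero (mu : 'rV[int]_n -> R[i]) xi s : uniq s ->
  map_poly (real_complex R) (char_poly (gmx xi s)) = \prod_(h <- s) ('X - (mu h)%:P) ->
  (exists h k, [/\ h \in s, k \in s, h <> k & mu k = mu h]) <-> disc v sg L s xi = 0.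
Proof.
move=> us E; have rootd k : k \in s ->
    root (\prod_(h <- s) ('X - (mu h)%:P) + (\prod_(h <- s) ('X - (mu h)%:P))^`()) (mu k) =
    root (\prod_(h <- rem k s) ('X - (mu h)%:P)) (mu k).
  move=> ks; rewrite (big_rem k ks) /= !rootE derivM derivXsubC mul1r !hornerD !hornerM.
  by rewrite hornerXsubC subrr !mul0r add0r addr0.
have -> : (disc v sg L s xi = 0) = (has (fun k =>
    root (\prod_(h <- rem k s) ('X - (mu h)%:P)) (mu k)) s : Prop).
  transitivity (is_true (disc v sg L s xi == 0)); first by apply/propext; split=> /eqP.
  rewrite -(fmorph_eq0 (real_complex R)) /disc.
  rewrite rmorph_resultant ?monic_add_deriv ?char_poly_monic // rmorphD /= -deriv_map E.
  rewrite resultant_roots ?monic_add_deriv ?monic_prod_XsubC //.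
  by congr (is_true _); apply: eq_in_has => k /rootd.
split=> [[h [k [hs ks hk e]]]|/hasP[k ks /root_prodX[h hs e]]].
  apply/hasP; exists k => //; have hr : h \in rem k s by rewrite mem_rem_uniq // inE hs andbT; apply/eqP.
  by rewrite (big_rem h hr) /= e rootM root_XsubC eqxx.
exists h, k; split=> //; first exact: mem_rem hs.
by move=> hk; move: hs; rewrite hk mem_rem_uniqF.
Qed.

Definition polyX : 'rV[mpoly m R]_m := \row_i mpolyX R (mnm1 i).

Lemma map_polyX xi : map_mx (meval (xi 0)) polyX = xi.
Proof. by apply/rowP => i; rewrite !mxE mevalXU. Qed.

(** [G] is a formula available over every ring that receives the real constants; read at the
    indeterminates, it is itself the polynomial whose zeros are studied. *)
Lemma natural_zeros_null (G : forall K : comNzRingType, (R -> K) -> 'rV[K]_m -> K) :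
  (0 < m)%N ->
  (forall xi, meval (xi 0) (G (mpoly m R) (@mpolyC m R) polyX) = G R id xi) ->
  (exists xi, G R id xi != 0) -> null_set [set xi | G R id xi = 0].
Proof.
move=> m0 nat [xi0 G0]; apply: (null_set_sub (F := [set xi : 'rV[R]_m |
    meval (xi 0) (G (mpoly m R) (@mpolyC m R) polyX) = 0])).
  by move=> xi /=; rewrite nat.
by apply: null_zeros => //; apply: contra G0 => /eqP e; rewrite -nat e meval0.
Qed.

Lemma natural_zeros_algebraic (G : forall K : comNzRingType, (R -> K) -> 'rV[K]_m -> K)
    (D E : set 'rV[R]_m) :
  (forall xi, meval (xi 0) (G (mpoly m R) (@mpolyC m R) polyX) = G R id xi) ->
  (forall xi, D xi -> (E xi <-> G R id xi = 0)) -> algebraic_in D (D `&` E).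
Proof.
move=> nat h; exists [:: G (mpoly m R) (@mpolyC m R) polyX].
apply/seteqP; split=> xi [Dxi].
  by move=> /(h _ Dxi) e; split=> //= P; rewrite inE => /eqP ->; rewrite nat.
by move=> /(_ _ (mem_head _ _)); rewrite nat => e; split=> //; apply/(h _ Dxi).
Qed.

End RealSpectrum.

Lemma dvdz2_sub (a b : int) : (2 %| a + b)%Z -> (2 %| b - a)%Z.
Proof.
by move=> h; rewrite (_ : b - a = a + b - 2 * a); [rewrite rpredB // dvdz_mulr|ring].
Qed.

(** * Geometry of the components for generic sites *)

Section ConfigBound.
Variables (m p : nat).
Local Notation n := p.+1.
Local Notation o5 k := (@Ordinal 5 k isT).

(** Each of the last three points is joined to an earlier one, as happens when an even pair is
    enlarged inside its components. Five points serve both dimensions, the first four being enough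
    for n = 2. *)
Definition no_even_config N (v : 'M[int]_(m, n)) :=
  forall (c : 'I_5 -> bool) (M : 'I_5 -> 'rV[int]_m), (forall i, bounded N (M i)) ->
    even_pair c M (o5 0) (o5 1) ->
    (exists2 l : 'I_5, (l < 2)%N & real_edge c M (o5 2) l) ->
    (exists2 l : 'I_5, (l < 3)%N & real_edge c M (o5 3) l) ->
    (exists2 l : 'I_5, (l < 4)%N & real_edge c M (o5 4) l) ->
    forall pt, ~ realized c M v pt.

Lemma generic_no_even_config N : p = 1%N \/ p = 2%N -> generic (no_even_config N).
Proof.
move=> hp; pose G (c : {ffun 'I_5 -> bool}) (A : 'M[int]_(5, m)) (v : 'M[int]_(m, n)) :=
  let M i := row i A in even_pair c M (o5 0) (o5 1) ->
    (exists2 l : 'I_5, (l < 2)%N & real_edge c M (o5 2) l) ->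
    (exists2 l : 'I_5, (l < 3)%N & real_edge c M (o5 3) l) ->
    (exists2 l : 'I_5, (l < 4)%N & real_edge c M (o5 4) l) ->
    forall pt, ~ realized c M v pt.
suff H : generic (fun v => forall A : 'M[int]_(5, m), bounded N A -> forall c, G c A v).
  apply: generic_imp H => v H c M bM.
  have -> : c = [ffun i => c i] :> (_ -> _) by apply/funext => i; rewrite ffunE.
  have -> : M = (fun i => row i (\matrix_i M i)) by apply/funext => i; rewrite rowK.
  apply: (H (\matrix_i M i)) => i j; have := bM i ord0 j; by rewrite !mxE.
apply: generic_bounded => A; apply: generic_forall => c; rewrite /G.
apply: generic_implies => ev; apply: generic_implies => g1.
apply: generic_implies => g2; apply: generic_implies => g3; case: hp => hp.
  subst p; pose g (i : 'I_4) : 'I_5 := widen_ord (isT : 4 <= 5)%N i.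
  have gi : injective g by move=> i j /(congr1 val) /= /val_inj.
  have ge0 : g (@Ordinal 4 0 isT) = o5 0 by apply: val_inj.
  have ge1 : g (@Ordinal 4 1 isT) = o5 1 by apply: val_inj.
  have := @generic_config2 m (c \o g) ((fun i => row i A) \o g) (@Ordinal 4 0 isT) (@Ordinal 4 1 isT) isT.
  rewrite /even_pair /= ge0 ge1 => /(_ ev) H'.
  by apply: generic_imp H' => v h pt r; apply: (h (pt \o g)); apply: realized_sub.
subst p.
have E k h h' : @Ordinal 5 k h = @Ordinal 5 k h' by apply: val_inj.
apply: (@generic_config3 m c (fun i => row i A) (o5 0) (o5 1) (o5 2) (o5 3) (o5 4)) => //.
- by case: g1 => -[[|[|//]] h] _; rewrite (E _ h isT) => e; [left|right].
- by case: g2 => -[[|[|[|//]]] h] _; rewrite (E _ h isT) => e; [apply: Or31|apply: Or32|apply: Or33].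
- by case: g3 => -[[|[|[|[|//]]]] h] _; rewrite (E _ h isT) => e;
    [apply: Or41|apply: Or42|apply: Or43|apply: Or44].
Qed.

Lemma lab_realized (v : 'M[int]_(m, n)) z0 k (s : 'I_k -> int) M (pt : 'I_k -> 'rV[int]_n) :
  injective pt -> (forall i, is_sign (s i)) -> (forall i, lab v z0 (s i) (M i) (pt i)) ->
  realized (fun i => s i == 1) M v pt.
Proof.
move=> pti ss hl; split=> // i j.
  move=> e; apply: lab_eqp (hl i) _; have -> : s i = s j; last exact: hl.
  by move: e; case: (ss i) => ->; case: (ss j) => ->.
move=> e; apply: lab_eqm (hl i) _; have -> : - s i = s j; last exact: hl.
by move: e; case: (ss i) => ->; case: (ss j) => ->.
Qed.

(** With five vertices, the pair could be enlarged three times along edges to a configuration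
    excluded by [no_even_config]. All labels refer to one origin [z0], so [V] may also consist of
    two components. *)
Lemma config_bound (v : 'M[int]_(m, n)) N (V : seq 'rV[int]_n) z0 (s : 'rV[int]_n -> int) M a0 b0 :
  no_even_config N v -> uniq V ->
  (forall y, y \in V -> [/\ is_sign (s y), bounded N (M y) & lab v z0 (s y) (M y) y]) ->
  (forall i j a b, a \in V -> b \in V -> black v i j a b ->
     s b = s a /\ M b = M a + delta_mx 0 j - delta_mx 0 i) ->
  (forall i j a b, a \in V -> b \in V -> red v i j a b ->
     s b = - s a /\ M b = delta_mx 0 i + delta_mx 0 j - M a) ->
  a0 \in V -> b0 \in V -> a0 != b0 -> even_vec (M a0 + M b0) ->
  (forall T : seq 'rV[int]_n, {subset T <= V} -> a0 \in T -> b0 \in T -> (size T < size V)%N ->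
     uniq T -> exists z z', [/\ z \in T, z' \in V, z' \notin T & adj v z z']) ->
  (size V <= 4)%N.
Proof.
move=> nc uV hV hb hr aV bV ab ev grow; rewrite leqNgt; apply/negP => lt.
have sub2 : {subset [:: a0; b0] <= V} by move=> y; rewrite !inE => /orP[] /eqP ->.
have b2 : b0 \in [:: a0; b0] by rewrite !inE eqxx orbT.
have u2 : uniq [:: a0; b0] by rewrite /= inE ab.
have [|z1 [k1 [z1T k1V k1T e1]]] := grow [:: a0; b0] sub2 (mem_head _ _) b2 _ u2.
  exact: leq_trans lt.
have sub3 : {subset [:: a0; b0; k1] <= V}.
  by move=> y; rewrite !inE => /or3P[] /eqP ->.
have in3 y : y \in [:: a0; b0] -> y \in [:: a0; b0; k1].
  by rewrite !inE => /orP[] ->; rewrite ?orbT.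
have u3 : uniq [:: a0; b0; k1] by rewrite -[[:: a0; b0; k1]]/(rcons [:: a0; b0] k1) rcons_uniq k1T.
have [|z2 [k2 [z2T k2V k2T e2]]] := grow [:: a0; b0; k1] sub3 (in3 _ (mem_head _ _)) (in3 _ b2) _ u3.
  exact: leq_trans lt.
have sub4 : {subset [:: a0; b0; k1; k2] <= V}.
  by move=> y; rewrite !inE => /or4P[] /eqP ->.
have in4 y : y \in [:: a0; b0; k1] -> y \in [:: a0; b0; k1; k2].
  by rewrite !inE => /or3P[] ->; rewrite ?orbT.
have u4 : uniq [:: a0; b0; k1; k2].
  by rewrite -[[:: a0; b0; k1; k2]]/(rcons [:: a0; b0; k1] k2) rcons_uniq k2T.
have [|z3 [k3 [z3T k3V k3T e3]]] := grow [:: a0; b0; k1; k2] sub4 (in4 _ (in3 _ (mem_head _ _)))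
    (in4 _ (in3 _ b2)) _ u4.
  exact: lt.
pose W := [:: a0; b0; k1; k2; k3].
have uW : uniq W by rewrite -[W]/(rcons [:: a0; b0; k1; k2] k3) rcons_uniq k3T.
have WV y : y \in W -> y \in V.
  by rewrite -[W]/(rcons [:: a0; b0; k1; k2] k3) mem_rcons inE => /predU1P[->|/sub4].
pose pt (i : 'I_5) := nth 0 W i.
have ptW i : pt i \in W by apply: mem_nth.
have pti : injective pt by move=> i j /eqP; rewrite /pt nth_uniq // => /eqP/val_inj.
have ss i : is_sign (s (pt i)) by have [] := hV _ (WV _ (ptW i)).
have edge i j : adj v (pt i) (pt j) -> real_edge (fun i => s (pt i) == 1) (M \o pt) j i.
  rewrite adj_sym => /and3P[_ _ /existsP[q /existsP[r /orP[h|h]]]]; rewrite /real_edge /=.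
    have [-> ->] := hb _ _ _ _ (WV _ (ptW j)) (WV _ (ptW i)) h.
    rewrite eqxx; exists q, r; split; first by case/and3P: h.
    by rewrite addrAC [M _ + _]addrC addrK.
  have [-> ->] := hr _ _ _ _ (WV _ (ptW j)) (WV _ (ptW i)) h.
  have -> : ((s (pt j) == 1) == (- s (pt j) == 1)) = false by case: (ss j) => ->.
  by exists q, r; split; [case/and3P: h|rewrite addrC subrK].
have idx T y k : y \in T -> T = take k W -> (size T <= k)%N -> (k < 5)%N ->
    exists2 l : 'I_5, (l < k)%N & pt l = y.
  move=> yT ET sk k5; have lk : (index y T < k)%N by apply: leq_trans sk; rewrite index_mem.
  exists (Ordinal (ltn_trans lk k5)) => //=; rewrite /pt /=.
  by rewrite -(nth_take 0 lk) -ET nth_index.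
apply: (nc (fun i => s (pt i) == 1) (M \o pt) _ _ _ _ _ pt).
- by move=> i; have [] := hV _ (WV _ (ptW i)).
- rewrite /even_pair /= -[pt (o5 0)]/a0 -[pt (o5 1)]/b0; case: ifP => // _ l.
  by move: (ev l); rewrite !mxE; apply: dvdz2_sub.
- have [l lk e] := idx _ _ 2%N z1T erefl (leqnn _) isT; exists l => //; apply: edge.
  by rewrite e.
- have [l lk e] := idx _ _ 3%N z2T erefl (leqnn _) isT; exists l => //; apply: edge.
  by rewrite e.
- have [l lk e] := idx _ _ 4%N z3T erefl (leqnn _) isT; exists l => //; apply: edge.
  by rewrite e.
- by apply: (lab_realized (z0 := z0)) => // i; have [] := hV _ (WV _ (ptW i)).
Qed.

End ConfigBound.

Section Components.
Variables (m p : nat).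
Local Notation n := p.+1.
Variables (N : nat) (v : 'M[int]_(m, n)).
Hypotheses (good : good_labels N v) (N_large : (2 * diameter p + 2 <= N)%N).
Variables (x : 'rV[int]_n -> 'rV[int]_n) (sg : 'rV[int]_n -> int) (L : 'rV[int]_n -> 'rV[int]_m).
Hypotheses (hx : root_choice v x) (hl : labels v x sg L).
Implicit Types (a b k : 'rV[int]_n) (s : seq 'rV[int]_n).

Lemma root_insites k : ~~ insites v k -> ~~ insites v (x k).
Proof. by move=> kS; have [c _] := hx kS; apply: same_comp_insites c kS. Qed.

(** The labels given by the rules are those collected along a path from the root, and a simple path
    has bounded length. *)
Lemma labels_plab k : ~~ insites v k -> plab v (diameter p) (x k) (sg k) (L k) k.
Proof.
move=> kS; have [c e] := hx kS; have xS := root_insites kS.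
have [l1 l2 l3] := hl; have [sx Lx] := l1 k kS.
have [q hq] := same_comp_sym c; case/shortenP: hq => q' h1 h2 _ lq.
have sq : (size q' <= diameter p)%N.
  by apply: (uniq_path_size good) h1 h2 => //; apply: leq_trans N_large; rewrite leq_addr.
suff P r : path (adj v) (x k) r -> let y := last (x k) r in
    ~~ insites v y /\ plab v (size r) (x k) (sg y) (L y) y.
  by have [_] := P q' h1; rewrite /= lq; apply: plab_leq.
elim/last_ind: r => [|r z IH] /=; first by rewrite sx Lx; split=> //; apply: plab_refl.
rewrite rcons_path last_rcons size_rcons => /andP[/IH[yS hy] az].
have /and3P[_ zS /existsP[i /existsP[j h]]] := az; split=> //; move: hy; set y := last _ _ => hy.
rewrite -(addn1 (size r)); case/orP: h => h.
  have [-> ->] := l2 _ _ _ _ yS zS h; have := plab_comp hy (plab_black h).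
  by rewrite mul1r scale1r addrA.
have [-> ->] := l3 _ _ _ _ yS zS h; have := plab_comp hy (plab_red h).
by rewrite mulN1r scaleN1r addrC.
Qed.

Lemma is_sign_sg k : ~~ insites v k -> is_sign (sg k).
Proof. by move/labels_plab => []. Qed.

Lemma comp_edge_labels s : {in s, forall a, ~~ insites v a} -> edge_labels v sg L s.
Proof.
have [_ l2 l3] := hl; move=> hs; split=> [a /hs|i j a b /hs aS /hs bS|i j a b /hs aS /hs bS].
- exact: is_sign_sg.
- exact: l2.
- exact: l3.
Qed.

Lemma comp_enumP k s : ~~ insites v k -> comp_enum v k s ->
  [/\ uniq s, k \in s, {in s, forall h, ~~ insites v h} & {in s, forall h, x h = x k}].
Proof.
move=> kS [us hs]; split=> //; first by apply/hs; apply: same_comp_refl.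
  by move=> h /hs c; apply: same_comp_insites c kS.
by move=> h /hs c; have [_ ->] := hx kS.
Qed.

Lemma row_neq i j : i != j -> row i v != row j v.
Proof.
move=> ij; have [g1 _ _] := good; rewrite -subr_eq0 -!row_deltaM -mulmxBl; apply: g1.
  apply: (@bounded_leq _ 1); first by apply: leq_trans N_large; lia.
  by rewrite -scaleN1r; apply: bounded_pair; [right|rewrite eq_sym].
apply/negP => /eqP/rowP/(_ i); rewrite !mxE !eqxx (negbTE ij) /=; lia.
Qed.

(** Equivalently (a - v_i, v_j - v_i) = 0: the origin of the edge lies on the hyperplane through v_i
    orthogonal to v_j - v_i. *)
Lemma black_dot i j a b : black v i j a b ->
  dot a (row j v) - dot a (row i v) = dot (row i v) (row j v) - sqn (row i v).
Proof.
move=> /and3P[_ /eqP e1 /eqP e2].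
have eb : b = a + (row j v - row i v) by rewrite -e1 addrC subrK.
have := sqnD a (row j v - row i v); rewrite -eb (sqnD (row j v)) sqnN dotDr !dotNr.
rewrite [dot (row j v) _]dotC => h; apply: (mulfI (isT : (2 : int) != 0)); apply/esym.
apply: (eq_of_subr (congr2 (fun u w => u - w) h e2)); ring.
Qed.

(** Equivalently (a - v_i, a - v_j) = 0: the vertex lies on the sphere whose diameter joins v_i and
    v_j. *)
Lemma red_dot i j a b : red v i j a b ->
  sqn a = dot a (row i v) + dot a (row j v) - dot (row i v) (row j v).
Proof.
move=> /and3P[_ /eqP e1 /eqP e2].
have eb : b = row i v + row j v - a by rewrite -e1 addrK.
have := sqnD (row i v + row j v) (- a); rewrite -eb (sqnD (row i v)) sqnN dotNr dotDl.
rewrite [dot (row i v) a]dotC [dot (row j v) a]dotC => h.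
apply: (mulfI (isT : (2 : int) != 0)); apply/esym.
apply: (eq_of_subr (congr2 (fun u w => u - w) h e2)); ring.
Qed.

(** The two hyperplanes are parallel and distinct. *)
Lemma black_black_false i j a b b' : black v i j a b -> black v j i a b' -> False.
Proof.
move=> h h'; have /and3P[ij _ _] := h; have e := black_dot h; have := black_dot h'.
rewrite [dot (row j v) _]dotC => e'; have : sqn (row i v - row j v) = 0.
  rewrite sqnD sqnN dotNr.
  by apply: (eq_of_subr (congr2 (fun u w => u + w) e e')); ring.
by move/eqP; rewrite sqn_eq0 subr_eq0 (negbTE (row_neq ij)).
Qed.

(** The hyperplane touches the sphere only at the site v_i. *)
Lemma black_red_false i j a b b' : ~~ insites v a ->
  black v i j a b -> red v i j a b' -> False.
Proof.
move=> aS h h'; have e := black_dot h; have e' := red_dot h'.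
have : sqn (a - row i v) = 0.
  rewrite sqnD sqnN dotNr.
  by apply: (eq_of_subr (congr2 (fun u w => u + w) e e')); ring.
move/eqP; rewrite sqn_eq0 subr_eq0 => ai; case/negP: aS; apply/existsP; by exists i.
Qed.

Definition active i j a b := marked v i j a b || marked v j i a b.

Lemma activeC i j a b : active i j a b = active j i a b.
Proof. by rewrite /active orbC. Qed.

Lemma red_swap i j a b : red v i j a b = red v j i a b.
Proof. by rewrite /red eq_sym [row i v + _]addrC [sqn (row i v) + _]addrC. Qed.

Lemma activeP i j a b : active i j a b -> [\/ black v i j a b, black v j i a b | red v i j a b].
Proof.
move=> /orP[/orP[h|h]|/orP[h|h]]; [exact: Or31|exact: Or33|exact: Or32|].
by apply: Or33; rewrite red_swap.
Qed.

(** By the two incompatibilities above, the edges with a given pair of marks form a matching. *)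
Lemma active_unique i j a b b' : ~~ insites v a -> active i j a b -> active i j a b' -> b = b'.
Proof.
move=> aS /activeP h /activeP h'.
have bl i' j' c c' : black v i' j' a c -> black v i' j' a c' -> c = c'.
  by move=> /and3P[_ /eqP e _] /and3P[_ /eqP e' _]; apply: (addIr (- a)); rewrite e e'.
have rd c c' : red v i j a c -> red v i j a c' -> c = c'.
  by move=> /and3P[_ /eqP e _] /and3P[_ /eqP e' _]; apply: (addIr a); rewrite e e'.
case: h => h; case: h' => h'; try exact: bl h h'; try exact: rd h h'; exfalso.
- exact: black_black_false h h'.
- exact: black_red_false aS h h'.
- exact: black_black_false h h'.
- by rewrite red_swap in h'; apply: black_red_false aS h h'.
- exact: black_red_false aS h' h.
- by rewrite red_swap in h; apply: black_red_false aS h' h.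
Qed.

Lemma active_sym i j a b : active i j a b = active i j b a.
Proof.
suff imp c d : active i j c d -> active i j d c by apply/idP/idP; apply: imp.
by rewrite /active /marked => /activeP[/black_sym->|/black_sym->|/red_sym->]; rewrite ?orbT.
Qed.

Lemma adj_active a b : adj v a b -> exists i j, i != j /\ active i j a b.
Proof.
move=> /and3P[_ _ /existsP[i /existsP[j h]]]; exists i, j.
by split; [case/orP: h => /and3P[]|rewrite /active h].
Qed.

Lemma active_labels i j a b : ~~ insites v a -> ~~ insites v b -> active i j a b ->
  i != j /\ ((exists2 e : int, is_sign e & sg b = sg a /\
                L b = L a + e *: (delta_mx 0 j - delta_mx 0 i))
   \/ sg b = - sg a /\ L b = delta_mx 0 i + delta_mx 0 j - L a).
Proof.
have [_ l2 l3] := hl; move=> aS bS /activeP[h|h|h]; have /and3P[ij _ _] := h.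
- split=> //; left; exists 1; first by left.
  by have [-> ->] := l2 _ _ _ _ aS bS h; rewrite scale1r addrA.
- split; [by rewrite eq_sym|left; exists (-1); first by right].
  by have [-> ->] := l2 _ _ _ _ aS bS h; rewrite scaleN1r opprB addrA.
- by split=> //; right; have [-> ->] := l3 _ _ _ _ aS bS h.
Qed.

(** Modulo 2 signs disappear, and black and red edges behave alike. *)
Lemma active_parity i j a b : ~~ insites v a -> ~~ insites v b -> active i j a b ->
  even_vec (L a + L b + (delta_mx 0 i + delta_mx 0 j)).
Proof.
move=> aS bS h l; have [ij [[e es [_ ->]]|[_ ->]]] := active_labels aS bS h; rewrite !mxE.
  move: (L a 0 l) => z; case: es => ->; case: (l == i); case: (l == j);
  rewrite ?mulr1n ?mulr0n; clear; lia.
move: (L a 0 l) => z; case: (l == i); case: (l == j); clear; lia.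
Qed.

Lemma active_sgL i j a b q : ~~ insites v a -> ~~ insites v b -> active i j a b ->
  q != i -> q != j -> sg b * L b 0 q = sg a * L a 0 q.
Proof.
move=> aS bS h qi qj; have [ij [[e es [-> ->]]|[-> ->]]] := active_labels aS bS h;
rewrite !mxE (negbTE qi) (negbTE qj) /=; first by rewrite subrr mulr0 addr0.
by rewrite addr0 add0r mulrNN.
Qed.

Lemma comp_exit (T : seq 'rV[int]_n) a w : same_comp v a w -> a \in T -> w \notin T ->
  exists z z', [/\ z \in T, z' \notin T, adj v z z' & same_comp v a z'].
Proof.
move=> [q hq <-]; elim: q a hq => [|b q IH] a /=; first by move=> _ ->.
move=> /andP[ab hq] aT lT; have [bT|bT] := boolP (b \in T); last first.
  by exists a, b; split=> //; apply: same_comp_adj.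
have [z [z' [h1 h2 h3 h4]]] := IH b hq bT lT; exists z, z'; split=> //.
exact: same_comp_trans (same_comp_adj ab) h4.
Qed.

(** [mark] picks some mark of the edge; well-posedness fixes it up to order. *)
Lemma mark_pair a b i j : ~~ insites v a -> ~~ insites v b -> active i j a b ->
  exists ij, mark v a b = Some ij /\ (ij = (i, j) \/ ij = (j, i)).
Proof.
move=> aS bS h; have [_ wp _] := good_well_posed good N_large.
have [ij E] : exists ij, mark v a b = Some ij.
  rewrite /mark; case: pickP => [ij _|no]; first by exists ij.
  by case/orP: h => h; [have := no (i, j)|have := no (j, i)]; rewrite /= h.
exists ij; split=> //; have hm := markP E.
have ne i' j' : marked v i' j' a b -> i' != j' by case/orP => /and3P[].
have [ij0 n2] : i != j /\ ij.1 != ij.2.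
  by split; [case/orP: h => /ne //; rewrite eq_sym|apply: ne hm].
have /setP S : [set ij.1; ij.2]%SET = [set i; j]%SET.
  by case/orP: h => h; [apply: (wp _ _ _ _ _ _ aS bS hm h)|rewrite [RHS]finset.setUC; apply: (wp _ _ _ _ _ _ aS bS hm h)].
move: (S ij.1) (S ij.2) n2; rewrite !inE !eqxx /= ?orbT; case: ij {E hm S} => a1 a2 /=.
by move=> /esym/orP[] /eqP -> /esym/orP[] /eqP ->; rewrite ?eqxx //; [left|right].
Qed.

Lemma sentry_inactive (K : comNzRingType) (y : 'rV[K]_m) i j a b :
  (forall q, q != i -> q != j -> y 0 q = 0) -> a != b -> ~~ active i j a b ->
  sentry v sg L y a b = 0.
Proof.
move=> y0 ab nact; rewrite /sentry (negbTE ab).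
case E : (mark v a b) => [[q r]|] //=; have := markP E => /= hm.
have qr : q != r by case/orP: hm => /and3P[].
have inij l : y 0 l != 0 -> l = i \/ l = j.
  by move=> yl; have [->|li] := eqVneq l i; [left|right; apply: contraNeq yl => lj; rewrite y0].
have [->|/inij yq] := eqVneq (y 0 q) 0; first by rewrite mul0r mulr0.
have [->|/inij yr] := eqVneq (y 0 r) 0; first by rewrite !mulr0.
by move: nact qr; rewrite /active; case: yq hm => ->; case: yr => -> hm; rewrite ?hm ?orbT ?eqxx.
Qed.

Lemma sentry_active (K : comNzRingType) (y : 'rV[K]_m) i j a b :
  ~~ insites v a -> ~~ insites v b -> a != b -> active i j a b ->
  sentry v sg L y a b = 2 * (sg b)%:~R * (y 0 i * y 0 j).
Proof.
move=> aS bS ab h; rewrite /sentry (negbTE ab).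
by have [ij [-> [->|->]]] := mark_pair aS bS h => //=; rewrite [y 0 j * _]mulrC.
Qed.

Lemma active_neq i j a b : ~~ insites v a -> ~~ insites v b -> active i j a b -> a != b.
Proof.
move=> aS bS h; apply/eqP => ab; rewrite -{b}ab in bS h.
have [ij [[e es [_]]|[s0 _]]] := active_labels aS bS h; last first.
  by move: s0; case: (is_sign_sg aS) => ->.
move=> /rowP/(_ i); rewrite !mxE !eqxx (negbTE ij) /=; move: (L a 0 i) => z.
by case: es => ->; clear; lia.
Qed.

End Components.

(** * Spectrum at points supported on one or two coordinates *)

Section Eigenvectors.
Variables (F : fieldType) (T : eqType) (t0 : T) (s : seq T) (e : T -> T -> F).
Hypothesis us : uniq s.
Let A : 'M[F]_(size s) := \matrix_(p, q) e (nth t0 s p) (nth t0 s q).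

Lemma root_eigenvector z : root (char_poly A) z ->
  exists u : T -> F, (exists2 b, b \in s & u b != 0) /\
    forall b, b \in s -> \sum_(a <- s) u a * e a b = z * u b.
Proof.
rewrite -eigenvalue_root_char => /eigenvalueP[w wA w0].
pose u a := if insub (index a s) is Some i then w 0 i else 0.
have uE (i : 'I_(size s)) : u (nth t0 s i) = w 0 i by rewrite /u index_uniq // valK.
exists u; split.
  have /rV0Pn[i wi] := w0; exists (nth t0 s i); first exact: mem_nth.
  by rewrite uE.
move=> b /(nthP t0)[q qs <-]; have := congr1 (fun M : 'rV_(size s) => M 0 (Ordinal qs)) wA.
rewrite !mxE -[q]/(val (Ordinal qs)) uE => <-; rewrite (big_nth t0) big_mkord.
by apply: eq_bigr => i _; rewrite uE !mxE.
Qed.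

Lemma eigenvector_root z (u : T -> F) : (exists2 b, b \in s & u b != 0) ->
  (forall b, b \in s -> \sum_(a <- s) u a * e a b = z * u b) -> root (char_poly A) z.
Proof.
move=> [b bs ub] h; rewrite -eigenvalue_root_char; apply/eigenvalueP.
exists (\row_i u (nth t0 s i)).
  apply/rowP => q; rewrite !mxE -h ?mem_nth // (big_nth t0) big_mkord.
  by apply: eq_bigr => i _; rewrite !mxE.
apply/rV0Pn; have hb : (index b s < size s)%N by rewrite index_mem.
by exists (Ordinal hb); rewrite mxE nth_index.
Qed.

End Eigenvectors.

Section Spectrum.
Variables (R : realType) (m p : nat).
Local Notation n := p.+1.
Variables (N : nat) (v : 'M[int]_(m, n)).
Hypotheses (good : good_labels N v) (N_large : (2 * diameter p + 2 <= N)%N).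
Variables (x : 'rV[int]_n -> 'rV[int]_n) (sg : 'rV[int]_n -> int) (L : 'rV[int]_n -> 'rV[int]_m).
Hypotheses (hx : root_choice v x) (hl : labels v x sg L).
Implicit Types (a b k : 'rV[int]_n) (s : seq 'rV[int]_n) (xi : 'rV[R]_m).
Local Notation "z %:C" := (real_complex R z).
Local Notation active := (active v).

(** Complex square roots, because points with negative coordinates are used as well. *)
Definition sqrt_point xi : 'rV[R[i]]_m := map_mx (fun t => sqrtC (t%:C)) xi.

Lemma sqrt_pointE xi : map_mx (fun t => t ^+ 2) (sqrt_point xi) = map_mx (real_complex R) xi.
Proof. by apply/rowP => q; rewrite !mxE sqrtCK. Qed.

Definition ev xi b : R := (sg b)%:~R * lform xi (L b).

Lemma sentry_diag xi b : sentry v sg L (sqrt_point xi) b b = (ev xi b)%:C.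
Proof. by rewrite /sentry eqxx sqrt_pointE rmorphM rmorph_int map_lform. Qed.

Lemma res3_common (sigma : int) nu eta s s' kappa xi : is_sign sigma ->
  edge_labels v sg L s -> edge_labels v sg L s' -> res3 v sg L sigma nu eta s s' kappa xi = 0 ->
  exists z w, [/\ root (char_poly (smx v sg L (sqrt_point xi) s)) z,
    root (char_poly (smx v sg L (sqrt_point xi) s')) w
    & z + sigma%:~R * w = (tform xi nu eta - kappa)%:C].
Proof.
move=> ss hs hs' /(congr1 (real_complex R)); rewrite map_res3 rmorph0 /res3.
move=> /(resultant_common_root (char_poly_monic _))[z]; rewrite -!sqrt_pointE.
rewrite (char_gmx _ hs) root_char_affine // (char_gmx _ hs') => rz rw.
exists z; eexists; split; [exact: rz|exact: rw|].
rewrite mulrA -rmorphM /= (signK ss) mul1r addrC subrK rmorphB map_tform.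
by rewrite sqrt_pointE.
Qed.

Lemma spectrum_diag s xi z : uniq s -> {in s, forall a, ~~ insites v a} ->
  (forall i j, i != j -> xi 0 i = 0 \/ xi 0 j = 0) ->
  root (char_poly (smx v sg L (sqrt_point xi) s)) z -> exists2 b, b \in s & z = (ev xi b)%:C.
Proof.
move=> us hs x0 /(root_eigenvector us)[u [[b bs ub] hu]]; exists b => //.
apply: (mulIf ub); rewrite -hu // (big_rem b bs) /= sentry_diag mulrC big_seq big1 ?addr0 // => a ar.
have ab : a != b by apply: contraTneq ar => ->; rewrite mem_rem_uniqF.
rewrite /sentry (negbTE ab); case E : mark => [[i j]|]; last by rewrite mulr0.
have ij : i != j by have /orP[] := markP E => /and3P[].
have y0 q : xi 0 q = 0 -> sqrt_point xi 0 q = 0 by move=> e; rewrite mxE e rmorph0 sqrtC0.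
by rewrite /=; case: (x0 i j ij) => /y0 ->; rewrite ?mul0r ?mulr0 // !mulr0.
Qed.

(* At a point supported on a pair {i, j} the active edges form a matching, and
   the matrix is a direct sum of blocks of size one and two. *)
Lemma spectrum_pair s i j xi z : uniq s -> {in s, forall a, ~~ insites v a} ->
  (forall q, q != i -> q != j -> xi 0 q = 0) ->
  root (char_poly (smx v sg L (sqrt_point xi) s)) z ->
  exists2 b, b \in s &
    (z = (ev xi b)%:C /\ forall a, a \in s -> ~~ active i j a b) \/
    exists2 a, a \in s & active i j a b /\
      (z - ((ev xi a + ev xi b) / 2)%:C) ^+ 2 =
      (((ev xi a - ev xi b) ^+ 2 / 4 + 4 * (sg a * sg b)%:~R * (xi 0 i * xi 0 j)) : R)%:C.
Proof.
move=> us hs x0 /(root_eigenvector us)[u [[b bs ub] hu]]; exists b => //.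
have y0 q : q != i -> q != j -> sqrt_point xi 0 q = 0.
  by move=> qi qj; rewrite mxE x0 // rmorph0 sqrtC0.
have inact c d : c \in s -> d \in s -> c != d -> ~~ active i j c d ->
    sentry v sg L (sqrt_point xi) c d = 0.
  by move=> _ _; apply: sentry_inactive.
have [/hasP[a as_ act]|/hasPn nact] := boolP (has (fun a => active i j a b) s); last first.
  left; split=> //; apply: (mulIf ub).
  rewrite -hu // (big_rem b bs) /= sentry_diag mulrC big_seq big1 ?addr0 // => a ar.
  have ab : a != b by apply: contraTneq ar => ->; rewrite mem_rem_uniqF.
  by rewrite inact ?mulr0 ?(mem_rem ar) //; apply/nact/(mem_rem ar).
right; exists a => //; split=> //.
have aS := hs _ as_; have bS := hs _ bs.
(* In the eigenvalue equation at a matched vertex only the diagonal entry and the partner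
   contribute. *)
have two c d : c \in s -> d \in s -> active i j c d ->
    z * u d = u d * (ev xi d)%:C + u c * sentry v sg L (sqrt_point xi) c d.
  move=> cs ds cd; have cS := hs _ cs; have dS := hs _ ds.
  have ne := active_neq good N_large hx hl cS dS cd.
  have cr : c \in rem d s by rewrite mem_rem_uniq // inE ne.
  rewrite -hu // (big_rem d ds) /= sentry_diag (big_rem c cr) /=; congr (_ + _).
  rewrite big_seq big1 ?addr0 // => e er; have eds := mem_rem er.
  have es := mem_rem eds.
  have ed : e != d by apply: contraTneq eds => ->; rewrite mem_rem_uniqF.
  have ec : e != c by apply: contraTneq er => ->; rewrite mem_rem_uniqF // rem_uniq.
  rewrite inact ?mulr0 //; apply: contra ec => h; apply/eqP.
  rewrite active_sym in h; rewrite active_sym in cd.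
  exact: (active_unique good N_large dS h cd).
have act' : active i j b a by rewrite active_sym.
have e1 := two _ _ as_ bs act; have e2 := two _ _ bs as_ act'.
have ab := active_neq good N_large hx hl aS bS act.
rewrite (sentry_active good N_large _ _ _ aS bS ab act) in e1.
have ba : b != a by rewrite eq_sym.
rewrite (sentry_active good N_large _ _ _ bS aS ba act') in e2.
have sq q : (sqrt_point xi 0 q) ^+ 2 = (xi 0 q)%:C by rewrite mxE sqrtCK.
move: (sqrt_point xi 0 i) (sqrt_point xi 0 j) (sq i) (sq j) e1 e2 => yi yj si sj e1 e2.
apply: (mulIf ub); move: (ev xi a) (ev xi b) e1 e2 => la lb e1 e2.
rewrite !(rmorph_nat, rmorph_int, rmorphD, rmorphB, rmorphN, rmorphM, rmorphXn, fmorphV) /= -si -sj.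
move: (la%:C) (lb%:C) e1 e2 => {}la {}lb e1 e2.
have e3 : (z - lb) * u b = u a * (2 * (sg b)%:~R * (yi * yj)) by rewrite mulrBl e1; ring.
have e4 : (z - la) * u a = u b * (2 * (sg a)%:~R * (yi * yj)) by rewrite mulrBl e2; ring.
(* Inserting one equation into the other gives the characteristic equation of the 2 x 2 block. *)
have e5 : (z - la) * ((z - lb) * u b) = u b * (4 * (sg a)%:~R * (sg b)%:~R * (yi * yj) ^+ 2).
  rewrite e3 [_ * (_ * _)]mulrA e4; ring.
by apply: (eq_of_subr e5); field.
Qed.

End Spectrum.

Section RealRoots.
Variable R : realType.
Local Notation "z %:C" := (real_complex R z).
Implicit Types (z w : R[i]) (r d t : R).

Lemma nonreal_root z r d t : d < 0 -> (z - r%:C) ^+ 2 = d%:C -> z <> t%:C.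
Proof.
move=> d0 h e; have : (t - r) ^+ 2 = d.
  by apply: complexI; rewrite /= -h e rmorphXn rmorphB.
by move=> h'; have := sqr_ge0 (t - r); rewrite h' leNgt d0.
Qed.

Lemma real_root z r d : 0 <= d -> (z - r%:C) ^+ 2 = d%:C -> exists t, z = t%:C.
Proof.
move=> d0; rewrite -(sqr_sqrtr d0) rmorphXn => /eqP; rewrite eqf_sqr.
case/orP => /eqP e; [exists (r + Num.sqrt d)|exists (r - Num.sqrt d)].
  by rewrite rmorphD -[_%:C + _]addrC -e subrK.
by rewrite rmorphB -[_%:C - _]addrC -e subrK.
Qed.

(** With U = t - r - sigma r', the equality of the squares of z - r and w - r' becomes U (U - 2
    sigma (w - r')) = 0, and the second factor is nonzero because w is not real. *)
Lemma root_sum (sigma : int) z w r r' d t : is_sign sigma -> d < 0 ->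
  (z - r%:C) ^+ 2 = d%:C -> (w - r'%:C) ^+ 2 = d%:C -> z + sigma%:~R * w = t%:C ->
  r + sigma%:~R * r' = t.
Proof.
move=> ss d0 hz hw e; have [U UE] : exists U, U = t - r - sigma%:~R * r' by eexists.
have e1 : z - r%:C = U%:C - sigma%:~R * (w - r'%:C).
  by rewrite UE !(rmorphB, rmorphM, rmorph_int) /= -e; ring.
have s2 : (sigma%:~R * sigma%:~R : R[i]) = 1 by rewrite -rmorphM /= (signK ss).
have e2 : U%:C * (U%:C - 2 * sigma%:~R * (w - r'%:C)) = 0.
  have := hz; rewrite e1 -hw => h.
  have h2 : (U%:C - sigma%:~R * (w - r'%:C)) ^+ 2 - (w - r'%:C) ^+ 2 = 0 by rewrite h subrr.
  rewrite -h2; have -> : (w - r'%:C) ^+ 2 = (sigma%:~R * sigma%:~R) * (w - r'%:C) ^+ 2 by rewrite s2 mul1r.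
  ring.
move/eqP: e2; rewrite mulf_eq0 => /orP[/eqP U0|/eqP e2].
  have : U = 0 by apply: complexI; rewrite /= U0 rmorph0.
  by rewrite UE => h; apply/esym/eqP; rewrite -subr_eq0 opprD addrA h.
case: (@nonreal_root w r' d (r' + sigma%:~R * U / 2) d0 hw).
have e3 : w - r'%:C = sigma%:~R * U%:C / 2.
  have e4 : U%:C = 2 * sigma%:~R * (w - r'%:C) by apply/eqP; rewrite -subr_eq0 e2.
  transitivity ((sigma%:~R * sigma%:~R) * (w - r'%:C)); first by rewrite s2 mul1r.
  rewrite e4; by field.
rewrite !(rmorph_nat, rmorphD, rmorphM, rmorph_int, fmorphV) /=.
rewrite -e3; ring.
Qed.

End RealRoots.

Section ResonantForms.
Variables (R : realType) (m p : nat).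
Local Notation n := p.+1.
Variables (N : nat) (v : 'M[int]_(m, n)).
Hypotheses (good : good_labels N v) (N_large : (2 * diameter p + 2 <= N)%N).
Variables (x : 'rV[int]_n -> 'rV[int]_n) (sg : 'rV[int]_n -> int) (L : 'rV[int]_n -> 'rV[int]_m).
Hypotheses (hx : root_choice v x) (hl : labels v x sg L).
Variables (sigma : int) (nu : 'rV[int]_m) (eta : int).
Hypothesis sigma_sign : is_sign sigma.
Implicit Types (a b k : 'rV[int]_n) (s : seq 'rV[int]_n) (xi : 'rV[R]_m).
Local Notation "z %:C" := (real_complex R z).
Local Notation ev := (ev sg L).
Local Notation active := (active v).
Local Notation res3 := (@res3 m n v sg L R sigma nu eta).

(** Coefficient of xi_q in the defect of the resonance between the diagonal entries at [a] and [b];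
    see [gapE]. *)
Definition gap a b q : int := sg a * L a 0 q + sigma * (sg b * L b 0 q) - nu 0 q + 2 * eta.

Lemma gapE xi a b : ev xi a + sigma%:~R * ev xi b - tform xi nu eta =
  \sum_q xi 0 q * (gap a b q)%:~R.
Proof.
rewrite /ev /tform /lform !mulr_sumr opprB addrA -big_split /= addrAC -sumrB -big_split /=.
by apply: eq_bigr => q _; rewrite /gap !(rmorphD, rmorphB, rmorphM) /=; ring.
Qed.

Definition resonant s s' := forall xi : 'rV[R]_m,
  exists z w, [/\ root (char_poly (smx v sg L (sqrt_point xi) s)) z,
    root (char_poly (smx v sg L (sqrt_point xi) s')) w
    & z + sigma%:~R * w = (tform xi nu eta)%:C].
Definition component s := uniq s /\ {in s, forall a, ~~ insites v a}.

Lemma common_eigenvalues s s' kappa xi : component s -> component s' ->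
  res3 s s' kappa xi = 0 ->
  exists z w, [/\ root (char_poly (smx v sg L (sqrt_point xi) s)) z,
    root (char_poly (smx v sg L (sqrt_point xi) s')) w
    & z + sigma%:~R * w = (tform xi nu eta - kappa)%:C].
Proof.
move=> [_ hs] [_ hs']; apply: res3_common => //.
  exact: (comp_edge_labels good N_large hx hl hs).
exact: (comp_edge_labels good N_large hx hl hs').
Qed.

Lemma vanishing_resonant s s' : component s -> component s' ->
  (forall xi : 'rV[R]_m, res3 s s' 0 xi = 0) -> resonant s s'.
Proof. by move=> cs cs' h xi; have := common_eigenvalues cs cs' (h xi); rewrite subr0. Qed.

(** At xi = 0 all eigenvalues and the linear form vanish, and only the constant remains. *)
Lemma res3_at0 s s' kappa : component s -> component s' -> kappa != 0 -> res3 s s' kappa 0 != 0.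
Proof.
move=> cs cs' k0; apply/eqP => /(common_eigenvalues cs cs')[z [w []]].
have x0 i j : i != j -> (0 : 'rV[R]_m) 0 i = 0 \/ (0 : 'rV[R]_m) 0 j = 0 by left; rewrite mxE.
have [us hs] := cs; have [us' hs'] := cs'.
have lf0 M : lform (0 : 'rV[R]_m) M = 0 by apply: big1 => q _; rewrite mxE mul0r.
move=> /(spectrum_diag us hs x0)[a _ ->] /(spectrum_diag us' hs' x0)[b _ ->].
have ev0 c : ev (0 : 'rV[R]_m) c = 0 by rewrite /ev lf0 mulr0.
have t0 : tform (0 : 'rV[R]_m) nu eta = 0.
  by rewrite /tform lf0 big1 ?mulr0 ?subrr // => q _; rewrite mxE.
rewrite !ev0 t0 rmorph0 mulr0 addr0 sub0r => /esym/eqP.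
by rewrite fmorph_eq0 oppr_eq0 (negbTE k0).
Qed.

(** On a coordinate axis every off-diagonal entry vanishes. *)
Lemma resonant_axis s s' q : component s -> component s' -> resonant s s' ->
  exists a b, [/\ a \in s, b \in s' & gap a b q = 0].
Proof.
move=> cs cs' h; have [z [w []]] := h (delta_mx 0 q).
have x0 i j : i != j -> (delta_mx 0 q : 'rV[R]_m) 0 i = 0 \/ (delta_mx 0 q : 'rV[R]_m) 0 j = 0.
  move=> ij; rewrite !mxE /=; have [iq|_] := eqVneq i q; last by left.
  by right; rewrite -iq eq_sym (negbTE ij).
have [us hs] := cs; have [us' hs'] := cs'.
move=> /(spectrum_diag us hs x0)[a as_ ->] /(spectrum_diag us' hs' x0)[b bs ->] e.
exists a, b; split=> //; have := gapE (delta_mx 0 q) a b.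
have -> : ev (delta_mx 0 q : 'rV[R]_m) a + sigma%:~R * ev (delta_mx 0 q : 'rV[R]_m) b =
    tform (delta_mx 0 q : 'rV[R]_m) nu eta.
  apply: complexI.
  by rewrite /= -e; move: (ev _ a) (ev _ b) => ea eb; rewrite rmorphD rmorphM rmorph_int.
rewrite subrr (bigD1 q) //= mxE !eqxx mul1r big1 ?addr0 => [/esym/eqP|r rq].
  by rewrite intr_eq0 => /eqP.
by rewrite mxE (negbTE rq) andbF mul0r.
Qed.

Definition pair_point i j (t : R) : 'rV[R]_m :=
  \row_q (if q == i then 1 else if q == j then t else 0).

Lemma sum_pair_point i j t (f : 'I_m -> R) : i != j ->
  \sum_q pair_point i j t 0 q * f q = f i + t * f j.
Proof.
move=> ij; rewrite (bigD1 i) //= (bigD1 j) 1?eq_sym //= !mxE !eqxx mul1r.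
rewrite eq_sym (negbTE ij) big1 ?addr0 // => q /andP[qi qj].
by rewrite mxE (negbTE qi) (negbTE qj) mul0r.
Qed.

Lemma two_points (e : int) (z1 z2 : int) : is_sign e ->
  z1%:~R + e%:~R * z2%:~R = 0 :> R -> z1%:~R + (2 * e)%:~R * z2%:~R = 0 :> R -> z1 = 0 /\ z2 = 0.
Proof.
move=> es /eqP; rewrite -rmorphM -rmorphD /= intr_eq0 => /eqP h1 /eqP.
rewrite -rmorphM -rmorphD /= intr_eq0 => /eqP h2.
by move: h1 h2; case: es => ->; clear; lia.
Qed.

Lemma active_ev_sq i j a b xi : ~~ insites v a -> ~~ insites v b -> active i j a b ->
  (ev xi a - ev xi b) ^+ 2 =
    (if sg a == sg b then xi 0 j - xi 0 i else xi 0 i + xi 0 j) ^+ 2.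
Proof.
move=> aS bS h; have sa : is_sign (sg a) by apply: (is_sign_sg good N_large hx hl aS).
have lfd l : lform xi (delta_mx 0 l) = xi 0 l.
  rewrite /lform (bigD1 l) //= mxE !eqxx mulr1 big1 ?addr0 // => q ql.
  by rewrite mxE (negbTE ql) andbF mulr0.
have lfZ e M : lform xi (e *: M) = e%:~R * lform xi M.
  by rewrite /lform mulr_sumr; apply: eq_bigr => q _; rewrite mxE rmorphM mulrCA.
have lfN M : lform xi (- M) = - lform xi M by rewrite -scaleN1r lfZ mulN1r.
have ss : ((sg a)%:~R : R) ^+ 2 = 1 by rewrite expr2 -rmorphM /= (signK sa).
have [_ [[e es [sb Lb]]|[sb Lb]]] := active_labels hl aS bS h; rewrite /ev sb Lb !lformD.
  rewrite eqxx lfZ lformD lfN !lfd; have se : ((e%:~R : R)) ^+ 2 = 1 by rewrite expr2 -rmorphM /= (signK es).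
  rewrite -mulrBr opprD addrA subrr sub0r exprMn ss mul1r sqrrN exprMn se mul1r //.
have -> : (sg a == - sg a) = false by case: sa => ->.
rewrite lfN !lfd rmorphN mulNr opprK -mulrDr addrC subrK exprMn ss mul1r //.
Qed.

(** A quarter of the discriminant of the 2 x 2 block at xi_i = 1, xi_j = t, according to whether its
    two vertices have the same sign. *)
Definition pair_disc (same : bool) (t : R) : R :=
  (if same then t - 1 else 1 + t) ^+ 2 / 4 + 4 * (if same then t else - t).

(** For t equal to this sign, or to twice it, a block of the given kind has nonreal eigenvalues
    while one of the other kind has real ones. Two values of t are kept because they separate the
    coefficients of xi_i and xi_j. *)
Definition nonreal_sign (same : bool) : int := if same then -1 else 1.

Lemma pair_disc_lt0 same t : t = (nonreal_sign same)%:~R \/ t = (2 * nonreal_sign same)%:~R ->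
  pair_disc same t < 0.
Proof. by rewrite /pair_disc /nonreal_sign; case: same => -[] -> /=; lra. Qed.

Lemma pair_disc_ge0 same t : t = (nonreal_sign same)%:~R \/ t = (2 * nonreal_sign same)%:~R ->
  0 <= pair_disc (~~ same) t.
Proof. by rewrite /pair_disc /nonreal_sign; case: same => -[] -> /=; nra. Qed.

Lemma spectrum_pair_point s i j t z : component s -> i != j ->
  root (char_poly (smx v sg L (sqrt_point (pair_point i j t)) s)) z ->
  exists2 b, b \in s &
    (z = (ev (pair_point i j t) b)%:C /\ forall a, a \in s -> ~~ active i j a b) \/
    exists2 a, a \in s & active i j a b /\
      (z - ((ev (pair_point i j t) a + ev (pair_point i j t) b) / 2)%:C) ^+ 2 =
      (pair_disc (sg a == sg b) t)%:C.
Proof.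
move=> [us hs] ij rz.
have x0 q : q != i -> q != j -> pair_point i j t 0 q = 0.
  by move=> qi qj; rewrite mxE (negbTE qi) (negbTE qj).
have [b bs h] := spectrum_pair good N_large hx hl us hs x0 rz; exists b => //.
case: h => [h|[a as_ [act e]]]; [by left|right; exists a => //; split=> //].
have aS := hs _ as_; have bS := hs _ bs.
rewrite e (active_ev_sq _ aS bS act) /pair_disc; congr (real_complex R _).
have sa := is_sign_sg good N_large hx hl aS; have sb := is_sign_sg good N_large hx hl bS.
rewrite !mxE !eqxx [j == i]eq_sym (negbTE ij); congr (_ + _).
by case: sa => ->; case: sb => -> /=; rewrite ?mulrNN ?mulN1r ?mulr1 !mul1r // mulrN1z ?mulrN ?mulNr mulr1.
Qed.

Lemma gap_zero i j (e : int) a b : is_sign e -> i != j ->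
  (forall t : R, t = e%:~R \/ t = (2 * e)%:~R ->
     ev (pair_point i j t) a + sigma%:~R * ev (pair_point i j t) b = tform (pair_point i j t) nu eta) ->
  gap a b i = 0 /\ gap a b j = 0.
Proof.
move=> es ij h; apply: (two_points es).
  by rewrite -(sum_pair_point _ (fun q => (gap a b q)%:~R)) // -gapE h ?subrr //; left.
by rewrite -(sum_pair_point _ (fun q => (gap a b q)%:~R)) // -gapE h ?subrr //; right.
Qed.

End ResonantForms.

Lemma odd_mul_eq0 (k : nat) (t : int) : (0 < k)%N -> (2 * k%:Z - 1) * t = 0 -> t = 0.
Proof. by move=> k0 /eqP; rewrite mulf_eq0 => /orP[/eqP|/eqP //]; lia. Qed.

Lemma odd_mul_eqN2 (k : nat) (t : int) :
  (0 < k)%N -> (2 * k%:Z - 1) * t = -2 -> t = -2 /\ k = 1%N.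
Proof.
case: k => [|[|k]] // _ e; first by lia.
have k0 : 0 <= k%:Z by [].
have : t < 0 by rewrite ltNge; apply/negP => t0; nia.
by move=> t0; nia.
Qed.

(** * Resonances between components with at most four vertices in all *)

Section SmallComponents.
Variables (R : realType) (m p : nat).
Local Notation n := p.+1.
Variables (N : nat) (v : 'M[int]_(m, n)).
Hypotheses (good : good_labels N v) (N_large : (2 * diameter p + 2 <= N)%N).
Variables (x : 'rV[int]_n -> 'rV[int]_n) (sg : 'rV[int]_n -> int) (L : 'rV[int]_n -> 'rV[int]_m).
Hypotheses (hx : root_choice v x) (hl : labels v x sg L) (m_gt0 : (0 < m)%N).
Implicit Types (a b k : 'rV[int]_n) (s : seq 'rV[int]_n) (nu : 'rV[int]_m) (eta sigma : int).
Local Notation "z %:C" := (real_complex R z).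
Local Notation ev := (ev sg L).
Local Notation active := (active v).
Local Notation resonant := (@resonant R m p v sg L).
Local Notation gap := (@gap m p sg L).
Local Notation component := (component v).
Let sign_sg := is_sign_sg good N_large hx hl.

Lemma resonant_swap sigma nu eta s s' : is_sign sigma ->
  resonant sigma nu eta s s' -> resonant sigma (sigma *: nu) (sigma * eta) s' s.
Proof.
move=> ss h xi; have [z [w [hz hw e]]] := h xi; exists w, z; split=> //.
have s2 : (sigma%:~R * sigma%:~R : R[i]) = 1 by rewrite -rmorphM /= (signK ss).
have -> : tform xi (sigma *: nu) (sigma * eta) = sigma%:~R * tform xi nu eta.
  rewrite /tform /lform mulrBr mulr_sumr rmorphM /=; congr (_ - _); last by ring.
  by apply: eq_bigr => q _; rewrite mxE rmorphM mulrCA.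
rewrite rmorphM rmorph_int /= -e mulrDr mulrA s2 mul1r addrC //.
Qed.

Lemma gap_swap sigma nu eta a b q : is_sign sigma ->
  gap sigma (sigma *: nu) (sigma * eta) b a q = sigma * gap sigma nu eta a b q.
Proof. by rewrite /gap mxE; case=> ->; ring. Qed.

Lemma mass_const (t : int) : mass (const_mx t : 'rV[int]_m) = m%:Z * t.
Proof.
rewrite /mass (eq_bigr (fun=> t)) => [|q _]; last by rewrite mxE.
by rewrite sumr_const card_ord -mulr_natl natz.
Qed.

(* The label from b to a is a constant vector; comparing masses, it vanishes,
   or m = 1 and its entry is 4, which makes |a - b|^2 nonpositive. *)
Lemma gap_eq0 sigma nu eta a b : is_sign sigma -> ~~ insites v a -> ~~ insites v b ->
  lab v (x b) (- sigma) (- nu) (x a) -> eta = mass nu + 1 + sigma ->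
  (forall q, gap sigma nu eta a b q = 0) -> a = b.
Proof.
move=> ss aS bS hr he h.
have [sa ma _ la] := labels_plab good N_large hx hl aS.
have [sb mb _ lb] := labels_plab good N_large hx hl bS.
have hab := lab_comp (lab_comp (lab_inv sb lb) hr) la.
(* The label from [b] to [a] through both roots; vanishing gaps make it constant, with entries - 2
   t. *)
set M := (_ *: (_ *: _ + _) + _) in hab; pose t := sg a * eta.
have ME : M = const_mx (- 2 * t).
  apply/rowP => q; rewrite !mxE; apply/eqP; rewrite -subr_eq0; apply/eqP.
  have := h q; rewrite /gap => e.
  transitivity (sg a * (sg a * L a 0 q + sigma * (sg b * L b 0 q) - nu 0 q + 2 * eta)).
    rewrite /t; case: sa => ->; ring.
  by rewrite e mulr0.
have mM : m%:Z * (- 2 * t) = sg a * (sigma * (sg b * (1 - sg b)) - mass nu) + (1 - sg a).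
  rewrite -mass_const -ME /M massD massZ massD massZ massZ massN ma mb; ring.
have eta_t : (2 * m%:Z - 1) * t = - sg a * sigma * sg b - 1.
  have mnu : mass nu = eta - 1 - sigma by rewrite he; ring.
  move: mM; rewrite mnu /t; case: sa => ->; case: sb => ->; case: ss => -> mM;
  by apply/esym; apply: (eq_of_subr mM); ring.
(* The right-hand side of [eta_t] is 0 or -2, and 2 m - 1 is odd. *)
have [[t0 tau]|[t2 [m1 tau]]] : t = 0 /\ sg a * (- sigma * sg b) = 1 \/
    t = -2 /\ m = 1%N /\ sg a * (- sigma * sg b) = -1.
  move: (t) eta_t => t'; case: sa => ->; case: sb => ->; case: ss => -> e;
  first [left; split; [apply: (odd_mul_eq0 m_gt0); exact: e|by []]
        |right; have [-> ->] := odd_mul_eqN2 m_gt0 e; by []].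
- have [e _] := hab; rewrite tau scale1r ME t0 mulr0 in e.
  by rewrite e (_ : const_mx 0 = 0) ?mul0mx ?addr0 //; apply/rowP => q; rewrite !mxE.
pose i0 := Ordinal m_gt0.
have M4 : M = 4 *: delta_mx 0 i0.
  apply/rowP => q; rewrite ME t2 !mxE eqxx.
  have -> : (q == i0) = true by apply/eqP/val_inj; case: q => -[|q] //=; rewrite m1.
  by [].
rewrite tau M4 in hab; have [e1 e2] := hab; have := sqnD a b.
have -> : a + b = 4 *: row i0 v by rewrite e1 scaleN1r -scalemxAl row_deltaM addrAC addNr add0r.
have := sqnD a (- b); rewrite sqnN dotNr e2 enZ en_delta sqnZ => e3 e4.
(* Parallelogram law with a + b = 4 v and |a|^2 + |b|^2 = 4 |v|^2, where v is the only site. *)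
have e5 : sqn (a - b) = - 8 * sqn (row i0 v).
  by apply: (eq_of_subr (congr2 (fun u w => u + w) e3 e4)); ring.
have := sqn_ge0 (a - b); rewrite e5 => s1; have := sqn_ge0 (row i0 v) => s2.
have : sqn (a - b) = 0 by rewrite e5; lia.
by move/eqP; rewrite sqn_eq0 subr_eq0 => /eqP.
Qed.

(** On each axis a resonance gives nu_q = 2 eta up to the size of two labels. Summing over q and
    using eta = mass(nu) + 1 + sigma bounds (2 m - 1) eta, hence eta and then every nu_q. *)
Lemma resonant_bounded sigma nu eta s s' : is_sign sigma -> component s -> component s' ->
  eta = mass nu + 1 + sigma -> resonant sigma nu eta s s' ->
  bounded (2 * diameter p + 2 * (2 * diameter p * m + 2)) nu.
Proof.
move=> ss cs cs' he h; pose D := (2 * diameter p)%N.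
have gq q : `|nu 0 q - 2 * eta| <= D%:Z.
  have [a [b [as_ bs]]] := resonant_axis q cs cs' h.
  have [sa _ /(_ ord0 q) La _] := labels_plab good N_large hx hl (cs.2 _ as_).
  have [sb _ /(_ ord0 q) Lb _] := labels_plab good N_large hx hl (cs'.2 _ bs).
  rewrite /gap /D; move: (diameter p) (L a 0 q) (L b 0 q) (nu 0 q) La Lb => d la lb nq.
  by case: sa => ->; case: sb => ->; case: ss => ->; clear; lia.
have h1 : `|eta - 1 - sigma - 2 * m%:Z * eta| <= (D * m)%:Z.
  have -> : eta - 1 - sigma - 2 * m%:Z * eta = \sum_q (nu 0 q - 2 * eta).
    rewrite sumrB sumr_const card_ord -/(mass nu) -mulr_natl natz he; ring.
  apply: le_trans (ler_norm_sum _ _ _) _.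
  apply: le_trans (ler_sum _ (fun q _ => gq q)) _.
  by rewrite sumr_const card_ord -mulr_natl natz PoszM mulrC.
have h2 : `|eta| <= (D * m + 2)%:Z.
  move: h1; case: ss => ->; move: (D * m)%N (eta) => k e h1.
    have [e0|e0] := leP 0 e; move: m_gt0 h1 e0; clear; nia.
  have [e0|e0] := leP 0 e; move: m_gt0 h1 e0; clear; nia.
move=> r q; rewrite ord1; have := gq q; move: h2 (nu 0 q); rewrite -/D.
by move: (eta) (D * m)%N (D) => e k d; clear; lia.
Qed.

End SmallComponents.

Section SmallGaps.
Variables (R : realType) (m p : nat).
Local Notation n := p.+1.
Variables (N : nat) (v : 'M[int]_(m, n)).
Hypotheses (good : good_labels N v) (N_large : (2 * diameter p + 2 <= N)%N).
Variables (x : 'rV[int]_n -> 'rV[int]_n) (sg : 'rV[int]_n -> int) (L : 'rV[int]_n -> 'rV[int]_m).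
Hypotheses (hx : root_choice v x) (hl : labels v x sg L).
Implicit Types (a b k : 'rV[int]_n) (s : seq 'rV[int]_n) (nu : 'rV[int]_m) (eta sigma : int).
Local Notation "z %:C" := (real_complex R z).
Local Notation ev := (ev sg L).
Local Notation active := (active v).
Local Notation resonant := (@resonant R m p v sg L).
Local Notation gap := (@gap m p sg L).
Local Notation component := (component v).
Local Notation point i j t := (@pair_point R m i j t).

(** Among at most three vertices a matching has only one edge. *)
Lemma matched_pair i j s a a' d b1 a2 : {in s, forall a, ~~ insites v a} ->
  {subset s <= [:: a; a'; d]} -> a \in s -> a' \in s -> active i j a a' ->
  b1 \in s -> a2 \in s -> active i j a2 b1 ->
  sg a2 == sg b1 = (sg a == sg a').
Proof.
move=> hs sub as_ as' act bs a2s h.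
have uni c d1 d2 : c \in s -> active i j c d1 -> active i j c d2 -> d1 = d2.
  by move=> cs; apply: (active_unique good N_large (hs _ cs)).
have act' : active i j a' a by rewrite active_sym.
have h' : active i j b1 a2 by rewrite active_sym.
have ne := active_neq good N_large hx hl (hs _ a2s) (hs _ bs) h.
have : b1 \in [:: a; a'] \/ a2 \in [:: a; a'].
  move: (sub _ bs) (sub _ a2s) ne; rewrite !inE.
  by case/or3P => /eqP ->; case/or3P => /eqP ->; rewrite !eqxx ?orbT //; auto.
rewrite !inE; case=> /orP[] /eqP E; subst.
- by rewrite (uni _ _ _ as_ act h') eq_sym.
- by rewrite (uni _ _ _ as' act' h').
- by rewrite (uni _ _ _ as_ act h).
- by rewrite (uni _ _ _ as' act' h) eq_sym.
Qed.

Lemma single_pair sigma nu eta s s' b i j a a' d : is_sign sigma ->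
  component s -> component s' -> resonant sigma nu eta s s' ->
  {subset s' <= [:: b]} -> {subset s <= [:: a; a'; d]} -> a \in s -> a' \in s ->
  active i j a a' -> [/\ d \in s, d != a, d != a', gap sigma nu eta d b i = 0
    & gap sigma nu eta d b j = 0].
Proof.
move=> ss cs cs' res sub' sub as_ as' act; have [us hs] := cs; have [us' hs'] := cs'.
have [ij _] := active_labels hl (hs _ as_) (hs _ as') act.
pose e := nonreal_sign (sg a == sg a').
have es : is_sign e by rewrite /e /nonreal_sign; case: ifP => _; [right|left].
have key (t : R) : t = e%:~R \/ t = (2 * e)%:~R -> [/\ d \in s, d != a, d != a'
    & ev (point i j t) d + sigma%:~R * ev (point i j t) b = tform (point i j t) nu eta].
  move=> ht; have [z [w [rz rw E]]] := res (point i j t).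
  have {rw} wE : w = (ev (point i j t) b)%:C.
    have [b1 b1s [[-> _]|[b2 b2s [h _]]]] := spectrum_pair_point good N_large hx hl cs' ij rw.
      by have := sub' _ b1s; rewrite inE => /eqP ->.
    have := active_neq good N_large hx hl (hs' _ b2s) (hs' _ b1s) h.
    by have := sub' _ b1s; have := sub' _ b2s; rewrite !inE => /eqP -> /eqP ->; rewrite eqxx.
  have [a1 a1s [[zE nact]|[a2 a2s [h zE]]]] := spectrum_pair_point good N_large hx hl cs ij rz.
    have n1 : a1 != a by apply: contraTneq act => <-; rewrite active_sym nact.
    have n2 : a1 != a' by apply: contraTneq act => <-; rewrite nact.
    have a1d : a1 = d by have := sub _ a1s; rewrite !inE (negbTE n1) (negbTE n2) => /eqP.
    rewrite -a1d; split=> //; apply: complexI; rewrite /= -E zE wE.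
    by move: (ev _ a1) (ev _ b) => u1 u2; rewrite rmorphD rmorphM rmorph_int.
  rewrite (matched_pair hs sub as_ as' act a1s a2s h) in zE.
  case: (nonreal_root (t := tform (point i j t) nu eta - sigma%:~R * ev (point i j t) b)
    (pair_disc_lt0 ht) zE).
  have -> : (tform (point i j t) nu eta - sigma%:~R * ev (point i j t) b)%:C =
    (tform (point i j t) nu eta)%:C - sigma%:~R * (ev (point i j t) b)%:C.
    by move: (tform _ _ _) (ev _ b) => u1 u2; rewrite rmorphB rmorphM rmorph_int.
  by rewrite -E wE addrK.
have [ds n1 n2 _] := key _ (or_introl erefl).
have [h1 h2] : gap sigma nu eta d b i = 0 /\ gap sigma nu eta d b j = 0; last by split.
by apply: (gap_zero (R := R) es ij) => t ht; have [] := key _ ht.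
Qed.

Lemma active_diff i j a a' : ~~ insites v a -> ~~ insites v a' -> active i j a a' ->
  exists2 e, is_sign e & forall q, sg a' * L a' 0 q = sg a * L a 0 q -
    e * ((q == j)%:R + (if sg a == sg a' then -1 else 1) * (q == i)%:R).
Proof.
move=> aS aS' h; have sa := is_sign_sg good N_large hx hl aS.
have [_ [[e es [-> ->]]|[-> ->]]] := active_labels hl aS aS' h.
  exists (- (sg a * e)) => [|q].
    by rewrite -mulN1r; apply: is_signM; [right|apply: is_signM].
  by rewrite eqxx !mxE eqxx /=; ring.
exists (sg a) => // q.
have -> : (sg a == - sg a) = false by case: sa => ->.
by rewrite !mxE eqxx /=; ring.
Qed.

(** A nonreal eigenvalue on one side requires one on the other, so both blocks belong to the same
    mark and are of the same kind, and by [root_sum] their half traces are resonant. It remains to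
    split the traces into single diagonal entries. *)
Lemma two_two sigma nu eta s s' i j a a' b b' : is_sign sigma ->
  component s -> component s' -> resonant sigma nu eta s s' ->
  {subset s <= [:: a; a']} -> {subset s' <= [:: b; b']} ->
  a \in s -> a' \in s -> b \in s' -> b' \in s' -> active i j a a' ->
  active i j b b' /\ exists2 b1, b1 \in s' &
    gap sigma nu eta a b1 i = 0 /\ gap sigma nu eta a b1 j = 0.
Proof.
move=> ss cs cs' res sub sub' as_ as' bs bs' act; have [us hs] := cs; have [us' hs'] := cs'.
have [ij _] := active_labels hl (hs _ as_) (hs _ as') act.
have sub3 : {subset s <= [:: a; a'; a]}.
  by move=> y /sub; rewrite !inE => /orP[] ->; rewrite ?orbT.
have sub3' : {subset s' <= [:: b; b'; b]}.
  by move=> y /sub'; rewrite !inE => /orP[] ->; rewrite ?orbT.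
pose same := sg a == sg a'; pose e := nonreal_sign same.
have es : is_sign e by rewrite /e /nonreal_sign; case: ifP => _; [right|left].
have key (t : R) : t = e%:~R \/ t = (2 * e)%:~R -> [/\ active i j b b', (sg b == sg b') = same
   & (ev (point i j t) a + ev (point i j t) a') / 2 +
     sigma%:~R * ((ev (point i j t) b + ev (point i j t) b') / 2) = tform (point i j t) nu eta].
  move=> ht; have [z [w [rz rw E]]] := res (point i j t).
  have nonreal_z (y : R) : z <> y%:C /\
      (z - ((ev (point i j t) a + ev (point i j t) a') / 2)%:C) ^+ 2 = (pair_disc same t)%:C.
    have [a1 a1s [[_ nact]|[a2 a2s [h zE]]]] := spectrum_pair_point good N_large hx hl cs ij rz.
      have := sub _ a1s; rewrite !inE => /orP[] /eqP e1; subst.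
        by have := nact _ as'; rewrite active_sym act.
      by have := nact _ as_; rewrite act.
    rewrite (matched_pair hs sub3 as_ as' act a1s a2s h) in zE.
    split; first exact: (nonreal_root (pair_disc_lt0 ht) zE).
    have ne := active_neq good N_large hx hl (hs _ a2s) (hs _ a1s) h.
    move: (sub _ a1s) (sub _ a2s) ne zE; rewrite !inE.
    case/orP => /eqP ->; case/orP => /eqP ->; rewrite ?eqxx // => _.
    by rewrite [ev _ a' + _]addrC.
  have w_nonreal (y : R) : w <> y%:C.
    move=> wE; case: (nonreal_z (tform (point i j t) nu eta - sigma%:~R * y)) => nz _; apply: nz.
    rewrite rmorphB rmorphM rmorph_int /= -E wE addrK //.
  have [b1 b1s [[wE _]|[b2 b2s [h wE]]]] := spectrum_pair_point good N_large hx hl cs' ij rw.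
    by case: (w_nonreal _ wE).
  have ne := active_neq good N_large hx hl (hs' _ b2s) (hs' _ b1s) h.
  have [act' wE'] : active i j b b' /\
     (w - ((ev (point i j t) b + ev (point i j t) b') / 2)%:C) ^+ 2 = (pair_disc (sg b == sg b') t)%:C.
    move: (sub' _ b1s) (sub' _ b2s) ne h wE; rewrite !inE.
    case/orP => /eqP ->; case/orP => /eqP ->; rewrite ?eqxx // => _ h wE.
      by rewrite active_sym h; split=> //; rewrite [ev _ b + _]addrC [sg b == _]eq_sym.
  have sE : (sg b == sg b') = same.
    have [//|ne'] := eqVneq (sg b == sg b') same.
    have sE : (sg b == sg b') = ~~ same by move: ne'; case: (sg b == _); case: (same).
    have := pair_disc_ge0 ht; rewrite sE in wE'; move=> d0.
    by have [y /w_nonreal] := real_root d0 wE'.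
  rewrite sE in wE'; have [_ zE] := nonreal_z 0.
  split=> //; exact: root_sum ss (pair_disc_lt0 ht) zE wE' E.
have [actb sb _] := key _ (or_introl erefl); split=> //.
have [e1 e1s d1] := active_diff (hs _ as_) (hs _ as') act.
have [e2 e2s d2] := active_diff (hs' _ bs) (hs' _ bs') actb.
rewrite sb in d2; rewrite -/same in d1.
have pairing b1 b2 : b1 \in s' ->
    (forall t : R, ev (point i j t) b1 + ev (point i j t) b2 = ev (point i j t) b + ev (point i j t) b') ->
    (forall q, gap sigma nu eta a b1 q = gap sigma nu eta a' b2 q) ->
    exists2 b1, b1 \in s' & gap sigma nu eta a b1 i = 0 /\ gap sigma nu eta a b1 j = 0.
  move=> b1s sumE gE; exists b1 => //.
  apply: (gap_zero (R := R) es ij) => t ht.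
  have [_ _ E] := key _ ht; move: E; rewrite -sumE => E.
  have G1 := gapE sg L sigma nu eta (point i j t) a b1.
  have G2 := gapE sg L sigma nu eta (point i j t) a' b2.
  have G : ev (point i j t) a + sigma%:~R * ev (point i j t) b1 =
           ev (point i j t) a' + sigma%:~R * ev (point i j t) b2.
    apply: (addIr (- tform (point i j t) nu eta)); rewrite G1 G2.
    by apply: eq_bigr => q _; rewrite gE.
  rewrite -E; move: (ev _ a) (ev _ a') (ev _ b1) (ev _ b2) G => u1 u2 u3 u4 G.
  have -> : u1 = (u2 + sigma%:~R * u4) - sigma%:~R * u3 by rewrite -G addrK.
  by field.
(* Depending on the relative orientation of the edges, (a, b) and (a', b') have the same gap, or (a,
   b') and (a', b) do; the half traces make this common gap vanish on the mark. *)
have [eq12|ne12] := eqVneq e1 (- sigma * e2).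
  apply: (pairing b b' bs) => // q; rewrite /gap d1 d2 eq12; ring.
have e12 : e1 = sigma * e2.
  by case: e1s ne12 => ->; case: e2s => ->; case: ss => ->.
apply: (pairing b' b bs') => [t|q]; first by rewrite addrC.
rewrite /gap d1 d2 e12; ring.
Qed.

End SmallGaps.

Lemma even_diff (z1 z2 z3 : int) : (2 %| z1 + z2)%Z -> (2 %| z1 + z3)%Z -> (2 %| z2 + z3)%Z.
Proof. lia. Qed.

Lemma parity_pair (z1 z2 z3 : int) (b1 b2 b3 b4 : bool) :
  (2 %| z1 + z3)%Z -> (2 %| z1 + z2 + (b1 + b2)%:Z)%Z -> (2 %| z2 + z3 + (b3 + b4)%:Z)%Z ->
  (2 %| (b1 + b2 + (b3 + b4))%:Z)%Z.
Proof. by case: b1; case: b2; case: b3; case: b4; lia. Qed.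

Section SmallResonances.
Variables (R : realType) (m p : nat).
Local Notation n := p.+1.
Variables (N : nat) (v : 'M[int]_(m, n)).
Hypotheses (good : good_labels N v) (N_large : (2 * diameter p + 2 <= N)%N).
Variables (x : 'rV[int]_n -> 'rV[int]_n) (sg : 'rV[int]_n -> int) (L : 'rV[int]_n -> 'rV[int]_m).
Hypotheses (hx : root_choice v x) (hl : labels v x sg L) (m_gt0 : (0 < m)%N).
Implicit Types (a b k : 'rV[int]_n) (s T : seq 'rV[int]_n) (nu : 'rV[int]_m) (eta sigma : int).
Local Notation active := (active v).
Local Notation resonant := (@resonant R m p v sg L).
Local Notation gap := (@gap m p sg L).

Lemma comp_step k s T a : ~~ insites v k -> comp_enum v k s -> a \in T -> uniq T ->
  {subset T <= s} -> (size T < size s)%N ->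
  exists z z', [/\ z \in T, z' \in s, z' \notin T & adj v z z'].
Proof.
move=> kS ks aT uT sub lt; have [us hs] := ks.
have /allPn[w ws wT] : ~~ all (mem T) s.
  apply/negP => /allP sT; have := uniq_leq_size us sT; by rewrite leqNgt lt.
have caw : same_comp v a w.
  by apply: same_comp_trans (same_comp_sym (proj1 (hs a) (sub _ aT))) (proj1 (hs w) ws).
have [z [z' [zT z'T zz' c]]] := comp_exit caw aT wT; exists z, z'; split=> //.
by apply/hs; apply: same_comp_trans (proj1 (hs a) (sub _ aT)) c.
Qed.

Lemma subset_cover s T : uniq T -> {subset T <= s} -> (size s <= size T)%N -> {subset s <= T}.
Proof. by move=> uT sub le y; have [_ ->] := uniq_min_size uT sub le. Qed.

Lemma comp_path3 k s : ~~ insites v k -> comp_enum v k s -> size s = 3%N ->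
  exists e1 c e2, [/\ uniq [:: e1; c; e2], {subset s <= [:: e1; c; e2]},
    {subset [:: e1; c; e2] <= s}, adj v e1 c & adj v c e2].
Proof.
move=> kS ks sz; have [us kks _ _] := comp_enumP hx kS ks.
have sub1 : {subset [:: k] <= s} by move=> y; rewrite inE => /eqP ->.
have [|z [b [zk bs bk ab]]] := comp_step kS ks (mem_head k [::]) isT sub1; first by rewrite sz.
move: zk bk ab; rewrite !inE => /eqP -> bk kb.
have u2 : uniq [:: k; b] by rewrite /= inE eq_sym bk.
have sub2 : {subset [:: k; b] <= s} by move=> y; rewrite !inE => /orP[] /eqP ->.
have [|z' [c [zkb cs cT zc]]] := comp_step kS ks (mem_head k _) u2 sub2; first by rewrite sz.
have u3 : uniq [:: c; k; b] by rewrite /= -/(uniq [:: k; b]) cT.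
have sub3 : {subset [:: c; k; b] <= s}.
  by move=> y; rewrite inE => /predU1P[->|/sub2].
have cov3 := subset_cover u3 sub3 (eq_leq sz).
move: zkb zc; rewrite !inE => /orP[] /eqP -> zc.
  by exists c, k, b; split=> //; rewrite adj_sym.
exists k, b, c; split=> //.
- move: u3; rewrite /= !inE !negb_or => /and3P[/andP[n1 n2] n3 _].
  by rewrite n3 [k == c]eq_sym n1 [b == c]eq_sym n2.
- by move=> y /cov3; rewrite !inE => /or3P[] ->; rewrite ?orbT.
- by move=> y yT; apply: sub3; move: yT; rewrite !inE => /or3P[] ->; rewrite ?orbT.
Qed.

Lemma active_parity_at i j a b q : ~~ insites v a -> ~~ insites v b -> active i j a b ->
  (2 %| L a 0%R q + L b 0%R q + ((q == i) + (q == j))%:Z)%Z.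
Proof.
move=> aS bS h; have := active_parity hl aS bS h q.
by rewrite !mxE /=; case: (q == i); case: (q == j).
Qed.

Lemma gap_even sigma nu eta a b q : is_sign sigma -> ~~ insites v a -> ~~ insites v b ->
  gap sigma nu eta a b q = 0 -> (2 %| nu 0%R q + L a 0%R q + L b 0%R q)%Z.
Proof.
move=> ss aS bS; rewrite /gap.
have sa := is_sign_sg good N_large hx hl aS; have sb := is_sign_sg good N_large hx hl bS.
move: (nu 0 q) (L a 0 q) (L b 0 q) => u1 u2 u3.
by case: sa => ->; case: sb => ->; case: ss => ->; clear; lia.
Qed.

Lemma same_pair (i j k l : 'I_m) : k != l ->
  (2 %| ((k == i) + (k == j) + ((k == k) + (k == l)))%:Z)%Z ->
  (2 %| ((l == i) + (l == j) + ((l == k) + (l == l)))%:Z)%Z ->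
  i != j -> (k = i /\ l = j) \/ (k = j /\ l = i).
Proof.
move=> kl h1 h2 ij; rewrite eqxx (negbTE kl) in h1.
rewrite eqxx [l == k]eq_sym (negbTE kl) in h2.
have : (k == i) || (k == j) by move: h1; case: (k == i); case: (k == j).
have : (l == i) || (l == j) by move: h2; case: (l == i); case: (l == j).
by move=> /orP[] /eqP el /orP[] /eqP ek; move: kl; rewrite el ek ?eqxx //; auto.
Qed.

Lemma active_same (i j k l : 'I_m) a b : (k = i /\ l = j) \/ (k = j /\ l = i) ->
  active k l a b -> active i j a b.
Proof. by case=> -[-> ->] //; rewrite activeC. Qed.

(** The sizes are 1 + 1, 2 + 1, 2 + 2 or 3 + 1. Points supported on the mark of an edge exclude 2 +
    1 and determine the coefficients of the mark otherwise; off the mark both ends of the edge have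
    the same diagonal coefficients, and the axes suffice. *)
Lemma small_gap sigma nu eta kA sA kB sB a0 b0 : is_sign sigma ->
  ~~ insites v kA -> comp_enum v kA sA -> ~~ insites v kB -> comp_enum v kB sB ->
  resonant sigma nu eta sA sB -> a0 \in sA -> b0 \in sB -> even_vec (nu + L a0 + L b0) ->
  (size sA + size sB <= 4)%N -> (size sB <= size sA)%N ->
  exists a b, [/\ a \in sA, b \in sB & forall q, gap sigma nu eta a b q = 0].
Proof.
move=> ss kAS cA kBS cB res a0s b0s ev sz le.
have [uA kA_s hA xA] := comp_enumP hx kAS cA; have [uB kB_s hB xB] := comp_enumP hx kBS cB.
have cA' : component v sA by []. have cB' : component v sB by [].
have axis q := resonant_axis q cA' cB' res.
have B1 : size sB = 1%N -> {subset sB <= [:: b0]}.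
  by move=> h; apply: subset_cover; rewrite ?h // => y; rewrite inE => /eqP ->.
have adj2 k s : ~~ insites v k -> comp_enum v k s -> size s = 2%N -> exists a' i j,
    [/\ {subset s <= [:: k; a']}, k \in s, a' \in s & active i j k a'].
  move=> kS ks h; have [us ks' hs _] := comp_enumP hx kS ks.
  have sub1 : {subset [:: k] <= s} by move=> y; rewrite inE => /eqP ->.
  have [|z [b [zk bs bk ab]]] := comp_step kS ks (mem_head k [::]) isT sub1; first by rewrite h.
  move: zk bk ab; rewrite !inE => /eqP -> bk /adj_active[i [j [_ act]]].
  exists b, i, j; split=> //; apply: subset_cover; rewrite ?h //= ?inE 1?eq_sym ?bk //.
  by move=> y; rewrite !inE => /orP[] /eqP ->.
have sA0 : (0 < size sA)%N by case: (sA) a0s.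
have sB0 : (0 < size sB)%N by case: (sB) b0s.
have [szA|[szA|[szA|szA]]] : size sA = 1%N \/ size sA = 2%N /\ size sB = 1%N \/
    size sA = 2%N /\ size sB = 2%N \/ size sA = 3%N /\ size sB = 1%N by lia.
- have szB : size sB = 1%N by lia.
  have A1 : {subset sA <= [:: a0]}.
    by apply: subset_cover; rewrite ?szA // => y; rewrite inE => /eqP ->.
  exists a0, b0; split=> // q; have [a [b [/A1 + /(B1 szB) +]]] := axis q.
  by rewrite !inE => /eqP -> /eqP ->.
- have [a' [i [j [sub as_ as' act]]]] := adj2 _ _ kAS cA szA.1.
  have sub3 : {subset sA <= [:: kA; a'; kA]}.
    by move=> y /sub; rewrite !inE => /orP[] ->; rewrite ?orbT.
  have [_] := single_pair good N_large hx hl ss cA' cB' res (B1 szA.2) sub3 as_ as' act.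
  by rewrite eqxx.
- have [a' [i [j [sub as_ as' act]]]] := adj2 _ _ kAS cA szA.1.
  have [b' [i' [j' [sub' bs bs' act']]]] := adj2 _ _ kBS cB szA.2.
  have [actB [b1 b1s [g1 g2]]] := two_two good N_large hx hl ss cA' cB' res sub sub' as_ as' bs bs' act.
  exists kA, b1; split=> // q.
  have [->//|qi] := eqVneq q i; have [->//|qj] := eqVneq q j.
  have [a2 [b2 [a2s b2s <-]]] := axis q; rewrite /gap.
  have eA : sg a2 * L a2 0 q = sg kA * L kA 0 q.
    have := sub _ a2s; rewrite !inE => /orP[] /eqP -> //.
    exact: (active_sgL hl (hA _ as_) (hA _ as') act).
  have eB c : c \in sB -> sg c * L c 0 q = sg kB * L kB 0 q.
    move=> /sub'; rewrite !inE => /orP[] /eqP -> //.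
    exact: (active_sgL hl (hB _ bs) (hB _ bs') actB).
  by rewrite eA (eB b1) // (eB b2).
have [e1 [c [e2 [u3 cov sub3 /adj_active[i [j [ij act1]]] /adj_active[k [l [kl act2]]]]]]] :=
  comp_path3 kAS cA szA.1.
have e1s : e1 \in sA by apply: sub3; rewrite !inE eqxx.
have cs : c \in sA by apply: sub3; rewrite !inE eqxx !orbT.
have e2s : e2 \in sA by apply: sub3; rewrite !inE eqxx !orbT.
have e12 : e1 != e2 by move: u3; rewrite /= !inE negb_or => /and3P[/andP[]].
(* On the path e1, c, e2 each edge makes the vertex opposite to it resonant on its mark. *)
have [_ _ _ g2i g2j] := single_pair good N_large hx hl ss cA' cB' res (B1 szA.2) cov e1s cs act1.
have cov' : {subset sA <= [:: c; e2; e1]}.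
  by move=> y /cov; rewrite !inE => /or3P[] ->; rewrite ?orbT.
have [_ _ _ g1k g1l] := single_pair good N_large hx hl ss cA' cB' res (B1 szA.2) cov' cs e2s act2.
have distinct : ~ ((k = i /\ l = j) \/ (k = j /\ l = i)).
  move=> h; have act2' := active_same h act2; rewrite active_sym in act1.
  by move/eqP: e12; apply; apply: (active_unique good N_large (hA _ cs) act1 act2').
have par1 q := active_parity_at q (hA _ e1s) (hA _ cs) act1.
have par2 q := active_parity_at q (hA _ cs) (hA _ e2s) act2.
have evq q : (2 %| (nu 0%R q + L b0 0%R q) + L a0 0%R q)%Z.
  by have := ev q; rewrite !mxE addrAC.
have gev a q : a \in sA -> gap sigma nu eta a b0 q = 0 ->
    (2 %| (nu 0%R q + L b0 0%R q) + L a 0%R q)%Z.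
  by move=> as_ /(gap_even ss (hA _ as_) (hB _ b0s)); rewrite addrAC.
(* If the even partner of [b0] is an end of the path, it is congruent to the other end, and the two
   edges at [c] would carry the same mark. *)
exists c, b0; split=> //; have := cov _ a0s; rewrite !inE => /or3P[] /eqP a0E; subst a0; last 1 first.
- case: distinct; apply: same_pair => //.
    exact: parity_pair (even_diff (gev _ _ e1s g1k) (evq k)) (par1 k) (par2 k).
  exact: parity_pair (even_diff (gev _ _ e1s g1l) (evq l)) (par1 l) (par2 l).
- case: distinct; have [|||[<- <-]|[<- <-]] := @same_pair k l i j ij; [| |by []|by left|by right].
    by rewrite addnC; apply: parity_pair (even_diff (evq i) (gev _ _ e2s g2i)) (par1 i) (par2 i).
  by rewrite addnC; apply: parity_pair (even_diff (evq j) (gev _ _ e2s g2j)) (par1 j) (par2 j).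
(* With [c] as even partner the two marks are disjoint, so the gap of [c] can be replaced by that of
   [e2] on the first mark and by that of [e1] on the second. *)
have off q : gap sigma nu eta e2 b0 q = 0 -> (q != k) && (q != l).
  move=> g; have := even_diff (evq q) (gev _ _ e2s g); have := par2 q.
  have [->|_] := eqVneq q k; first by rewrite (negbTE kl); clear; lia.
  by case: (q == l) => //=; clear; lia.
have /andP[ik il] := off i g2i; have /andP[jk jl] := off j g2j.
have ce2 q : q != k -> q != l -> gap sigma nu eta c b0 q = gap sigma nu eta e2 b0 q.
  by move=> qk ql; rewrite /gap (active_sgL hl (hA _ cs) (hA _ e2s) act2 qk ql).
have ce1 q : q != i -> q != j -> gap sigma nu eta c b0 q = gap sigma nu eta e1 b0 q.
  by move=> qi qj; rewrite /gap (active_sgL hl (hA _ e1s) (hA _ cs) act1 qi qj).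
move=> q; have [->|qi] := eqVneq q i; first by rewrite ce2.
have [->|qj] := eqVneq q j; first by rewrite ce2.
have [->|qk] := eqVneq q k; first by rewrite ce1 // eq_sym.
have [->|ql] := eqVneq q l; first by rewrite ce1 // eq_sym.
have [a [b [/cov + /(B1 szA.2) +]]] := axis q; rewrite !inE => + /eqP ->.
by case/or3P => /eqP -> g; [rewrite ce1|exact: g|rewrite ce2].
Qed.

(** After a swap the larger component comes first; the vanishing gaps identify, by [gap_eq0], a
    vertex of one component with a vertex of the other. *)
Lemma no_small_resonance sigma nu eta kA sA kB sB a0 b0 : is_sign sigma ->
  ~~ insites v kA -> comp_enum v kA sA -> ~~ insites v kB -> comp_enum v kB sB ->
  x kA != x kB -> lab v (x kB) (- sigma) (- nu) (x kA) -> eta = mass nu + 1 + sigma ->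
  resonant sigma nu eta sA sB -> a0 \in sA -> b0 \in sB -> even_vec (nu + L a0 + L b0) ->
  (size sA + size sB <= 4)%N -> False.
Proof.
move=> ss kAS cA kBS cB ne hlab he res a0s b0s ev sz.
have [uA kA_s hA xA] := comp_enumP hx kAS cA; have [uB kB_s hB xB] := comp_enumP hx kBS cB.
have [a [b [as_ bs g]]] : exists a b,
    [/\ a \in sA, b \in sB & forall q, gap sigma nu eta a b q = 0].
  have [le|/ltnW le] := leqP (size sB) (size sA); first exact: (small_gap ss kAS cA kBS cB res a0s b0s ev sz le).
  have ev' : even_vec (sigma *: nu + L b0 + L a0).
    move=> q; have := ev q; rewrite !mxE; move: (nu 0 q) (L a0 0 q) (L b0 0 q) => u1 u2 u3.
    by case: ss => ->; clear; lia.
  rewrite addnC in sz.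
  have [b [a [bs as_ g]]] := small_gap ss kBS cB kAS cA (resonant_swap ss res) b0s a0s ev' sz le.
  exists a, b; split=> // q; have := g q; rewrite gap_swap // => /eqP.
  by rewrite mulf_eq0 => /orP[|/eqP //]; case: ss => ->.
have aS := hA _ as_; have bS := hB _ bs.
rewrite -(xA _ as_) -(xB _ bs) in hlab ne.
by rewrite (gap_eq0 good N_large hx hl m_gt0 ss aS bS hlab he g) eqxx in ne.
Qed.

End SmallResonances.

(** * Components with labels congruent modulo 2 *)

Section EvenPairs.
Variables (m p : nat).
Local Notation n := p.+1.
Variables (N : nat) (v : 'M[int]_(m, n)).
Hypotheses (good : good_labels N v) (N_large : (2 * diameter p + 2 <= N)%N).
Variables (x : 'rV[int]_n -> 'rV[int]_n) (sg : 'rV[int]_n -> int) (L : 'rV[int]_n -> 'rV[int]_m).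
Hypotheses (hx : root_choice v x) (hl : labels v x sg L).
Variable N' : nat.
Hypothesis nc : no_even_config N' v.
Implicit Types (a b k : 'rV[int]_n) (s T : seq 'rV[int]_n) (nu : 'rV[int]_m) (sigma : int).
Local Notation active := (active v).

(** Composition with the label [- nu] between the roots refers the first component to the root of
    the second, and [config_bound] applies to the union. *)
Lemma size_bound_two sigma nu kA sA kB sB a0 b0 K : is_sign sigma ->
  ~~ insites v kA -> comp_enum v kA sA -> ~~ insites v kB -> comp_enum v kB sB ->
  x kA != x kB -> lab v (x kB) (- sigma) (- nu) (x kA) ->
  bounded K nu -> (K + diameter p <= N')%N ->
  a0 \in sA -> b0 \in sB -> even_vec (nu + L a0 + L b0) -> (size sA + size sB <= 4)%N.
Proof.
move=> ss kAS cA kBS cB ne hlab bnu KN a0s b0s ev.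
have [uA kA_s hA xA] := comp_enumP hx kAS cA; have [uB kB_s hB xB] := comp_enumP hx kBS cB.
have [_ l2 l3] := hl.
have dis a : a \in sB -> a \notin sA.
  by move=> /xB e; apply: contraNN ne => /xA; rewrite e => ->.
have cross a b : a \in sA ++ sB -> b \in sA ++ sB -> adj v a b -> (a \in sA) = (b \in sA).
  move=> aV bV ab; have hS c : c \in sA ++ sB -> ~~ insites v c.
    by rewrite mem_cat => /orP[/hA|/hB].
  have : x b = x a by have [_ ->] := hx (hS _ aV) => //; apply: same_comp_adj.
  move: aV bV; rewrite !mem_cat; case: (boolP (a \in sA)) => aA; case: (boolP (b \in sA)) => bA //=.
    by move=> _ /xB -> /esym; rewrite (xA _ aA) => e; rewrite e eqxx in ne.
  by move=> /xB -> _; rewrite (xA _ bA) => e; rewrite e eqxx in ne.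
pose st y := if y \in sA then sg y * - sigma else sg y.
pose M y := if y \in sA then sg y *: - nu + L y else L y.
rewrite -size_cat; apply: (@config_bound m p v N' (sA ++ sB) (x kB) st M a0 b0 nc).
- rewrite cat_uniq uA uB andbT /=; apply/hasPn => y /dis; by rewrite /= => ->.
- move=> y; rewrite mem_cat /st /M; case: (boolP (y \in sA)) => [yA _|_ /= yB].
    have [h1 _ h3 h4] := labels_plab good N_large hx hl (hA _ yA); split.
    + by apply: is_signM => //; case: ss => ->; [right|left].
    + by apply: (bounded_leq KN); apply: boundedD h3; apply/boundedS/boundedN.
    + by apply: lab_comp hlab _; rewrite -(xA _ yA).
  have [h1 _ h3 h4] := labels_plab good N_large hx hl (hB _ yB); split=> //.
    by apply: bounded_leq h3; apply: leq_trans KN; apply: leq_addl.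
  by rewrite -(xB _ yB).
- move=> i j a b aV bV h; have hS c : c \in sA ++ sB -> ~~ insites v c.
    by rewrite mem_cat => /orP[/hA|/hB].
  have ab := marked_adj (hS _ aV) (hS _ bV) (introT orP (or_introl h)).
  have [s1 s2] := l2 _ _ _ _ (hS _ aV) (hS _ bV) h.
  by rewrite /st /M (cross _ _ aV bV ab); case: ifP => _; rewrite s1 s2 ?addrA.
- move=> i j a b aV bV h; have hS c : c \in sA ++ sB -> ~~ insites v c.
    by rewrite mem_cat => /orP[/hA|/hB].
  have ab := marked_adj (hS _ aV) (hS _ bV) (introT orP (or_intror h)).
  have [s1 s2] := l3 _ _ _ _ (hS _ aV) (hS _ bV) h.
  rewrite /st /M (cross _ _ aV bV ab); case: ifP => _; rewrite s1 s2 //.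
  by rewrite mulNr scaleNr opprD addrCA addrC.
- by rewrite mem_cat a0s.
- by rewrite mem_cat b0s orbT.
- by apply: contraTneq b0s => <-; apply/negP => /dis; rewrite a0s.
- rewrite /M a0s (negbTE (dis _ b0s)) => q; have := ev q; rewrite !mxE.
  move: (nu 0 q) (L a0 0 q) (L b0 0 q) => u1 u2 u3.
  by case: (is_sign_sg good N_large hx hl (hA _ a0s)) => ->; clear; lia.
- move=> T sub aT bT lt uT.
  have /allPn[w wV wT] : ~~ all (mem T) (sA ++ sB).
    by apply/negP => /allP sT; have := uniq_leq_size _ sT; rewrite leqNgt lt => /(_ _)/negP[] //;
      rewrite cat_uniq uA uB andbT /=; apply/hasPn => y /dis /= ->.
  have [hsA hsB] := (proj2 cA, proj2 cB).
  move: wV; rewrite mem_cat => /orP[wA|wB].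
    have c := same_comp_trans (same_comp_sym (proj1 (hsA a0) a0s)) (proj1 (hsA w) wA).
    have [z [z' [zT z'T zz' c']]] := comp_exit c aT wT; exists z, z'; split=> //.
    rewrite mem_cat; apply/orP; left; apply/hsA.
    exact: same_comp_trans (proj1 (hsA a0) a0s) c'.
  have c := same_comp_trans (same_comp_sym (proj1 (hsB b0) b0s)) (proj1 (hsB w) wB).
  have [z [z' [zT z'T zz' c']]] := comp_exit c bT wT; exists z, z'; split=> //.
  rewrite mem_cat; apply/orP; right; apply/hsB.
  exact: same_comp_trans (proj1 (hsB b0) b0s) c'.
Qed.

Lemma size_bound_one k s a0 b0 : ~~ insites v k -> comp_enum v k s -> (diameter p <= N')%N ->
  a0 \in s -> b0 \in s -> a0 != b0 -> even_vec (L a0 + L b0) -> (size s <= 4)%N.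
Proof.
move=> kS ks DN a0s b0s ab ev; have [us kks hs xs] := comp_enumP hx kS ks; have [_ l2 l3] := hl.
apply: (config_bound (z0 := x k) (s := sg) (M := L) nc us _ _ _ a0s b0s ab ev).
- move=> y ys; have [h1 _ h3 h4] := labels_plab good N_large hx hl (hs _ ys); split=> //.
    exact: bounded_leq h3.
  by rewrite -(xs _ ys).
- by move=> i j a b as_ bs; apply: l2; apply: hs.
- by move=> i j a b as_ bs; apply: l3; apply: hs.
- by move=> T sub aT _ lt uT; apply: (comp_step kS ks aT uT sub lt).
Qed.

(** The two vertices are not adjacent, since the sum of the labels across an edge is odd on its
    mark, and have no common neighbour, since its two edges would carry the same mark. With at most
    four vertices and connectedness only a path of length three remains. *)
Lemma even_path k s a0 b0 : ~~ insites v k -> comp_enum v k s -> (diameter p <= N')%N ->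
  a0 \in s -> b0 \in s -> a0 != b0 -> even_vec (L a0 + L b0) ->
  exists c d (i j i' j' k' l' : 'I_m), [/\ uniq [:: a0; c; d; b0], s =i [:: a0; c; d; b0],
    active i j a0 c, active i' j' c d & active k' l' d b0].
Proof.
move=> kS ks DN a0s b0s ab ev; have sz := size_bound_one kS ks DN a0s b0s ab ev.
have [us kks hs xs] := comp_enumP hx kS ks.
have pair0 i j a b : a \in s -> b \in s -> active i j a b -> ~ even_vec (L a + L b).
  move=> as_ bs h e; have := active_parity_at hl i (hs _ as_) (hs _ bs) h.
  have [ij _] := active_labels hl (hs _ as_) (hs _ bs) h.
  have := e i; rewrite mxE eqxx (negbTE ij); move: (L a 0 i) (L b 0 i) => u1 u2; clear; lia.
have nopair a b : a \in s -> b \in s -> even_vec (L a + L b) -> ~~ adj v a b.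
  by move=> as_ bs e; apply/negP => /adj_active[i [j [_ h]]]; apply: (pair0 _ _ _ _ as_ bs h e).
have nocommon c : c \in s -> adj v a0 c -> adj v c b0 -> False.
  move=> cs /adj_active[i [j [ij h1]]] /adj_active[k' [l' [kl h2]]].
  have par q := active_parity_at hl q (hs _ a0s) (hs _ cs) h1.
  have par' q := active_parity_at hl q (hs _ cs) (hs _ b0s) h2.
  have evq q : (2 %| L a0 0%R q + L b0 0%R q)%Z by have := ev q; rewrite mxE.
  have E := same_pair kl (parity_pair (evq k') (par k') (par' k'))
    (parity_pair (evq l') (par l') (par' l')) ij.
  have h2' := active_same E h2; rewrite active_sym in h1.
  by move/eqP: ab; apply; apply: (active_unique good N_large (hs _ cs) h1 h2').
have sub1 y : y \in s -> {subset [:: y] <= s} by move=> ys z; rewrite inE => /eqP ->.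
have s2 : (2 <= size s)%N.
  apply: (uniq_leq_size (s1 := [:: a0; b0])); first by rewrite /= inE ab.
  by move=> y; rewrite !inE => /orP[] /eqP ->.
have [|z [c [za cs ca ac]]] := comp_step kS ks (mem_head a0 [::]) isT (sub1 _ a0s); first exact: s2.
move: za ca ac; rewrite !inE => /eqP -> ca ac.
have [|z' [d [zb ds db bd]]] := comp_step kS ks (mem_head b0 [::]) isT (sub1 _ b0s); first exact: s2.
move: zb db bd; rewrite !inE => /eqP -> db bd; rewrite adj_sym in bd.
have cb : c != b0.
  by apply: contraTneq ac => ->; apply: nopair.
have da : d != a0.
  by apply: contraTneq bd => ->; apply: nopair.
have cd : c != d by apply/eqP => cd; rewrite -cd in bd; apply: nocommon ac bd.
have u4 : uniq [:: a0; c; d; b0].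
  by rewrite /= !inE !negb_or ab [a0 == c]eq_sym ca [a0 == d]eq_sym da cd cb db.
have sub4 : {subset [:: a0; c; d; b0] <= s}.
  by move=> y; rewrite !inE => /or4P[] /eqP ->.
have cov := subset_cover u4 sub4 sz.
have acd : adj v c d.
  have u2 : uniq [:: a0; c] by rewrite /= inE eq_sym ca.
  have sub2 : {subset [:: a0; c] <= s} by move=> y; rewrite !inE => /orP[] /eqP ->.
  have [|w [w' [wT ws w'T ww]]] := comp_step kS ks (mem_head a0 _) u2 sub2.
    by apply: leq_trans (uniq_leq_size u4 sub4).
  move: wT w'T (cov _ ws) ww; rewrite !inE negb_or => hw /andP[n1 n2].
  rewrite (negbTE n1) (negbTE n2) /= => hw'.
  case/orP: hw => /eqP ->; case/orP: hw' => /eqP -> // h; exfalso.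
  - exact: (nocommon d).
  - by have := nopair _ _ a0s b0s ev; rewrite h.
  - exact: (nocommon c).
have /adj_active[i [j [_ h1]]] := ac; have /adj_active[i' [j' [_ h2]]] := acd.
have /adj_active[k' [l' [_ h3]]] := bd.
exists c, d, i, j, i', j', k', l'; split=> //.
by move=> y; apply/idP/idP; [apply: cov|apply: sub4].
Qed.

End EvenPairs.

(** * Nonvanishing of the discriminant and of the resultants *)

Section Separability.

Lemma sum_two (V : nmodType) (T : eqType) (s : seq T) (f : T -> V) a c : uniq s ->
  a \in s -> c \in s -> a != c -> (forall e, e != a -> e != c -> f e = 0) ->
  \sum_(e <- s) f e = f a + f c.
Proof.
move=> us as_ cs ac h; have ca : c \in rem a s by rewrite mem_rem_uniq // inE eq_sym ac.
rewrite (big_rem a as_) /= (big_rem c ca) /= big_seq big1 ?addr0 // => e es.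
have es' := mem_rem es; apply: h; first by apply: contraTneq es' => ->; rewrite mem_rem_uniqF.
by apply: contraTneq es => ->; rewrite mem_rem_uniqF // rem_uniq.
Qed.

Lemma sum_one (V : nmodType) (T : eqType) (s : seq T) (f : T -> V) a : uniq s ->
  a \in s -> (forall e, e != a -> f e = 0) -> \sum_(e <- s) f e = f a.
Proof.
move=> us as_ h; rewrite (big_rem a as_) /= big_seq big1 ?addr0 // => e es; apply: h.
by apply: contraTneq es => ->; rewrite mem_rem_uniqF.
Qed.

Lemma resultant_separable (K : idomainType) (rs : seq K) (P : {poly K}) :
  P = \prod_(r <- rs) ('X - r%:P) -> uniq rs -> resultant P (P + P^`()) != 0.
Proof.
move=> -> us; rewrite resultant_roots ?monic_add_deriv ?monic_prod_XsubC //.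
apply/hasPn => k ks; rewrite (big_rem k ks) /= rootE derivM derivXsubC mul1r !hornerD !hornerM.
rewrite hornerXsubC subrr !mul0r add0r addr0; apply/negP => /root_prodX[h hs e].
by move: hs; rewrite -e mem_rem_uniqF.
Qed.

End Separability.

Section Discriminant.
Variables (R : realType) (m p : nat).
Local Notation n := p.+1.
Variables (N : nat) (v : 'M[int]_(m, n)).
Hypotheses (good : good_labels N v) (N_large : (2 * diameter p + 2 <= N)%N).
Variables (x : 'rV[int]_n -> 'rV[int]_n) (sg : 'rV[int]_n -> int) (L : 'rV[int]_n -> 'rV[int]_m).
Hypotheses (hx : root_choice v x) (hl : labels v x sg L).
Variable N' : nat.
Hypotheses (nc : no_even_config N' v) (N'_large : (diameter p <= N')%N).
Implicit Types (a b k : 'rV[int]_n) (s T : seq 'rV[int]_n).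
Local Notation active := (active v).
Local Notation ev := (ev sg L).
Local Notation "z %:C" := (real_complex R z).
Local Notation point i j t := (@pair_point R m i j t).
Local Notation component := (component v).

Lemma point_support i j t q : q != i -> q != j -> sqrt_point (point i j t) 0 q = 0.
Proof. by move=> qi qj; rewrite !mxE (negbTE qi) (negbTE qj) rmorph0 sqrtC0. Qed.

Lemma unmatched_root s i j t e : component s -> e \in s -> (forall a, a \in s -> ~~ active i j a e) ->
  root (char_poly (smx v sg L (sqrt_point (point i j t)) s)) (ev (point i j t) e)%:C.
Proof.
move=> [us hs] es ina; apply: (eigenvector_root 0 (e := sentry v sg L (sqrt_point (point i j t))) (u := fun a => (a == e)%:R)).
  by exists e; rewrite // eqxx oner_neq0.
move=> b bs; rewrite (sum_one (a := e)) // => [|a /negbTE ->]; last by rewrite mul0r.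
rewrite eqxx mul1r; have [->|be] := eqVneq b e; first by rewrite sentry_diag mulr1.
rewrite mulr0; apply: (sentry_inactive _ _ (@point_support i j t)); first by rewrite eq_sym.
by rewrite active_sym; apply: ina.
Qed.

Lemma matched_root s i j (t : R) a c z : component s -> a \in s -> c \in s -> active i j a c -> t != 0 ->
  (z - ((ev (point i j t) a + ev (point i j t) c) / 2)%:C) ^+ 2 = (pair_disc (sg a == sg c) t)%:C ->
  root (char_poly (smx v sg L (sqrt_point (point i j t)) s)) z.
Proof.
move=> [us hs] as_ cs act t0 hz; have aS := hs _ as_; have cS := hs _ cs.
have [ij _] := active_labels hl aS cS act.
have ac := active_neq good N_large hx hl aS cS act.
have act' : active i j c a by rewrite active_sym.
have ca : c != a by rewrite eq_sym.
set y := sqrt_point _; pose w := y 0 i * y 0 j.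
have Eac : sentry v sg L y a c = 2 * (sg c)%:~R * w := sentry_active good N_large _ _ _ aS cS ac act.
have Eca : sentry v sg L y c a = 2 * (sg a)%:~R * w := sentry_active good N_large _ _ _ cS aS ca act'.
have w2 : w ^+ 2 = t%:C.
  by rewrite /w exprMn !mxE !sqrtCK !eqxx [j == i]eq_sym (negbTE ij) rmorph1 mul1r.
have w0 : w != 0.
  by apply: contraNneq t0 => w0; rewrite -(fmorph_eq0 (real_complex R)) /= -w2 w0 expr0n.
have sa := is_sign_sg good N_large hx hl aS; have sc := is_sign_sg good N_large hx hl cS.
(* Eigenvector of the block, from the equation at [a]. *)
pose u b : R[i] := if b == a then 2 * (sg a)%:~R * w else if b == c then z - (ev (point i j t) a)%:C else 0.
apply: (eigenvector_root 0 (e := sentry v sg L y) (u := u)).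
  exists a => //; rewrite /u eqxx; apply: mulf_neq0 => //; apply: mulf_neq0.
    by rewrite pnatr_eq0.
  exact: sign_neq0.
move=> b bs; rewrite (sum_two us as_ cs ac) => [|e ea ec]; last first.
  by rewrite /u (negbTE ea) (negbTE ec) mul0r.
rewrite /u eqxx (negbTE ca) eqxx.
have [->|ba] := eqVneq b a; first by rewrite sentry_diag Eca -/y; ring.
have inact d : d \in s -> d != b -> ~~ active i j d b -> sentry v sg L y d b = 0.
  by move=> _ db; apply: (sentry_inactive _ _ (@point_support i j t)).
have [->|bc] := eqVneq b c.
  rewrite Eac sentry_diag -/y.
  have D : (z - (ev (point i j t) a)%:C) * (z - (ev (point i j t) c)%:C) =
      4 * (sg a)%:~R * (sg c)%:~R * w ^+ 2.
    have E := active_ev_sq good N_large hx hl (point i j t) aS cS act.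
    have PD : pair_disc (sg a == sg c) t = (ev (point i j t) a - ev (point i j t) c) ^+ 2 / 4
        + 4 * (sg a)%:~R * (sg c)%:~R * t.
      rewrite E !mxE !eqxx [j == i]eq_sym (negbTE ij) /pair_disc; congr (_ + _).
      by case: sa => ->; case: sc => -> /=; rewrite ?mulrN1z; ring.
    move: hz; rewrite PD w2; move: (ev _ a) (ev _ c) => la lc hz.
    move: hz; rewrite !(rmorph_nat, rmorph_int, rmorphD, rmorphB, rmorphN, rmorphM, rmorphXn, fmorphV) /=.
    by move=> hz; apply: (eq_of_subr hz); field.
  by apply/esym; apply: (eq_of_subr D); ring.
rewrite !inact ?mulr0 ?addr0 ?mulr0 // 1?eq_sym //; apply/negP => h.
  by move/eqP: ba; apply; apply: (active_unique good N_large cS h act').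
by move/eqP: bc; apply; apply: (active_unique good N_large aS h act).
Qed.

(** Were the discriminant zero everywhere, the component would be a path a0, c, d, b0 as in
    [even_path]. At points supported on the mark of the first edge, a0 and c form a block with two
    distinct nonreal eigenvalues, while d and b0 are unmatched and have real ones. A point where the
    latter differ gives four distinct eigenvalues. *)
Lemma disc_nonvanishing k s : ~~ insites v k -> comp_enum v k s ->
  exists xi : 'rV[R]_m, disc v sg L s xi != 0.
Proof.
move=> kS ks; have [//|none] := pselect (exists xi : 'rV[R]_m, disc v sg L s xi != 0).
have van (xi : 'rV[R]_m) : disc v sg L s xi = 0.
  by apply/eqP/negPn/negP => h; apply: none; exists xi.
exfalso; have [us kks hs xs] := comp_enumP hx kS ks; have cs' : component s by [].
have [a0 [b0 [a0s b0s ab ev0]]] := disc_nonzero us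
  (fun a as_ => is_sign_sg good N_large hx hl (hs a as_)) van.
have [c [d [i [j [i' [j' [k' [l' [u4 E4 h1 h2 h3]]]]]]]]] :=
  even_path good N_large hx hl nc kS ks N'_large a0s b0s ab ev0.
have cs : c \in s by rewrite E4 !inE eqxx orbT.
have ds : d \in s by rewrite E4 !inE eqxx !orbT.
have evq q : (2 %| L a0 0%R q + L b0 0%R q)%Z by have := ev0 q; rewrite mxE.
have [ij _] := active_labels hl (hs _ a0s) (hs _ cs) h1.
have [ij' _] := active_labels hl (hs _ cs) (hs _ ds) h2.
have [kl' _] := active_labels hl (hs _ ds) (hs _ b0s) h3.
have p1 q := active_parity_at hl q (hs _ a0s) (hs _ cs) h1.
have p2 q := active_parity_at hl q (hs _ cs) (hs _ ds) h2.
have p3 q := active_parity_at hl q (hs _ ds) (hs _ b0s) h3.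
have sum3 (z1 z2 z3 z4 t1 t2 t3 : int) : (2 %| z1 + z4)%Z -> (2 %| z1 + z2 + t1)%Z ->
    (2 %| z2 + z3 + t2)%Z -> (2 %| z3 + z4 + t3)%Z -> (2 %| t1 + t2 + t3)%Z.
  by clear; lia.
(* The marks of the three edges add up to an even vector. *)
have tri q := sum3 _ _ _ _ _ _ _ (evq q) (p1 q) (p2 q) (p3 q).
have uni b b' e : b \in s -> active i j b b' -> active i j b e -> b' = e.
  by move=> bs; apply: (active_unique good N_large (hs _ bs)).
have self b : b \in s -> ~~ active i j b b.
  by move=> bs; apply/negP => h; have := active_neq good N_large hx hl (hs _ bs) (hs _ bs) h; rewrite eqxx.
move: u4; rewrite /= !inE !negb_or => /and4P[/and3P[n1 n2 n3] /andP[n4 n5] n6 _].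
have h1' : active i j c a0 by rewrite active_sym.
have ndb : ~~ active i j d b0.
  apply/negP => h; have := sum3 _ _ _ _ _ _ _ (evq i') (p1 i') (p2 i')
    (active_parity_at hl i' (hs _ ds) (hs _ b0s) h).
  by rewrite eqxx (negbTE ij'); case: (i' == i); case: (i' == j).
have ina b : b \in [:: d; b0] -> forall a, a \in s -> ~~ active i j a b.
  rewrite !inE => hb a; rewrite E4 !inE => /or4P[] /eqP ->; case/orP: hb => /eqP ->.
  - by apply/negP => h; move: n4; rewrite (uni _ _ _ a0s h1 h) eqxx.
  - by apply/negP => h; move: n5; rewrite (uni _ _ _ a0s h1 h) eqxx.
  - by apply/negP => h; move: n2; rewrite (uni _ _ _ cs h1' h) eqxx.
  - by apply/negP => h; move: n3; rewrite (uni _ _ _ cs h1' h) eqxx.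
  - exact: self.
  - exact: ndb.
  - by rewrite active_sym.
  - exact: self.
pose same := sg a0 == sg c; pose e := nonreal_sign same.
have es : is_sign e by rewrite /e /nonreal_sign; case: ifP => _; [right|left].
have diffE xi : ev xi d - ev xi b0 = \sum_q xi 0 q * (sg d * L d 0 q - sg b0 * L b0 0 q)%:~R.
  rewrite /ev /lform !mulr_sumr -sumrB; apply: eq_bigr => q _.
  by rewrite rmorphB !rmorphM /=; ring.
(* If the real eigenvalues agreed for both values of t, the mark of the first edge would be disjoint
   from that of the last, and by [tri] the mark of the middle edge would contain three distinct
   indices. *)
have [t ht ne] : exists2 t : R, t = e%:~R \/ t = (2 * e)%:~R &
    ev (point i j t) d != ev (point i j t) b0.
  have [ne1|/eqP] := boolP (ev (point i j e%:~R) d != ev (point i j e%:~R) b0).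
    by exists e%:~R => //; left.
  have [ne2 _|/eqP] := boolP (ev (point i j (2 * e)%:~R) d != ev (point i j (2 * e)%:~R) b0).
    by exists (2 * e)%:~R => //; right.
  move=> /eqP; rewrite negbK -subr_eq0 diffE sum_pair_point // => /eqP e2.
  move=> /eqP; rewrite negbK -subr_eq0 diffE sum_pair_point // => /eqP e1.
  have [zi zj] := two_points es e1 e2; exfalso.
  have sd := is_sign_sg good N_large hx hl (hs _ ds).
  have sb := is_sign_sg good N_large hx hl (hs _ b0s).
  have evd q : sg d * L d 0 q - sg b0 * L b0 0 q = 0 -> (2 %| L d 0%R q + L b0 0%R q)%Z.
    move: (L d 0 q) (L b0 0 q) => u1 u2.
    by case: sd => ->; case: sb => ->; clear; lia.
  have out q : sg d * L d 0 q - sg b0 * L b0 0 q = 0 -> (q != k') && (q != l').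
    move=> /evd; have := p3 q; have [->|_] := eqVneq q k'.
      by rewrite (negbTE kl'); clear; lia.
    by case: (q == l') => //=; clear; lia.
  have /andP[ik il] := out i zi; have /andP[jk jl] := out j zj.
  have := tri i; rewrite eqxx (negbTE ij) (negbTE ik) (negbTE il) => ti.
  have := tri j; rewrite eqxx [j == i]eq_sym (negbTE ij) (negbTE jk) (negbTE jl) => tj.
  have := tri k'; rewrite eqxx [k' == i]eq_sym (negbTE ik) [k' == j]eq_sym (negbTE jk) (negbTE kl') => tk.
  have hi : (i == i') || (i == j') by move: ti; case: (i == i'); case: (i == j').
  have hj : (j == i') || (j == j') by move: tj; case: (j == i'); case: (j == j').
  have hk : (k' == i') || (k' == j') by move: tk; case: (k' == i'); case: (k' == j').
  move: ij ik jk; case/orP: hi => /eqP ->; case/orP: hj => /eqP ->; case/orP: hk => /eqP ->;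
  by rewrite ?eqxx.
have d0 := pair_disc_lt0 ht.
set pt := point i j t in ne *; pose r := ((ev pt a0 + ev pt c) / 2)%:C.
pose q := sqrtC ((pair_disc same t)%:C).
have q0 : q != 0 by rewrite sqrtC_eq0 fmorph_eq0 lt_eqF.
have hz z : z = r + q \/ z = r - q -> (z - r) ^+ 2 = (pair_disc same t)%:C.
  by case=> ->; rewrite addrAC subrr add0r ?sqrrN sqrtCK.
have t0 : t != 0 by case: ht => ->; rewrite intr_eq0; case: es => ->.
have nr z : z = r + q \/ z = r - q -> forall w, z != (ev pt w)%:C.
  by move=> h w; apply/eqP; apply: (nonreal_root d0 (hz _ h)).
pose rs := [:: r + q; r - q; (ev pt d)%:C; (ev pt b0)%:C].
have urs : uniq rs.
  have d1 w : r + q != (ev pt w)%:C by apply: nr; left.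
  have d2 w : r - q != (ev pt w)%:C by apply: nr; right.
  have d3 : (ev pt d)%:C != (ev pt b0)%:C.
    by apply: contra ne => /eqP/complexI ->.
  have d4 : r + q != r - q.
    by apply: contra q0 => /eqP/addrI/eqP; rewrite -addr_eq0 -mulr2n mulrn_eq0.
  by rewrite /= !inE !negb_or d4 !d1 !d2 d3.
have := van pt => /(congr1 (real_complex R)); rewrite map_disc rmorph0 /disc -sqrt_pointE.
rewrite char_gmx; last exact: (comp_edge_labels good N_large hx hl hs).
move/eqP; apply/negP; apply: (resultant_separable (rs := rs)) => //.
rewrite [LHS](@all_roots_prod_XsubC _ _ rs).
- by rewrite (monicP (char_poly_monic _)) scale1r.
- rewrite size_char_poly; have -> // : size s = size [:: a0; c; d; b0].
  apply/perm_size/uniq_perm => //.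
  by rewrite /= !inE !negb_or n1 n2 n3 n4 n5 n6.
- have R1 z : z = r + q \/ z = r - q -> root (char_poly (smx v sg L (sqrt_point pt) s)) z.
    by move=> h; apply: (matched_root cs' a0s cs h1 t0); apply: hz.
  apply/allP => z; rewrite !inE => /or4P[] /eqP ->; [by apply: R1; left|by apply: R1; right| |].
    by apply: (unmatched_root _ cs' ds); apply: ina; rewrite !inE eqxx.
  by apply: (unmatched_root _ cs' b0s); apply: ina; rewrite !inE eqxx orbT.
- by rewrite uniq_rootsE.
Qed.

End Discriminant.

Lemma nonzero_or_vanishing (T : Type) (K : nmodType) (G : T -> K) :
  (exists t, G t != 0) \/ forall t, G t = 0.
Proof.
have [|none] := pselect (exists t, G t != 0); first by left.
by right=> t; apply/eqP/negPn/negP => h; apply: none; exists t.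
Qed.

Section Nonvanishing.
Variables (R : realType) (m p : nat).
Local Notation n := p.+1.
Variables (N : nat) (v : 'M[int]_(m, n)).
Definition resonance_bound := (2 * diameter p + 2 * (2 * diameter p * m + 2))%N.
Hypotheses (good : good_labels N v) (N_large : (2 * diameter p + 2 <= N)%N)
  (N_bound : (resonance_bound <= N)%N).
Variables (x : 'rV[int]_n -> 'rV[int]_n) (sg : 'rV[int]_n -> int) (L : 'rV[int]_n -> 'rV[int]_m).
Hypotheses (hx : root_choice v x) (hl : labels v x sg L) (m_gt0 : (0 < m)%N).
Implicit Types (a b k : 'rV[int]_n) (s T : seq 'rV[int]_n) (nu : 'rV[int]_m) (sigma : int).
Local Notation "z %:C" := (real_complex R z).

Definition res1 (K : comNzRingType) nu (xi : 'rV[K]_m) : K :=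
  (en v nu)%:~R - 2 * tform xi nu (mass nu).

(** If the form vanishes, its coefficients give nu_q = 2 mass(nu) for all q, and summation gives (2
    m - 1) mass(nu) = 0. *)
Lemma res1_nonvanishing nu : nu != 0 -> exists xi : 'rV[R]_m, res1 nu xi != 0.
Proof.
move=> nu0; have [//|van] := nonzero_or_vanishing (@res1 R nu).
have e0 : (en v nu)%:~R = 0 :> R.
  have := van 0; rewrite /res1 /tform /lform big1 => [|q _]; last by rewrite mxE mul0r.
  by rewrite big1 => [|q _]; rewrite ?mxE // !mulr0 subrr mulr0 subr0.
have hq q : nu 0 q - 2 * mass nu = 0.
  have := van (delta_mx 0 q); rewrite /res1 e0 sub0r => /eqP.
  rewrite oppr_eq0 mulf_eq0 pnatr_eq0 /= /tform /lform (bigD1 q) //= big1 => [|r rq]; last first.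
    by rewrite mxE (negbTE rq) andbF mul0r.
  rewrite (bigD1 q) //= big1 => [|r rq]; last by rewrite mxE (negbTE rq) andbF.
  rewrite !mxE !eqxx !addr0 mul1r mulr1 -(rmorph_nat (intr : int -> R)) -rmorphM -rmorphB /=.
  by rewrite intr_eq0 => /eqP.
have m0 : mass nu = 0.
  apply: (odd_mul_eq0 m_gt0); apply/eqP.
  have : \sum_q (nu 0 q - 2 * mass nu) = 0 by apply: big1 => q _.
  rewrite sumrB sumr_const card_ord -/(mass nu) -mulr_natl natz => h.
  by rewrite -oppr_eq0 -h; apply/eqP; ring.
case/eqP: nu0; apply/rowP => q; have := hq q; rewrite m0 mulr0 subr0 mxE //.
Qed.

(** Vanishing at xi = 0 removes the constant, and modulo 2 there is a vertex with nu + L(a) even;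
    but L(a) has mass 0 or 2 while nu has odd mass. *)
Lemma res2_nonvanishing nu k s : ~~ insites v k -> comp_enum v k s -> ~~ (2 %| mass nu)%Z ->
  exists xi : 'rV[R]_m, res2 v sg L nu (mass nu + 1) s ((en v nu + sqn (x k))%:~R / 2) xi != 0.
Proof.
move=> kS ks odd; have [us kks hs xs] := comp_enumP hx kS ks.
set kappa := _ / 2.
have [//|van] := nonzero_or_vanishing (res2 v sg L nu (mass nu + 1) s kappa).
have k0 : kappa = 0.
  have := van 0 => /(congr1 (real_complex R)); rewrite map_res2 rmorph0 /res2 -sqrt_pointE.
  rewrite char_gmx; last exact: (comp_edge_labels good N_large hx hl hs).
  rewrite sqrt_pointE -map_tform -rmorphB => /eqP; rewrite -/(root _ _) => rt.
  have x0 i j : i != j -> (0 : 'rV[R]_m) 0 i = 0 \/ (0 : 'rV[R]_m) 0 j = 0 by left; rewrite mxE.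
  have [a _ /complexI] := spectrum_diag us hs x0 rt.
  have lf0 M : lform (0 : 'rV[R]_m) M = 0 by apply: big1 => q _; rewrite mxE mul0r.
  have -> : tform (0 : 'rV[R]_m) nu (mass nu + 1) = 0.
    by rewrite /tform lf0 big1 ?mulr0 ?subrr // => q _; rewrite mxE.
  have -> : ev sg L (0 : 'rV[R]_m) a = 0 by rewrite /ev lf0 mulr0.
  by rewrite sub0r => /eqP; rewrite oppr_eq0 => /eqP.
rewrite k0 in van; have [a as_ ev] := res2_nonzero us
  (fun a as_ => is_sign_sg good N_large hx hl (hs a as_)) van.
case/negP: odd; have [sa ma _ _] := labels_plab good N_large hx hl (hs _ as_).
have : (2 %| mass (nu + L a))%Z by apply: rpred_sum => q _; apply: ev.
by rewrite massD ma; case: sa => ->; move: (mass nu) => z; clear; lia.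
Qed.

Hypothesis sites_dot : forall i j, i != j -> dot (row i v) (row j v) != 0 /\
  dot (row i v) (row j v) != sqn (row i v).

(** Each kind of edge at the origin imposes on two sites one of the relations excluded by
    [sites_dot]. This settles the case of a root at the origin with nu = 0 and sigma = 1. *)
Lemma origin_isolated b : ~~ adj v 0 b.
Proof.
apply/negP => /adj_active[i [j [ij]]]; have d0 (y : 'rV[int]_n) : dot 0 y = 0 by rewrite dotC dot0r.
have [s1 s2] := sites_dot ij; have [_ s3] := sites_dot (negbT (etrans (eq_sym j i) (negbTE ij))).
case/activeP => h.
- have := black_dot h; rewrite !d0 subrr => /esym/eqP; by rewrite subr_eq0 (negbTE s2).
- have := black_dot h; rewrite !d0 subrr => /esym/eqP; by rewrite subr_eq0 (negbTE s3).
- have := red_dot h; rewrite /sqn !d0 addr0 sub0r => /esym/eqP; by rewrite oppr_eq0 (negbTE s1).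
Qed.

Variable N' : nat.
Hypotheses (nc : no_even_config N' v) (N'_large : (resonance_bound + diameter p <= N')%N).

(** A nonzero constant is seen at xi = 0; otherwise [- nu] is an exact label between the roots.
    Distinct roots are the case of an even pair in two components. For equal roots and sigma = -1
    the momentum of nu vanishes, so nu = 0; for sigma = 1, 2 x = pi(- nu) with radius zero leaves
    only nu = 0 and x = 0. *)
Lemma res3_nonvanishing sigma nu kA sA kB sB : is_sign sigma ->
  ~~ insites v kA -> comp_enum v kA sA -> ~~ insites v kB -> comp_enum v kB sB ->
  nu *m v + x kA + sigma *: x kB = 0 -> ~ [/\ sigma = -1, nu = 0 & x kA = x kB] ->
  exists xi : 'rV[R]_m, res3 v sg L sigma nu (mass nu + 1 + sigma) sA sB
    ((en v nu + sqn (x kA) + sigma * sqn (x kB))%:~R / 2) xi != 0.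
Proof.
move=> ss kAS cA kBS cB mom excl.
have [uA kA_s hA xA] := comp_enumP hx kAS cA; have [uB kB_s hB xB] := comp_enumP hx kBS cB.
have cA' : component v sA by []. have cB' : component v sB by [].
set K := en v nu + _ + _; set eta := mass nu + 1 + sigma.
have [K0|K0] := eqVneq K 0; last first.
  exists 0; apply: (res3_at0 good N_large hx hl nu eta ss cA' cB').
  by rewrite mulf_neq0 ?intr_eq0 // invr_eq0 pnatr_eq0.
rewrite K0 mul0r; have [//|van] := nonzero_or_vanishing (@res3 m n v sg L R sigma nu eta sA sB 0).
exfalso; have res := vanishing_resonant good N_large hx hl ss cA' cB' van.
have bnu := resonant_bounded good N_large hx hl m_gt0 ss cA' cB' erefl res.
have hlab : lab v (x kB) (- sigma) (- nu) (x kA).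
  split; first by apply/eqP; rewrite -subr_eq0 scaleNr mulNmx opprD !opprK addrC -addrA addrC mom.
  by rewrite enN; apply: (eq_of_subr K0); rewrite /K; ring.
have [e|ne] := eqVneq (x kA) (x kB); last first.
  have [a0 [b0 [a0s b0s ev]]] := res3_nonzero ss uA uB
    (fun a as_ => is_sign_sg good N_large hx hl (hA a as_))
    (fun a as_ => is_sign_sg good N_large hx hl (hB a as_)) van.
  have sz := size_bound_two good N_large hx hl nc ss kAS cA kBS cB ne hlab bnu N'_large a0s b0s ev.
  exact: (no_small_resonance good N_large hx hl m_gt0 ss kAS cA kBS cB ne hlab erefl res a0s b0s ev sz).
have [g1 g2 _] := good; have bN := bounded_leq N_bound bnu.
have xS := root_insites hx kAS.
case: ss => sE; last first.
  apply: excl; split=> //; apply/eqP/negPn/negP => /(g1 _ bN)/eqP; apply.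
  by move: mom; rewrite e sE scaleN1r addrK.
have x2 : 2 *: x kA = - nu *m v.
  apply/eqP; rewrite -subr_eq0 mulNmx opprK addrC; apply/eqP.
  by move: mom; rewrite -e sE scale1r -addrA => <-; congr (_ + _); rewrite -mulr2n scaler_nat.
have rf0 : rf v (- nu) = 0.
  rewrite /rf -x2 sqnZ enN; have := K0; rewrite /K -e sE => h.
  by apply/esym; apply: (eq_of_subr (congr1 (fun z => 2 * z) h)); ring.
have [nu0|[i nuE]] := g2 _ (boundedN bN) rf0; last first.
  case/negP: xS; apply/existsP; exists i; apply/eqP/rowP => l.
  move: x2; rewrite nuE -scalemxAl row_deltaM => /rowP/(_ l); rewrite !mxE; exact: mulfI.
have {}nu0 : nu = 0 by apply/eqP; rewrite -oppr_eq0 nu0.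
have xA0 : x kA = 0.
  apply/rowP => l; move: x2; rewrite nu0 oppr0 mul0mx => /rowP/(_ l); rewrite !mxE.
  by move=> /eqP; rewrite mulf_eq0 /= => /eqP.
have only a k s : comp_enum v k s -> x k = 0 -> ~~ insites v k -> a \in s -> a = 0.
  move=> ks xk kS /(proj2 ks) c; have [c0 _] := hx kS.
  have [q hq <-] := same_comp_trans (same_comp_sym c0) c; rewrite xk in hq *.
  by case: q hq => //= b q /andP[h _]; have := origin_isolated b; rewrite h.
(* Both components reduce to the origin, and their gap is 2 eta = 4. *)
have [a [b [as_ bs]]] := resonant_axis (Ordinal m_gt0) cA' cB' res.
rewrite (only _ _ _ cA xA0 kAS as_) (only _ _ _ cB _ kBS bs) -?e //.
have [l1 _ _] := hl; have [_ L0] := l1 _ kAS; rewrite -xA0 /gap L0 nu0 /eta nu0 mass0 sE !mxE.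
by rewrite !mulr0.
Qed.

End Nonvanishing.

(** * The resonance sets and the theorem *)

Section ResonanceSets.
Variables (R : realType) (m p : nat).
Local Notation n := p.+1.
Variables (N N' : nat) (v : 'M[int]_(m, n)).
Hypotheses (good : good_labels N v) (N_large : (2 * diameter p + 2 <= N)%N)
  (N_bound : (resonance_bound m p <= N)%N).
Hypothesis sites_dot : forall i j, i != j -> dot (row i v) (row j v) != 0 /\
  dot (row i v) (row j v) != sqn (row i v).
Variables (x : 'rV[int]_n -> 'rV[int]_n) (sg : 'rV[int]_n -> int) (L : 'rV[int]_n -> 'rV[int]_m).
Hypotheses (hx : root_choice v x) (hl : labels v x sg L) (m_gt0 : (0 < m)%N).
Variables (D : set 'rV[R]_m) (Om : 'rV[R]_m -> 'rV[int]_n -> R[i]).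
Hypotheses (D_pos : forall xi, D xi -> forall i, 0 < xi 0 i)
  (hOm : forall xi, D xi -> eigen_labelling v x sg L xi (Om xi)).
Implicit Types (a b h k : 'rV[int]_n) (s : seq 'rV[int]_n) (nu : 'rV[int]_m) (sigma : int).
Local Notation evC xi := (evC x (Om xi) xi).

Lemma enum_exists k : ~~ insites v k -> exists s, comp_enum v k s.
Proof. by have [e _ _] := good_well_posed good N_large; apply: e. Qed.

Lemma char_product k s xi : ~~ insites v k -> comp_enum v k s -> D xi ->
  map_poly (real_complex R) (char_poly (gmx v sg L xi s)) = \prod_(h <- s) ('X - (evC xi h)%:P).
Proof.
move=> kS ks Dxi; have [_ _ hs xs] := comp_enumP hx kS ks.
apply: (char_gmx_evC (hOm Dxi) kS ks _ (D_pos Dxi) xs).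
exact: (comp_edge_labels good N_large hx hl hs).
Qed.

Lemma null_set_empty (E : set 'rV[R]_m) : (forall xi, ~ E xi) -> null_set E.
Proof.
move=> h; apply: (null_set_sub (F := [set xi : 'rV[R]_m | meval (xi 0) (1 : mpoly m R) = 0])).
  by move=> xi /h.
exact: (null_zeros m_gt0 (oner_neq0 _)).
Qed.

Lemma algebraic_empty (E : set 'rV[R]_m) : (forall xi, D xi -> ~ E xi) -> algebraic_in D (D `&` E).
Proof.
move=> h; exists [:: 1]; apply/seteqP; split=> xi [Dxi]; first by move/(h _ Dxi).
by move=> /(_ 1 (mem_head _ _)) /eqP; rewrite meval1 oner_eq0.
Qed.

(** These definitions have the shape expected by [natural_zeros_null]: [c] is the identity over the
    reals and the inclusion of constants over polynomials. *)
Definition res1_at nu (K : comNzRingType) (c : R -> K) (xi : 'rV[K]_m) := res1 v nu xi.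
Definition res2_at nu s (kappa : R) (K : comNzRingType) (c : R -> K) (xi : 'rV[K]_m) :=
  res2 v sg L nu (mass nu + 1) s (c kappa) xi.
Definition res3_at sigma nu s s' (kappa : R) (K : comNzRingType) (c : R -> K) (xi : 'rV[K]_m) :=
  res3 v sg L sigma nu (mass nu + 1 + sigma) s s' (c kappa) xi.
Definition disc_at s (K : comNzRingType) (c : R -> K) (xi : 'rV[K]_m) := disc v sg L s xi.

Let natural (G : forall K : comNzRingType, (R -> K) -> 'rV[K]_m -> K) := forall xi : 'rV[R]_m,
  meval (xi 0) (G (mpoly m R) (@mpolyC m R) (polyX R m)) = G R id xi.

Lemma res1_natural nu : natural (res1_at nu).
Proof.
move=> xi; rewrite /res1_at /res1 rmorphB rmorphM rmorph_nat rmorph_int map_tform.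
by rewrite map_polyX.
Qed.

Lemma res2_natural nu s kappa : natural (res2_at nu s kappa).
Proof. by move=> xi; rewrite /res2_at map_res2 /= mevalC map_polyX. Qed.

Lemma res3_natural sigma nu s s' kappa : natural (res3_at sigma nu s s' kappa).
Proof. by move=> xi; rewrite /res3_at map_res3 /= mevalC map_polyX. Qed.

Lemma disc_natural s : natural (disc_at s).
Proof. by move=> xi; rewrite /disc_at map_disc map_polyX. Qed.

Lemma resM1_zero nu xi : dot (omega v xi) (toreal R nu) = res1_at nu id xi.
Proof. by rewrite dot_omega /res1_at /res1 /tform; ring. Qed.

Lemma null_resM1 nu : null_set (D `&` [set xi | resM1 v nu xi]).
Proof.
have [nu0|nu0] := eqVneq nu 0.
  by apply: null_set_empty => xi [_ []]; rewrite nu0 eqxx.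
apply: (null_set_sub (F := [set xi : 'rV[R]_m | res1_at nu id xi = 0])).
  by move=> xi [_ [_ _ _]] /=; rewrite resM1_zero.
by apply: (natural_zeros_null m_gt0 (@res1_natural nu)); have [xi h] := res1_nonvanishing R v m_gt0 nu0; exists xi.
Qed.

Lemma algebraic_resM1 nu : algebraic_in D (D `&` [set xi | resM1 v nu xi]).
Proof.
have [[c1 c2 c3]|nC] := pselect [/\ nu != 0, nu *m v = 0 & (2 %| mass nu)%Z]; last first.
  by apply: algebraic_empty => xi _ [? ? ? _]; apply: nC.
apply: (natural_zeros_algebraic (@res1_natural nu)) => xi _ /=.
by rewrite -resM1_zero; split=> [[]|].
Qed.

Definition kappa2 nu k : R := (en v nu + sqn (x k))%:~R / 2.
Definition kappa3 sigma nu h k : R := (en v nu + sqn (x k) + sigma * sqn (x h))%:~R / 2.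

Lemma resM2_zero nu a s xi : ~~ insites v a -> comp_enum v a s -> D xi ->
  nu *m v + x a = 0 -> ~~ (2 %| mass nu)%Z ->
  (exists2 k, same_comp v a k & resM2 v x Om nu k xi) <-> res2_at nu s (kappa2 nu a) id xi = 0.
Proof.
move=> aS as_ Dxi mom odd; have [_ _ hs xs] := comp_enumP hx aS as_.
rewrite /res2_at -(res2_zero _ _ _ (char_product aS as_ Dxi)) /kappa2.
split=> [[k /(proj2 as_) ks [_ _ _ /resM2_evC e]]|[k ks e]].
  by exists k; rewrite // e (xs _ ks).
exists k; first exact/(proj2 as_).
split; rewrite ?(xs _ ks) //; first exact: hs.
by apply/(resM2_evC v x); rewrite e (xs _ ks).
Qed.

Lemma null_resM2 nu k : null_set (D `&` [set xi | resM2 v x Om nu k xi]).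
Proof.
have [[kS mom odd]|nC] := pselect [/\ ~~ insites v k, nu *m v + x k = 0 & ~~ (2 %| mass nu)%Z];
  last by apply: null_set_empty => xi [_ [? ? ? _]]; apply: nC.
have [s ks] := enum_exists kS.
apply: (null_set_sub (F := [set xi : 'rV[R]_m | res2_at nu s (kappa2 nu k) id xi = 0])).
  move=> xi [Dxi r] /=; apply/(resM2_zero kS ks Dxi mom odd); exists k => //.
  exact: same_comp_refl.
apply: (natural_zeros_null m_gt0 (@res2_natural nu s _)).
by have [xi h] := res2_nonvanishing R good N_large hx hl kS ks odd; exists xi.
Qed.

Lemma algebraic_resM2 nu a : ~~ insites v a -> algebraic_in D
  (D `&` [set xi | exists2 k, same_comp v a k & resM2 v x Om nu k xi]).
Proof.
move=> aS; have [_ xa] := hx aS.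
have [[mom odd]|nC] := pselect (nu *m v + x a = 0 /\ ~~ (2 %| mass nu)%Z); last first.
  by apply: algebraic_empty => xi _ [k /xa xk [_ mom ? _]]; apply: nC; rewrite -xk.
have [s as_] := enum_exists aS.
apply: (natural_zeros_algebraic (@res2_natural nu s (kappa2 nu a))) => xi Dxi.
exact: resM2_zero.
Qed.

Lemma resM3_zero sigma nu b a s' s xi : is_sign sigma -> ~~ insites v b -> ~~ insites v a ->
  comp_enum v b s' -> comp_enum v a s -> D xi -> nu *m v + x a + sigma *: x b = 0 ->
  (2 %| mass nu)%Z -> ~ [/\ sigma = -1, nu = 0 & x a = x b] ->
  (exists h k, [/\ same_comp v b h, same_comp v a k & resM3 v x Om sigma nu h k xi]) <->
  res3_at sigma nu s s' (kappa3 sigma nu b a) id xi = 0.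
Proof.
move=> ss bS aS bs as_ Dxi mom ev excl.
have [_ _ hs xs] := comp_enumP hx aS as_; have [_ _ hs' xs'] := comp_enumP hx bS bs.
rewrite /res3_at -(res3_zero _ _ _ ss (char_product aS as_ Dxi) (char_product bS bs Dxi)) /kappa3.
split=> [[h [k [/(proj2 bs) hb /(proj2 as_) ka [_ _ _ _ /resM3_evC e]]]]|[h [k [hb ka e]]]].
  by exists h, k; split=> //; rewrite e (xs _ ka) (xs' _ hb).
exists h, k; split; [exact/(proj2 bs)|exact/(proj2 as_)|].
split=> //; rewrite ?(xs _ ka) ?(xs' _ hb) //; first by split; [apply: hs'|apply: hs].
  by case=> s1 n0 hk; apply: excl; split=> //; rewrite -(xs _ ka) -(xs' _ hb) hk.
by apply/(resM3_evC v x); rewrite e (xs _ ka) (xs' _ hb).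
Qed.

Lemma resM3_diff xi h k : x h = x k ->
  real_complex R (dot (omega v xi) (toreal R 0)) + Om xi k + (-1)%:~R * Om xi h = 0 <->
  evC xi k = evC xi h.
Proof.
move=> xhk; apply: (iff_trans (resM3_evC v x _ _ _ _ _ _)).
have -> : tform xi 0 (mass (0 : 'rV[int]_m) + 1 + -1) - (en v 0 + sqn (x k) + -1 * sqn (x h))%:~R / 2 = 0.
  have en0 : en v 0 = 0 by rewrite /en big1 // => q _; rewrite mxE mul0r.
  have lf0 : lform xi 0 = 0 by rewrite /lform big1 // => q _; rewrite mxE mulr0.
  rewrite /tform en0 lf0 mass0 xhk mulN1r !add0r !subrr !mulr0z mulr0 !mul0r !subr0 oppr0.
  by [].
rewrite rmorph0 mulrN1z mulN1r; split=> [/eqP|->]; last by rewrite subrr.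
by rewrite subr_eq0 => /eqP.
Qed.

(** In this case the resultant vanishes identically, since it compares the component with itself;
    the resonance says that two eigenvalues at different vertices coincide. *)
Lemma resM3_same_zero b a s xi : ~~ insites v b -> ~~ insites v a ->
  comp_enum v a s -> D xi -> x a = x b ->
  (exists h k, [/\ same_comp v b h, same_comp v a k & resM3 v x Om (-1) 0 h k xi]) <->
  disc_at s id xi = 0.
Proof.
move=> bS aS as_ Dxi xab; have [us _ hs xs] := comp_enumP hx aS as_.
have cab : same_comp v a b.
  have [c1 _] := hx aS; have [c2 _] := hx bS; rewrite xab in c1.
  exact: same_comp_trans c1 (same_comp_sym c2).
rewrite /disc_at -(disc_zero us (char_product aS as_ Dxi)).
split=> [[h [k [hb ka [_ _ ne _ e]]]]|[h [k [hb ka ne e]]]].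
  have hs1 := proj2 (proj2 as_ h) (same_comp_trans cab hb).
  have ks1 := proj2 (proj2 as_ k) ka.
  exists h, k; split=> //; first by move=> hk; apply: ne; rewrite hk.
  by apply/resM3_diff; rewrite ?(xs _ hs1) ?(xs _ ks1).
have ch := proj1 (proj2 as_ h) hb; have ck := proj1 (proj2 as_ k) ka.
exists h, k; split=> //; first exact: same_comp_trans (same_comp_sym cab) ch.
split; [by split; apply: hs|by right|by case| |].
  split; last by rewrite mass0.
  by rewrite mul0mx add0r (xs _ hb) (xs _ ka) scaleN1r subrr.
by apply/resM3_diff; rewrite ?(xs _ hb) ?(xs _ ka).
Qed.

Lemma algebraic_resM3 sigma nu b a : ~~ insites v b -> ~~ insites v a -> algebraic_in D
  (D `&` [set xi | exists h k, [/\ same_comp v b h, same_comp v a k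
                                 & resM3 v x Om sigma nu h k xi]]).
Proof.
move=> bS aS; have [_ xa] := hx aS; have [_ xb] := hx bS.
have [[ss mom ev]|nC] := pselect [/\ is_sign sigma, nu *m v + x a + sigma *: x b = 0
    & (2 %| mass nu)%Z]; last first.
  apply: algebraic_empty => xi _ [h [k [/xb xh /xa xk [_ ss _ [mom ev] _]]]].
  by apply: nC; rewrite -xh -xk.
have [s as_] := enum_exists aS; have [s' bs] := enum_exists bS.
have [[s1 n0 xab]|excl] := pselect [/\ sigma = -1, nu = 0 & x a = x b].
  rewrite s1 n0; apply: (natural_zeros_algebraic (@disc_natural s)) => xi Dxi.
  exact: resM3_same_zero.
apply: (natural_zeros_algebraic (@res3_natural sigma nu s s' (kappa3 sigma nu b a))) => xi Dxi.
exact: resM3_zero.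
Qed.

Hypotheses (nc : no_even_config N' v) (N'_large : (resonance_bound m p + diameter p <= N')%N).

Lemma null_resM3 sigma nu h k : null_set (D `&` [set xi | resM3 v x Om sigma nu h k xi]).
Proof.
have [[[hS kS] ss mom ev]|nC] := pselect [/\ ~~ insites v h /\ ~~ insites v k, is_sign sigma,
    nu *m v + x k + sigma *: x h = 0 & (2 %| mass nu)%Z]; last first.
  by apply: null_set_empty => xi [_ [? ? _ [? ?] _]]; apply: nC.
have [s ks] := enum_exists kS; have [s' hs'] := enum_exists hS.
have hk xi : resM3 v x Om sigma nu h k xi -> exists h' k',
    [/\ same_comp v h h', same_comp v k k' & resM3 v x Om sigma nu h' k' xi].
  by move=> r; exists h, k; split=> //; apply: same_comp_refl.
have [[s1 n0 xab]|excl] := pselect [/\ sigma = -1, nu = 0 & x k = x h].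
  apply: (null_set_sub (F := [set xi : 'rV[R]_m | disc_at s id xi = 0])).
    move=> xi [Dxi /hk r] /=; rewrite s1 n0 in r; exact/(resM3_same_zero hS kS ks Dxi xab).
  apply: (natural_zeros_null m_gt0 (@disc_natural s)).
  have DN : (diameter p <= N')%N by apply: leq_trans N'_large; apply: leq_addl.
  by have [xi hxi] := disc_nonvanishing R good N_large hx hl nc DN kS ks; exists xi.
apply: (null_set_sub (F := [set xi : 'rV[R]_m | res3_at sigma nu s s' (kappa3 sigma nu h k) id xi = 0])).
  by move=> xi [Dxi /hk r] /=; apply/(resM3_zero ss hS kS hs' ks Dxi mom ev excl).
apply: (natural_zeros_null m_gt0 (@res3_natural sigma nu s s' _)).
by have [xi hxi] := res3_nonvanishing R good N_large N_bound hx hl m_gt0 sites_dot nc N'_large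
  ss kS ks hS hs' mom excl; exists xi.
Qed.

End ResonanceSets.

Section GenericSites.
Variables (m p : nat).

Lemma dot_row_vline (y : 'I_m -> int) i j : dot (row i (vline p y)) (row j (vline p y)) = y i * y j :> int.
Proof.
rewrite /dot (bigD1 ord0) //= big1 ?addr0 => [|l l0]; first by rewrite !mxE eqxx.
by rewrite !mxE (negbTE l0) mul0r.
Qed.

Lemma generic_sites_dot : generic (fun v : 'M[int]_(m, p.+1) => forall i j, i != j ->
  dot (row i v) (row j v) != 0 /\ dot (row i v) (row j v) != sqn (row i v)).
Proof.
have pd i j : polyfun (fun v : 'M[int]_(m, p.+1) => dot (row i v) (row j v)).
  apply: polyfun_sum => l; apply: (polyfun_ext (f := fun v => v i l * v j l)).
    by move=> v; rewrite !mxE.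
  by apply: polyfunM; apply: polyfun_entry.
apply: generic_forall => i; apply: generic_forall => j; apply: generic_implies => ij.
(* On a line, one site at 1 and the others at 2: the scalar product is 2 and the square is 1. *)
pose w := vline p (fun k : 'I_m => if k == i then 1 else 2).
have [wij wii] : dot (row i w) (row j w) = 2 /\ dot (row i w) (row i w) = 1.
  by rewrite !dot_row_vline eqxx eq_sym (negbTE ij).
have h1 := generic_neq0 (w := w) (pd i j); have h2 := generic_neq0 (w := w) (polyfunB (pd i j) (pd i i)).
rewrite wij wii in h1 h2.
apply: generic_imp (generic_and (h1 isT) (h2 isT)) => v [d1 d2]; split=> //.
by rewrite -subr_eq0.
Qed.

End GenericSites.


Theorem theorem3 (R : realType) (n m : nat) (hn : (2 <= n)%N) (hm : (0 < m)%N) :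
  exists2 P : mpoly (m * n) int, P != 0 &
  forall v : 'M[int]_(m, n), meval (mxvec v 0) P != 0 ->
  well_posed v /\
  forall (x : 'rV[int]_n -> 'rV[int]_n)
    (sg : 'rV[int]_n -> int) (L : 'rV[int]_n -> 'rV[int]_m),
  root_choice v x -> labels v x sg L ->
  forall alpha : R, 0 < alpha < 2 ->
  exists2 r0 : R, 0 < r0 & forall r : R, 0 < r < r0 ->
  forall Om : 'rV[R]_m -> 'rV[int]_n -> R[i],
  (forall xi, Abox alpha r xi -> eigen_labelling v x sg L xi (Om xi)) ->
  null_set (Abox alpha r `&`
    [set xi | (exists nu, resM1 v nu xi) \/
              (exists nu k, resM2 v x Om nu k xi)])
  /\
  (n = 2%N \/ n = 3%N ->
   [/\ null_set (Abox alpha r `&`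
         [set xi | [\/ exists nu, resM1 v nu xi,
                       exists nu k, resM2 v x Om nu k xi
                     | exists sigma nu h k, resM3 v x Om sigma nu h k xi]]),
       forall nu, algebraic_in (Abox alpha r)
         (Abox alpha r `&` [set xi | resM1 v nu xi]),
       forall nu a, ~~ insites v a -> algebraic_in (Abox alpha r)
         (Abox alpha r `&`
            [set xi | exists2 k, same_comp v a k & resM2 v x Om nu k xi])
     & forall sigma nu b a, ~~ insites v b -> ~~ insites v a ->
         algebraic_in (Abox alpha r)
         (Abox alpha r `&`
            [set xi | exists h k, [/\ same_comp v b h, same_comp v a k
                                    & resM3 v x Om sigma nu h k xi]])]).
Proof.
case: n hn => [//|p] hn.
(* [N] covers the labels of paths and the [nu] of a vanishing resultant, [N'] the labels of two
   components referred to one root. *)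
pose N := (2 * diameter p + 2 + resonance_bound m p)%N.
pose N' := (resonance_bound m p + diameter p)%N.
have [P P0 HP] := generic_and (generic_good_labels m p N) (generic_and (generic_sites_dot m p)
  (generic_implies (generic_no_even_config m N' (p := p)))).
exists P => // v /HP[good [sites_dot nc]].
have N_large : (2 * diameter p + 2 <= N)%N by rewrite /N leq_addr.
have N_bound : (resonance_bound m p <= N)%N by rewrite /N leq_addl.
split; first exact: good_well_posed good N_large.
move=> x sg L hx hl alpha _; exists 1 => // r /andP[r0 _] Om hOm.
(* On the box the real square roots in [Centry] square back to xi, which links the matrices with
   their polynomial form. *)
have D_pos (xi : 'rV[R]_m) : Abox alpha r xi -> forall i, 0 < xi 0 i.
  move=> h i; have /andP[le _] := h i; apply: lt_le_trans le.
  by rewrite divr_gt0 // powR_gt0.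
have M1 := null_resM1 v hm (Abox alpha r); have M2 := null_resM2 good N_large hx hl hm D_pos hOm.
split.
  (* A countable index type for both kinds of conditions, with 0 as a dummy vertex for the first
     kind. *)
  pose E (t : bool * 'rV[int]_m * 'rV[int]_p.+1) := Abox alpha r `&`
    [set xi | if t.1.1 then resM1 v t.1.2 xi else resM2 v x Om t.1.2 t.2 xi].
  apply: (null_set_sub (F := \bigcup_t E t)).
    move=> xi [Dxi [[nu h]|[nu [k h]]]]; first by exists (true, nu, 0).
    by exists (false, nu, k).
  apply: null_set_bigcup_count => // -[[[] nu] k]; [exact: M1|exact: M2].
move=> n23; have {}nc : no_even_config N' v.
  by apply: nc; case: n23 => -[->]; [left|right].
have M3 := null_resM3 good N_large N_bound sites_dot hx hl hm D_pos hOm nc (leqnn _).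
split.
- pose E (t : bool * bool * int * 'rV[int]_m * 'rV[int]_p.+1 * 'rV[int]_p.+1) := Abox alpha r `&`
    [set xi | let: (b, b', sigma, nu, h, k) := t in
      if b then resM1 v nu xi else if b' then resM2 v x Om nu k xi else resM3 v x Om sigma nu h k xi].
  apply: (null_set_sub (F := \bigcup_t E t)).
    move=> xi [Dxi [[nu h]|[nu [k h]]|[sigma [nu [h [k hr]]]]]].
    + by exists (true, true, 0, nu, 0, 0).
    + by exists (false, true, 0, nu, 0, k).
    + by exists (false, false, sigma, nu, h, k).
  apply: null_set_bigcup_count => // -[[[[[[] b'] sigma] nu] h] k]; first exact: M1.
  by case: b'; [exact: M2|exact: M3].
- exact: algebraic_resM1.
- by move=> nu a aS; apply: (algebraic_resM2 good N_large hx hl D_pos hOm).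
- by move=> sigma nu b a bS aS; apply: (algebraic_resM3 good N_large hx hl D_pos hOm).
Qed.
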